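(* Let $\Omega=\mathbb{R}^n$, let $\alpha\in(0,1)\cup(1,2)$, and let $u_\gamma(x,t)$ denote the solution of the time-fractional diffusion problem with index $\gamma$, order $\alpha$ and initial data $v_\gamma\in L_2(\mathbb{R}^n)$, as specified in the context. Then the following limits hold in $L_2(\mathbb{R}^n)$ as $t\to\infty$ (each for those $\alpha$ for which $u_\gamma$ is defined, i.e. $\alpha\in(0,1)\cup(1,2)$ for $\gamma=0$ and $\gamma=\alpha-1$, and $\alpha\in(1,2)$ for $\gamma=1$ and $\gamma=\alpha-2$): $$t^{\alpha}\,\Gamma(1-\alpha)\,(-\Delta)u_0(\cdot,t)\longrightarrow v_0,$$ $$t^{\alpha-1}\,\Gamma(2-\alpha)\,(-\Delta)u_1(\cdot,t)\longrightarrow v_1,$$ $$-t^{\alpha+1}\,\Gamma(-\alpha)\,(-\Delta)^2u_{\alpha-1}(\cdot,t)\longrightarrow v_{\alpha-1},$$ $$-t^{\alpha+2}\,\Gamma(-\alpha-1)\,(-\Delta)^2u_{\alpha-2}(\cdot,t)\longrightarrow v_{\alpha-2}.$$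
   Context: Fractional operators in $t$. For $\nu>0$, the Riemann-Liouville integral is $J^\nu[f](t)=\frac1{\Gamma(\nu)}\int_0^t f(z)(t-z)^{\nu-1}\,dz$, and $J^0$ is the identity. For $\alpha>0$, the Riemann-Liouville derivative is ${}^{RL}D^\alpha[f]=\frac{d^{\lceil\alpha\rceil}}{dt^{\lceil\alpha\rceil}}J^{\lceil\alpha\rceil-\alpha}[f]$ and the Caputo derivative is ${}^{C}D^\alpha[f]=J^{\lceil\alpha\rceil-\alpha}\big[\frac{d^{\lceil\alpha\rceil}f}{dt^{\lceil\alpha\rceil}}\big]$. For $\alpha\le 0$ both are $J^{-\alpha}[f]$. The solutions $u_\gamma$. For $\alpha\in(0,1)\cup(1,2)$ and $\gamma\in\{0,1,\alpha-1,\alpha-2\}$, $u_\gamma(x,t)$ is the unique solution of $$D_t^\alpha u_\gamma-\Delta u_\gamma=0\ \text{ on }\mathbb{R}^n\times(0,\infty),\qquad D_t^\gamma u_\gamma|_{t=0^+}=v_\gamma,$$ where $v_\gamma\in L_2(\mathbb{R}^n)$ and the initial condition $D_t^\gamma u_\gamma|_{t=0^+}=v_\gamma$ is satisfied in $L_2(\mathbb{R}^n)$ in the limit $t\to0^+$. The cases are: - $\gamma=0$ (Caputo derivative $D^\alpha_t$, $\alpha\in(0,1)\cup(1,2)$): $u_0(x,0)=v_0(x)$, and, if $\alpha>1$, $\partial_tu_0(x,0)=0$. - $\gamma=1$ (Caputo, $\alpha\in(1,2)$ only): $\partial_tu_1(x,0)=v_1(x)$ and $u_1(x,0)=0$. -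 $\gamma=\alpha-1$ (Riemann-Liouville, $\alpha\in(0,1)\cup(1,2)$): ${}^{RL}D_t^{\alpha-1}[u_{\alpha-1}](x,0^+)=v_{\alpha-1}(x)$, and, if $\alpha>1$, ${}^{RL}D_t^{\alpha-2}[u_{\alpha-1}](x,0^+)=0$. - $\gamma=\alpha-2$ (Riemann-Liouville, $\alpha\in(1,2)$ only): ${}^{RL}D_t^{\alpha-2}[u_{\alpha-2}](x,0^+)=v_{\alpha-2}(x)$ and ${}^{RL}D_t^{\alpha-1}[u_{\alpha-2}](x,0^+)=0$. Spectral setting. Let $\tilde f(k)$ be the Fourier transform of $f$ in $x$, normalized so that $-\Delta$ corresponds to multiplication by $k^2:=|k|^2$; $(-\Delta)^m$ is the Fourier multiplier $|k|^{2m}$. The problem is understood mode by mode: for (almost) every $k$, $\tilde u_\gamma(k,t)$ solves $D_t^\alpha\tilde u_\gamma(k,t)=-k^2\tilde u_\gamma(k,t)$ with initial data $\tilde v_\gamma(k)$ (and zero for the other initial datum when $\alpha>1$). *)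

(* Defs.v *)
From HB Require Import structures.
From mathcomp Require Import all_boot all_order all_algebra.
From mathcomp Require Import complex.
From mathcomp Require Import all_classical all_reals all_analysis.

Set Implicit Arguments.
Unset Strict Implicit.
Unset Printing Implicit Defensive.

Import Order.TTheory GRing.Theory Num.Theory.
Import numFieldNormedType.Exports.

Local Open Scope classical_set_scope.
Local Open Scope ring_scope.
Local Open Scope complex_scope.

Notation Rn R n := (n.-tuple (measurableTypeR R)).

(* Lebesgue measure on R^n, by recursion on the dimension: the product of the
    one-dimensional measure with the measure on R^n, carried to R^(n+1). *)
Section lebesgue_Rn.
Context {R : realType}.
Local Notation mR := (measurableTypeR R).

Definition cons_pair n (p : mR * Rn R n) : Rn R n.+1 := [tuple of p.1 :: p.2].

Definition uncons n (x : Rn R n.+1) : mR * Rn R n :=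
  (tnth x ord0, [tuple of behead x]).

Lemma cons_pairK n : cancel (@cons_pair n) (@uncons n).
Proof.
move=> [a x]; rewrite /uncons /cons_pair /=; congr (_, _).
by apply: val_inj.
Qed.

Lemma unconsK n : cancel (@uncons n) (@cons_pair n).
Proof. by move=> x; rewrite [RHS]tuple_eta; apply: val_inj. Qed.

Lemma measurable_cons_pair n : measurable_fun setT (@cons_pair n).
Proof. exact: measurable_cons. Qed.

Lemma measurable_uncons n : measurable_fun setT (@uncons n).
Proof.
by apply: measurable_fun_pair; [exact: measurable_tnth|exact: measurable_behead].
Qed.

Section step.
Variables (n : nat) (mu : {sigma_finite_measure set (Rn R n) -> \bar R}).

Definition lebesgue_cons : set (Rn R n.+1) -> \bar R :=
  pushforward (@lebesgue_measure R \x mu)%E (@cons_pair n).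

HB.instance Definition _ := Measure.copy lebesgue_cons
  (measure_function_pushforward__canonical__measure_function_Measure
    (@lebesgue_measure R \x mu)%E (@measurable_cons_pair n)).

Let lebesgue_cons_sigma_finite : sigma_finite setT lebesgue_cons.
Proof.
have /sigma_finiteP[F [FT ndF Foo]] := sigma_finiteT (@lebesgue_measure R).
have /sigma_finiteP[G [GT ndG Goo]] := sigma_finiteT mu.
exists (fun i => @uncons n @^-1` (F i `*` G i)).
  rewrite -preimage_bigcup (_ : \bigcup_i _ = setT) ?preimage_setT//.
  apply/seteqP; split=> // -[x y] _.
  have [i _ Fix] : (\bigcup_i F i) x by rewrite -FT.
  have [j _ Gjy] : (\bigcup_i G i) y by rewrite -GT.
  exists (maxn i j) => //; split => /=.
    by move: x Fix; exact/subsetPset/ndF/leq_maxl.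
  by move: y Gjy; exact/subsetPset/ndG/leq_maxr.
move=> i; have [mF Fi] := Foo i; have [mG Gi] := Goo i.
have mFG : measurable (F i `*` G i) by exact: measurableX.
split; first by rewrite -[X in measurable X]setTI; exact: measurable_uncons.
rewrite /lebesgue_cons /pushforward -comp_preimage (_ : _ \o _ = id); last first.
  by apply/funext => p; exact: cons_pairK.
by rewrite preimage_id product_measure1E// lte_mul_pinfty// ge0_fin_numE.
Qed.

HB.instance Definition _ :=
  Measure_isSigmaFinite.Build _ _ _ lebesgue_cons lebesgue_cons_sigma_finite.

End step.

Fixpoint lebesgueRn n : {sigma_finite_measure set (Rn R n) -> \bar R} :=
  if n is n'.+1 then lebesgue_cons (lebesgueRn n')
  else \d_([tuple] : Rn R 0).

Lemma lebesgueRn_box n (I : 'I_n -> interval R) :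
  lebesgueRn n [set x | forall i, [set` I i] (tnth x i)] =
  (\prod_(i < n) lebesgue_measure [set` I i])%E.
Proof.
elim: n I => [|n IHn] I.
  rewrite big_ord0 /= diracE mem_set//= => -[].
  by [].
rewrite big_ord_recl -IHn /= /lebesgue_cons /pushforward.
rewrite -[RHS]product_measure1E//; last first.
  rewrite (_ : mkset _ = \bigcap_(i in [set: 'I_n])
    ((@tnth n mR ^~ i) @^-1` [set` I (lift ord0 i)])); last first.
    by apply/seteqP; split=> x /= h i => [_|]; exact: h.
  apply: fin_bigcap_measurable => [|i _]; first exact: finite_finset.
  rewrite -[X in measurable X]setTI; apply: measurable_tnth => //.
congr (_ _); apply/seteqP; split => -[a x] /=.
  move=> h; split; first exact: (h ord0).
  by move=> i; have := h (lift ord0 i); rewrite tnthS.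
move=> [h0 h] i; case: (unliftP ord0 i) => [j ->|->//].
by rewrite tnthS; exact: h.
Qed.

End lebesgue_Rn.

Section L2_fourier.
Context {R : realType} {n : nat}.
Implicit Types (f g F : Rn R n -> R[i]) (k x : Rn R n).

Definition dotRn k x : R := \sum_(i < n) tnth k i * tnth x i.

Definition sqnormRn k : R := dotRn k k.

Definition normL2 f : \bar R :=
  Lnorm (lebesgueRn n) 2%:E (fun x => (Normc.normc (f x))%:E).

Definition in_L2 f : Prop :=
  [/\ measurable_fun setT (fun x => complex.Re (f x)),
      measurable_fun setT (fun x => complex.Im (f x)) &
      (normL2 f < +oo)%E].

Definition cvg_L2 (G : set_system R) (h : R -> Rn R n -> R[i]) f : Prop :=
  normL2 (fun x => h t x - f x) @[t --> G] --> 0%E.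

Definition Cintegral (D : set (Rn R n)) f : R[i] :=
  (\int[lebesgueRn n]_(x in D) complex.Re (f x)) +i*
  (\int[lebesgueRn n]_(x in D) complex.Im (f x)).

Definition fourier_ball f (r : R) k : R[i] :=
  Cintegral [set x | sqnormRn x <= r ^+ 2]
    (fun x => f x * (cos (dotRn k x) -i* sin (dotRn k x))).

(* [F] is the Fourier-Plancherel transform of [f], with kernel e^{-i k.x} and no
   prefactor. [F] is only determined almost everywhere. *)
Definition is_fourier f F : Prop :=
  [/\ in_L2 f, in_L2 F &
      normL2 (fun k => fourier_ball f N%:R k - F k) @[N --> \oo] --> 0%E].

Definition is_neg_laplacian_pow (m : nat) f g : Prop :=
  exists2 F, is_fourier f F &
    is_fourier g (fun k => (sqnormRn k ^+ m)%:C * F k).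

End L2_fourier.

Section fractional_calculus.
Context {R : realType}.
Implicit Types (f : R -> R) (alpha nu t : R).

(* Euler's integral for x > 0, continued to x < 0 by
   Gamma (x + m) = x (x + 1) ... (x + m - 1) Gamma x, where x + m is in [0, 1[.
   The value at the poles is meaningless. *)
Definition Gamma (x : R) : R :=
  let m := if 0 < x then 0%N else `|Num.floor x|%N in
  (\int[lebesgue_measure]_(s in `]0, +oo[) (s `^ (x + m%:R - 1) * expR (- s)))
  / \prod_(i < m) (x + i%:R).

Definition RL_integral nu f t : R :=
  if nu == 0 then f t else
  (Gamma nu)^-1 *
  \int[lebesgue_measure]_(z in `]0, t[) (f z * (t - z) `^ (nu - 1)).

Inductive derivative_kind := Caputo | RiemannLiouville.

Definition ceiln (x : R) : nat := `|Num.ceil x|%N.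

Definition fracD (K : derivative_kind) alpha f : R -> R :=
  if alpha <= 0 then RL_integral (- alpha) f else
  let m := ceiln alpha in
  match K with
  | Caputo => RL_integral (m%:R - alpha) (derive1n m f)
  | RiemannLiouville => derive1n m (RL_integral (m%:R - alpha) f)
  end.

Definition derivable_times (m : nat) f : Prop :=
  forall j t, (j < m)%N -> 0 < t -> derivable (derive1n j f) t 1.

Definition continuous_locally_integrable f : Prop :=
  (forall t, 0 < t -> {for t, continuous f}) /\
  (forall T, 0 < T ->
     lebesgue_measure.-integrable `]0, T[ (fun t => (f t)%:E)).

(* Since [derive1n] and integrals are total functions, this is what makes the
   formula for [fracD K alpha f t] meaningful at every t > 0. *)
Definition fracD_exists (K : derivative_kind) alpha f : Prop :=
  let m := ceiln alpha in
  match K with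
  | Caputo =>
      derivable_times m f /\ continuous_locally_integrable (derive1n m f)
  | RiemannLiouville =>
      continuous_locally_integrable f /\
      derivable_times m (RL_integral (m%:R - alpha) f)
  end.

Definition CfracD (K : derivative_kind) alpha (y : R -> R[i]) (t : R) : R[i] :=
  fracD K alpha (fun s => complex.Re (y s)) t +i*
  fracD K alpha (fun s => complex.Im (y s)) t.

End fractional_calculus.

Section diffusion.
Context {R : realType}.
Variable alpha : R.

(* The index gamma in {0, 1, alpha - 1, alpha - 2} of the prescribed datum; the
   first two cases use Caputo derivatives, the others Riemann-Liouville ones. *)
Inductive datum_index := gamma_0 | gamma_1 | gamma_am1 | gamma_am2.

Definition kind_of (i : datum_index) : derivative_kind :=
  match i with
  | gamma_0 | gamma_1 => Caputo
  | gamma_am1 | gamma_am2 => RiemannLiouville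
  end.

Definition order_of (i : datum_index) : R :=
  match i with
  | gamma_0 => 0
  | gamma_1 => 1
  | gamma_am1 => alpha - 1
  | gamma_am2 => alpha - 2
  end.

(* The index of the datum that vanishes when alpha > 1. *)
Definition other_index (i : datum_index) : datum_index :=
  match i with
  | gamma_0 => gamma_1
  | gamma_1 => gamma_0
  | gamma_am1 => gamma_am2
  | gamma_am2 => gamma_am1
  end.

(* D_t^alpha f = - lambda f on t > 0 with initial datum [a]. *)
Definition mode_solution (i : datum_index) (lambda a : R) (f : R -> R) : Prop :=
  [/\ fracD_exists (kind_of i) alpha f,
      forall t, 0 < t -> fracD (kind_of i) alpha f t = - lambda * f t,
      fracD (kind_of i) (order_of i) f t @[t --> 0^'+] --> a &
      1 < alpha ->
      fracD (kind_of i) (order_of (other_index i)) f t @[t --> 0^'+] --> 0].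

(* [U t] and [V] represent the Fourier transforms of [u t] and [v]; the modes
   t |-> U t k are complex valued and solve an equation with real coefficients,
   hence the separate real and imaginary parts. *)
Definition diffusion_solution (n : nat) (i : datum_index)
    (v : Rn R n -> R[i]) (u : R -> Rn R n -> R[i]) : Prop :=
  exists (V : Rn R n -> R[i]) (U : R -> Rn R n -> R[i]),
  [/\ is_fourier v V,
      forall t, 0 < t -> is_fourier (u t) (U t),
      {ae lebesgueRn n, forall k,
        mode_solution i (sqnormRn k) (complex.Re (V k))
          (fun t => complex.Re (U t k)) /\
        mode_solution i (sqnormRn k) (complex.Im (V k))
          (fun t => complex.Im (U t k))} &
      exists2 Du : R -> Rn R n -> R[i],
        (forall t, 0 < t -> is_fourier (Du t)
          (fun k => CfracD (kind_of i) (order_of i) (U ^~ k) t)) &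
        cvg_L2 (0 : R)^'+ Du v].

End diffusion.

(* Main.v *)
(* Each Fourier mode solves a linear Volterra equation, which has at most one
   solution by injectivity of the Laplace transform (Lerch).  The solution is the
   Mittag-Leffler function, written as the integral of
   e^{tw} w^p / (w^alpha + lambda) over a pair of rays arg w = +- theta,
   pi/2 < theta < pi, along which w^alpha + lambda does not vanish.  On this
   integral, scaling and dominated convergence show that
   c(t) |k|^{2m} u^(k, t) = M(|k|^2 t^alpha) v^(k) with M bounded and M -> 1 at
   infinity; c(t) comes from the inverse Laplace transform t^{-q-1} / Gamma(-q) of
   w^q.  Dominated convergence in k and Plancherel's theorem then
   give the limits in L2.  Plancherel on the line is proved with the Abel kernel
   e^{-eps |k|} and extended to R^n by Fubini; surjectivity of the transform, which
   provides (-Delta)^m u, follows from the inversion formula and completeness. *)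
Require Import Defs.
From mathcomp Require Import all_boot all_order all_algebra.
From mathcomp Require Import complex.
From mathcomp Require Import all_classical all_reals all_analysis.
From mathcomp Require Import measurable_realfun.
From mathcomp Require Import ring lra.

Set Implicit Arguments.
Unset Strict Implicit.
Unset Printing Implicit Defensive.

Import Order.TTheory GRing.Theory Num.Theory.
Import numFieldNormedType.Exports.

Local Open Scope classical_set_scope.
Local Open Scope ring_scope.
Local Open Scope complex_scope.

(** * Real-valued Lebesgue integrals *)

(** The assumptions on a mode are local in [t > 0]: they give no growth bound at infinity, and a
    Riemann-Liouville solution may blow up at 0. The equation is therefore integrated once and
    studied through [J 1 f]: fractional integrals of total order at least 1 compose at every [t],
    and the exponential bound on [J 1 f] comes from the Volterra equation itself, by absorption.

    With [w = e^{x + i t}] sectors become rectangles, and Cauchy's theorem is Fubini applied to the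
    Cauchy-Riemann equations. What is needed about [Gamma] (functional equation, beta integral,
    Hankel's formula) is read off from the contour integrals.

    The squared Laplacian of the Riemann-Liouville cases comes from the zeros of [1 / Gamma] at 0
    and -1. In [lam w^j / (w^al + lam) = w^j - w^{al + j} / (w^al + lam)], with [j = 0] or [1], the
    term [w^j] has zero inverse transform; what remains decays like the inverse transform of
    [- w^{al + j} / lam], which accounts for one more factor [1 / lam] and for the minus sign. The
    rays need [pi / 2 < theta < pi] and [alpha theta < pi], which is possible because
    [alpha < 2]. *)

Notation L1 mu f := (integrable mu setT (EFin \o f)).
Notation RI mu f := (Rintegral mu setT f).

Section real_integrals.
Context d (T : measurableType d) (R : realType).
Variable mu : {measure set T -> \bar R}.
Implicit Types f g h : T -> R.

Lemma L1_measurable f : L1 mu f -> measurable_fun setT f.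
Proof. by move=> /measurable_int /measurable_EFinP. Qed.

Lemma L1_le f g : measurable_fun setT f -> L1 mu g ->
  (forall x, `|f x| <= g x) -> L1 mu f.
Proof.
move=> mf ig fg; apply: le_integrable ig => //; first exact/measurable_EFinP.
by move=> x _ /=; rewrite lee_fin (le_trans (fg x))// ler_norm.
Qed.

Lemma L1_D f g : L1 mu f -> L1 mu g -> L1 mu (fun x => f x + g x).
Proof. by move=> fi gi; exact: (integrableD measurableT fi gi). Qed.

Lemma L1_B f g : L1 mu f -> L1 mu g -> L1 mu (fun x => f x - g x).
Proof. by move=> fi gi; exact: (integrableB measurableT fi gi). Qed.

Lemma L1_Z (k : R) f : L1 mu f -> L1 mu (fun x => k * f x).
Proof. by move=> fi; exact: (integrableZl measurableT k fi). Qed.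

Lemma L1_0 : L1 mu (fun=> 0).
Proof. exact: integrable0. Qed.

Lemma L1_norm f : L1 mu f -> L1 mu (fun x => `|f x|).
Proof. exact: integrable_norm. Qed.

Lemma L1_bM (M : R) h f : measurable_fun setT h -> (forall x, `|h x| <= M) ->
  L1 mu f -> L1 mu (fun x => h x * f x).
Proof.
move=> mh hM fi; have mf := L1_measurable fi.
apply: (@L1_le _ (fun x => M * `|f x|)); first exact: measurable_funM.
  exact/L1_Z/L1_norm.
by move=> x; rewrite normrM ler_wpM2r.
Qed.

Lemma RI_D f g : L1 mu f -> L1 mu g ->
  RI mu (fun x => f x + g x) = RI mu f + RI mu g.
Proof. exact: RintegralD. Qed.

Lemma RI_B f g : L1 mu f -> L1 mu g ->
  RI mu (fun x => f x - g x) = RI mu f - RI mu g.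
Proof. exact: RintegralB. Qed.

Lemma RI_Z (k : R) f : L1 mu f -> RI mu (fun x => k * f x) = k * RI mu f.
Proof. exact: RintegralZl. Qed.

Lemma RI_0 : RI mu (fun=> 0) = 0.
Proof. by rewrite /Rintegral integral0. Qed.

Lemma RI_le f g : L1 mu f -> L1 mu g -> (forall x, f x <= g x) ->
  RI mu f <= RI mu g.
Proof. by move=> fi gi fg; exact: le_Rintegral. Qed.

Lemma RI_ge0 f : (forall x, 0 <= f x) -> 0 <= RI mu f.
Proof. by move=> f0; exact: Rintegral_ge0. Qed.

Lemma RI_normr f : L1 mu f -> `|RI mu f| <= RI mu (fun x => `|f x|).
Proof. exact: le_normr_Rintegral. Qed.

Lemma RI_normr_le f g : L1 mu f -> L1 mu g -> (forall x, `|f x| <= g x) ->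
  `|RI mu f| <= RI mu g.
Proof.
by move=> fi gi fg; rewrite (le_trans (RI_normr fi))// RI_le//; exact: L1_norm.
Qed.

Lemma eq_RI f g : f =1 g -> RI mu f = RI mu g.
Proof. by move=> fg; apply: eq_Rintegral => x _; exact: fg. Qed.

Lemma RI_EFin f : L1 mu f -> (RI mu f)%:E = (\int[mu]_x (f x)%:E)%E.
Proof. by move=> fi; rewrite fineK//; exact: integrable_fin_num. Qed.

Lemma ge0_RI_EFin f (I : R) : measurable_fun setT f -> (forall x, 0 <= f x) ->
  (\int[mu]_x (f x)%:E)%E = I%:E -> L1 mu f /\ RI mu f = I.
Proof.
move=> mf f0 fI; split; last by rewrite /Rintegral fI.
apply/integrableP; split; first exact/measurable_EFinP.
by under eq_integral do rewrite /= ger0_norm//; rewrite fI ltry.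
Qed.

Lemma ge0_L1 f (I : R) : measurable_fun setT f -> (forall x, 0 <= f x) ->
  (\int[mu]_x (f x)%:E <= I%:E)%E -> L1 mu f.
Proof.
move=> mf f0 fI; apply/integrableP; split; first exact/measurable_EFinP.
by under eq_integral do rewrite /= ger0_norm//; exact: le_lt_trans (ltry I).
Qed.

Lemma ae_eq_L1 f g : {ae mu, forall x, f x = g x} -> measurable_fun setT g ->
  L1 mu f -> L1 mu g.
Proof.
move=> fg mg /integrableP[mf fi]; apply/integrableP.
split; first exact/measurable_EFinP.
rewrite -(@ge0_ae_eq_integral _ _ _ mu setT (abse \o (EFin \o f)))//.
- exact: measurableT_comp.
- by apply: measurableT_comp => //; exact/measurable_EFinP.
- by move=> x _; exact: abse_ge0.
- by apply: filterS fg => x /= -> .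
Qed.

Lemma ae_eq_RI f g : {ae mu, forall x, f x = g x} -> measurable_fun setT f ->
  measurable_fun setT g -> RI mu f = RI mu g.
Proof.
move=> fg mf mg; congr fine; apply: ae_eq_integral => //.
- exact/measurable_EFinP.
- exact/measurable_EFinP.
- by apply: filterS fg => x /= ->.
Qed.

Lemma ae_L1_le f g : measurable_fun setT f -> L1 mu g ->
  {ae mu, forall x, `|f x| <= g x} -> L1 mu f.
Proof.
move=> mf gi fg; have mg := L1_measurable gi.
(* Cutting [|f|] at [g] turns the almost everywhere bound into one that holds everywhere, and
   changes [|f|] only on a null set. *)
pose h x := Num.min `|f x| (g x).
have hi : L1 mu h.
  apply: (@L1_le _ (fun x => `|g x|)); last 1 first.
  - move=> x; rewrite /h; case: (ltP `|f x| (g x)) => // H.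
    by rewrite ger0_norm// (le_trans (ltW H))// ler_norm.
  - by apply: measurable_minr => //; exact: measurableT_comp.
  - exact: L1_norm.
suff : L1 mu (fun x => `|f x|).
  by move=> fi; apply: L1_le fi _ => // x; rewrite normr_id.
apply: ae_eq_L1 hi.
- by apply: filterS fg => x; rewrite /h; case: ltP => // h1 h2; apply/eqP; rewrite eq_le h1.
- exact: measurableT_comp.
Qed.

Lemma RI_dct (f_ : nat -> T -> R) f g :
  (forall n, measurable_fun setT (f_ n)) -> measurable_fun setT f ->
  {ae mu, forall x, f_ n x @[n --> \oo] --> f x} -> L1 mu g ->
  {ae mu, forall x, forall n, `|f_ n x| <= g x} ->
  L1 mu f /\ RI mu (f_ n) @[n --> \oo] --> RI mu f.
Proof.
move=> mf_ mf f_f gi fg.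
have mf_' n : measurable_fun setT (EFin \o f_ n) by exact/measurable_EFinP.
have mf' : measurable_fun setT (EFin \o f) by exact/measurable_EFinP.
have f_f' : {ae mu, forall x, setT x -> (EFin \o f_ n) x @[n --> \oo] --> (EFin \o f) x}.
  by apply: filterS f_f => x h _; apply: cvg_EFin h; exact: nearW.
have fg' : {ae mu, forall x n, setT x -> (`|(EFin \o f_ n) x| <= (EFin \o g) x)%E}.
  by apply: filterS fg => x h n _ /=; rewrite lee_fin.
have [fi _ cv] := dominated_convergence measurableT mf_' mf' f_f' gi fg'.
split=> //; apply: fine_cvg; rewrite fineK//; exact: integrable_fin_num.
Qed.

End real_integrals.

(** * Fubini's theorem for real-valued integrals *)

Section fubini_real.
Context d1 d2 (T1 : measurableType d1) (T2 : measurableType d2) (R : realType).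
Variable m1 : {sigma_finite_measure set T1 -> \bar R}.
Variable m2 : {sigma_finite_measure set T2 -> \bar R}.
Implicit Type f : T1 * T2 -> R.

(** The inner integral may diverge on a null set of [x], where [fine] returns a default value.
    Almost everywhere it agrees with the extended-real inner integral, to which Fubini applies. *)
Lemma RI_prod1 f : L1 (m1 \x m2)%E f ->
  L1 m1 (fun x => RI m2 (fun y => f (x, y))) /\
  RI m1 (fun x => RI m2 (fun y => f (x, y))) = RI (m1 \x m2)%E f.
Proof.
move=> fi.
have aefin : {ae m1, forall x, ((RI m2 (fun y => f (x, y)))%:E =
    \int[m2]_y (EFin \o f) (x, y))%E}.
  by apply: filterS (ae_integrable1 fi) => x; exact: RI_EFin.
have mF := measurable_fubini_F fi; have iF := integrable_fubini_F fi.
have mRF : measurable_fun setT (fun x => RI m2 (fun y => f (x, y))).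
  exact: (measurableT_comp (fine_measurable measurableT) mF).
split.
  apply/integrableP; split; first exact/measurable_EFinP.
  move/integrableP : iF => [_].
  rewrite -(@ge0_ae_eq_integral _ _ _ m1 setT
     (abse \o (EFin \o (fun x => RI m2 (fun y => f (x, y))))))//.
  - by apply: measurableT_comp => //; exact/measurable_EFinP.
  - exact: measurableT_comp.
  - by move=> x _; exact: abse_ge0.
  - by apply: filterS aefin => x h _; exact: (congr1 abse h).
congr fine; rewrite -integral12_prod_meas1//.
apply: ae_eq_integral => //; first exact/measurable_EFinP.
by apply: filterS aefin => x /= ->.
Qed.

Lemma RI_prod2 f : L1 (m1 \x m2)%E f ->
  L1 m2 (fun y => RI m1 (fun x => f (x, y))) /\
  RI m2 (fun y => RI m1 (fun x => f (x, y))) = RI (m1 \x m2)%E f.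
Proof.
move=> fi.
have aefin : {ae m2, forall y, ((RI m1 (fun x => f (x, y)))%:E =
    \int[m1]_x (EFin \o f) (x, y))%E}.
  by apply: filterS (ae_integrable2 fi) => x; exact: RI_EFin.
have mF := measurable_fubini_G fi.
have mRF : measurable_fun setT (fun y => RI m1 (fun x => f (x, y))).
  exact: (measurableT_comp (fine_measurable measurableT) mF).
split.
  apply/integrableP; split; first exact/measurable_EFinP.
  have mf := measurable_int _ fi.
  have mG : measurable_fun setT (fun y => \int[m1]_x (abse \o (EFin \o f)) (x, y))%E.
    apply: (measurable_fun_fubini_tonelli_G (abse \o (EFin \o f))) => //.
      exact: measurableT_comp.
    by move=> x; exact: abse_ge0.
  apply: le_lt_trans ((@integrable21ltyP _ _ _ _ _ m1 m2 (EFin \o f) mf).1 fi).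
  apply: ae_ge0_le_integral => //.
  - by apply: measurableT_comp => //; exact/measurable_EFinP.
  - by move=> x _; exact: integral_ge0.
  - apply: filterS aefin => y h _.
    apply: (@le_trans _ _ `|\int[m1]_x (EFin \o f) (x, y)|%E); last first.
      apply: le_abse_integral => //.
      exact: (measurableT_comp mf (measurable_pair2 _)).
    by move: (congr1 abse h) => /= ->.
congr fine; rewrite -integral21_prod_meas1//.
apply: ae_eq_integral => //; first exact/measurable_EFinP.
by apply: filterS aefin => x /= ->.
Qed.

Lemma RI_fubini f : L1 (m1 \x m2)%E f ->
  RI m1 (fun x => RI m2 (fun y => f (x, y))) =
  RI m2 (fun y => RI m1 (fun x => f (x, y))).
Proof. by move=> fi; rewrite (RI_prod1 fi).2 (RI_prod2 fi).2. Qed.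

Lemma L1_prod f (g : T1 -> R) : measurable_fun setT f -> L1 m1 g ->
  (forall x, (\int[m2]_y `|f (x, y)|%:E <= (g x)%:E)%E) -> L1 (m1 \x m2)%E f.
Proof.
move=> mf gi fg; apply/(integrable12ltyP _); first exact/measurable_EFinP.
have /integrableP[mg] := gi; apply: le_lt_trans.
apply: ge0_le_integral => //=.
- by move=> x _; exact: integral_ge0.
- apply: (measurable_fun_fubini_tonelli_F (EFin \o (Num.norm \o f))) => //.
  + by apply/measurable_EFinP/measurableT_comp.
  + by move=> x; rewrite lee_fin /=.
- by apply/measurable_EFinP/measurableT_comp => //; exact: L1_measurable gi.
- by move=> x _; rewrite (le_trans (fg x))// lee_fin ler_norm.
Qed.

Lemma L1_prodM f (g : T1 -> R) (h : T2 -> R) : measurable_fun setT f ->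
  L1 m1 g -> L1 m2 h -> (forall x y, `|f (x, y)| <= g x * h y) ->
  L1 (m1 \x m2)%E f.
Proof.
move=> mf gi hi fgh.
pose C := RI m2 (fun y => `|h y|).
apply: (@L1_prod _ (fun x => C * `|g x|)) => //; first exact/L1_Z/L1_norm.
move=> x; rewrite /C EFinM (RI_EFin (L1_norm hi)) -ge0_integralZr//.
- apply: ge0_le_integral => //.
  + apply/measurable_EFinP/measurableT_comp => //.
    exact: (measurableT_comp mf (measurable_pair1 _)).
  + apply: emeasurable_funM => //; apply/measurable_EFinP.
    by apply: measurableT_comp => //; exact: L1_measurable hi.
  + move=> y _; rewrite lee_fin (le_trans (fgh x y))//.
    by rewrite (le_trans (ler_norm _))// normrM mulrC.
- by apply/measurable_EFinP/measurableT_comp => //; exact: L1_measurable hi.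
Qed.

End fubini_real.

(** * Affine changes of variable *)

Section affine_change.
Context {R : realType}.
Local Notation mu := (@lebesgue_measure R).

Definition affine (c a : R) (x : measurableTypeR R) : measurableTypeR R := c * x + a.

Lemma measurable_affine c a : measurable_fun setT (affine c a).
Proof. by apply: measurable_funD => //; exact: measurable_funM. Qed.

(** By uniqueness of Lebesgue measure, it is enough to compare the two sides on the intervals []u,
    v]]. A negative [c] reverses the endpoints of the preimage, which becomes closed on the left. *)
Lemma lebesgue_measure_affine c a (A : set (measurableTypeR R)) :
  c != 0 -> measurable A ->
  mu A = (`|c|%:E * pushforward mu (affine c a) A)%E.
Proof.
move=> c0 mA.
pose nu := pushforward mu (affine c a).
pose m := mscale (NngNum (normr_ge0 c)) (measure_function_pushforward__canonical__measure_function_Measure mu (measurable_affine c a)).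
rewrite -[RHS]/(m A).
apply: lebesgue_measure_unique => //= _ [[u v]] _ <-.
rewrite /m /mscale/= /pushforward.
have [c_gt0|c_lt0|/eqP] := ltgtP 0 c; last by rewrite eq_sym (negbTE c0).
- rewrite (_ : affine c a @^-1` _ = `]((u - a) / c), ((v - a) / c)]%classic); last first.
    apply/seteqP; split=> x /=; rewrite /affine !in_itv/=;
      by rewrite ltr_pdivrMr// ler_pdivlMr// ltrBlDr lerBrDr mulrC.
  rewrite !lebesgue_measure_itv/= !lte_fin ltr_pM2r ?invr_gt0// ltrD2r.
  case: ifPn => _; last by rewrite mule0.
  rewrite -!EFinB -EFinM; congr EFin; rewrite gtr0_norm//.
  by field.
- rewrite (_ : affine c a @^-1` _ = `[((v - a) / c), ((u - a) / c)[%classic); last first.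
    apply/seteqP; split=> x /=; rewrite /affine !in_itv/=;
      by rewrite ltr_ndivlMr// ler_ndivrMr// ltrBlDr lerBrDr mulrC andbC.
  rewrite !lebesgue_measure_itv/= !lte_fin ltr_nM2r ?invr_lt0// ltrD2r.
  case: ifPn => _; last by rewrite mule0.
  rewrite -!EFinB -EFinM; congr EFin; rewrite ltr0_norm//.
  by field.
Qed.

Lemma ge0_integral_affine c a (f : R -> \bar R) : c != 0 ->
  measurable_fun setT f -> (forall x, (0 <= f x)%E) ->
  (\int[mu]_x f (c * x + a)%R = `|c|^-1%:E * \int[mu]_x f x)%E.
Proof.
move=> c0 mf f0.
pose P := measure_function_pushforward__canonical__measure_function_Measure mu (measurable_affine c a).
pose m := mscale (NngNum (normr_ge0 c)) P.
have -> : (\int[mu]_x f x = \int[m]_x f x)%E.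
  by apply: eq_measure_integral => A mA _; exact: lebesgue_measure_affine.
rewrite ge0_integral_mscale//= muleA -EFinM mulVf ?normr_eq0// mul1e.
rewrite ge0_integral_pushforward//; exact: measurable_affine.
Qed.

Lemma L1_affine c a (f : R -> R) : c != 0 -> L1 mu f ->
  L1 mu (fun x => f (c * x + a)).
Proof.
move=> c0 fi; have mf := L1_measurable fi.
have mfa : measurable_fun setT (fun x : R => f (c * x + a)).
  exact: (measurableT_comp mf (measurable_affine c a)).
apply/integrableP; split; first exact/measurable_EFinP.
have /integrableP[_] := fi.
rewrite (@ge0_integral_affine c a (abse \o (EFin \o f)))//; last 2 first.
- by apply: measurableT_comp => //; exact/measurable_EFinP.
- by move=> x; exact: abse_ge0.
by move=> h; rewrite lte_mul_pinfty// lee_fin invr_ge0.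
Qed.

Lemma RI_affine c a (f : R -> R) : c != 0 -> L1 mu f ->
  RI mu (fun x => f (c * x + a)) = `|c|^-1 * RI mu f.
Proof.
move=> c0 fi; have mf := L1_measurable fi.
have pn g : L1 mu g -> (forall x, 0 <= g x) ->
    RI mu (fun x => g (c * x + a)) = `|c|^-1 * RI mu g.
  move=> gi g0; apply: EFin_inj; rewrite EFinM (RI_EFin gi) RI_EFin; last exact: L1_affine.
  rewrite -(@ge0_integral_affine c a (EFin \o g))//.
  exact: (measurable_int _ gi).
pose fp x := Num.max (f x) 0; pose fn x := Num.max (- f x) 0.
have mfp : measurable_fun setT fp by exact: measurable_maxr.
have mfn : measurable_fun setT fn by apply: measurable_maxr => //; exact: measurableT_comp.
have fpi : L1 mu fp.
  apply: L1_le (L1_norm fi) _ => // x; rewrite /fp ger0_norm ?le_max ?lexx ?orbT//.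
  by rewrite ge_max ler_norm normr_ge0.
have fni : L1 mu fn.
  apply: L1_le (L1_norm fi) _ => // x; rewrite /fn ger0_norm ?le_max ?lexx ?orbT//.
  by rewrite ge_max -normrN ler_norm normr_ge0.
have -> : f = (fun x => fp x - fn x).
  apply/funext => x; rewrite /fp /fn; case: (leP 0 (f x)) => h.
    by rewrite max_r ?oppr_le0// subr0.
  by rewrite max_l ?oppr_ge0 1?ltW// sub0r opprK.
rewrite !RI_B ?(L1_affine _ c0)// mulrBr !pn// => x; by rewrite le_max lexx orbT.
Qed.

End affine_change.

(** * Derivatives and complex-valued integrals *)

Section real_calculus.
Context {R : realType}.
Local Notation mu := (@lebesgue_measure R).
Local Notation D1 f x d := (is_derive (x : R) (1 : R) (f : R -> R) (d : R)).

Lemma D1_eq (f : R -> R) x d d' : D1 f x d -> d = d' -> D1 f x d'.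
Proof. by move=> h <-. Qed.

Lemma D1_cst (c x : R) : D1 (fun=> c) x 0.
Proof. exact: is_derive_cst. Qed.

Lemma D1_id (x : R) : D1 (fun y => y) x 1.
Proof. exact: is_derive_id. Qed.

Lemma D1_D (f g : R -> R) x a b : D1 f x a -> D1 g x b ->
  D1 (fun y => f y + g y) x (a + b).
Proof. by move=> fa gb; exact: is_deriveD. Qed.

Lemma D1_N (f : R -> R) x a : D1 f x a -> D1 (fun y => - f y) x (- a).
Proof. by move=> fa; exact: is_deriveN. Qed.

Lemma D1_B (f g : R -> R) x a b : D1 f x a -> D1 g x b ->
  D1 (fun y => f y - g y) x (a - b).
Proof. by move=> fa gb; apply: D1_D => //; exact: D1_N. Qed.

Lemma D1_M (f g : R -> R) x a b : D1 f x a -> D1 g x b ->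
  D1 (fun y => f y * g y) x (a * g x + f x * b).
Proof.
move=> fa gb.
have h : D1 (fun y => f y * g y) x (f x *: b + g x *: a) by exact: is_deriveM.
by apply: (D1_eq h); rewrite /GRing.scale/= addrC; congr (_ + _); rewrite mulrC.
Qed.

Lemma D1_Z (c : R) (f : R -> R) x a : D1 f x a -> D1 (fun y => c * f y) x (c * a).
Proof.
move=> fa; have h := D1_M (D1_cst c x) fa.
by apply: (D1_eq h); rewrite mul0r add0r.
Qed.

Lemma D1_comp (f g : R -> R) x a b : D1 g (f x) b -> D1 f x a ->
  D1 (fun y => g (f y)) x (b * a).
Proof. by move=> gb fa; apply: D1_eq (is_derive1_comp _ _) _; rewrite // mulrC. Qed.

Lemma D1_V (f : R -> R) x a : f x != 0 -> D1 f x a ->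
  D1 (fun y => (f y)^-1) x (- a / f x ^+ 2).
Proof.
move=> f0 fa.
have h : D1 (fun y => (f y)^-1) x (- (f x) ^- 2 *: a) by exact: is_deriveV.
by apply: (D1_eq h); rewrite /GRing.scale/=; field.
Qed.

Lemma D1_expR (f : R -> R) x a : D1 f x a -> D1 (fun y => expR (f y)) x (expR (f x) * a).
Proof. by move=> fa; apply: D1_comp. Qed.

Lemma D1_cos (f : R -> R) x a : D1 f x a -> D1 (fun y => cos (f y)) x (- sin (f x) * a).
Proof. by move=> fa; apply: D1_comp. Qed.

Lemma D1_sin (f : R -> R) x a : D1 f x a -> D1 (fun y => sin (f y)) x (cos (f x) * a).
Proof. by move=> fa; apply: D1_comp. Qed.

Lemma D1_lin (c x : R) : D1 (fun y => c * y) x c.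
Proof. by apply: D1_eq (D1_Z c (D1_id x)) _; rewrite mulr1. Qed.

Lemma D1_continuous (f : R -> R) x a : D1 f x a -> {for x, continuous f}.
Proof. by move=> [df _]; apply: differentiable_continuous; exact/derivable1_diffP. Qed.

Lemma within_continuous_pt (a b : R) (f : R -> R) :
  (forall x, a <= x <= b -> {for x, continuous f}) -> {within `[a, b], continuous f}.
Proof.
move=> cf; apply: continuous_in_subspaceT => x; rewrite inE/= in_itv/= => xab.
exact: cf.
Qed.

Lemma continuous_L1_itv (a b : R) (f : R -> R) :
  (forall x, a <= x <= b -> {for x, continuous f}) ->
  mu.-integrable `[a, b] (EFin \o f).
Proof.
move=> cf; apply: continuous_compact_integrable; first exact: segment_compact.
exact: within_continuous_pt.
Qed.

Lemma RI_FTC (a b : R) (F f : R -> R) : a <= b ->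
  (forall x, a <= x <= b -> D1 F x (f x)) ->
  (forall x, a <= x <= b -> {for x, continuous f}) ->
  (\int[mu]_(x in `[a, b]) f x)%R = F b - F a.
Proof.
rewrite le_eqVlt => /predU1P[<- _ _|ab dF cf].
  by rewrite set_itv1 Rintegral_set1 subrr.
rewrite /Rintegral (@continuous_FTC2 _ f F)//.
- exact: within_continuous_pt.
- split.
  + move=> x /[!in_itv]/= /andP[ax xb].
    by have [] := dF x; first by rewrite !ltW.
  + apply: cvg_at_right_filter; apply: (D1_continuous (dF _ _)).
    by rewrite lexx ltW.
  + apply: cvg_at_left_filter; apply: (D1_continuous (dF _ _)).
    by rewrite lexx ltW.
- move=> x /[!in_itv]/= /andP[ax xb]; rewrite derive1E.
  by have [|_ ->] := dF x; first by rewrite !ltW.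
Qed.

Lemma RI_indic (A : set R) (f : R -> R) :
  (\int[mu]_(x in A) f x)%R = RI mu (fun x => \1_A x * f x).
Proof.
rewrite Rintegral_mkcond; apply: eq_Rintegral => x _.
by rewrite patchE indicE; case: ifPn; rewrite ?mul1r ?mul0r.
Qed.

Lemma L1_indic (A : set R) (f : R -> R) : measurable A ->
  mu.-integrable A (EFin \o f) <-> L1 mu (fun x => \1_A x * f x).
Proof.
move=> mA.
have <- : (EFin \o f) \_ A = EFin \o (fun x => \1_A x * f x).
  apply/funext => x; rewrite patchE /= indicE.
  by case: ifPn; rewrite ?mul1r ?mul0r.
exact: integrable_mkcond.
Qed.

Lemma RI_FTCT (F f : R -> R) (l m : R) : (forall x, D1 F x (f x)) ->
  (forall x, {for x, continuous f}) -> L1 mu f ->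
  F x @[x --> +oo] --> l -> F x @[x --> -oo] --> m ->
  RI mu f = l - m.
Proof.
move=> dF cf fi Fl Fm.
have mf := L1_measurable fi.
pose f_ n := fun x : R => \1_`[- n%:R, n%:R] x * f x.
have mI n : measurable_fun setT (\1_(`[- n%:R, n%:R] : set R) : R -> R) by exact: measurable_indic.
have [_ cv] : L1 mu f /\ RI mu (f_ n) @[n --> \oo] --> RI mu f.
  apply: (@RI_dct _ _ _ mu f_ f (fun x => `|f x|)) => //.
  - by move=> n; exact: measurable_funM.
  - apply: aeW => x; apply: cvg_near_cst; near=> n.
    rewrite /f_ indicE mem_set ?mul1r//= in_itv/= -ler_norml.
    near: n; exact: nbhs_infty_ger.
  - exact: L1_norm.
  - apply: aeW => x n; rewrite /f_ normrM ler_piMl// indicE.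
    by case: (_ \in _); rewrite ?normr1 ?normr0.
have FE n : RI mu (f_ n) = F n%:R - F (- n%:R).
  rewrite -RI_indic; apply: RI_FTC => //.
  by rewrite lerNl (le_trans (_ : _ <= 0)) ?oppr_le0.
apply: (cvg_unique _ cv) => //.
rewrite (_ : (fun n => _) = fun n => F n%:R - F (- n%:R)); last exact/funext.
apply: cvgB; first exact: (cvg_comp _ _ (@cvgr_idn R) Fl).
apply: (cvg_comp _ _ _ Fm); apply: (cvg_comp _ _ (@cvgr_idn R)).
by apply/cvgNrNy; exact: cvg_id.
Unshelve. all: by end_near. Qed.

Lemma RI_FTCy (F f : R -> R) (l : R) : (forall x, 0 <= x -> D1 F x (f x)) ->
  (forall x, 0 <= x -> {for x, continuous f}) ->
  L1 mu (fun x => \1_`[0, +oo[ x * f x) ->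
  F x @[x --> +oo] --> l ->
  RI mu (fun x => \1_`[0, +oo[ x * f x) = l - F 0.
Proof.
move=> dF cf fi Fl.
have mf := L1_measurable fi.
pose f_ n := fun x : R => \1_`[0, n%:R] x * f x.
have f_E n : f_ n = fun x => \1_`[0, n%:R] x * (\1_`[0, +oo[ x * f x).
  apply/funext => x; rewrite /f_ mulrA; congr (_ * _).
  rewrite !indicE -natrM mulnb; congr ((_ : bool)%:R).
  rewrite -in_setI; congr (_ \in _); apply/seteqP; split => y /=.
    by rewrite !in_itv/= andbT => /andP[-> ->].
  by move=> [].
have [_ cv] : L1 mu (fun x => \1_`[0, +oo[ x * f x) /\ RI mu (f_ n) @[n --> \oo] --> RI mu (fun x => \1_`[0, +oo[ x * f x).
  apply: (@RI_dct _ _ _ mu f_ _ (fun x => `|\1_`[0, +oo[ x * f x|)) => //.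
  - move=> n; rewrite f_E; apply: measurable_funM => //.
  - apply: aeW => x; apply: cvg_near_cst; near=> n.
    rewrite f_E.
    have [x0|x0] := leP 0 x; last first.
      have -> : (\1_`[0, +oo[ x = 0 :> R); last by rewrite mul0r mulr0.
      by rewrite indicE memNset//= in_itv/= andbT; apply/negP; rewrite -ltNge.
    rewrite {1}indicE mem_set ?mul1r//= in_itv/= x0/=.
    near: n; exact: nbhs_infty_ger.
  - exact: L1_norm.
  - apply: aeW => x n; rewrite f_E normrM ler_piMl// indicE.
    by case: (_ \in _); rewrite ?normr1 ?normr0.
have FE n : RI mu (f_ n) = F n%:R - F 0.
  rewrite -RI_indic; apply: RI_FTC => //.
  - by move=> x /andP[x0 _]; exact: dF.
  - by move=> x /andP[x0 _]; exact: cf.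
apply: (cvg_unique _ cv) => //.
rewrite (_ : (fun n => _) = fun n => F n%:R - F 0); last exact/funext.
apply: cvgB; first exact: (cvg_comp _ _ (@cvgr_idn R) Fl).
exact: cvg_cst.
Unshelve. all: by end_near. Qed.

End real_calculus.

(** * Complex-valued measurable and integrable functions, by real and imaginary parts *)

Section complex_integrals.
Context d (T : measurableType d) (R : realType).
Variable mu : {measure set T -> \bar R}.
Implicit Types f g : T -> R[i].

Definition cmeas f := measurable_fun setT (fun x => complex.Re (f x)) /\
  measurable_fun setT (fun x => complex.Im (f x)).

Definition CL1 f := L1 mu (fun x => complex.Re (f x)) /\ L1 mu (fun x => complex.Im (f x)).

Definition CI f : R[i] :=
  RI mu (fun x => complex.Re (f x)) +i* RI mu (fun x => complex.Im (f x)).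

Local Notation normc := Normc.normc.

Lemma cReM (x y : R[i]) : complex.Re (x * y) =
  complex.Re x * complex.Re y - complex.Im x * complex.Im y.
Proof. by case: x y => [a b] [c e]. Qed.

Lemma cImM (x y : R[i]) : complex.Im (x * y) =
  complex.Re x * complex.Im y + complex.Im x * complex.Re y.
Proof. by case: x y => [a b] [c e]. Qed.

Lemma cReD (x y : R[i]) : complex.Re (x + y) = complex.Re x + complex.Re y.
Proof. by case: x y => [a b] [c e]. Qed.

Lemma cImD (x y : R[i]) : complex.Im (x + y) = complex.Im x + complex.Im y.
Proof. by case: x y => [a b] [c e]. Qed.

Lemma cReN (x : R[i]) : complex.Re (- x) = - complex.Re x.
Proof. by case: x => [a b]. Qed.

Lemma cImN (x : R[i]) : complex.Im (- x) = - complex.Im x.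
Proof. by case: x => [a b]. Qed.

Lemma cReV (x : R[i]) : complex.Re x^-1 =
  complex.Re x / (complex.Re x ^+ 2 + complex.Im x ^+ 2).
Proof. by case: x => [a b]. Qed.

Lemma cImV (x : R[i]) : complex.Im x^-1 =
  - (complex.Im x / (complex.Re x ^+ 2 + complex.Im x ^+ 2)).
Proof. by case: x => [a b]. Qed.

Lemma complex_eq (x y : R[i]) : complex.Re x = complex.Re y ->
  complex.Im x = complex.Im y -> x = y.
Proof. by case: x y => [a b] [c e] /= -> ->. Qed.

Lemma normc_sqr (x : R[i]) : normc x ^+ 2 = complex.Re x ^+ 2 + complex.Im x ^+ 2.
Proof. by case: x => a b /=; rewrite sqr_sqrtr// addr_ge0 ?sqr_ge0. Qed.

Lemma normc_ge0 (x : R[i]) : 0 <= normc x.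
Proof. by case: x => a b /=; exact: sqrtr_ge0. Qed.
Hint Resolve normc_ge0 : core.

Lemma normr_Re_le (x : R[i]) : `|complex.Re x| <= normc x.
Proof.
by case: x => a b /=; rewrite -sqrtr_sqr ler_wsqrtr// lerDl sqr_ge0.
Qed.

Lemma normr_Im_le (x : R[i]) : `|complex.Im x| <= normc x.
Proof.
by case: x => a b /=; rewrite -sqrtr_sqr ler_wsqrtr// lerDr sqr_ge0.
Qed.

Lemma normc_real (a : R) : normc a%:C = `|a|.
Proof. by rewrite /= expr0n/= addr0 sqrtr_sqr. Qed.

Lemma normcB_le (x y : R[i]) : normc (x - y) <= normc x + normc y.
Proof. by rewrite (le_trans (le_normcD _ _))// normcN. Qed.

Lemma conjc_Re (x : R[i]) : complex.Re x^* = complex.Re x. Proof. by case: x. Qed.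
Lemma conjc_Im (x : R[i]) : complex.Im x^* = - complex.Im x. Proof. by case: x. Qed.
Lemma normc_conj (x : R[i]) : normc x^* = normc x.
Proof. by case: x => a b /=; rewrite sqrrN. Qed.

Lemma mulc_conj (x : R[i]) : x * x^* = (normc x ^+ 2)%:C.
Proof. by apply: complex_eq; rewrite ?cReM ?cImM conjc_Re conjc_Im ?normc_sqr/=; ring. Qed.

Lemma cmeas_cst (c : R[i]) : cmeas (fun=> c).
Proof. by split. Qed.

Lemma cmeasD f g : cmeas f -> cmeas g -> cmeas (fun x => f x + g x).
Proof.
move=> [f1 f2] [g1 g2]; split.
  by under eq_fun do rewrite cReD; exact: measurable_funD.
by under eq_fun do rewrite cImD; exact: measurable_funD.
Qed.

Lemma cmeasN f : cmeas f -> cmeas (fun x => - f x).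
Proof.
move=> [f1 f2]; split.
  by under eq_fun do rewrite cReN; exact: measurableT_comp.
by under eq_fun do rewrite cImN; exact: measurableT_comp.
Qed.

Lemma cmeasB f g : cmeas f -> cmeas g -> cmeas (fun x => f x - g x).
Proof. by move=> mf mg; apply: cmeasD => //; exact: cmeasN. Qed.

Lemma cmeasM f g : cmeas f -> cmeas g -> cmeas (fun x => f x * g x).
Proof.
move=> [f1 f2] [g1 g2]; split.
  by under eq_fun do rewrite cReM; apply: measurable_funB; exact: measurable_funM.
by under eq_fun do rewrite cImM; apply: measurable_funD; exact: measurable_funM.
Qed.

Lemma cmeasV f : cmeas f -> cmeas (fun x => (f x)^-1).
Proof.
move=> [f1 f2].
have mV : measurable_fun setT
  (fun x => (complex.Re (f x) ^+ 2 + complex.Im (f x) ^+ 2)^-1).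
  under eq_fun do rewrite -powR_inv1 ?addr_ge0 ?sqr_ge0//.
  apply: (measurableT_comp (measurable_powR _)).
  by apply: measurable_funD; exact: measurable_funX.
split.
  by under eq_fun do rewrite cReV; exact: measurable_funM.
under eq_fun do rewrite cImV; apply: measurableT_comp => //.
exact: measurable_funM.
Qed.

Lemma cmeas_conj f : cmeas f -> cmeas (fun x => (f x)^*).
Proof.
move=> [f1 f2]; split; first by under eq_fun do rewrite conjc_Re.
by under eq_fun do rewrite conjc_Im; exact: measurableT_comp.
Qed.

Lemma cmeas_real (f : T -> R) : measurable_fun setT f -> cmeas (fun x => (f x)%:C).
Proof. by move=> mf; split => //=; exact: measurable_cst. Qed.

Lemma cmeas_normc f : cmeas f -> measurable_fun setT (fun x => normc (f x)).
Proof.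
move=> [f1 f2].
have -> : (fun x => normc (f x)) =
    fun x => Num.sqrt (complex.Re (f x) ^+ 2 + complex.Im (f x) ^+ 2).
  by apply/funext => x; case: (f x).
under eq_fun do rewrite -powR12_sqrt ?addr_ge0 ?sqr_ge0//.
apply: (measurableT_comp (measurable_powR _)).
apply: measurable_funD; exact: measurable_funX.
Qed.

Lemma CL1_cmeas f : CL1 f -> cmeas f.
Proof. by move=> [f1 f2]; split; [exact: L1_measurable f1|exact: L1_measurable f2]. Qed.

Lemma CL1_le f (g : T -> R) : cmeas f -> L1 mu g -> (forall x, normc (f x) <= g x) ->
  CL1 f.
Proof.
move=> [f1 f2] gi fg; split; apply: L1_le gi _ => // x.
  exact: le_trans (normr_Re_le _) (fg x).
exact: le_trans (normr_Im_le _) (fg x).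
Qed.

Lemma normc_le_ReIm (x : R[i]) : normc x <= `|complex.Re x| + `|complex.Im x|.
Proof.
rewrite -(@ler_pXn2r _ 2)// ?nnegrE ?addr_ge0//.
rewrite normc_sqr sqrrD !real_normK ?num_real// -addrA lerD2l lerDr.
by rewrite mulrn_wge0// mulr_ge0.
Qed.

Lemma CL1_normc f : CL1 f -> L1 mu (fun x => normc (f x)).
Proof.
move=> fi; have [f1 f2] := fi.
apply: L1_le (L1_D (L1_norm f1) (L1_norm f2)) _.
  exact: cmeas_normc (CL1_cmeas fi).
by move=> x; rewrite ger0_norm// normc_le_ReIm.
Qed.

Lemma CL1Z (c : R[i]) f : CL1 f -> CL1 (fun x => c * f x).
Proof.
move=> [f1 f2]; split; rewrite /comp.
  by under eq_fun do rewrite cReM; apply: L1_B; exact: L1_Z.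
by under eq_fun do rewrite cImM; apply: L1_D; exact: L1_Z.
Qed.

Lemma CI_D f g : CL1 f -> CL1 g -> CI (fun x => f x + g x) = CI f + CI g.
Proof.
move=> [f1 f2] [g1 g2]; apply: complex_eq; rewrite /CI/=.
  by under eq_Rintegral do rewrite cReD; rewrite RI_D.
by under eq_Rintegral do rewrite cImD; rewrite RI_D.
Qed.

Lemma CI_Z (c : R[i]) f : CL1 f -> CI (fun x => c * f x) = c * CI f.
Proof.
move=> [f1 f2]; apply: complex_eq; rewrite /CI/=.
  under eq_Rintegral do rewrite cReM.
  by rewrite RI_B ?RI_Z ?cReM//; exact: L1_Z.
under eq_Rintegral do rewrite cImM.
by rewrite RI_D ?RI_Z ?cImM//; exact: L1_Z.
Qed.

Lemma CI_B f g : CL1 f -> CL1 g -> CI (fun x => f x - g x) = CI f - CI g.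
Proof.
move=> fi gi; under [X in CI X]eq_fun do rewrite -mulN1r.
by rewrite CI_D ?CI_Z ?mulN1r//; exact: CL1Z.
Qed.

Lemma eq_CI f g : f =1 g -> CI f = CI g.
Proof. by move=> /funext ->. Qed.

Lemma normc_CI f : CL1 f -> normc (CI f) <= RI mu (fun x => normc (f x)).
Proof.
move=> fi; have [I0|I0] := eqVneq (CI f) 0.
  by rewrite I0 Normc.normc0 RI_ge0.
(* The unit number [c] below rotates the integral onto the positive real axis; it then remains to
   bound the real part of the rotated integrand by its modulus. *)
have nI : normc (CI f) != 0.
  by apply/eqP => /Normc.eq0_normc/eqP; apply/negP.
pose c := (CI f)^* * ((normc (CI f))^-1)%:C.
have nc : normc c = 1.
  by rewrite /c Normc.normcM normc_real normc_conj gtr0_norm ?mulfV// invr_gt0 lt0r nI/=.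
have cI : c * CI f = (normc (CI f))%:C.
  rewrite /c mulrAC [X in X * _]mulrC mulc_conj -rmorphM/=; congr (_%:C).
  by rewrite expr2 mulfK.
have -> : normc (CI f) = complex.Re (CI (fun x => c * f x)) by rewrite CI_Z// cI.
apply: RI_le; [exact: (CL1Z c fi).1|exact: CL1_normc|move=> x].
by rewrite (le_trans (ler_norm _))// (le_trans (normr_Re_le _))// Normc.normcM nc mul1r.
Qed.

End complex_integrals.
#[global] Hint Resolve normc_ge0 : core.

(** * Cauchy's theorem on a sector, in logarithmic coordinates *)

Section holomorphic.
Context {R : realType}.
Local Notation mu := (@lebesgue_measure R).
Local Notation normc := Normc.normc.
Local Notation D1 f x d := (is_derive (x : R) (1 : R) (f : R -> R) (d : R)).

(** The number [e^{a + i b}]. Keeping the logarithm [x + i t] of [w] as the variable makes every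
    real power [w^p = cexp (p * x) (p * t)] available with no choice of a branch. *)
Definition cexp (a b : R) : R[i] := (expR a * cos b) +i* (expR a * sin b).

Lemma cexpD a a' b b' : cexp (a + a') (b + b') = cexp a b * cexp a' b'.
Proof.
by apply: complex_eq; rewrite ?cReM ?cImM /= expRD ?cosD ?sinD; ring.
Qed.

Lemma cexp0 : cexp 0 0 = 1.
Proof. by rewrite /cexp expR0 cos0 sin0 mulr1 mulr0. Qed.

Lemma normc_cexp a b : normc (cexp a b) = expR a.
Proof.
rewrite /= -[RHS]gtr0_norm ?expR_gt0// -sqrtr_sqr; congr Num.sqrt.
by rewrite !exprMn -mulrDr cos2Dsin2 mulr1.
Qed.

Lemma cexp_neq0 a b : cexp a b != 0.
Proof.
by apply/eqP => h; have := normc_cexp a b; rewrite h Normc.normc0 => /esym/eqP; rewrite expR_eq0.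
Qed.

Lemma cexpN a b : cexp (- a) (- b) = (cexp a b)^-1.
Proof.
apply: (mulIf (cexp_neq0 a b)); rewrite mulVf ?cexp_neq0// -cexpD.
by rewrite !addNr cexp0.
Qed.

Definition cD1 (f : R -> R[i]) (x : R) (d : R[i]) :=
  D1 (fun y => complex.Re (f y)) x (complex.Re d) /\
  D1 (fun y => complex.Im (f y)) x (complex.Im d).

Definition ccont (f : R -> R[i]) (x : R) :=
  {for x, continuous (fun y => complex.Re (f y))} /\
  {for x, continuous (fun y => complex.Im (f y))}.

Lemma cD1_eq f x d d' : cD1 f x d -> d = d' -> cD1 f x d'.
Proof. by move=> h <-. Qed.

Lemma cD1_cst c x : cD1 (fun=> c) x 0.
Proof. by split; exact: D1_cst. Qed.

Lemma cD1_D f g x a b : cD1 f x a -> cD1 g x b -> cD1 (fun y => f y + g y) x (a + b).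
Proof.
move=> [f1 f2] [g1 g2]; split.
  by under eq_fun do rewrite cReD; rewrite cReD; exact: D1_D.
by under eq_fun do rewrite cImD; rewrite cImD; exact: D1_D.
Qed.

Lemma cD1_M f g x a b : cD1 f x a -> cD1 g x b ->
  cD1 (fun y => f y * g y) x (a * g x + f x * b).
Proof.
move=> [f1 f2] [g1 g2]; split.
  under eq_fun do rewrite cReM.
  apply: D1_eq (D1_B (D1_M f1 g1) (D1_M f2 g2)) _.
  by rewrite cReD !cReM; ring.
under eq_fun do rewrite cImM.
apply: D1_eq (D1_D (D1_M f1 g2) (D1_M f2 g1)) _.
by rewrite cImD !cImM; ring.
Qed.

Lemma sqr_normc_neq0 (z : R[i]) : z != 0 -> complex.Re z ^+ 2 + complex.Im z ^+ 2 != 0.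
Proof.
move=> z0; rewrite -normc_sqr sqrf_eq0; apply/eqP => /Normc.eq0_normc/eqP.
exact/negP.
Qed.

Lemma cD1_V f x a : f x != 0 -> cD1 f x a ->
  cD1 (fun y => (f y)^-1) x (- a * ((f x)^-1 * (f x)^-1)).
Proof.
move=> f0 [f1 f2]; have n0 := sqr_normc_neq0 f0.
have dn : D1 (fun y => complex.Re (f y) * complex.Re (f y) + complex.Im (f y) * complex.Im (f y)) x
   (complex.Re a * complex.Re (f x) + complex.Re (f x) * complex.Re a +
   (complex.Im a * complex.Im (f x) + complex.Im (f x) * complex.Im a)).
  by apply: D1_D; exact: D1_M.
have n0' : complex.Re (f x) * complex.Re (f x) + complex.Im (f x) * complex.Im (f x) != 0.
  by rewrite -!expr2.
split.
  under eq_fun do rewrite cReV !expr2.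
  apply: D1_eq (D1_M f1 (D1_V _ dn)) _ => //.
  by rewrite cReM cReN cImN !cReM !cImM !cReV !cImV; field.
under eq_fun do rewrite cImV !expr2.
apply: D1_eq (D1_N (D1_M f2 (D1_V _ dn))) _ => //.
by rewrite cImM cReN cImN !cReM !cImM !cReV !cImV; field.
Qed.

Lemma cD1_ccont f x a : cD1 f x a -> ccont f x.
Proof. by move=> [f1 f2]; split; [exact: D1_continuous f1|exact: D1_continuous f2]. Qed.

Lemma cD1_cexp (f g : R -> R) x a b : D1 f x a -> D1 g x b ->
  cD1 (fun y => cexp (f y) (g y)) x ((a +i* b) * cexp (f x) (g x)).
Proof.
move=> fa gb; split; rewrite /cexp ?cReM ?cImM /=.
  by apply: D1_eq (D1_M (D1_expR fa) (D1_cos gb)) _; ring.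
by apply: D1_eq (D1_M (D1_expR fa) (D1_sin gb)) _; ring.
Qed.

Lemma ccont_cst c x : ccont (fun=> c) x.
Proof. by split; exact: cvg_cst. Qed.

Lemma ccontD f g x : ccont f x -> ccont g x -> ccont (fun y => f y + g y) x.
Proof.
move=> [f1 f2] [g1 g2]; split.
  by rewrite (funext (fun y => cReD (f y) (g y))); exact: cvgD.
by rewrite (funext (fun y => cImD (f y) (g y))); exact: cvgD.
Qed.

Lemma ccontM f g x : ccont f x -> ccont g x -> ccont (fun y => f y * g y) x.
Proof.
move=> [f1 f2] [g1 g2]; split.
  by rewrite (funext (fun y => cReM (f y) (g y))); apply: cvgB; exact: cvgM.
by rewrite (funext (fun y => cImM (f y) (g y))); apply: cvgD; exact: cvgM.
Qed.

Lemma ccontV f x : f x != 0 -> ccont f x -> ccont (fun y => (f y)^-1) x.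
Proof.
move=> f0 [f1 f2]; have n0 := sqr_normc_neq0 f0.
have cn : {for x, continuous (fun y => (complex.Re (f y) ^+ 2 + complex.Im (f y) ^+ 2)^-1)}.
  by apply: cvgV => //; apply: cvgD; apply: cvgM.
split.
  by rewrite (funext (fun y => cReV (f y))); exact: cvgM.
by rewrite (funext (fun y => cImV (f y))); apply: cvgN; exact: cvgM.
Qed.

Variables x1 x2 t1 t2 : R.

(* [K x t] is a holomorphic function of [x +i* t], with derivative [k]; in terms of
   [w = e^{x + i t} = cexp x t], rectangles become sectors of annuli. *)
Record hol (K k : R -> R -> R[i]) : Prop := Hol {
  hol_x : forall x t, x1 <= x <= x2 -> t1 <= t <= t2 -> cD1 (K ^~ t) x (k x t);
  hol_t : forall x t, x1 <= x <= x2 -> t1 <= t <= t2 -> cD1 (K x) t ('i * k x t);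
  hol_cx : forall x t, x1 <= x <= x2 -> t1 <= t <= t2 -> ccont (k ^~ t) x;
  hol_ct : forall x t, x1 <= x <= x2 -> t1 <= t <= t2 -> ccont (k x) t;
  hol_mK : cmeas (fun p : R * R => K p.1 p.2);
  hol_mk : cmeas (fun p : R * R => k p.1 p.2);
  hol_bd : exists M : R, forall x t, x1 <= x <= x2 -> t1 <= t <= t2 ->
    normc (K x t) <= M /\ normc (k x t) <= M }.

Lemma hol_cst c : hol (fun _ _ => c) (fun _ _ => 0).
Proof.
split => *; try exact: cD1_cst; try exact: ccont_cst; try exact: cmeas_cst.
  by rewrite mulr0; exact: cD1_cst.
exists (normc c) => x t _ _; by rewrite Normc.normc0.
Qed.

Lemma cmeas_cexp d (T : measurableType d) (f g : T -> R) :
  measurable_fun setT f -> measurable_fun setT g ->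
  cmeas (fun x => cexp (f x) (g x)).
Proof.
move=> mf mg; split => /=; apply: measurable_funM.
- exact: measurableT_comp.
- by apply: measurableT_comp => //; apply: continuous_measurable_fun; exact: continuous_cos.
- exact: measurableT_comp.
- by apply: measurableT_comp => //; apply: continuous_measurable_fun; exact: continuous_sin.
Qed.

Lemma hol_cexp p : hol (fun x t => cexp (p * x) (p * t))
  (fun x t => p%:C * cexp (p * x) (p * t)).
Proof.
have dx x t : cD1 (fun x => cexp (p * x) (p * t)) x (p%:C * cexp (p * x) (p * t)).
  apply: cD1_eq (cD1_cexp (D1_lin p x) (D1_cst _ x)) _; by [].
have dt x t : cD1 (fun t => cexp (p * x) (p * t)) t ('i * (p%:C * cexp (p * x) (p * t))).
  apply: cD1_eq (cD1_cexp (D1_cst _ t) (D1_lin p t)) _; rewrite mulrA; congr (_ * _).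
  by apply: complex_eq; rewrite ?cReM ?cImM /=; ring.
have m : cmeas (fun p0 : R * R => cexp (p * p0.1) (p * p0.2)).
  by apply: cmeas_cexp; apply: measurable_funM.
split => //.
- by move=> x t _ _; apply: ccontM (ccont_cst _ _) (cD1_ccont (dx _ _)).
- by move=> x t _ _; apply: ccontM (ccont_cst _ _) (cD1_ccont (dt _ _)).
- by apply: cmeasM => //; exact: cmeas_cst.
pose M := expR (Num.max (p * x1) (p * x2)).
exists (Num.max M (`|p| * M)) => x t /andP[x1x xx2] _.
have h : expR (p * x) <= M.
  rewrite ler_expR le_max; have [p0|p0] := leP 0 p.
    by rewrite [X in _ || X]ler_wpM2l ?orbT.
  by rewrite ler_wnM2l// ltW.
rewrite Normc.normcM normc_cexp normc_real !le_max h; split=> //.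
by rewrite ler_wpM2l ?orbT.
Qed.

Lemma hol_D K k L l : hol K k -> hol L l ->
  hol (fun x t => K x t + L x t) (fun x t => k x t + l x t).
Proof.
move=> [K1 K2 K3 K4 K5 K6 [M KM]] [L1 L2 L3 L4 L5 L6 [N LN]]; split.
- by move=> x t hx ht; apply: cD1_D; [exact: K1|exact: L1].
- by move=> x t hx ht; rewrite mulrDr; apply: cD1_D; [exact: K2|exact: L2].
- by move=> x t hx ht; apply: ccontD; [exact: K3|exact: L3].
- by move=> x t hx ht; apply: ccontD; [exact: K4|exact: L4].
- exact: cmeasD.
- exact: cmeasD.
exists (M + N) => x t hx ht; have [a b] := KM _ _ hx ht; have [c e] := LN _ _ hx ht.
by split; rewrite (le_trans (le_normcD _ _))// lerD.
Qed.

Lemma hol_M K k L l : hol K k -> hol L l ->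
  hol (fun x t => K x t * L x t) (fun x t => k x t * L x t + K x t * l x t).
Proof.
move=> [K1 K2 K3 K4 K5 K6 [M KM]] [L1 L2 L3 L4 L5 L6 [N LN]]; split.
- by move=> x t hx ht; apply: (cD1_M (K1 _ _ hx ht)); exact: L1.
- move=> x t hx ht; apply: cD1_eq (cD1_M (K2 _ _ hx ht) (L2 _ _ hx ht)) _; ring.
- move=> x t hx ht; apply: ccontD; apply: ccontM;
    [exact: K3|exact: cD1_ccont (L1 _ _ _ _)|exact: cD1_ccont (K1 _ _ _ _)|exact: L3].
- move=> x t hx ht; apply: ccontD; apply: ccontM;
    [exact: K4|exact: cD1_ccont (L2 _ _ _ _)|exact: cD1_ccont (K2 _ _ _ _)|exact: L4].
- exact: cmeasM.
- by apply: cmeasD; exact: cmeasM.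
exists (M * N + M * N) => x t hx ht; have [a b] := KM _ _ hx ht; have [c e] := LN _ _ hx ht.
split; last first.
  by rewrite (le_trans (le_normcD _ _))// !Normc.normcM lerD//; apply: ler_pM => //; exact: normc_ge0.
rewrite Normc.normcM; apply: (@le_trans _ _ (M * N)); first by apply: ler_pM => //; exact: normc_ge0.
rewrite lerDl.
by rewrite mulr_ge0//; [apply: le_trans a|apply: le_trans c]; exact: normc_ge0.
Qed.

Lemma hol_V K k (c : R) : 0 < c -> hol K k ->
  (forall x t, x1 <= x <= x2 -> t1 <= t <= t2 -> c <= normc (K x t)) ->
  hol (fun x t => (K x t)^-1) (fun x t => - k x t * ((K x t)^-1 * (K x t)^-1)).
Proof.
move=> c0 [K1 K2 K3 K4 K5 K6 [M KM]] cK.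
have K0 x t : x1 <= x <= x2 -> t1 <= t <= t2 -> K x t != 0.
  move=> hx ht; apply/eqP => h; have := cK _ _ hx ht.
  by rewrite h Normc.normc0 leNgt c0.
split.
- by move=> x t hx ht; apply: cD1_V; [exact: K0|exact: K1].
- move=> x t hx ht; apply: cD1_eq (cD1_V (K0 _ _ hx ht) (K2 _ _ hx ht)) _; ring.
- move=> x t hx ht; apply: ccontM.
    under [X in ccont X]eq_fun do rewrite -mulN1r.
    by apply: ccontM; [exact: ccont_cst|exact: K3].
  by apply: ccontM; apply: (@ccontV (K ^~ t)); rewrite ?K0//; exact: cD1_ccont (K1 _ _ _ _).
- move=> x t hx ht; apply: ccontM.
    under [X in ccont X]eq_fun do rewrite -mulN1r.
    by apply: ccontM; [exact: ccont_cst|exact: K4].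
  by apply: ccontM; apply: (@ccontV (K x)); rewrite ?K0//; exact: cD1_ccont (K2 _ _ _ _).
- exact: cmeasV.
- by apply: cmeasM; [exact: cmeasN|apply: cmeasM; exact: cmeasV].
exists (Num.max c^-1 (M * (c^-1 * c^-1))) => x t hx ht; have [a b] := KM _ _ hx ht.
have hV : normc (K x t)^-1 <= c^-1.
  by rewrite Normc.normcV lef_pV2 ?posrE//; [exact: cK|exact: lt_le_trans c0 (cK _ _ _ _)].
rewrite !le_max hV; split=> //; apply/orP; right.
rewrite Normc.normcM normcN Normc.normcM; apply: ler_pM => //; rewrite ?mulr_ge0 ?normc_ge0//.
by apply: ler_pM => //; exact: normc_ge0.
Qed.

(** The imaginary part of Cauchy's theorem for [K dz] with [z = x + i t]. By the Cauchy-Riemann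
    equations [Re k] is both the [t]-derivative of [Im K] and the [x]-derivative of [Re K], so both
    sides are the double integral of [Re k], taken in the two orders. *)
Lemma cauchy_rectangle K k : x1 <= x2 -> t1 <= t2 -> hol K k ->
  (\int[mu]_(x in `[x1, x2]) (complex.Im (K x t2)) -
   \int[mu]_(x in `[x1, x2]) (complex.Im (K x t1)) =
   \int[mu]_(t in `[t1, t2]) (complex.Re (K x2 t)) -
   \int[mu]_(t in `[t1, t2]) (complex.Re (K x1 t)))%R.
Proof.
move=> x12 t12 H; have [K1 K2 K3 K4 K5 K6 [M KM]] := H.
have tt1 : t1 <= t1 <= t2 by rewrite lexx.
have tt2 : t1 <= t2 <= t2 by rewrite lexx andbT.
have xx1 : x1 <= x1 <= x2 by rewrite lexx.
have xx2 : x1 <= x2 <= x2 by rewrite lexx andbT.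
have ix t : t1 <= t <= t2 ->
    mu.-integrable `[x1, x2] (EFin \o (fun x => complex.Im (K x t))).
  by move=> ht; apply: continuous_L1_itv => x hx; have [_] := cD1_ccont (K1 _ _ hx ht).
have it x : x1 <= x <= x2 ->
    mu.-integrable `[t1, t2] (EFin \o (fun t => complex.Re (K x t))).
  by move=> hx; apply: continuous_L1_itv => t ht; have [] := cD1_ccont (K2 _ _ hx ht).
rewrite -RintegralB//; [|exact: ix|exact: ix].
rewrite -RintegralB//; [|exact: it|exact: it].
pose iX : R -> R := \1_`[x1, x2]; pose iT : R -> R := \1_`[t1, t2].
pose f (p : R * R) : R := iX p.1 * (iT p.2 * complex.Re (k p.1 p.2)).
have mf : measurable_fun setT f.
  apply: measurable_funM; first by apply: measurableT_comp => //; exact: measurable_indic.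
  apply: measurable_funM; first by apply: measurableT_comp => //; exact: measurable_indic.
  exact: K6.1.
have fi : L1 (mu \x mu)%E f.
  apply: (@L1_prodM _ _ _ _ _ mu mu f (fun x => `|M| * \1_`[x1, x2] x) (\1_`[t1, t2])) => //.
  - apply: L1_Z; exact: integrable_indic_itv.
  - exact: integrable_indic_itv.
  - move=> x t; rewrite /f /iX /iT /= !indicE.
    case: (boolP (x \in _)) => hx; last by rewrite mul0r normr0 mulr0 mul0r.
    case: (boolP (t \in _)) => ht; last by rewrite mul0r mulr0 normr0 mulr0.
    rewrite !mul1r !mulr1 (le_trans (normr_Re_le _))//.
    move: hx ht; rewrite !inE/= !in_itv/= => hx ht.
    by rewrite (le_trans (KM _ _ hx ht).2)// ler_norm.
transitivity (RI mu (fun x => RI mu (fun t => f (x, t)))).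
  rewrite RI_indic; apply: eq_RI => x; rewrite /f /iX /=.
  rewrite indicE; case: (boolP (x \in _)) => hx; last first.
    rewrite mul0r; under eq_Rintegral do rewrite mul0r.
    by rewrite RI_0.
  move: hx; rewrite inE/= in_itv/= => hx.
  have dK t : t1 <= t <= t2 -> D1 (fun t => complex.Im (K x t)) t (complex.Re (k x t)).
    by move=> ht; have [_ h] := K2 _ _ hx ht; apply: (D1_eq h); rewrite cImM /= mul0r mul1r add0r.
  have ck t : t1 <= t <= t2 -> {for t, continuous (fun t => complex.Re (k x t))}.
    by move=> ht; have [] := K4 _ _ hx ht.
  have <- := RI_FTC t12 dK ck.
  by rewrite mul1r RI_indic; apply: eq_RI => t; rewrite mul1r.
rewrite RI_fubini// RI_indic; apply: eq_RI => t; rewrite /f /= -[\1_ _ t]/(iT t).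
case: (boolP (t \in `[t1, t2]%classic)) => ht; last first.
  have t0 : iT t = 0 by rewrite /iT indicE (negbTE ht).
  by rewrite t0 mul0r; under eq_Rintegral do rewrite mul0r mulr0; rewrite RI_0.
have t0 : iT t = 1 by rewrite /iT indicE ht.
move: (ht); rewrite inE/= in_itv/= => ht'.
have dK x : x1 <= x <= x2 -> D1 (fun x => complex.Re (K x t)) x (complex.Re (k x t)).
  by move=> hx; have [] := K1 _ _ hx ht'.
have ck x : x1 <= x <= x2 -> {for x, continuous (fun x => complex.Re (k x t))}.
  by move=> hx; have [] := K3 _ _ hx ht'.
have <- := RI_FTC x12 dK ck.
by rewrite t0 mul1r RI_indic; apply: eq_RI => x; rewrite mul1r.
Qed.

End holomorphic.

(** * Lower bounds along rays, and the contribution of a pole at [w = 1] *)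

Section contour.
Context {R : realType}.
Local Notation mu := (@lebesgue_measure R).
Local Notation normc := Normc.normc.
Local Notation D1 f x d := (is_derive (x : R) (1 : R) (f : R -> R) (d : R)).

Lemma expR_ge1 (x : R) : (1 <= expR x) = (0 <= x).
Proof. by rewrite -expR0 ler_expR. Qed.

Lemma RI_itv_cst (a b A : R) : a <= b -> (\int[mu]_(x in `[a, b]) A)%R = A * (b - a).
Proof.
move=> ab; rewrite (RI_FTC ab (fun z _ => D1_lin A z)) ?mulrBr//.
by move=> z _; exact: cvg_cst.
Qed.

(** The half-angle form splits the square into two nonnegative terms. Each of them is a lower bound;
    the first one is uniform as long as [p] stays away from [pi]. *)
Lemma sqr_normc_addE (a x p : R) :
  normc (a%:C + cexp x p) ^+ 2 =
  (a + expR x) ^+ 2 * cos (p / 2) ^+ 2 + (a - expR x) ^+ 2 * sin (p / 2) ^+ 2.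
Proof.
have pE : p = (p / 2) *+ 2 by rewrite -mulr_natr divfK.
rewrite normc_sqr cReD cImD /= add0r {1 2}pE cos_mulr2n sin_mulr2n !mulr2n.
have := cos2Dsin2 (p / 2); set c := cos _; set s := sin _ => h.
have -> : s ^+ 2 = 1 - c ^+ 2 by rewrite -h; ring.
have -> : (expR x * (c * s + c * s)) ^+ 2 = expR x ^+ 2 * 4 * c ^+ 2 * s ^+ 2 by ring.
have -> : s ^+ 2 = 1 - c ^+ 2 by rewrite -h; ring.
by ring.
Qed.

Lemma sqr_normc_subE (x p : R) :
  normc (1 - cexp x p) ^+ 2 =
  (1 - expR x) ^+ 2 * cos (p / 2) ^+ 2 + (1 + expR x) ^+ 2 * sin (p / 2) ^+ 2.
Proof.
have pE : p = (p / 2) *+ 2 by rewrite -mulr_natr divfK.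
rewrite normc_sqr cReD cImD cReN cImN /= add0r {1 2}pE cos_mulr2n sin_mulr2n !mulr2n.
have := cos2Dsin2 (p / 2); set c := cos _; set s := sin _ => h.
have -> : s ^+ 2 = 1 - c ^+ 2 by rewrite -h; ring.
have -> : (- (expR x * (c * s + c * s))) ^+ 2 = expR x ^+ 2 * 4 * c ^+ 2 * s ^+ 2 by ring.
have -> : s ^+ 2 = 1 - c ^+ 2 by rewrite -h; ring.
by ring.
Qed.

Lemma le_normc_of_sqr (z : R[i]) (b : R) : b ^+ 2 <= normc z ^+ 2 -> b <= normc z.
Proof.
move=> h; have [b0|b0] := leP 0 b; last by rewrite (le_trans (ltW b0))// normc_ge0.
by rewrite -(@ler_pXn2r _ 2)// nnegrE normc_ge0.
Qed.

Lemma cos_half_le (p q : R) : 0 <= p <= q -> q < pi -> cos (q / 2) <= cos (p / 2).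
Proof.
move=> /andP[p0 pq] qpi.
rewrite leNgt; apply/negP => h.
have : q / 2 < p / 2.
  move: h; rewrite ltr_cos// in_itv/=; apply/andP; split; lra.
lra.
Qed.

Lemma cos_half_gt0 (q : R) : 0 <= q < pi -> 0 < cos (q / 2).
Proof. by move=> /andP[q0 qpi]; apply: cos_gt0_pihalf; apply/andP; split; lra. Qed.

Lemma normc_add_ge (a x p q : R) : 0 <= a -> 0 <= p <= q -> q < pi ->
  cos (q / 2) * (a + expR x) <= normc (a%:C + cexp x p).
Proof.
move=> a0 pq qpi; apply: le_normc_of_sqr; rewrite sqr_normc_addE.
have q0 : 0 < cos (q / 2) by rewrite cos_half_gt0// (le_trans _ (andP pq).2)//; case/andP: pq.
rewrite exprMn mulrC -[leLHS]addr0; apply: lerD; last by apply: mulr_ge0; exact: sqr_ge0.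
rewrite ler_wpM2l ?sqr_ge0// lerXn2r ?nnegrE ?(ltW q0) ?cos_half_le//.
by rewrite (le_trans (ltW q0)) ?cos_half_le.
Qed.

(** Measures the distance from [w] to 1 by the modulus of [w], and degenerates at [x = 0]. There
    [normc_sub_ge2] takes over: it keeps the other term of [sqr_normc_subE] and uses the angle
    [p]. *)
Lemma normc_sub_ge1 (x p q : R) : 0 <= p <= q -> q < pi ->
  cos (q / 2) * `|1 - expR x| <= normc (1 - cexp x p).
Proof.
move=> pq qpi; apply: le_normc_of_sqr; rewrite sqr_normc_subE.
have q0 : 0 < cos (q / 2) by rewrite cos_half_gt0// (le_trans _ (andP pq).2)//; case/andP: pq.
rewrite exprMn mulrC -[leLHS]addr0; apply: lerD; last by apply: mulr_ge0; exact: sqr_ge0.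
rewrite real_normK ?num_real// ler_wpM2l ?sqr_ge0// lerXn2r ?nnegrE ?(ltW q0) ?cos_half_le//.
by rewrite (le_trans (ltW q0)) ?cos_half_le.
Qed.

Lemma sin_ge_lin (u v : R) : 0 <= u <= v -> v < pi / 2 -> u * cos v <= sin u.
Proof.
move=> /andP[u0 uv] vpi.
move: u0; rewrite le_eqVlt => /predU1P[<-|u0]; first by rewrite mul0r sin0.
have [c /[!in_itv]/= /andP[c0 cu]] := @MVT_segment R (@sin R) (@cos R) 0 u (ltW u0)
  (fun x _ => is_derive_sin x) (continuous_subspaceT (@continuous_sin R)).
rewrite sin0 !subr0 => ->; rewrite mulrC ler_wpM2r ?(ltW u0)//.
rewrite leNgt; apply/negP => h.
have : v < c by move: h; rewrite ltr_cos// in_itv/=; apply/andP; split; lra.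
lra.
Qed.

Lemma normc_sub_ge2 (x p q : R) : 0 <= p <= q -> q < pi ->
  (1 + expR x) * (p / 2 * cos (q / 2)) <= normc (1 - cexp x p).
Proof.
move=> pq qpi; apply: le_normc_of_sqr; rewrite sqr_normc_subE.
have q0 : 0 < cos (q / 2) by rewrite cos_half_gt0// (le_trans _ (andP pq).2)//; case/andP: pq.
have h : p / 2 * cos (q / 2) <= sin (p / 2).
  by apply: sin_ge_lin; [apply/andP; split|]; case/andP: pq => *; lra.
have p0 : 0 <= p / 2 * cos (q / 2) by rewrite mulr_ge0 ?(ltW q0)//; case/andP: pq => *; lra.
rewrite exprMn -[leLHS]add0r; apply: lerD; first by apply: mulr_ge0; exact: sqr_ge0.
by rewrite ler_wpM2l ?sqr_ge0// lerXn2r ?nnegrE// (le_trans p0).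
Qed.

Lemma RI_exp (d : R) : 0 < d -> L1 mu (fun x => \1_`[0, +oo[ x * expR (- (d * x))) /\
  RI mu (fun x => \1_`[0, +oo[ x * expR (- (d * x))) = d^-1.
Proof.
move=> d0.
have mh : measurable_fun setT (fun x : R => d * (\1_`[0, +oo[ x * expR (- (d * x)))).
  apply: measurable_funM => //; apply: measurable_funM; first exact: measurable_indic.
  by apply: measurableT_comp => //; apply: measurableT_comp.
have h0 x : 0 <= d * (\1_`[0, +oo[ x * expR (- (d * x))).
  by rewrite !mulr_ge0 ?expR_ge0 ?(ltW d0)// indicE.
have [|fi fE] := @ge0_RI_EFin _ _ _ mu (fun x => d * (\1_`[0, +oo[ x * expR (- (d * x)))) 1 mh h0.
  rewrite -(integral_exponential_pdf d0); apply: eq_integral => x _.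
  rewrite /exponential_pdf patchE indicE; case: ifPn => _; rewrite ?mul1r ?mul0r ?mulr0//.
  by rewrite mulNr.
have dE : (fun x => \1_`[0, +oo[ x * expR (- (d * x))) =
   fun x => d^-1 * (d * (\1_`[0, +oo[ x * expR (- (d * x)))).
  by apply/funext => x; rewrite mulKf// gt_eqF.
rewrite dE; split; first exact: L1_Z.
by rewrite RI_Z// fE mulr1.
Qed.

Lemma L1_expRN (d : R) : 0 < d -> L1 mu (fun x => expR (- (d * `|x|))).
Proof.
move=> d0.
have mE : measurable_fun setT (fun x : R => expR (- (d * `|x|))).
  apply: measurableT_comp => //; apply: measurableT_comp => //.
  by apply: measurable_funM => //; exact: measurableT_comp.
have half := (RI_exp d0).1.
have N10 : -1 != 0 :> R by rewrite oppr_eq0 oner_eq0.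
have half2 := L1_affine 0 N10 half.
apply: (@L1_le _ _ _ mu _ _ mE (L1_D half half2)).
move=> x; rewrite ger0_norm ?expR_ge0// addr0 mulN1r !indicE.
have [x0|x0] := leP 0 x.
  rewrite mem_set; last by rewrite /= in_itv/= x0.
  rewrite mul1r ger0_norm// lerDl.
  by rewrite mulr_ge0 ?expR_ge0.
have -> : (- x \in `[0, +oo[%classic) = true by rewrite mem_set//= in_itv/= andbT; lra.
by rewrite mul1r ltr0_norm// lerDr mulr_ge0 ?expR_ge0.
Qed.

Lemma cvg_RI_itv (f : R -> R) : L1 mu f ->
  (\int[mu]_(x in `[- n%:R, n%:R]) f x)%R @[n --> \oo] --> RI mu f.
Proof.
move=> fi; have mf := L1_measurable fi.
pose f_ n := fun x : R => \1_`[- n%:R, n%:R] x * f x.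
rewrite (_ : (fun n => _) = fun n => RI mu (f_ n)); last first.
  by apply/funext => n; exact: RI_indic.
have mI n : measurable_fun setT (\1_(`[- n%:R, n%:R] : set R) : R -> R).
  exact: measurable_indic.
apply: (proj2 (@RI_dct _ _ _ mu f_ f (fun x => `|f x|) _ _ _ _ _)) => //.
- by move=> n; exact: measurable_funM.
- apply: aeW => x; apply: cvg_near_cst; near=> n.
  rewrite /f_ indicE mem_set ?mul1r//= in_itv/= -ler_norml.
  near: n; exact: nbhs_infty_ger.
- exact: L1_norm.
- apply: aeW => x n; rewrite /f_ normrM ler_piMl// indicE.
  by case: (_ \in _); rewrite ?normr1 ?normr0.
Unshelve. all: by end_near. Qed.

Lemma D1_lipschitz (f df : R -> R) (a b N x y : R) :
  (forall z, a <= z <= b -> D1 f z (df z) /\ `|df z| <= N) ->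
  a <= x <= b -> a <= y <= b -> `|f y - f x| <= N * `|y - x|.
Proof.
move=> H; wlog xy : x y / x <= y.
  move=> h hx hy; have [xy|/ltW yx] := leP x y; first exact: h.
  by rewrite distrC [in leRHS]distrC; exact: h.
move=> /andP[ax xb] /andP[ay yb].
have [||c] := @MVT_segment R f df x y xy.
- move=> z; rewrite in_itv/= => /andP[/ltW xz /ltW zy]; apply: (H _ _).1.
  by rewrite (le_trans ax)//= (le_trans zy).
- apply: within_continuous_pt => z /andP[xz zy].
  apply: (D1_continuous (H _ _).1).
  by rewrite (le_trans ax)//= (le_trans zy).
rewrite in_itv/= => /andP[xc cy] ->; rewrite normrM ler_wpM2r//; apply: (H _ _).2.
by rewrite (le_trans ax)//= (le_trans cy).
Qed.

Definition holo x1 x2 t1 t2 (K : R -> R -> R[i]) := exists k, hol x1 x2 t1 t2 K k.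

Lemma holo_cst x1 x2 t1 t2 c : holo x1 x2 t1 t2 (fun _ _ => c).
Proof. by eexists; exact: hol_cst. Qed.

Lemma holo_cexp x1 x2 t1 t2 p : holo x1 x2 t1 t2 (fun x t => cexp (p * x) (p * t)).
Proof. by eexists; exact: hol_cexp. Qed.

Lemma holoD x1 x2 t1 t2 K L : holo x1 x2 t1 t2 K -> holo x1 x2 t1 t2 L ->
  holo x1 x2 t1 t2 (fun x t => K x t + L x t).
Proof. by move=> [k Kk] [l Ll]; eexists; exact: hol_D Kk Ll. Qed.

Lemma holoM x1 x2 t1 t2 K L : holo x1 x2 t1 t2 K -> holo x1 x2 t1 t2 L ->
  holo x1 x2 t1 t2 (fun x t => K x t * L x t).
Proof. by move=> [k Kk] [l Ll]; eexists; exact: hol_M Kk Ll. Qed.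

Lemma holoB x1 x2 t1 t2 K L : holo x1 x2 t1 t2 K -> holo x1 x2 t1 t2 L ->
  holo x1 x2 t1 t2 (fun x t => K x t - L x t).
Proof.
move=> hK hL; have := holoD hK (holoM (holo_cst _ _ _ _ (-1)) hL).
by under [X in holo _ _ _ _ X]eq_fun do under eq_fun do rewrite mulN1r.
Qed.

Lemma holoV x1 x2 t1 t2 K (c : R) : 0 < c -> holo x1 x2 t1 t2 K ->
  (forall x t, x1 <= x <= x2 -> t1 <= t <= t2 -> c <= normc (K x t)) ->
  holo x1 x2 t1 t2 (fun x t => (K x t)^-1).
Proof. by move=> c0 [k Kk] cK; eexists; exact: hol_V c0 Kk cK. Qed.

Lemma holo_sub x1 x2 t1 t2 y1 y2 u1 u2 K : x1 <= y1 -> y2 <= x2 -> t1 <= u1 -> u2 <= t2 ->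
  holo x1 x2 t1 t2 K -> holo y1 y2 u1 u2 K.
Proof.
move=> xy1 xy2 tu1 tu2 [k [K1 K2 K3 K4 K5 K6 [M KM]]]; exists k.
have hx x : y1 <= x <= y2 -> x1 <= x <= x2.
  by move=> /andP[a b]; rewrite (le_trans xy1 a) (le_trans b xy2).
have ht t : u1 <= t <= u2 -> t1 <= t <= t2.
  by move=> /andP[a b]; rewrite (le_trans tu1 a) (le_trans b tu2).
split=> //; try by move=> x t /hx hx' /ht ht'; auto.
by exists M => x t /hx hx' /ht ht'; exact: KM.
Qed.

Lemma holo_w x1 x2 t1 t2 : holo x1 x2 t1 t2 cexp.
Proof.
have := holo_cexp x1 x2 t1 t2 1.
by under [X in holo _ _ _ _ X]eq_fun do under eq_fun do rewrite !mul1r.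
Qed.

Lemma expR_ratio_le (x : R) : expR x / (1 + expR x) ^+ 2 <= expR (- `|x|).
Proof.
have e0 := expR_gt0 x.
have h0 : 0 < 1 + expR x by rewrite addr_gt0.
rewrite ler_pdivrMr ?exprn_gt0//.
have [x0|x0] := leP 0 x.
  rewrite expRN ger0_norm// ler_pdivlMl//.
  by rewrite -expr2 lerXn2r ?nnegrE ?(ltW e0) ?(ltW h0)// lerDr.
by rewrite ltr0_norm// opprK ler_pMr// exprn_ege1// lerDl ltW.
Qed.

Lemma one_sub_cexp_neq0 (x th : R) : 0 < th < pi -> 1 - cexp x th != 0.
Proof.
move=> /andP[th0 thpi]; apply/eqP => h.
have : complex.Im (1 - cexp x th) = 0 by rewrite h.
rewrite cImD cImN /= add0r => /eqP; rewrite oppr_eq0 mulf_eq0 expR_eq0/=.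
by rewrite gt_eqF// sin_gt0_pi// th0.
Qed.

Lemma one_add_cexp_neq0 (x th : R) : 0 <= th < pi -> 1 + cexp x th != 0.
Proof.
move=> /andP[th0 thpi]; apply/eqP => h.
have th1 : 0 <= th <= th by rewrite th0/=.
have := @normc_add_ge 1 x th th ler01 th1 thpi.
rewrite (_ : 1%:C + _ = 0)// Normc.normc0 leNgt mulr_gt0//.
  by rewrite cos_half_gt0// th0.
Qed.

Lemma cvgr_sinh : (expR x - expR (- x)) @[x --> +oo] --> (+oo : set_system R).
Proof.
apply/cvgryPge => A; near=> x.
have x0 : 0 <= x by near: x; apply: nbhs_pinfty_ge; rewrite num_real.
have xA : A <= x by near: x; apply: nbhs_pinfty_ge; rewrite num_real.
apply: (le_trans xA).
have h1 : expR (- x) <= 1 by rewrite expR_le1; lra.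
have := expR_ge1Dx x; lra.
Unshelve. all: by end_near. Qed.

(** With [w = e^{x + i th}] the integrand is the imaginary part of [2 w / (1 - w^2)], whose
    primitive is [atan (sinh x / sin th)]. This function has the same pole part at [w = 1] as
    [w / (1 - w)] and decays at both ends of the ray, so it serves to subtract the pole. *)
Lemma poisson_kernel (th : R) : 0 < th < pi ->
  L1 mu (fun x => complex.Im (2 * cexp x th / ((1 - cexp x th) * (1 + cexp x th)))) /\
  RI mu (fun x => complex.Im (2 * cexp x th / ((1 - cexp x th) * (1 + cexp x th)))) = pi.
Proof.
move=> hth; have [th0 thpi] := andP hth.
set f := fun x => complex.Im _.
have s0 : 0 < sin th by exact: sin_gt0_pi.
have n1 x := one_sub_cexp_neq0 x hth.
have n2 x : 1 + cexp x th != 0 by apply: one_add_cexp_neq0; rewrite ltW.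
pose S x : R := expR x + expR (- x); pose D x : R := expR x - expR (- x).
have fE x : f x = (2 * sin th)^-1 * S x / (1 + (D x / (2 * sin th)) ^+ 2).
  have -> : f x = complex.Im (2 / (cexp (- x) (- th) - cexp x th)).
    rewrite /f; congr complex.Im; rewrite cexpN.
    have w0 := cexp_neq0 x th; have := n1 x; have := n2 x.
    set w := cexp x th in w0 *; move=> a b.
    have -> : w^-1 - w = (1 - w) * (1 + w) / w by field.
    by field; rewrite w0 b a.
  have -> : (2 : R[i]) = 2%:C by rewrite rmorph_nat.
  rewrite cImM /= mul0r addr0 cosN sinN.
  rewrite /S /D; set a := expR x; set b := expR (- x).
  have ab : b = a^-1 by rewrite /b expRN.
  have a0 : a != 0 by rewrite /a expR_eq0.
  have cs := cos2Dsin2 th; set c := cos th in cs *; set s := sin th in cs s0 *.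
  have -> : (b * c - a * c) ^+ 2 + (b * - s - a * s) ^+ 2 = (a - b) ^+ 2 + 4 * s ^+ 2.
    have -> : (b * c - a * c) ^+ 2 + (b * - s - a * s) ^+ 2 =
      (a - b) ^+ 2 * (c ^+ 2 + s ^+ 2) + 4 * (a * b) * s ^+ 2 by ring.
    by rewrite cs ab mulfV//; ring.
  have p1 : (a - b) ^+ 2 + 4 * s ^+ 2 != 0.
    by rewrite gt_eqF// ltr_wpDl ?sqr_ge0// mulr_gt0// exprn_gt0.
  by field; rewrite (gt_eqF s0)/=; lra.
pose F x := atan (D x / (2 * sin th)).
have dD x : D1 D x (S x).
  apply: D1_eq (D1_B (D1_expR (D1_id x)) (D1_expR (D1_N (D1_id x)))) _.
  by rewrite /S; ring.
have dF x : D1 F x (f x).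
  have h := D1_M (dD x) (D1_cst (2 * sin th)^-1 x).
  apply: D1_eq (@D1_comp _ _ (@atan R) x _ _ (is_derive1_atan _) h) _.
  by rewrite fE; ring.
have cf x : {for x, continuous f}.
  have := ccontM (ccont_cst 2 x) (cD1_ccont (cD1_cexp (D1_id x) (D1_cst th x))).
  move=> c1; have cw := cD1_ccont (cD1_cexp (D1_id x) (D1_cst th x)).
  have c2 : ccont (fun x => (1 - cexp x th) * (1 + cexp x th)) x.
    apply: ccontM; (apply: ccontD; [exact: ccont_cst|]); last exact: cw.
    by have := ccontM (ccont_cst (-1) x) cw; under [X in ccont X]eq_fun do rewrite mulN1r.
  have c3 := ccontM c1 (ccontV (mulf_neq0 (n1 x) (n2 x)) c2).
  exact: c3.2.
have f0 x : 0 <= f x.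
  rewrite fE divr_ge0 ?addr_ge0 ?sqr_ge0//.
  by rewrite mulr_ge0 ?invr_ge0 ?mulr_ge0 ?(ltW s0) ?addr_ge0 ?expR_ge0.
have mf : measurable_fun setT f by apply: continuous_measurable_fun => x; exact: cf.
have fle x : f x <= 2 * (cos (th / 2) * (th / 2 * cos (th / 2)))^-1 * expR (- (1 * `|x|)).
  have c0 : 0 < cos (th / 2) by rewrite cos_half_gt0// (ltW th0).
  rewrite (le_trans (ler_norm _))// (le_trans (normr_Im_le _))//.
  rewrite !Normc.normcM Normc.normcV Normc.normcM normc_cexp.
  have -> : normc (2 : R[i]) = 2.
    by rewrite (_ : (2 : R[i]) = 2%:C) ?normc_real ?ger0_norm// rmorph_nat.
  have th1 : 0 <= th <= th by rewrite lexx ltW.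
  have h1 := normc_sub_ge2 x th1 thpi; have h2 := @normc_add_ge 1 x th th ler01 th1 thpi.
  have e1 : 0 < 1 + expR x by rewrite addr_gt0// expR_gt0.
  have t2 : 0 < th / 2 by lra.
  have p0 : 0 < (1 + expR x) * (th / 2 * cos (th / 2)) * (cos (th / 2) * (1 + expR x)).
    by rewrite !mulr_gt0.
  rewrite mul1r (@le_trans _ _ (2 * expR x * ((1 + expR x) * (th / 2 * cos (th / 2)) * (cos (th / 2) * (1 + expR x)))^-1))//.
    rewrite ler_wpM2l ?mulr_ge0 ?expR_ge0// lef_pV2 ?posrE//.
      by apply: ler_pM => //; rewrite ltW// !mulr_gt0.
    apply: (lt_le_trans p0); apply: ler_pM => //; rewrite ltW// !mulr_gt0//.
  apply: le_trans (ler_wpM2l _ (expR_ratio_le x)); last first.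
    by rewrite mulr_ge0// invr_ge0 ltW// !mulr_gt0.
  rewrite le_eqVlt; apply/orP; left; apply/eqP.
  by field; rewrite !gt_eqF.
have fi : L1 mu f.
  apply: (@L1_le _ _ _ mu _ _ mf (L1_Z (2 / (cos (th / 2) * (th / 2 * cos (th / 2)))) (L1_expRN ltr01))) => x.
  by rewrite ger0_norm.
split=> //.
have cy : F x @[x --> +oo] --> pi / 2.
  apply: (cvg_comp _ _ _ (@cvgy_atan R)).
  by apply: gt0_cvgMly; [rewrite invr_gt0 mulr_gt0|exact: cvgr_sinh].
have cNy : F x @[x --> -oo] --> - (pi / 2).
  apply/cvgNy_compNP; rewrite (_ : _ \o _ = fun x => - F x); first exact: cvgN.
  by apply/funext => x; rewrite /F /D /= opprK -atanN -mulNr opprB.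
by rewrite (RI_FTCT dF cf fi cy cNy) opprK; field.
Qed.

(** * Rotation of the ray [arg w = th] onto the positive real axis *)

Section symbol.
Variables (th C d : R) (G : R -> R -> R[i]).
Hypotheses (hth : 0 < th < pi) (C0 : 0 <= C) (hd : 0 < d <= 1).
Hypothesis HG : forall x1 x2, holo x1 x2 0 th G.
(** Forces [w G / (1 - w)] to decay like [e^{-d |x|}] at both ends of the rays, so that the short
    sides of the rectangles vanish in the limit. *)
Hypothesis HB : forall x p, 0 <= p <= th ->
  normc (G x p) * expR x <= C * expR (- (d * `|x|)) * (1 + expR x).
Hypothesis H0 : forall x, complex.Im (G x 0) = 0.

Let c := cos (th / 2).
Let g := complex.Re (G 0 0).
Let thpi : th < pi. Proof. by case/andP: hth. Qed.
Let th0 : 0 < th. Proof. by case/andP: hth. Qed.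
Let c0 : 0 < c. Proof. by apply: cos_half_gt0; rewrite (ltW th0). Qed.
Let gE : G 0 0 = g%:C. Proof. by apply: complex_eq => //=; rewrite H0. Qed.

(** The integrand minus [g = G 0 0] times the function of [poisson_kernel]: the two poles at [w = 1]
    cancel. The proof shows that the integral of [Im K] along the ray is 0, which leaves
    [g * pi]. *)
Let K (x p : R) : R[i] := cexp x p * G x p / (1 - cexp x p) -
  g%:C * (2 * cexp x p / ((1 - cexp x p) * (1 + cexp x p))).

Let add_ge (x p : R) : 0 <= p <= th -> c * (1 + expR x) <= normc (1 + cexp x p).
Proof. by move=> hp; exact: (normc_add_ge x ler01 hp thpi). Qed.

Let onep_gt0 (x : R) : 0 < 1 + expR x.
Proof. by rewrite addr_gt0// expR_gt0. Qed.

Let holoK (m x1 x2 t1 t2 : R) : 0 < m -> 0 <= t1 -> t2 <= th ->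
  (forall x p, x1 <= x <= x2 -> t1 <= p <= t2 -> m <= normc (1 - cexp x p)) ->
  holo x1 x2 t1 t2 K.
Proof.
move=> m0 t10 t2th mK.
have hw := holo_w x1 x2 t1 t2; have h1 := holo_cst x1 x2 t1 t2 1.
have hG : holo x1 x2 t1 t2 G by apply: holo_sub (HG x1 x2).
have hs := holoV m0 (holoB h1 hw) mK.
have ha : holo x1 x2 t1 t2 (fun x t => (1 + cexp x t)^-1).
  apply: (holoV c0 (holoD h1 hw)) => x p _ /andP[tp pt].
  rewrite (le_trans _ (add_ge _ _))//; last by rewrite (le_trans t10)//= (le_trans pt).
  by rewrite ler_pMr// lerDl expR_ge0.
have h2 := holoM (holoM (holo_cst _ _ _ _ 2) hw) (holoM hs ha).
have := holoB (holoM (holoM hw hG) hs) (holoM (holo_cst _ _ _ _ g%:C) h2).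
suff -> : K = (fun x t : R => cexp x t * G x t / (1 - cexp x t) -
  g%:C * (2 * cexp x t * ((1 - cexp x t)^-1 / (1 + cexp x t)))) by [].
by apply/funext => x; apply/funext => p; rewrite /K invfM.
Qed.

Let mK (p : R) : cmeas (fun x => K x p).
Proof.
have mw : cmeas (fun x : R => cexp x p) by apply: cmeas_cexp.
have mG : cmeas (fun x => G x p).
  have [k [_ _ _ _ [m1 m2] _ _]] := HG 0 0.
  split; [exact: (measurableT_comp m1 (measurable_pair2 p))|
          exact: (measurableT_comp m2 (measurable_pair2 p))].
have ms : cmeas (fun x : R => (1 - cexp x p)^-1).
  by apply: cmeasV; apply: cmeasB => //; exact: cmeas_cst.
apply: cmeasB; first by do 2 apply: cmeasM => //.
apply: cmeasM; first exact: cmeas_cst.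
apply: cmeasM; first by apply: cmeasM => //; exact: cmeas_cst.
apply: cmeasV; apply: cmeasM.
  by apply: cmeasB => //; exact: cmeas_cst.
by apply: cmeasD => //; exact: cmeas_cst.
Qed.

Let e_le (x : R) : expR (- `|x|) <= expR (- (d * `|x|)).
Proof. by rewrite ler_expR lerN2 ler_piMl//; case/andP: hd. Qed.

Let K_bound (m x p : R) : 0 < m -> 0 <= p <= th ->
  m * (1 + expR x) <= normc (1 - cexp x p) ->
  normc (K x p) <= (C / m + `|g| * 2 / (m * c)) * expR (- (d * `|x|)).
Proof.
move=> m0 hp hm; have h1 := onep_gt0 x.
have n2 : normc (2 : R[i]) = 2.
  by rewrite (_ : (2 : R[i]) = 2%:C) ?normc_real ?ger0_norm// rmorph_nat.
rewrite /K; apply: (le_trans (normcB_le _ _)); rewrite [leRHS]mulrDl; apply: lerD.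
  rewrite !Normc.normcM Normc.normcV normc_cexp mulrC.
  rewrite ler_pdivrMl; last by rewrite (lt_le_trans _ hm)// mulr_gt0.
  rewrite [leLHS]mulrC; apply: (le_trans (HB x hp)).
  apply: (@le_trans _ _ ((m * (1 + expR x)) * (C / m * expR (- (d * `|x|))))).
    rewrite le_eqVlt; apply/orP; left; apply/eqP; field; by rewrite gt_eqF.
  by apply: ler_wpM2r => //; rewrite mulr_ge0 ?expR_ge0// divr_ge0// ltW.
rewrite !Normc.normcM Normc.normcV Normc.normcM normc_cexp normc_real n2.
rewrite -!mulrA ler_wpM2l// ler_wpM2l//.
have hc := add_ge x hp.
apply: (@le_trans _ _ (expR x / ((m * (1 + expR x)) * (c * (1 + expR x))))).
  rewrite ler_wpM2l ?expR_ge0// lef_pV2 ?posrE.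
  - by apply: ler_pM => //; rewrite ltW// mulr_gt0.
  - by rewrite mulr_gt0//; [apply: lt_le_trans hm|apply: lt_le_trans hc]; rewrite mulr_gt0.
  - by rewrite !mulr_gt0.
apply: (@le_trans _ _ ((m * c)^-1 * (expR x / (1 + expR x) ^+ 2))).
  rewrite le_eqVlt; apply/orP; left; apply/eqP; field; by rewrite !gt_eqF.
by rewrite ler_wpM2l ?invr_ge0 ?mulr_ge0 ?(ltW m0) ?(ltW c0)// (le_trans (expR_ratio_le x)).
Qed.

Let sub_ge (t1 x p : R) : 0 < t1 -> t1 <= p <= th ->
  t1 / 2 * c * (1 + expR x) <= normc (1 - cexp x p).
Proof.
move=> t10 /andP[t1p pth].
have hp : 0 <= p <= th by rewrite (le_trans (ltW t10) t1p).
rewrite mulrC (le_trans _ (normc_sub_ge2 x hp thpi))//.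
by rewrite ler_wpM2l ?(ltW (onep_gt0 x))// ler_wpM2r ?(ltW c0)//; lra.
Qed.

Let K_L1 (p : R) : 0 < p <= th -> L1 mu (fun x => complex.Im (K x p)).
Proof.
move=> /andP[p0 pth].
have m0 : 0 < p / 2 * c by rewrite mulr_gt0//; lra.
have [d0 _] := andP hd.
apply: (@L1_le _ _ _ mu _ _ (mK p).2 (L1_Z (C / (p / 2 * c) + `|g| * 2 / (p / 2 * c * c)) (L1_expRN d0))) => x.
rewrite (le_trans (normr_Im_le _))// K_bound//; first by rewrite (ltW p0).
by apply: sub_ge; rewrite ?lexx.
Qed.

(** [cauchy_rectangle] on [[-n, n] x [t1, th]]. The sides [x = n] and [x = -n] contribute at most a
    multiple of [e^{-d n}]. The angle [t1] stays positive, which keeps [1 - w] bounded away from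
    0. *)
Let K_rot (t1 : R) : 0 < t1 <= th ->
  RI mu (fun x => complex.Im (K x th)) = RI mu (fun x => complex.Im (K x t1)).
Proof.
move=> ht1; have [t10 t1th] := andP ht1; have [d0 _] := andP hd.
pose m := t1 / 2 * c; have m0 : 0 < m by rewrite mulr_gt0//; lra.
pose B := C / m + `|g| * 2 / (m * c).
have B0 : 0 <= B.
  by apply: addr_ge0; apply: divr_ge0; rewrite ?mulr_ge0// ltW// mulr_gt0.
have lth : 0 < th <= th by rewrite th0 lexx.
have /cvg_RI_itv cth := K_L1 lth; have /cvg_RI_itv ct1 := K_L1 ht1.
pose u n := (\int[mu]_(x in `[- n%:R, n%:R]) complex.Im (K x th) -
  \int[mu]_(x in `[- n%:R, n%:R]) complex.Im (K x t1))%R.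
have cu : u n @[n --> \oo] --> RI mu (fun x => complex.Im (K x th)) - RI mu (fun x => complex.Im (K x t1)).
  exact: cvgB.
apply/eqP; rewrite -subr_eq0; apply/eqP.
apply: (cvg_unique _ cu) => //.
have edge n x : `|x| = n%:R ->
    `|(\int[mu]_(p in `[t1, th]) complex.Re (K x p))%R| <= B * expR (- (d * n%:R)) * (th - t1).
  move=> xn.
  have [k hk] : holo x x t1 th K.
    apply: (holoK m0 (ltW t10) (lexx th)) => y p _ hp.
    by rewrite (le_trans _ (sub_ge y t10 hp))// ler_pMr// lerDl expR_ge0.
  have ii : mu.-integrable `[t1, th] (EFin \o (fun p => complex.Re (K x p))).
    apply: continuous_L1_itv => p hp.
    by have [] := cD1_ccont (hol_t hk (x := x) (t := p) ltac:(by rewrite lexx) hp).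
  have iB : mu.-integrable `[t1, th] (EFin \o (fun=> B * expR (- (d * n%:R)))).
    by apply: continuous_L1_itv => p _; exact: cvg_cst.
  apply: (le_trans (le_normr_Rintegral _ ii)) => //.
  have -> : B * expR (- (d * n%:R)) * (th - t1) = (\int[mu]_(p in `[t1, th]) (B * expR (- (d * n%:R))))%R.
    by rewrite RI_itv_cst.
  apply: le_Rintegral => //; first exact: integrable_norm.
  move=> p; rewrite /= in_itv/= => hp.
  rewrite (le_trans (normr_Re_le _))// -xn K_bound//.
    by have [a b] := andP hp; rewrite (le_trans (ltW t10) a).
  exact: sub_ge.
have uE n : `|u n| <= 2 * (B * (th - t1)) * expR (- (d * n%:R)).
  have n0 : - n%:R <= n%:R :> R by rewrite lerNl (le_trans (_ : _ <= 0)) ?oppr_le0.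
  have [k hk] : holo (- n%:R) n%:R t1 th K.
    apply: (holoK m0 (ltW t10) (lexx th)) => y p _ hp.
    by rewrite (le_trans _ (sub_ge y t10 hp))// ler_pMr// lerDl expR_ge0.
  rewrite /u (cauchy_rectangle n0 t1th hk) (le_trans (ler_normB _ _))//.
  have e1 := edge n n%:R (normr_nat _ _); have e2 := edge n (- n%:R) ltac:(by rewrite normrN normr_nat).
  by rewrite (le_trans (lerD e1 e2))// le_eqVlt; apply/orP; left; apply/eqP; ring.
apply/norm_cvg0P.
apply: (@squeeze_cvgr _ _ _ _ (fun=> 0) (fun n => 2 * (B * (th - t1)) * expR (- (d * n%:R)))).
- by apply: nearW => n; rewrite normr_ge0 uE.
- exact: cvg_cst.
rewrite -[X in _ --> X](mulr0 (2 * (B * (th - t1)))); apply: cvgM; first exact: cvg_cst.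
have -> : (fun n : nat => expR (- (d * n%:R))) = (fun x : R => expR (- x)) \o (fun n : nat => d * n%:R).
  by [].
apply: (cvg_comp _ _ _ (@cvgr_expR R)).
apply/cvgryPge => A; near=> n; rewrite -ler_pdivrMl//; near: n.
exact: nbhs_infty_ger.
Unshelve. all: by end_near. Qed.

(** Over the common denominator [(1 - w) (1 + w)] the numerator is [w ((1 + w) G - 2 g)], whose
    second factor vanishes at [w = 1] and is Lipschitz there. Since [|1 - w|] is at least a multiple
    of [|x| + p], the quotient is bounded uniformly in the angle, including small ones. *)
Let K_near : exists B, forall x p, 0 < p <= th -> `|x| <= 1 -> normc (K x p) <= B.
Proof.
have hM : holo (-1) 1 0 th (fun x p => (1 + cexp x p) * G x p).
  by apply: holoM (HG _ _); apply: holoD; [exact: holo_cst|exact: holo_w].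
have [k hk] := hM; have [N hN] := hol_bd hk.
have [i0 i1] : (-1 <= (0 : R) <= 1) /\ (0 <= (0 : R) <= th).
  by rewrite oppr_le0 ler01 lexx (ltW th0).
have M0 : (1 + cexp 0 0) * G 0 0 = (2 * g)%:C.
  by rewrite gE cexp0 rmorphM/= rmorph_nat.
have lip x p : 0 <= p <= th -> `|x| <= 1 ->
    normc ((1 + cexp x p) * G x p - (2 * g)%:C) <= 2 * N * (`|x| + p).
  move=> hp; rewrite ler_norml => hx; rewrite -M0.
  pose M x p := (1 + cexp x p) * G x p; rewrite -/(M x p) -/(M 0 0).
  have p0 : 0 <= p by case/andP: hp.
  have xRe := @D1_lipschitz (fun x => complex.Re (M x p)) (fun x => complex.Re (k x p)) (-1) 1 N 0 x _ i0 hx.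
  have xIm := @D1_lipschitz (fun x => complex.Im (M x p)) (fun x => complex.Im (k x p)) (-1) 1 N 0 x _ i0 hx.
  have pRe := @D1_lipschitz (fun p => complex.Re (M 0 p)) (fun p => complex.Re ('i * k 0 p)) 0 th N 0 p _ i1 hp.
  have pIm := @D1_lipschitz (fun p => complex.Im (M 0 p)) (fun p => complex.Im ('i * k 0 p)) 0 th N 0 p _ i1 hp.
  have ni p' : normc ('i * k 0 p') = normc (k 0 p').
    by rewrite Normc.normcM /= expr0n/= add0r expr1n sqrtr1 mul1r.
  move: xRe xIm pRe pIm; rewrite !subr0 (ger0_norm p0) => xRe xIm pRe pIm.
  have {}xRe : `|complex.Re (M x p) - complex.Re (M 0 p)| <= N * `|x|.
    apply: xRe => z hz; split; first by have [] := hol_x hk hz hp.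
    by rewrite (le_trans (normr_Re_le _))//; have [] := hN z p hz hp.
  have {}xIm : `|complex.Im (M x p) - complex.Im (M 0 p)| <= N * `|x|.
    apply: xIm => z hz; split; first by have [] := hol_x hk hz hp.
    by rewrite (le_trans (normr_Im_le _))//; have [] := hN z p hz hp.
  have {}pRe : `|complex.Re (M 0 p) - complex.Re (M 0 0)| <= N * p.
    apply: pRe => z hz; split; first by have [] := hol_t hk i0 hz.
    by rewrite (le_trans (normr_Re_le _))// ni; have [] := hN 0 z i0 hz.
  have {}pIm : `|complex.Im (M 0 p) - complex.Im (M 0 0)| <= N * p.
    apply: pIm => z hz; split; first by have [] := hol_t hk i0 hz.
    by rewrite (le_trans (normr_Im_le _))// ni; have [] := hN 0 z i0 hz.
  rewrite (le_trans (normc_le_ReIm _))// cReD cImD cReN cImN.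
  have -> : complex.Re (M x p) - complex.Re (M 0 0) =
    (complex.Re (M x p) - complex.Re (M 0 p)) + (complex.Re (M 0 p) - complex.Re (M 0 0)) by ring.
  have -> : complex.Im (M x p) - complex.Im (M 0 0) =
    (complex.Im (M x p) - complex.Im (M 0 p)) + (complex.Im (M 0 p) - complex.Im (M 0 0)) by ring.
  rewrite (le_trans (lerD (ler_normD _ _) (ler_normD _ _)))//; lra.
have N0 : 0 <= N.
  by have [h _] := hN 0 0 i0 i1; rewrite (le_trans _ h)// normc_ge0.
exists (2 * N * ((expR 1 + 2) / c) / c) => x p hp hx.
have [p0 pth] := andP hp.
have hp' : 0 <= p <= th by rewrite (ltW p0).
have s0 : 1 - cexp x p != 0 by apply: one_sub_cexp_neq0; rewrite p0 (le_lt_trans pth).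
have a0 : 1 + cexp x p != 0 by apply: one_add_cexp_neq0; rewrite (ltW p0) (le_lt_trans pth).
have -> : K x p = cexp x p * ((1 + cexp x p) * G x p - (2 * g)%:C) / ((1 - cexp x p) * (1 + cexp x p)).
  have -> : (2 * g)%:C = 2 * g%:C by rewrite rmorphM/= rmorph_nat.
  rewrite /K; move: s0 a0; set w := cexp x p; move=> s0 a0.
  by field; rewrite ?s0 ?a0.
have ns : 0 < normc (1 - cexp x p).
  by rewrite lt0r normc_ge0 andbT; apply: contraNneq s0 => /Normc.eq0_normc ->.
have hs : `|x| + p <= (expR 1 + 2) / c * normc (1 - cexp x p).
  have h1 : `|x| <= expR 1 * `|1 - expR x|.
    have e1 : 1 <= expR 1 :> R by rewrite expR_ge1.
    have [x0|x0] := leP 0 x.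
      have := expR_ge1Dx x; rewrite ger0_norm// => h.
      rewrite distrC ger0_norm; last by lra.
      by rewrite (le_trans (_ : x <= expR x - 1)) ?ler_peMl//; lra.
    have h := expR_ge1Dx (- x); rewrite ltr0_norm//.
    have ex1 : expR x <= 1 by rewrite expR_le1 ltW.
    rewrite ger0_norm; last by lra.
    have -> : 1 - expR x = expR x * (expR (- x) - 1) by rewrite mulrBr expRxMexpNx_1 mulr1.
    rewrite mulrA -expRD.
    apply: (@le_trans _ _ (expR (- x) - 1)); first lra.
    rewrite ler_peMl//; first lra.
    by rewrite expR_ge1; move: hx; rewrite ltr0_norm//; lra.
  have h2 := normc_sub_ge1 x hp' thpi; have h3 := normc_sub_ge2 x hp' thpi.
  rewrite mulrAC ler_pdivlMr//.
  have h4 : p * c <= 2 * normc (1 - cexp x p).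
    apply: (@le_trans _ _ (2 * ((1 + expR x) * (p / 2 * c)))); last first.
      by rewrite ler_wpM2l.
    have -> : 2 * ((1 + expR x) * (p / 2 * c)) = (p * c) * (1 + expR x) by field.
    by rewrite ler_peMr ?lerDl ?expR_ge0// mulr_ge0 ?(ltW p0)// ltW.
  have h5 : `|x| * c <= expR 1 * normc (1 - cexp x p).
    rewrite (le_trans (ler_wpM2r (ltW c0) h1))// -mulrA ler_wpM2l ?expR_ge0// mulrC.
    exact: h2.
  by rewrite mulrDl mulrDl lerD.
rewrite !Normc.normcM Normc.normcV Normc.normcM normc_cexp.
have hl := lip x p hp' hx; have ha := add_ge x hp'; have e1 := onep_gt0 x.
have na : 0 < normc (1 + cexp x p) by rewrite (lt_le_trans _ ha)// mulr_gt0.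
have -> : expR x * normc ((1 + cexp x p) * G x p - (2 * g)%:C) /
  (normc (1 - cexp x p) * normc (1 + cexp x p)) =
  (expR x / normc (1 + cexp x p)) * (normc ((1 + cexp x p) * G x p - (2 * g)%:C) / normc (1 - cexp x p)).
  by rewrite invfM; ring.
rewrite [leRHS]mulrC; apply: ler_pM.
- by rewrite divr_ge0 ?expR_ge0 ?normc_ge0.
- by rewrite divr_ge0 ?normc_ge0.
- rewrite ler_pdivrMr// ler_pdivlMl// (le_trans _ ha)// ler_wpM2l ?(ltW c0)//.
  by rewrite lerDr.
- rewrite ler_pdivrMr//; apply: (le_trans hl); rewrite -[leRHS]mulrA.
  by apply: ler_wpM2l => //; rewrite mulr_ge0.
Qed.

Let K_far (x p : R) : 0 < p <= th -> 1 < `|x| ->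
  normc (K x p) <= (C / (c / 3) + `|g| * 2 / (c / 3 * c)) * expR (- (d * `|x|)).
Proof.
move=> /andP[p0 pth] hx; have hp : 0 <= p <= th by rewrite (ltW p0).
(* For [|x| > 1] either [e^x >= 2] or [e^x <= 1 / 2], and in both cases
   [|1 - e^x| >= (1 + e^x) / 3]. *)
apply: K_bound => //; first by rewrite divr_gt0.
apply: le_trans (normc_sub_ge1 x hp thpi); rewrite -mulrA ler_wpM2l ?(ltW c0)//.
have [x0|x0] := leP 0 x.
  have := expR_ge1Dx x; move: hx; rewrite ger0_norm// => hx h.
  by rewrite distrC ger0_norm; lra.
have h := expR_ge1Dx (- x); move: hx; rewrite ltr0_norm// => hx.
have ex2 : expR x <= 2^-1.
  by rewrite -[x]opprK expRN lef_pV2 ?posrE ?expR_gt0//; lra.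
by rewrite ger0_norm; lra.
Qed.

Let K0_real x : complex.Im (K x 0) = 0.
Proof.
have iM (y z : R[i]) : complex.Im y = 0 -> complex.Im z = 0 -> complex.Im (y * z) = 0.
  by move=> a b; rewrite cImM a b mulr0 mul0r addr0.
have iD (y z : R[i]) : complex.Im y = 0 -> complex.Im z = 0 -> complex.Im (y + z) = 0.
  by move=> a b; rewrite cImD a b addr0.
have iN (y : R[i]) : complex.Im y = 0 -> complex.Im (- y) = 0.
  by move=> a; rewrite cImN a oppr0.
have iV (y : R[i]) : complex.Im y = 0 -> complex.Im y^-1 = 0.
  by move=> a; rewrite cImV a mul0r oppr0.
have iw : complex.Im (cexp x 0) = 0 by rewrite /= sin0 mulr0.
have i1 : complex.Im (1 : R[i]) = 0 by [].
have i2 : complex.Im (2 : R[i]) = 0 by apply: (iD).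
rewrite /K; apply: (iD).
  by apply: (iM); [apply: (iM)|apply: (iV); apply: (iD) => //; apply: (iN)].
apply: (iN); apply: (iM) => //; apply: (iM); first exact: (iM).
by apply: (iV); apply: (iM); apply: (iD) => //; apply: (iN).
Qed.

(** By [K_rot] the integral is the same at all the angles [th / (n + 1)]. As these tend to 0 the
    integrand tends to [Im (K x 0) = 0] for [x != 0], and [K_near] and [K_far] provide an integrable
    bound valid for all angles. *)
Let K_th_eq0 : RI mu (fun x => complex.Im (K x th)) = 0.
Proof.
have [d0 d1] := andP hd.
pose t n := th / n.+1%:R.
have ht n : 0 < t n <= th.
  rewrite divr_gt0// ler_pdivrMr// ler_peMr ?ler1n//; exact: ltW.
have [B hB] := K_near.
pose A := Num.max (B * expR 1) (C / (c / 3) + `|g| * 2 / (c / 3 * c)).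
have ct : t n @[n --> \oo] --> 0.
  rewrite -(mulr0 th); apply: cvgM; first exact: cvg_cst.
  exact: cvg_harmonic.
have bd : {ae mu, forall x n, `|complex.Im (K x (t n))| <= A * expR (- (d * `|x|))}.
  apply: aeW => x n; rewrite (le_trans (normr_Im_le _))//.
  have [x1|x1] := leP `|x| 1; last first.
    by rewrite (le_trans (K_far (ht n) x1))// ler_wpM2r ?expR_ge0// le_max lexx orbT.
  rewrite (le_trans (hB _ _ (ht n) x1))//.
  have B0 : 0 <= B by rewrite (le_trans _ (hB _ _ (ht n) x1))// normc_ge0.
  apply: (@le_trans _ _ (B * expR 1 * expR (- (d * `|x|)))).
    rewrite -mulrA -expRD ler_peMr// expR_ge1.
    by have : d * `|x| <= 1; [rewrite mulr_ile1 ?(ltW d0)|lra].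
  by rewrite ler_wpM2r ?expR_ge0// le_max lexx.
have cv : {ae mu, forall x, complex.Im (K x (t n)) @[n --> \oo] --> (0 : R)}.
  exists [set 0]; split => //; first exact: lebesgue_measure_set1.
  move=> x /= h; apply: contrapT => /eqP x0; apply: h.
  have m0 : 0 < c * `|1 - expR x|.
    rewrite mulr_gt0// normr_gt0 subr_eq0 eq_sym; apply: contra x0 => /eqP h.
    by rewrite -(inj_eq (@expR_inj R)) h expR0.
  have [k hk] : holo x x 0 th K.
    apply: (holoK m0 (lexx 0) (lexx th)) => y p /andP[xy yx] hp.
    have -> : y = x by apply/eqP; rewrite eq_le yx.
    exact: normc_sub_ge1.
  have [_ cK] := cD1_ccont (hol_t hk (x := x) (t := 0) ltac:(by rewrite lexx) ltac:(by rewrite lexx (ltW th0))).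
  by have := cvg_comp _ _ ct cK; rewrite K0_real.
have [_] := @RI_dct _ _ _ mu (fun n x => complex.Im (K x (t n))) (fun=> 0)
   (fun x => A * expR (- (d * `|x|))) (fun n => (mK (t n)).2) (measurable_cst _)
   cv (L1_Z A (L1_expRN d0)) bd.
rewrite RI_0 (_ : (fun n => _) = fun=> RI mu (fun x => complex.Im (K x th))); last first.
  by apply/funext => n; rewrite -K_rot.
move=> h; exact: (cvg_unique _ (cvg_cst _) h).
Qed.

(* The contour is moved from the ray [t = th] to the ray [t = 0], where [G] is real and the only
   contribution is that of the pole at [w = 1]. *)
Lemma stieltjes_symbol :
  L1 mu (fun x => complex.Im (cexp x th * G x th / (1 - cexp x th))) /\
  RI mu (fun x => complex.Im (cexp x th * G x th / (1 - cexp x th))) =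
  pi * complex.Re (G 0 0).
Proof.
have [pi_ piE] := poisson_kernel hth.
have E : (fun x => complex.Im (cexp x th * G x th / (1 - cexp x th))) =
    fun x => complex.Im (K x th) + g * complex.Im (2 * cexp x th / ((1 - cexp x th) * (1 + cexp x th))).
  apply/funext => x; by rewrite /K cImD cImN (cImM g%:C) /= mul0r addr0 subrK.
have lth : 0 < th <= th by rewrite th0 lexx.
rewrite E; split; first exact: L1_D (K_L1 lth) (L1_Z g pi_).
by rewrite (RI_D (K_L1 lth) (L1_Z g pi_)) RI_Z// piE K_th_eq0 add0r mulrC.
Qed.

End symbol.

End contour.

(** * Laplace inversion integrals *)

Section nonintegrable.
Context d (T : measurableType d) (R : realType).
Variable mu : {measure set T -> \bar R}.

(** The positive or the negative part has infinite integral, so the difference is infinite and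
    [fine] sends it to 0. Hence scalar multiplication ([RI_Zm]) and affine substitution
    ([RI_affine_m]) commute with [RI] for all measurable functions. *)
Lemma RI_nonL1 (f : T -> R) : measurable_fun setT f -> ~ L1 mu f -> RI mu f = 0.
Proof.
move=> mf nf; rewrite /Rintegral integralE.
have mf' : measurable_fun setT (EFin \o f) by exact/measurable_EFinP.
have p0 : (0 <= \int[mu]_x ((EFin \o f)^\+ x))%E by exact: integral_ge0.
have n0 : (0 <= \int[mu]_x ((EFin \o f)^\- x))%E by exact: integral_ge0.
case ep : (\int[mu]_x ((EFin \o f)^\+ x))%E p0 => [a||] // _;
  case en : (\int[mu]_x ((EFin \o f)^\- x))%E n0 => [b||] // _.
exfalso; apply: nf; apply/integrableP; split => //.
rewrite (eq_integral (fun x => ((EFin \o f)^\+ x + (EFin \o f)^\- x)%E)).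
  rewrite ge0_integralD//; [by rewrite ep en ltry|exact: measurable_funepos|exact: measurable_funeneg].
by move=> x _; rewrite -[LHS]/((abse \o (EFin \o f)) x) fune_abse.
Qed.

Lemma RI_Zm (k : R) (f : T -> R) : measurable_fun setT f ->
  RI mu (fun x => k * f x) = k * RI mu f.
Proof.
move=> mf; have [fi|nfi] := pselect (L1 mu f); first exact: RI_Z.
have [->|k0] := eqVneq k 0.
  by rewrite mul0r (_ : (fun x => _) = fun=> 0) ?RI_0//; apply/funext => x; rewrite mul0r.
rewrite (RI_nonL1 mf nfi) mulr0; apply: RI_nonL1.
  exact: measurable_funM.
move=> h; apply: nfi; have := L1_Z k^-1 h.
by rewrite (_ : (fun x => _) = f)//; apply/funext => x; rewrite mulKf.
Qed.

End nonintegrable.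

Section inverse_laplace.
Context {R : realType}.
Local Notation mu := (@lebesgue_measure R).
Local Notation normc := Normc.normc.
Local Notation D1 f x d := (is_derive (x : R) (1 : R) (f : R -> R) (d : R)).

Lemma RI_cexp (a b : R) (z : R[i]) : 0 < a ->
  L1 mu (fun t => \1_`[0, +oo[ t * complex.Im (cexp (- (a * t)) (b * t) * z)) /\
  RI mu (fun t => \1_`[0, +oo[ t * complex.Im (cexp (- (a * t)) (b * t) * z)) =
  complex.Im (z / (a -i* b)).
Proof.
move=> a0.
have ab0 : (- a +i* b : R[i]) != 0.
  by apply/eqP => /(congr1 (@complex.Re R))/= /eqP; rewrite oppr_eq0 gt_eqF.
pose F t := cexp (- (a * t)) (b * t) * (z / (- a +i* b)).
have dF t : cD1 F t (cexp (- (a * t)) (b * t) * z).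
  rewrite /F; have h := cD1_M (cD1_cexp (D1_N (D1_lin a t)) (D1_lin b t)) (cD1_cst (z / (- a +i* b)) t).
  apply: (cD1_eq h); rewrite mulr0 addr0.
  by move: (- a +i* b) ab0 (cexp _ _) => q q0 w; field.
have mI : measurable_fun setT (fun t : R => \1_`[0, +oo[ t * complex.Im (cexp (- (a * t)) (b * t) * z)).
  apply: measurable_funM; first exact: measurable_indic.
  suff mm : cmeas (fun t : measurableTypeR R => cexp (- (a * t)) (b * t) * z) by exact: mm.2.
  apply: cmeasM; last exact: cmeas_cst.
  apply: cmeas_cexp.
    by apply: measurableT_comp => //; exact: measurable_funM.
  exact: measurable_funM.
have iI : L1 mu (fun t => \1_`[0, +oo[ t * complex.Im (cexp (- (a * t)) (b * t) * z)).
  apply: (@L1_le _ _ _ mu _ _ mI (L1_Z (normc z) (RI_exp a0).1)) => t.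
  rewrite normrM mulrCA ger0_norm ?indicE//; apply: ler_wpM2l => //.
  by rewrite (le_trans (normr_Im_le _))// Normc.normcM normc_cexp mulrC.
split=> //.
rewrite (@RI_FTCy R (fun t => complex.Im (F t)) (fun t => complex.Im (cexp (- (a * t)) (b * t) * z)) 0 _ _ iI).
- rewrite /F !mulr0 oppr0 cexp0 mul1r sub0r -cImN -mulrN -invrN; congr (complex.Im (z / _)).
  by apply: complex_eq => /=; rewrite ?opprK.
- by move=> x _; exact: (dF x).2.
- move=> x _; apply: (proj2 (ccontM _ (ccont_cst z x))).
  exact: (cD1_ccont (cD1_cexp (D1_N (D1_lin a x)) (D1_lin b x))).
apply/norm_cvg0P.
apply: (@squeeze_cvgr _ _ _ _ (fun=> 0) (fun t => normc (z / (- a +i* b)) * expR (- (a * t)))).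
- apply: nearW => t; rewrite normr_ge0/= (le_trans (normr_Im_le _))// Normc.normcM normc_cexp.
  by rewrite mulrC.
- exact: cvg_cst.
rewrite -[X in _ --> X](mulr0 (normc (z / (- a +i* b)))); apply: cvgM; first exact: cvg_cst.
have -> : (fun x : R => expR (- (a * x))) = (fun x : R => expR (- x)) \o (fun x : R => a * x).
  by [].
apply: (cvg_comp _ _ _ (@cvgr_expR R)).
by apply/cvgryPge => A; near=> n; rewrite -ler_pdivrMl//; near: n; exact: nbhs_pinfty_ge.
Unshelve. all: by end_near. Qed.

(* [1 / (2 i pi)] times the integral of [e^{t w} G dw] along the two rays [arg w = - th] and
   [arg w = th], with [w = e^{x + i th}] on the second one; [G] is real on the real axis, so the
   two contributions are conjugate. *)
Definition TT (th : R) (G : R -> R[i]) (t : R) : R :=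
  pi^-1 * RI mu (fun x => complex.Im
    (cexp (t * (expR x * cos th)) (t * (expR x * sin th)) * (cexp x th * G x))).

(** * Laplace transform of an integral along the rays *)

Section laplace.
Variables (th : R) (G : R -> R[i]).
Hypotheses (hth : pi / 2 < th < pi) (mG : cmeas G).
Hypothesis iG : L1 mu (fun x => expR x * normc (G x) / (1 + expR x)).

Lemma Ncos_gt0 : 0 < - cos th.
Proof.
case/andP: hth => h1 h2; have -> : - cos th = sin (th - pi / 2).
  by rewrite sinB cos_pihalf sin_pihalf mulr0 mulr1 sub0r.
by apply: sin_gt0_pi; apply/andP; split; lra.
Qed.

Lemma cmeas_TT_integrand d (T : measurableType d) (f g : T -> R) :
  measurable_fun setT f -> measurable_fun setT g ->
  cmeas (fun p => cexp (g p * (expR (f p) * cos th)) (g p * (expR (f p) * sin th)) * (cexp (f p) th * G (f p))).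
Proof.
move=> mf mg; have mef : measurable_fun setT (fun p => expR (f p)) by exact: measurableT_comp.
apply: cmeasM; first by apply: cmeas_cexp; apply: measurable_funM => //; exact: measurable_funM.
apply: cmeasM; first exact: cmeas_cexp.
by split; [exact: (measurableT_comp mG.1 mf)|exact: (measurableT_comp mG.2 mf)].
Qed.

Lemma laplace_TT (s : R) : 0 < s ->
  L1 mu (fun t => \1_`[0, +oo[ t * (expR (- (s * t)) * TT th G t)) /\
  RI mu (fun t => \1_`[0, +oo[ t * (expR (- (s * t)) * TT th G t)) =
  pi^-1 * RI mu (fun x => complex.Im (cexp x th * G x / (s%:C - cexp x th))).
Proof.
move=> s0; have c0 := Ncos_gt0.
pose E x t := complex.Im (cexp (t * (expR x * cos th)) (t * (expR x * sin th)) * (cexp x th * G x)).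
pose f (p : R * R) := \1_`[0, +oo[ p.2 * (expR (- (s * p.2)) * E p.1 p.2).
have mE d (T : measurableType d) (h g : T -> R) :
    measurable_fun setT h -> measurable_fun setT g -> measurable_fun setT (fun p => E (h p) (g p)).
  by move=> mh mg; apply: (proj2 (cmeas_TT_integrand _ _)).
have fE x t : f (x, t) = \1_`[0, +oo[ t * complex.Im
    (cexp (- ((s - expR x * cos th) * t)) (expR x * sin th * t) * (cexp x th * G x)).
  rewrite /f /E /=; congr (_ * _).
  have -> : - ((s - expR x * cos th) * t) = - (s * t) + t * (expR x * cos th) by ring.
  have -> : expR x * sin th * t = 0 + t * (expR x * sin th) by ring.
  rewrite cexpD -mulrA; have -> : cexp (- (s * t)) 0 = (expR (- (s * t)))%:C.
    by apply: complex_eq; rewrite /= ?cos0 ?sin0 ?mulr1 ?mulr0.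
  by rewrite [RHS]cImM /= mul0r addr0.
have a0 x : 0 < s - expR x * cos th.
  by rewrite addr_gt0// -mulrN mulr_gt0// expR_gt0.
(* With this [m], [s - Re w >= m (1 + e^x)]; the weight [1 / (1 + e^x)] is the one that appears in
   the hypothesis [iG]. *)
pose m := Num.min s (- cos th); have m0 : 0 < m by rewrite lt_min s0 c0.
have am x : m * (1 + expR x) <= s - expR x * cos th.
  rewrite mulrDr mulr1 lerD//; first by rewrite ge_min lexx.
  by rewrite -mulrN mulrC ler_wpM2l ?expR_ge0// ge_min lexx orbT.
have mf : measurable_fun setT f.
  have m2 : measurable_fun setT (fun p : R * R => \1_`[0, +oo[ p.2 : R).
    apply: (measurableT_comp (f := (\1_(`[0, +oo[ : set R) : R -> R))) => //.
  apply: measurable_funM => //; apply: measurable_funM; last exact: mE.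
  by apply: measurableT_comp => //; apply: measurableT_comp => //; exact: measurable_funM.
have fi : L1 (mu \x mu)%E f.
  apply: (@L1_prod _ _ _ _ _ mu mu f (fun x => m^-1 * (expR x * normc (G x) / (1 + expR x))) mf).
    exact: L1_Z.
  move=> x; have [ei eE] := RI_exp (a0 x).
  pose K := expR x * normc (G x).
  have K0 : 0 <= K by rewrite mulr_ge0 ?expR_ge0 ?normc_ge0.
  apply: (@le_trans _ _ (\int[mu]_t (K * (\1_`[0, +oo[ t * expR (- ((s - expR x * cos th) * t))))%:E)%E).
    apply: ge0_le_integral => //.
    - apply/measurable_EFinP/measurableT_comp => //.
      exact: (measurableT_comp mf (measurable_pair1 x)).
    - by apply/measurable_EFinP/measurable_funM => //; exact: L1_measurable ei.
    move=> t _; rewrite lee_fin fE normrM [leRHS]mulrCA ger0_norm ?indicE//; apply: ler_wpM2l => //.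
    by rewrite (le_trans (normr_Im_le _))// !Normc.normcM !normc_cexp mulrC.
  rewrite -(RI_EFin (L1_Z K ei)) RI_Z// eE lee_fin.
  have p1 : 0 < 1 + expR x by rewrite addr_gt0// expR_gt0.
  rewrite -/K mulrCA ler_wpM2l// -invfM lef_pV2 ?posrE//.
  by rewrite mulr_gt0.
have [i2 e2] := RI_prod2 fi; have [i1 e1] := RI_prod1 fi.
have tE t : RI mu (fun x => f (x, t)) = pi * (\1_`[0, +oo[ t * (expR (- (s * t)) * TT th G t)).
  rewrite /f /=; have -> : (fun x => \1_`[0, +oo[ t * (expR (- (s * t)) * E x t)) =
      fun x => (\1_`[0, +oo[ t * expR (- (s * t))) * E x t.
    by apply/funext => x; rewrite mulrA.
  (* Integrability in [x] is not known for each fixed [t], hence [RI_Zm] instead of [RI_Z]. *)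
  rewrite RI_Zm; last by apply: mE.
  have aux (q a b I : R) : q != 0 -> a * b * I = q * (a * (b * (q^-1 * I))).
    by move=> q0; field.
  by apply: aux; rewrite gt_eqF// pi_gt0.
have xE x : RI mu (fun t => f (x, t)) = complex.Im (cexp x th * G x / (s%:C - cexp x th)).
  rewrite (eq_RI mu (fE x)).
  rewrite (proj2 (RI_cexp _ _ (a0 x))); congr (complex.Im (_ / _)).
  by apply: complex_eq => //=; rewrite sub0r.
have fT : (fun t => \1_`[0, +oo[ t * (expR (- (s * t)) * TT th G t)) =
   fun t => pi^-1 * RI mu (fun x => f (x, t)).
  by apply/funext => t; rewrite tE mulKf// gt_eqF ?pi_gt0.
rewrite fT; split; first exact: (L1_Z pi^-1 i2).
by rewrite (RI_Z pi^-1 i2) e2 -e1; congr (_ * _); apply: eq_RI => x; rewrite xE.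
Qed.

End laplace.

(* [w^p / (w^al + l)] at [w = e^{x + i ph}] *)
Definition Gs (p al l x ph : R) : R[i] :=
  cexp (p * x) (p * ph) / (cexp (al * x) (al * ph) + l%:C).

(** * The symbols [w^p / (w^al + l)] *)

Section Gs_laplace.
Variables (th p al : R).
Hypotheses (hth : pi / 2 < th < pi) (al0 : 0 <= al) (halth : al * th < pi) (hp : -1 < p < al).

Let c := cos (al * th / 2).

Let c0 : 0 < c.
Proof.
apply: cos_half_gt0; rewrite halth andbT mulr_ge0//.
by have := pi_gt0 R; case/andP: hth => *; lra.
Qed.

(** Since [al * th < pi], the power [w^al] stays in a sector that avoids the negative real axis, and
    [- l] with it. *)
Lemma Gs_den_ge l x ph : 0 < l -> 0 <= ph <= th ->
  cos (al * th / 2) * (l + expR (al * x)) <= normc (cexp (al * x) (al * ph) + l%:C).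
Proof.
move=> l0 /andP[ph0 phth]; rewrite [X in normc X]addrC; apply: normc_add_ge; rewrite ?(ltW l0)//.
by rewrite mulr_ge0//= ler_wpM2l.
Qed.

Lemma Gs_den_neq0 l x ph : 0 < l -> 0 <= ph <= th -> cexp (al * x) (al * ph) + l%:C != 0.
Proof.
move=> l0 hph; have h := Gs_den_ge x l0 hph.
apply/eqP => h0; move: h; rewrite h0 -[X in normc X]/((0 : R)%:C) normc_real normr0 leNgt.
by rewrite mulr_gt0// addr_gt0// expR_gt0.
Qed.

Lemma Gs_le l x ph : 0 < l -> 0 <= ph <= th ->
  normc (Gs p al l x ph) <= (cos (al * th / 2))^-1 * (expR (p * x) / (l + expR (al * x))).
Proof.
move=> l0 hph; rewrite /Gs Normc.normcM Normc.normcV normc_cexp mulrCA ler_wpM2l ?expR_ge0//.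
have h := Gs_den_ge x l0 hph.
have p1 : 0 < cos (al * th / 2) * (l + expR (al * x)) by rewrite mulr_gt0// addr_gt0// expR_gt0.
by rewrite -invfM lef_pV2 ?posrE// (lt_le_trans p1).
Qed.

(** Decay exponent: [e^x |Gs| / (1 + e^x)] is of order [e^{(p - al) x}] at [+oo] and [e^{(p + 1) x}]
    at [-oo]. The cap at 1 is what the section on symbols asks of [d]. *)
Let d := Num.min 1 (Num.min (p + 1) (al - p)).

Let hd : 0 < d <= 1.
Proof.
rewrite ge_min lexx andbT !lt_min ltr01/=; case/andP: hp => h1 h2.
by apply/andP; split; lra.
Qed.

Lemma Gs_bound l : 0 < l -> exists2 C, 0 <= C & forall x ph, 0 <= ph <= th ->
  normc (Gs p al l x ph) * expR x <= C * expR (- (d * `|x|)) * (1 + expR x).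
Proof.
move=> l0; exists (c^-1 * Num.max 1 l^-1); first by rewrite mulr_ge0 ?invr_ge0 ?(ltW c0)// le_max ler01.
move=> x ph hph; have h := Gs_le x l0 hph.
apply: (le_trans (ler_wpM2r (expR_ge0 x) h)); rewrite -/c -!mulrA ler_wpM2l ?invr_ge0 ?(ltW c0)//.
have [d0 _] := andP hd.
have ex0 := expR_gt0 x; have eal := expR_gt0 (al * x); have ep := expR_gt0 (p * x).
(* In the denominator [l + e^{al x}] the exponential is kept for [x >= 0], and [l] for [x < 0]. *)
have [x0|x0] := leP 0 x.
  rewrite ger0_norm//.
  apply: (@le_trans _ _ (1 * (expR (- (d * x)) * (1 + expR x)))); last first.
    by rewrite ler_wpM2r ?le_max ?lexx// mulr_ge0 ?expR_ge0// addr_ge0// ltW.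
  rewrite mul1r mulrA; apply: ler_pM; rewrite ?mulr_ge0 ?invr_ge0 ?(ltW ex0) ?(ltW ep) ?addr_ge0 ?(ltW l0) ?(ltW eal)//; last by rewrite lerDr.
  rewrite ler_pdivrMr ?addr_gt0//.
  apply: (@le_trans _ _ (expR (- (d * x)) * expR (al * x))); last by rewrite ler_wpM2l ?expR_ge0// lerDr ltW.
  rewrite -expRD ler_expR.
  have : d <= al - p by rewrite !ge_min lexx !orbT.
  move=> hdp; have := ler_wpM2r x0 hdp; lra.
rewrite ltr0_norm//.
apply: (@le_trans _ _ (l^-1 * (expR (- (d * - x)) * (1 + expR x)))); last first.
  by rewrite ler_wpM2r ?le_max ?lexx ?orbT// mulr_ge0 ?expR_ge0// addr_ge0// ltW.
rewrite mulrCA; apply: ler_pM; rewrite ?mulr_ge0 ?invr_ge0 ?addr_ge0 ?(ltW ex0) ?(ltW ep) ?(ltW l0) ?(ltW eal)//.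
  by rewrite lef_pV2 ?posrE ?addr_gt0// lerDl ltW.
apply: (@le_trans _ _ (expR (- (d * - x)))); last by rewrite ler_peMr ?expR_ge0// lerDl ltW.
rewrite -expRD ler_expR.
have : d <= p + 1 by rewrite !ge_min lexx !orbT.
move=> hdp; have := ler_wnM2r (ltW x0) hdp; lra.
Qed.

Lemma cmeas_Gs l : cmeas (fun x : R => Gs p al l x th).
Proof.
apply: cmeasM.
  by apply: cmeas_cexp; [exact: measurable_funM|exact: measurable_cst].
apply: cmeasV; apply: cmeasD; last exact: cmeas_cst.
by apply: cmeas_cexp; [exact: measurable_funM|exact: measurable_cst].
Qed.

Lemma L1_Gs l : 0 < l -> L1 mu (fun x => expR x * normc (Gs p al l x th) / (1 + expR x)).
Proof.
move=> l0; have [C C0 h] := Gs_bound l0; have [d0 _] := andP hd.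
have e1 (x : R) : 0 < 1 + expR x by rewrite addr_gt0// expR_gt0.
have th0 : 0 <= th <= th by rewrite lexx andbT; have := pi_gt0 R; case/andP: hth => *; lra.
have m : measurable_fun setT (fun x => expR x * normc (Gs p al l x th) / (1 + expR x)).
  have mi : measurable_fun setT (fun x : R => (1 + expR x)^-1).
    apply: continuous_measurable_fun => x; apply: cvgV; first by rewrite gt_eqF.
    by apply: cvgD; [exact: cvg_cst|exact: continuous_expR].
  apply: measurable_funM => //; apply: measurable_funM; first exact: measurable_expR.
  exact: cmeas_normc (cmeas_Gs l).
apply: (@L1_le _ _ _ mu _ _ m (L1_Z C (L1_expRN d0))) => x.
rewrite ger0_norm; last by rewrite divr_ge0 ?(ltW (e1 x))// mulr_ge0 ?expR_ge0 ?normc_ge0.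
by rewrite ler_pdivrMr// mulrC h.
Qed.

Let holo_Gs l x1 x2 : 0 < l -> holo x1 x2 0 th (Gs p al l).
Proof.
move=> l0; apply: holoM; first by exact: holo_cexp.
apply: (@holoV R _ _ _ _ _ (c * l)); first by rewrite mulr_gt0.
  by apply: holoD; [exact: holo_cexp|exact: holo_cst].
move=> x ph _ hph; apply: le_trans (Gs_den_ge x l0 hph).
by rewrite ler_wpM2l ?(ltW c0)// lerDl expR_ge0.
Qed.

(** By [laplace_TT] the transform at [s] is an integral with a pole at [w = s]. [stieltjes_symbol]
    evaluates it as the symbol at that point, once the pole has been moved to 1. *)
Lemma laplace_Gs l s : 0 < l -> 0 < s ->
  L1 mu (fun t => \1_`[0, +oo[ t * (expR (- (s * t)) * TT th (Gs p al l ^~ th) t)) /\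
  RI mu (fun t => \1_`[0, +oo[ t * (expR (- (s * t)) * TT th (Gs p al l ^~ th) t)) =
  s `^ p / (s `^ al + l).
Proof.
move=> l0 s0; have [h1 h2] := laplace_TT hth (cmeas_Gs l) (L1_Gs l0) s0.
split=> //; rewrite {}h2; set a := ln s.
have sE : s = expR a by rewrite lnK.
have sp q : s `^ q = expR (q * a) by rewrite /powR gt_eqF.
(* The substitution [w = s w'], a translation by [a = ln s] in [x], moves the pole to 1, replaces
   [l] by [l' = l s^{-al}] and brings out the factor [k = s^{p - al}]. *)
pose l' := l * expR (- (al * a)); have l'0 : 0 < l' by rewrite mulr_gt0 ?expR_gt0.
have [C C0 h] := Gs_bound l'0.
have tp : 0 < th < pi by have := pi_gt0 R; case/andP: hth => *; apply/andP; split; lra.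
have th0 : 0 <= th <= th by rewrite lexx andbT (ltW (proj1 (andP tp))).
have i0 x : complex.Im (Gs p al l' x 0) = 0.
  have cr q : cexp q 0 = (expR q)%:C :> R[i] by apply: complex_eq; rewrite /= ?cos0 ?sin0 ?mulr1 ?mulr0.
  by rewrite /Gs !mulr0 !cr -rmorphD -fmorphV -rmorphM.
have [i1 e1] := stieltjes_symbol tp C0 hd (fun x1 x2 => holo_Gs x1 x2 l'0) h i0.
pose k := expR ((p - al) * a).
have E x : complex.Im (cexp x th * Gs p al l x th / (s%:C - cexp x th)) =
    k * complex.Im (cexp (1 * x + - a) th * Gs p al l' (1 * x + - a) th / (1 - cexp (1 * x + - a) th)).
  rewrite mul1r; set y := x - a; have -> : x = a + y by rewrite /y; ring.
  have cD q : cexp (q * (a + y)) (q * th) = (expR (q * a))%:C * cexp (q * y) (q * th).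
    have -> : (expR (q * a))%:C = cexp (q * a) 0 by apply: complex_eq; rewrite /= ?cos0 ?sin0 ?mulr1 ?mulr0.
    by rewrite -cexpD mulrDr add0r.
  have -> : cexp (a + y) th = s%:C * cexp y th by have := cD 1; rewrite !mul1r sE.
  have -> : s%:C * cexp y th * Gs p al l (a + y) th / (s%:C - s%:C * cexp y th) =
    k%:C * (cexp y th * Gs p al l' y th / (1 - cexp y th)).
    rewrite /Gs !cD.
    have kE : k%:C = (expR (p * a))%:C / (expR (al * a))%:C.
      by rewrite -rmorphV ?unitfE ?gt_eqF ?expR_gt0//= -rmorphM/= -expRN -expRD /k mulrBl.
    have lE : l%:C = (expR (al * a))%:C * l'%:C.
      by rewrite -rmorphM/= /l' mulrCA -expRD subrr expR0 mulr1.
    rewrite kE lE.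
    have n1 := one_sub_cexp_neq0 y tp; have n2 := Gs_den_neq0 y l'0 th0.
    have n3 : s%:C != 0 by rewrite (inj_eq (@complexI R)) gt_eqF.
    have n4 : (expR (al * a))%:C != 0 by rewrite (inj_eq (@complexI R)) gt_eqF ?expR_gt0.
    move: n1 n2 n3 n4; move: (expR (al * a))%:C s%:C (cexp y th) (cexp (al * y) _) l'%:C (cexp (p * y) _) (expR (p * a))%:C => A S w u L v P n1 n2 n3 n4.
    have -> : A * u + A * L = A * (u + L) by ring.
    have -> : S - S * w = S * (1 - w) by ring.
    by field; rewrite ?n1 ?n2 ?n3 ?n4.
  by rewrite cImM /= mul0r addr0.
rewrite (eq_RI mu E).
rewrite RI_Z; last exact: (L1_affine _ (oner_neq0 R) i1).
rewrite (RI_affine (- a) (oner_neq0 R) i1) normr1 invr1 mul1r e1.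
have -> : complex.Re (Gs p al l' 0 0) = (1 + l')^-1.
  by rewrite /Gs !mulr0 !cexp0 mul1r -[1]/((1 : R)%:C) -rmorphD -fmorphV.
have := pi_gt0 R; move=> pi0; rewrite !sp /k mulrBl expRD expRN.
have -> : l = expR (al * a) * l' by rewrite /l' mulrCA -expRD subrr expR0 mulr1.
rewrite mulrCA mulKf ?gt_eqF// -{2}[expR (al * a)]mulr1 -mulrDr invfM mulrA; ring.
Qed.

End Gs_laplace.

End inverse_laplace.

(** * Hankel's integral for [1 / Gamma], and the inverse transforms for large parameter *)

Section inverse_power.
Context {R : realType}.
Local Notation mu := (@lebesgue_measure R).
Local Notation normc := Normc.normc.
Local Notation D1 f x d := (is_derive (x : R) (1 : R) (f : R -> R) (d : R)).

(** The double exponential beats every exponential: [e^x >= (x / 2)^2] for [x >= 0], and completing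
    the square in [m (x / 2)^2 - (q + 2) x] produces the constant. *)
Lemma expR_expR_le (m q x : R) : 0 < m -> 0 <= x -> 0 <= q + 2 ->
  expR (- (m * expR x)) * expR ((q + 1) * x) <= expR ((q + 2) ^+ 2 / m) * expR (- x).
Proof.
move=> m0 x0 q2; rewrite -!expRD ler_expR.
have h : (1 + x / 2) ^+ 2 <= expR x.
  have -> : expR x = expR (x / 2) ^+ 2 by rewrite -expRM_natr divfK.
  have := expR_ge1Dx (x / 2); move=> h; rewrite lerXn2r ?nnegrE ?expR_ge0//.
  by rewrite addr_ge0// divr_ge0.
have h2 : m * (x / 2) ^+ 2 <= m * expR x.
  rewrite ler_wpM2l ?(ltW m0)// (le_trans _ h)// lerXn2r ?nnegrE ?divr_ge0 ?addr_ge0 ?divr_ge0//.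
  by rewrite lerDr.
have h3 : (q + 2) * x <= (q + 2) ^+ 2 / m + m * (x / 2) ^+ 2.
  rewrite -subr_ge0.
  have -> : (q + 2) ^+ 2 / m + m * (x / 2) ^+ 2 - (q + 2) * x = m * (x / 2 - (q + 2) / m) ^+ 2.
    by field; rewrite gt_eqF.
  by rewrite mulr_ge0 ?sqr_ge0// ltW.
have -> : (q + 1) * x = (q + 2) * x - x by ring.
lra.
Qed.

Lemma L1_expR_expR (m q : R) : 0 < m -> -1 < q ->
  L1 mu (fun x => expR (- (m * expR x)) * expR ((q + 1) * x)).
Proof.
move=> m0 q1; pose d := Num.min 1 (q + 1).
have d0 : 0 < d by rewrite lt_min ltr01/=; lra.
have mE : measurable_fun setT (fun x : R => expR (- (m * expR x)) * expR ((q + 1) * x)).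
  apply: measurable_funM; last by apply: measurableT_comp => //; exact: measurable_funM.
  apply: measurableT_comp => //; apply: measurableT_comp => //.
  by apply: measurable_funM => //; exact: measurable_expR.
have q2 : 0 <= q + 2 by lra.
apply: (@L1_le _ _ _ mu _ _ mE (L1_Z (expR ((q + 2) ^+ 2 / m)) (L1_expRN d0))) => x.
rewrite ger0_norm ?mulr_ge0 ?expR_ge0//.
have [x0|x0] := leP 0 x.
  rewrite (le_trans (expR_expR_le m0 x0 q2))// ler_wpM2l ?expR_ge0// ler_expR lerN2 ger0_norm//.
  by rewrite ler_piMl// ge_min lexx.
rewrite ltr0_norm//; apply: ler_pM; rewrite ?expR_ge0// ler_expR.
  apply: (@le_trans _ _ 0); first by rewrite oppr_le0 mulr_ge0 ?expR_ge0// ltW.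
  by rewrite divr_ge0 ?sqr_ge0// ltW.
have : d <= q + 1 by rewrite ge_min lexx orbT.
by move=> hd; have := ler_wnM2r (ltW x0) hd; lra.
Qed.

Lemma normcN (z : R[i]) : normc (- z) = normc z.
Proof. by case: z => a b /=; rewrite !sqrrN. Qed.

Lemma cvgNy_expR : expR x @[x --> -oo] --> (0 : R).
Proof. by apply/cvgNy_compNP; exact: (@cvgr_expR R). Qed.

Section powbd.
Variable th : R.
Hypothesis hth : pi / 2 < th < pi.

(** Growth at most [C |w|^p] along the ray. With [p > -1] the factor [dw] compensates the
    singularity at [w = 0], and [e^{t w}] takes care of infinity. *)
Definition powbd (p C : R) (G : R -> R[i]) := cmeas G /\ forall x, normc (G x) <= C * expR (p * x).

Definition TTi (G : R -> R[i]) (t x : R) : R := complex.Im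
    (cexp (t * (expR x * cos th)) (t * (expR x * sin th)) * (cexp x th * G x)).

Lemma TTi_le p C G t x : powbd p C G ->
  `|TTi G t x| <= C * (expR (- (- (t * cos th) * expR x)) * expR ((p + 1) * x)).
Proof.
move=> [mG hG]; rewrite (le_trans (normr_Im_le _))// !Normc.normcM !normc_cexp.
have -> : - (- (t * cos th) * expR x) = t * (expR x * cos th) by ring.
rewrite [leRHS]mulrCA ler_wpM2l ?expR_ge0//.
have -> : (p + 1) * x = x + p * x by ring.
by rewrite expRD [leRHS]mulrCA ler_wpM2l ?expR_ge0.
Qed.

Lemma measurable_TTi G t : cmeas G -> measurable_fun setT (TTi G t).
Proof.
move=> mG.
exact: (proj2 (cmeas_TT_integrand th mG (@measurable_id _ R setT) (measurable_cst t))).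
Qed.

Lemma L1_TTi p C G t : -1 < p -> powbd p C G -> 0 < t -> L1 mu (TTi G t).
Proof.
move=> p1 hG t0; have c0 := Ncos_gt0 hth.
have m0 : 0 < - (t * cos th) by rewrite -mulrN mulr_gt0.
exact: (@L1_le _ _ _ mu _ _ (measurable_TTi t hG.1) (L1_Z C (L1_expR_expR m0 p1)) (fun x => TTi_le t x hG)).
Qed.

Lemma TT_lin p C G q C' H (a b t : R) : -1 < p -> -1 < q -> powbd p C G -> powbd q C' H -> 0 < t ->
  TT th (fun x => a%:C * G x + b%:C * H x) t = a * TT th G t + b * TT th H t.
Proof.
move=> p1 q1 hG hH t0; rewrite /TT.
have -> : (fun x => complex.Im (cexp (t * (expR x * cos th)) (t * (expR x * sin th)) *
      (cexp x th * (a%:C * G x + b%:C * H x)))) = fun x => a * TTi G t x + b * TTi H t x.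
  apply/funext => x; rewrite /TTi -[a * _]subr0 -[b * _]subr0.
  have reZ (r : R) (z : R[i]) : r * complex.Im z = complex.Im (r%:C * z).
    by rewrite cImM /= mul0r addr0.
  by rewrite !subr0 !reZ -cImD; congr complex.Im; ring.
have i1 := L1_TTi p1 hG t0; have i2 := L1_TTi q1 hH t0.
by rewrite (RI_D (L1_Z a i1) (L1_Z b i2)) !RI_Z// /TTi; ring.
Qed.

Lemma TT_scale p C G t : -1 < p -> powbd p C G -> 0 < t ->
  TT th G t = t^-1 * TT th (fun x => G (x - ln t)) 1.
Proof.
move=> p1 hG t0; rewrite /TT.
have i1 := L1_TTi p1 hG t0.
have := RI_affine (- ln t) (oner_neq0 R) i1; rewrite normr1 invr1 mul1r /TTi => <-.
rewrite mulrCA; congr (_ * _); rewrite -RI_Z; last first.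
  apply: (L1_TTi (p := p) (C := C * expR (- (p * ln t)))) => //; split.
    have mc : measurable_fun setT (fun x : R => x - ln t) by apply: measurable_funB => //.
    by split; [exact: (measurableT_comp hG.1.1 mc)|exact: (measurableT_comp hG.1.2 mc)].
  move=> x; rewrite (le_trans (hG.2 _))// -mulrA -expRD.
  by have -> : p * (x - ln t) = - (p * ln t) + p * x by ring.
apply: eq_RI => x; rewrite !mul1r.
have -> : expR (x - ln t) = t^-1 * expR x by rewrite expRD expRN lnK ?posrE// mulrC.
have tK (u : R) : t * (t^-1 * expR x * u) = expR x * u by rewrite -mulrA mulVKf// gt_eqF.
rewrite !tK.
have -> : cexp (x - ln t) th = (t^-1)%:C * cexp x th.
  have -> : (t^-1)%:C = cexp (- ln t) 0 :> R[i].
    by apply: complex_eq; rewrite /= ?cos0 ?sin0 ?mulr1 ?mulr0// expRN lnK.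
  by rewrite -cexpD add0r addrC.
move: (G _) => u.
have reZ (r : R) (z : R[i]) : r * complex.Im z = complex.Im (r%:C * z).
  by rewrite cImM /= mul0r addr0.
by rewrite reZ; congr complex.Im; ring.
Qed.

Lemma TT_continuous p C G t : -1 < p -> powbd p C G -> 0 < t -> {for t, continuous (TT th G)}.
Proof.
move=> p1 hG t0; have c0 := Ncos_gt0 hth.
have m0 : 0 < - (t / 2 * cos th) by rewrite -mulrN !mulr_gt0.
have C0 : 0 <= C.
  have := hG.2 0; rewrite mulr0 expR0 mulr1; exact/le_trans/normc_ge0.
(* On this neighbourhood of [t] the integrands are dominated by the bound at [t / 2], where the
   exponential decays most slowly. *)
have h : {in `]t / 2, t + 1[%classic, continuous (fun l => RI mu (TTi G l))}.
  apply: (@continuity_under_integral R _ _ mu (TTi G) setT measurableT (t / 2) (t + 1) _ _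
     (fun x => C * (expR (- (- (t / 2 * cos th) * expR x)) * expR ((p + 1) * x)))).
  - by move=> x /=; rewrite in_itv/= => /andP[x1 _]; apply: (L1_TTi p1 hG); lra.
  - apply: aeW => x _ y _; rewrite /TTi.
    apply: (proj2 (ccontM _ (ccont_cst _ y))).
    have lin (k : R) : D1 (fun z => z * k) y k.
      by rewrite (funext (fun z => mulrC z k)); exact: D1_lin.
    exact: (cD1_ccont (cD1_cexp (lin _) (lin _))).
  - exact: L1_Z (L1_expR_expR m0 p1).
  - move=> x /=; rewrite in_itv/= => /andP[x1 _]; apply: aeW => y _.
    rewrite (le_trans (TTi_le x y hG))// ler_wpM2l// ler_wpM2r ?expR_ge0// ler_expR lerN2.
    rewrite ler_wpM2r ?expR_ge0// -!mulrN ler_wpM2r ?(ltW c0)// ltW//.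
have tI : t \in `]t / 2, t + 1[%classic.
  by rewrite inE/= in_itv/=; apply/andP; split; lra.
have ct := h t tI.
rewrite /TT; apply: cvgM; first exact: cvg_cst.
exact: ct.
Qed.

Lemma powbd_cexp p : powbd p 1 (fun x => cexp (p * x) (p * th)).
Proof.
split; last by move=> x; rewrite normc_cexp mul1r.
by apply: cmeas_cexp; [exact: measurable_funM|exact: measurable_cst].
Qed.

(** Hankel's integral for [1 / Gamma (- q)], as [Gamma_gT] confirms. It exists also for natural [q],
    where [Gamma] has a pole. *)
Definition gT (q : R) := TT th (fun x => cexp (q * x) (q * th)) 1.

Lemma TT_cexp q t : -1 < q -> 0 < t ->
  TT th (fun x => cexp (q * x) (q * th)) t = t `^ (- q - 1) * gT q.
Proof.
move=> q1 t0; rewrite (TT_scale q1 (powbd_cexp q) t0).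
have -> : (fun x => cexp (q * (x - ln t)) (q * th)) =
  fun x => (t `^ (- q))%:C * cexp (q * x) (q * th) + (0 : R)%:C * cexp (q * x) (q * th).
  apply/funext => x; have -> : (t `^ (- q))%:C = cexp (- q * ln t) 0 :> R[i].
    by apply: complex_eq; rewrite /= ?cos0 ?sin0 ?mulr1 ?mulr0// /powR gt_eqF.
  by rewrite mul0r addr0 -cexpD add0r mulrBr addrC mulNr.
rewrite (TT_lin _ _ q1 q1 (powbd_cexp q) (powbd_cexp q) ltr01) mul0r addr0 mulrA; congr (_ * _).
by rewrite -(powR_inv1 (ltW t0)) -powRD ?(gt_eqF t0) ?implybT//; congr (_ `^ _); ring.
Qed.

(** Integrate the derivative of [e^w w^q] along the ray. At [q = 0] this already yields [gT 0 = 0],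
    and then [gT 1 = 0]: the zeros of [1 / Gamma] at 0 and -1, on which the Riemann-Liouville cases
    depend. *)
Lemma gT_rec q : 0 <= q -> gT q = - q * gT (q - 1).
Proof.
move=> q0; have c0 := Ncos_gt0 hth.
have q1 : -1 < q by lra.
pose F x := cexp (expR x * cos th) (expR x * sin th) * cexp (q * x) (q * th).
pose E q x := TTi (fun x => cexp (q * x) (q * th)) 1 x.
have Ei : L1 mu (E q) by exact: (L1_TTi q1 (powbd_cexp q) ltr01).
have mE q' : measurable_fun setT (E q') by apply: measurable_TTi; exact: (powbd_cexp q').1.
(* For [q = 0] the exponent [q - 1] is -1, outside the range of [L1_TTi], but the factor [q] kills
   the term. *)
have Ei' : L1 mu (fun x => q * E (q - 1) x).
  move: q0; rewrite le_eqVlt => /predU1P[<-|q0].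
    by rewrite (_ : (fun x => _) = fun=> 0); [exact: L1_0|apply/funext => x; rewrite mul0r].
  by apply: L1_Z; apply: (L1_TTi _ (powbd_cexp (q - 1)) ltr01); lra.
have dF x : D1 (fun x => complex.Im (F x)) x (E q x + q * E (q - 1) x).
  have d1 : cD1 (fun x => cexp (expR x * cos th) (expR x * sin th)) x
     ((expR x * cos th +i* (expR x * sin th)) * cexp (expR x * cos th) (expR x * sin th)).
    have e : D1 (fun y => expR y) x (expR x).
      by apply: D1_eq (D1_expR (D1_id x)) _; rewrite mulr1.
    apply: cD1_cexp; [have := D1_Z (cos th) e|have := D1_Z (sin th) e] => h;
      by rewrite (funext (fun z => mulrC (expR z) _)) mulrC.
  have d2 : cD1 (fun x => cexp (q * x) (q * th)) x ((q +i* 0) * cexp (q * x) (q * th)).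
    exact: cD1_cexp (D1_lin q x) (D1_cst _ x).
  apply: D1_eq (proj2 (cD1_M d1 d2)) _.
  rewrite /E /TTi !mul1r.
  have reZ (r : R) (z : R[i]) : r * complex.Im z = complex.Im (r%:C * z).
    by rewrite cImM /= mul0r addr0.
  rewrite reZ -cImD; congr complex.Im.
  have -> : cexp x th * cexp ((q - 1) * x) ((q - 1) * th) = cexp (q * x) (q * th) :> R[i].
    by rewrite -cexpD; congr cexp; ring.
  by rewrite -/(cexp x th) -[q +i* 0]/(q%:C); ring.
have cE q' x : {for x, continuous (E q')}.
  rewrite /E /TTi.
  have e : D1 (fun y => expR y) x (expR x).
    by apply: D1_eq (D1_expR (D1_id x)) _; rewrite mulr1.
  apply: (proj2 (ccontM _ _)); last first.
    apply: ccontM; first exact: (cD1_ccont (cD1_cexp (D1_id x) (D1_cst th x))).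
    exact: (cD1_ccont (cD1_cexp (D1_lin q' x) (D1_cst _ x))).
  apply: cD1_ccont; apply: cD1_cexp; apply: D1_Z;
    by rewrite (funext (fun z => mulrC (expR z) _)); apply: D1_Z e.
have cf x : {for x, continuous (fun x => E q x + q * E (q - 1) x)}.
  by apply: cvgD; [exact: cE|apply: cvgM; [exact: cvg_cst|exact: cE]].
have Fb x : `|complex.Im (F x)| <= expR (- (- cos th * expR x)) * expR (q * x).
  rewrite (le_trans (normr_Im_le _))// Normc.normcM !normc_cexp.
  by have -> : - (- cos th * expR x) = expR x * cos th by ring.
have cy : complex.Im (F x) @[x --> +oo] --> (0 : R).
  apply/norm_cvg0P.
  apply: (@squeeze_cvgr _ _ _ _ (fun=> 0) (fun x => expR ((q + 1) ^+ 2 / - cos th) * expR (- x))).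
  - near=> x; rewrite normr_ge0/= (le_trans (Fb x))//.
    have x0 : 0 <= x by near: x; exact: nbhs_pinfty_ge.
    have := @expR_expR_le (- cos th) (q - 1) x c0 x0.
    have -> : q - 1 + 1 = q by ring.
    have -> : q - 1 + 2 = q + 1 by ring.
    by apply; lra.
  - exact: cvg_cst.
  rewrite -[X in _ --> X](mulr0 (expR ((q + 1) ^+ 2 / - cos th))); apply: cvgM; first exact: cvg_cst.
  exact: cvgr_expR.
have cNy : complex.Im (F x) @[x --> -oo] --> (0 : R).
  (* At the end [w -> 0] of the ray, [e^w w^q] tends to 0 if [q > 0]. If [q = 0] it tends to 1, and
     only its imaginary part tends to 0. *)
  move: q0; rewrite le_eqVlt => /predU1P[q00|q0].
    have -> : (fun x => complex.Im (F x)) = (fun y => expR (y * cos th) * sin (y * sin th)) \o expR.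
      by apply/funext => x; rewrite /F -q00 !mul0r cexp0 mulr1.
    apply: (cvg_comp _ _ cvgNy_expR).
    have cl (k : R) : {for 0, continuous (fun y : R => y * k)}.
      by rewrite (funext (fun z => mulrC z k)); exact: D1_continuous (D1_lin k 0).
    have c1 : {for 0, continuous (fun y : R => expR (y * cos th))}.
      exact: (continuous_comp (cl (cos th)) (@continuous_expR R _)).
    have c2 : {for 0, continuous (fun y : R => sin (y * sin th))}.
      exact: (continuous_comp (cl (sin th)) (@continuous_sin R _)).
    have := cvgM c1 c2; rewrite mul0r (mul0r (sin th)) sin0 mulr0; exact.
  apply/norm_cvg0P.
  apply: (@squeeze_cvgr _ _ _ _ (fun=> 0) (fun x => expR (q * x))).
  - near=> x; rewrite normr_ge0/= (le_trans (Fb x))// ler_piMl ?expR_ge0// expR_le1.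
    by rewrite oppr_le0 mulr_ge0 ?expR_ge0// ltW.
  - exact: cvg_cst.
  apply: (cvg_comp _ _ _ cvgNy_expR).
  apply/cvgrNyPle => A; near=> x; rewrite -ler_pdivlMl//; near: x; exact: nbhs_ninfty_le.
have := RI_FTCT dF cf (L1_D Ei Ei') cy cNy.
rewrite subrr (RI_D Ei Ei') RI_Zm; last exact: mE.
have gE q' : gT q' = pi^-1 * RI mu (E q') by [].
rewrite !gE => /eqP; rewrite addr_eq0 => /eqP ->; ring.
Unshelve. all: by end_near. Qed.

Let th_pi : 0 < th. Proof. by have := pi_gt0 R; case/andP: hth => *; lra. Qed.

(** For [al = 0] and [l = 1] the symbol is [w^q / 2], with inverse transform [t^{-q-1} gT q / 2].
    The integral in [laplace_Gs] at [s = 1] is then Euler's integral times [gT q / 2], and its value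
    is [1 / 2]. *)
Lemma gammaint_gT q : -1 < q < 0 ->
  RI mu (fun s => \1_`]0, +oo[ s * (s `^ (- q - 1) * expR (- s))) * gT q = 1.
Proof.
move=> hq; have q1 : -1 < q by case/andP: hq.
have [|i1 e1] := @laplace_Gs R th q 0 hth (lexx 0) _ hq 1 1 ltr01 ltr01.
  by rewrite mul0r pi_gt0.
rewrite !powR1 in e1.
have hT t : 0 < t -> TT th (Gs q 0 1 ^~ th) t = 2^-1 * (t `^ (- q - 1) * gT q).
  move=> t0; rewrite -TT_cexp//.
  have -> : Gs q 0 1 ^~ th = fun x => (2^-1)%:C * cexp (q * x) (q * th) + (0 : R)%:C * cexp (q * x) (q * th).
    apply/funext => x; rewrite /Gs !mul0r cexp0 addr0 mulrC.
    by rewrite -[1]/((1 : R)%:C) -rmorphD fmorphV.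
  by rewrite (TT_lin _ _ q1 q1 (powbd_cexp q) (powbd_cexp q) t0) mul0r addr0.
have mpow : measurable_fun setT (fun s : R => \1_`]0, +oo[ s * (s `^ (- q - 1) * expR (- s)) : R).
  apply: measurable_funM; first exact: measurable_indic.
  apply: measurable_funM; first exact: measurable_powR.
  by apply: measurableT_comp => //; exact: measurableT_comp.
have := e1; rewrite (@ae_eq_RI _ _ _ mu _ (fun t => 2^-1 * gT q * (\1_`]0, +oo[ t * (t `^ (- q - 1) * expR (- t))))).
- rewrite RI_Zm// => h.
  by have := pi_gt0 R => _; rewrite mulrC; apply: (@mulfI _ 2^-1); rewrite ?invr_eq0 ?pnatr_eq0// mulr1 mulrA h div1r; congr (_^-1).
- exists [set 0]; split => //; first exact: lebesgue_measure_set1.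
  move=> t /= h; apply: contrapT => /eqP t0; apply: h.
  have [t1|t1] := ltP 0 t.
    rewrite !indicE !mem_set ?mul1r/=; try by rewrite in_itv/= ?(ltW t1) ?t1.
    by rewrite hT//; ring.
  have t2 : t < 0 by rewrite lt_neqAle t0.
  rewrite !indicE !memNset ?mul0r ?mulr0//= in_itv/= andbT; apply/negP; rewrite -?leNgt -?ltNge//.
- exact: L1_measurable i1.
- exact: measurable_funM.
Qed.

(** Each use of [gT_rec] yields one factor of the product by which [Gamma] continues Euler's
    integral. *)
Lemma gammaint_prod (m : nat) q : 0 < - q + m%:R < 1 ->
  RI mu (fun s => \1_`]0, +oo[ s * (s `^ (- q + m%:R - 1) * expR (- s))) * gT q =
  \prod_(i < m) (- q + i%:R).
Proof.
elim: m q => [|m IH] q hq.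
  rewrite big_ord0 addr0 gammaint_gT//; move: hq; rewrite addr0 => /andP[*]; apply/andP; split; lra.
have q0 : 0 <= q.
  have : 0 <= m%:R :> R by []; move: hq; rewrite -natr1 => /andP[h1 h2] h3; lra.
rewrite gT_rec// big_ord_recl addr0 mulrCA; congr (_ * _).
rewrite (eq_bigr (fun i : 'I_m => - (q - 1) + i%:R)); last first.
  by move=> i _; rewrite /= /bump leq0n add1n -natr1; ring.
rewrite -IH; last by move: hq; rewrite -natr1 => /andP[*]; apply/andP; split; lra.
have -> : - q + m.+1%:R - 1 = - (q - 1) + m%:R - 1 by rewrite -natr1; ring.
by [].
Qed.

Lemma Gamma_gT q : -1 < q -> (forall m : nat, q != m%:R) -> Gamma (- q) * gT q = 1.
Proof.
move=> q1 hq; rewrite /Gamma.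
set m := (if _ then _ else _).
(* [- q] is at most 0 or lies in []0, 1[]; the shift by [m] brings it into []0, 1[], the left end
   being excluded because [q] is not a natural number. *)
have hm : 0 < - q + m%:R < 1.
  rewrite /m; have [q0|q0] := ltP 0 (- q); first by rewrite addr0 q0/=; lra.
  have f0 : Num.floor (- q) <= 0 by rewrite floor_le0//; lra.
  have fE : (`|Num.floor (- q)|%N)%:R = - (Num.floor (- q))%:~R :> R.
    by rewrite natr_absz ler0_norm// mulrNz.
  rewrite fE; have := Num.Theory.floor_le (- q); have := floorD1_gt (- q); rewrite intrD1 => h1 h2.
  apply/andP; split; last lra.
  rewrite lt_neqAle; apply/andP; split; last lra.
  apply/eqP => h; have := hq `|Num.floor (- q)|%N; rewrite fE => /eqP; apply; lra.
rewrite RI_indic mulrAC (gammaint_prod hm) divff//; apply/prodf_neq0 => i _.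
rewrite addrC subr_eq0; apply/eqP => e; have := hq i; by rewrite e eqxx.
Qed.

Section Gs_asymptotics.
Variable al : R.
Hypotheses (al0 : 0 <= al) (halth : al * th < pi).

Let c := cos (al * th / 2).

Let c0 : 0 < c.
Proof. by apply: cos_half_gt0; rewrite halth andbT mulr_ge0// ltW. Qed.

Let hth0 : 0 <= th <= th. Proof. by rewrite lexx (ltW th_pi). Qed.

Lemma powbd_Gs p l : 0 < l -> powbd p (c^-1 / l) (Gs p al l ^~ th).
Proof.
move=> l0; split; first exact: cmeas_Gs.
move=> x; apply: (le_trans (@Gs_le R th p al hth al0 halth l x th l0 hth0)).
rewrite -/c -mulrA ler_wpM2l ?invr_ge0 ?(ltW c0)// mulrC ler_wpM2r ?expR_ge0//.
by rewrite lef_pV2 ?posrE// ?addr_gt0 ?expR_gt0// lerDl expR_ge0.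
Qed.

(** Self-similar profile: up to a power of [t] and a factor [lam], the inverse transform of
    [w^p / (w^al + lam)] depends on [lam] and [t] only through [lam t^al]. This is [TT_Gs]. *)
Definition mT (p l : R) := l * TT th (Gs p al l ^~ th) 1.

Lemma TT_Gs p lam t : -1 < p -> 0 < lam -> 0 < t ->
  t `^ (p + 1) * lam * TT th (Gs p al lam ^~ th) t = mT p (lam * t `^ al).
Proof.
move=> p1 lam0 t0; rewrite (TT_scale p1 (powbd_Gs p lam0) t0) /mT.
have l0 : 0 < lam * t `^ al by rewrite mulr_gt0// powR_gt0.
pose k := t `^ (- p) * t `^ al.
have tE q : (t `^ q)%:C = cexp (q * ln t) 0 :> R[i].
  by apply: complex_eq; rewrite /= ?cos0 ?sin0 ?mulr1 ?mulr0// /powR gt_eqF.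
have -> : (fun x => Gs p al lam (x - ln t) th) = fun x =>
    k%:C * Gs p al (lam * t `^ al) x th + (0 : R)%:C * Gs p al (lam * t `^ al) x th.
  apply/funext => x; rewrite mul0r addr0 /Gs.
  have cD q : cexp (q * (x - ln t)) (q * th) = (t `^ (- q))%:C * cexp (q * x) (q * th).
    by rewrite tE -cexpD add0r; congr cexp; ring.
  have n2 := Gs_den_neq0 hth al0 halth x l0 hth0.
  have ta : (t `^ (- al))%:C != 0 :> R[i] by rewrite (inj_eq (@complexI R)) gt_eqF ?powR_gt0.
  rewrite !cD /k; have -> : lam%:C = (t `^ (- al))%:C * (lam * t `^ al)%:C.
    by rewrite -rmorphM mulrCA -powRD ?(gt_eqF t0) ?implybT// addNr powRr0 mulr1.
  have -> : (t `^ (- p) * t `^ al)%:C = (t `^ (- p))%:C / (t `^ (- al))%:C :> R[i].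
    by rewrite rmorphM/= -fmorphV/= -powRN opprK.
  rewrite -mulrDr; move: n2 ta; move: (cexp (al * x) _ + _) (t `^ (- al))%:C => A B A0 B0.
  by field; rewrite A0 B0.
have pb := powbd_Gs p l0.
rewrite (TT_lin _ _ p1 p1 pb pb ltr01) mul0r addr0; move: (TT th _ 1) => T; rewrite !mulrA; congr (_ * _).
have -> : t `^ (p + 1) * lam * t^-1 * t `^ (- p) * t `^ al = lam * t `^ al * (t `^ (p + 1) * t^-1 * t `^ (- p)) by ring.
rewrite -(powR_inv1 (ltW t0)) -!powRD ?(gt_eqF t0) ?implybT//.
have -> : p + 1 + -1 + - p = 0 by ring.
by rewrite powRr0 mulr1.
Qed.

(** The factor [l] is absorbed by [|w^al + l| >= c l]. The bound no longer depends on [l], which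
    gives at once the boundedness of [mT] and the domination for its limit. *)
Let Gsl p l x : 0 < l -> normc (l%:C * Gs p al l x th) <= c^-1 * expR (p * x).
Proof.
move=> l0; rewrite Normc.normcM normc_real gtr0_norm//.
have ln0 : l != 0 by rewrite gt_eqF.
rewrite -[leRHS](mulVKf ln0) ler_wpM2l ?(ltW l0)//.
by rewrite mulrA (mulrC l^-1); exact: (powbd_Gs p l0).2.
Qed.

Let powbd_Gsl p l : 0 < l -> powbd p c^-1 (fun x => l%:C * Gs p al l x th).
Proof.
move=> l0; split; last by move=> x; exact: Gsl.
by apply: cmeasM; [exact: cmeas_cst|exact: cmeas_Gs].
Qed.

Let mTE p l : -1 < p -> 0 < l -> mT p l = pi^-1 * RI mu (TTi (fun x => l%:C * Gs p al l x th) 1).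
Proof.
move=> p1 l0; have pb := powbd_Gs p l0.
have := TT_lin l 0 p1 p1 pb pb ltr01; rewrite mul0r addr0 /mT => <-.
by rewrite /TT; congr (_ * _); apply: eq_RI => x; rewrite mul0r addr0.
Qed.

Lemma mT_bounded p : -1 < p -> exists B, forall l, 0 < l -> `|mT p l| <= B.
Proof.
move=> p1; have m0 := Ncos_gt0 hth.
pose h x := c^-1 * (expR (- (- (1 * cos th) * expR x)) * expR ((p + 1) * x)).
have hi : L1 mu h by apply: L1_Z; apply: L1_expR_expR => //; rewrite mul1r.
exists (pi^-1 * RI mu h) => l l0; rewrite mTE// normrM gtr0_norm ?invr_gt0 ?pi_gt0//.
rewrite ler_wpM2l ?invr_ge0 ?pi_ge0//.
apply: RI_normr_le => //; first exact: (L1_TTi p1 (powbd_Gsl p l0) ltr01).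
by move=> x; exact: TTi_le (powbd_Gsl p l0).
Qed.

Lemma mT_cvg p (l_ : nat -> R) : -1 < p -> (forall n, 0 < l_ n) -> l_ n @[n --> \oo] --> +oo ->
  mT p (l_ n) @[n --> \oo] --> gT p.
Proof.
move=> p1 l0 ly; have m0 := Ncos_gt0 hth.
pose h x := c^-1 * (expR (- (- (1 * cos th) * expR x)) * expR ((p + 1) * x)).
have hi : L1 mu h by apply: L1_Z; apply: L1_expR_expR => //; rewrite mul1r.
rewrite (_ : (fun n => _) = fun n => pi^-1 * RI mu (TTi (fun x => (l_ n)%:C * Gs p al (l_ n) x th) 1)); last first.
  by apply/funext => n; rewrite mTE.
apply: cvgM; first exact: cvg_cst.
apply: (proj2 (RI_dct _ _ _ hi _)).
- by move=> n; apply: measurable_TTi; exact: (powbd_Gsl p (l0 n)).1.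
- by apply: measurable_TTi; exact: (powbd_cexp p).1.
- apply: aeW => x; rewrite -/(TTi (fun x => cexp (p * x) (p * th)) 1 x).
  (* [l w^p / (w^al + l) - w^p = - w^p w^al / (w^al + l)] is of order [1 / l] at fixed [x]; [K]
     collects all the factors that do not depend on [l]. *)
  pose K := expR (- (- (1 * cos th) * expR x)) * expR ((p + 1) * x) * expR (al * x) * c^-1.
  have key n : `|TTi (fun x => (l_ n)%:C * Gs p al (l_ n) x th) 1 x - TTi (fun x => cexp (p * x) (p * th)) 1 x| <=
      K / l_ n.
    have -> : TTi (fun x => (l_ n)%:C * Gs p al (l_ n) x th) 1 x - TTi (fun x => cexp (p * x) (p * th)) 1 x =
      complex.Im (cexp (1 * (expR x * cos th)) (1 * (expR x * sin th)) * (cexp x th * ((l_ n)%:C * Gs p al (l_ n) x th - cexp (p * x) (p * th)))).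
      by rewrite /TTi -cImN -cImD -!mulrN -!mulrDr.
    rewrite (le_trans (normr_Im_le _))// !Normc.normcM !normc_cexp.
    have n2 := Gs_den_neq0 hth al0 halth x (l0 n) hth0.
    have -> : (l_ n)%:C * Gs p al (l_ n) x th - cexp (p * x) (p * th) = - (cexp (p * x) (p * th) * cexp (al * x) (al * th) / (cexp (al * x) (al * th) + (l_ n)%:C)).
      by rewrite /Gs; field.
    have hd := Gs_den_ge al0 halth x (l0 n) hth0.
    rewrite normcN !Normc.normcM Normc.normcV !normc_cexp.
    have d0 : 0 < c * l_ n by rewrite mulr_gt0.
    have hi' : (normc (cexp (al * x) (al * th) + (l_ n)%:C))^-1 <= c^-1 / l_ n.
      have h1 : c * l_ n <= normc (cexp (al * x) (al * th) + (l_ n)%:C).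
        by rewrite (le_trans _ hd)// ler_wpM2l ?(ltW c0)// lerDl expR_ge0.
      by rewrite -invfM lef_pV2 ?posrE// (lt_le_trans d0).
    have -> : K / l_ n =
        expR (1 * (expR x * cos th)) * (expR x * (expR (p * x) * expR (al * x) * (c^-1 / l_ n))).
      rewrite /K; have -> : - (- (1 * cos th) * expR x) = 1 * (expR x * cos th) by ring.
      have -> : (p + 1) * x = p * x + x by ring.
      by rewrite expRD; ring.
    by do 3 (apply: ler_wpM2l; rewrite ?mulr_ge0 ?expR_ge0//).
  apply/subr_cvg0/norm_cvg0P.
  apply: (@squeeze_cvgr _ _ _ _ (fun=> 0) (fun n => K / l_ n)).
  - by apply: nearW => n; rewrite normr_ge0 key.
  - exact: cvg_cst.
  rewrite -[X in _ --> X](mulr0 K); apply: cvgM; first exact: cvg_cst.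
  by apply/gtr0_cvgV0 => //; exact: nearW.
- by apply: aeW => x n; exact: TTi_le (powbd_Gsl p (l0 n)).
Qed.

End Gs_asymptotics.

End powbd.

End inverse_power.

(** * Riemann-Liouville calculus and the Laplace transform *)

Section convolution.
Context {R : realType}.
Local Notation mu := (@lebesgue_measure R).
Implicit Types f g h : R -> R.

Definition cv f g (t : R) : R := RI mu (fun z => f z * g (t - z)).

Lemma RI_affine_m c a f : c != 0 -> measurable_fun setT f ->
  RI mu (fun x => f (c * x + a)) = `|c|^-1 * RI mu f.
Proof.
move=> c0 mf; have [fi|nfi] := pselect (L1 mu f); first exact: RI_affine.
have -> : RI mu f = 0 by exact: (@RI_nonL1 _ (measurableTypeR R) R mu f mf nfi).
rewrite mulr0; apply: RI_nonL1; first exact: (measurableT_comp mf (measurable_affine c a)).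
move=> h; apply: nfi; have ci0 : c^-1 != 0 by rewrite invr_eq0.
have := L1_affine (- (c^-1 * a)) ci0 h.
rewrite (_ : (fun x : R => _) = f)//; apply/funext => x; congr f.
by rewrite mulrDr mulrN !mulrA divff// !mul1r subrK.
Qed.

Lemma measurable_shift g t : measurable_fun setT g -> measurable_fun setT (fun z : R => g (t - z)).
Proof.
move=> mg; apply: (measurableT_comp mg); exact: measurable_funB.
Qed.

Lemma cv_L1 f g : L1 mu f -> L1 mu g -> L1 mu (cv f g) /\ RI mu (cv f g) = RI mu f * RI mu g.
Proof.
move=> fi gi; have mf := L1_measurable fi; have mg := L1_measurable gi.
pose F (p : R * R) := f p.1 * g (p.2 - p.1).
have mF : measurable_fun setT F.
  apply: measurable_funM; first exact: measurableT_comp.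
  by apply: (measurableT_comp mg); exact: measurable_funB.
have sh z : L1 mu (fun t => g (t - z)) /\ RI mu (fun t => g (t - z)) = RI mu g.
  have e : (fun t => g (t - z)) = fun t => g (1 * t + - z) by apply/funext => t; rewrite mul1r.
  by rewrite e; split; [exact: (L1_affine _ (oner_neq0 R) gi)|rewrite (RI_affine _ (oner_neq0 R) gi) normr1 invr1 mul1r].
have Fi : L1 (mu \x mu)%E F.
  apply: (@L1_prod _ _ _ _ _ mu mu F (fun z => RI mu (fun t => `|g t|) * `|f z|) mF).
    exact/L1_Z/L1_norm.
  move=> z; have [s1 _] := sh z.
  have -> : (\int[mu]_y `|F (z, y)|%:E = \int[mu]_y (`|f z| * `|g (y - z)|)%:E)%E.
    by apply: eq_integral => y _; rewrite /F normrM.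
  rewrite -(RI_EFin (L1_Z _ (L1_norm s1))) RI_Z ?lee_fin; last exact: L1_norm.
  rewrite mulrC ler_wpM2r// le_eqVlt; apply/orP; left; apply/eqP.
  have e : (fun t => `|g (t - z)|) = fun t => `|g (1 * t + - z)| by apply/funext => t; rewrite mul1r.
  by rewrite e (RI_affine (f := fun t => `|g t|) _ (oner_neq0 R) (L1_norm gi)) normr1 invr1 mul1r.
have [i2 e2] := RI_prod2 Fi; have [i1 e1] := RI_prod1 Fi.
split; first exact: i2.
rewrite [LHS]e2 -e1.
have E z : RI mu (fun y => F (z, y)) = RI mu g * f z.
  by rewrite /F /= RI_Z; [rewrite (sh z).2 mulrC|exact: (sh z).1].
rewrite (eq_RI mu E).
by rewrite RI_Z// mulrC.
Qed.

Lemma cv_expR f g s t : measurable_fun setT f -> measurable_fun setT g ->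
  cv (fun z => expR (- (s * z)) * f z) (fun z => expR (- (s * z)) * g z) t = expR (- (s * t)) * cv f g t.
Proof.
move=> mf mg; rewrite /cv -RI_Zm; last by apply: measurable_funM => //; exact: measurable_shift.
apply: eq_RI => z; have -> : expR (- (s * t)) = expR (- (s * z)) * expR (- (s * (t - z))).
  by rewrite -expRD; congr expR; ring.
by rewrite -!mulrA; congr (_ * _); rewrite mulrCA.
Qed.

Lemma powR_gtD (t u v : R) : 0 < t -> t `^ (u + v) = t `^ u * t `^ v.
Proof. by move=> t0; apply: powRD; rewrite (gt_eqF t0) implybT. Qed.

Lemma indic_pos (t : R) : 0 < t -> \1_`]0, +oo[ t = 1 :> R.
Proof. by move=> t0; rewrite indicE mem_set//= in_itv/= t0. Qed.

Lemma indic_npos (t : R) : t <= 0 -> \1_`]0, +oo[ t = 0 :> R.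
Proof. by move=> t0; rewrite indicE memNset//= in_itv/= andbT; apply/negP; rewrite -leNgt. Qed.

(** The kernel of the Riemann-Liouville integral, extended by 0 to [t <= 0] so that fractional
    integrals become convolutions on the whole line. *)
Definition kk (nu t : R) : R := \1_`]0, +oo[ t * (t `^ (nu - 1) / Gamma nu).

Lemma kk0 nu t : t <= 0 -> kk nu t = 0.
Proof. by move=> t0; rewrite /kk indic_npos// mul0r. Qed.

Lemma kkE nu t : 0 < t -> kk nu t = t `^ (nu - 1) / Gamma nu.
Proof. by move=> t0; rewrite /kk indic_pos// mul1r. Qed.

Lemma measurable_kk nu : measurable_fun setT (kk nu).
Proof.
apply: measurable_funM; first exact: measurable_indic.
by apply: measurable_funM; [exact: measurable_powR|exact: measurable_cst].
Qed.

Definition kk_laplace nu := forall s, 0 < s ->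
  L1 mu (fun t => expR (- (s * t)) * kk nu t) /\ RI mu (fun t => expR (- (s * t)) * kk nu t) = s `^ (- nu).

Lemma GammaE (nu : R) : 0 < nu -> Gamma nu = RI mu (fun s => \1_`]0, +oo[ s * (s `^ (nu - 1) * expR (- s))).
Proof. by move=> nu0; rewrite /Gamma nu0 big_ord0 divr1 addr0 RI_indic. Qed.

Lemma Gamma_ge0 (nu : R) : 0 < nu -> 0 <= Gamma nu.
Proof.
move=> nu0; rewrite GammaE//; apply: RI_ge0 => s.
by rewrite !mulr_ge0 ?powR_ge0 ?expR_ge0// indicE.
Qed.

Lemma kk_ge0 nu t : 0 < nu -> 0 <= kk nu t.
Proof. by move=> nu0; rewrite /kk mulr_ge0 ?indicE// divr_ge0 ?powR_ge0 ?Gamma_ge0. Qed.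

(** [laplace_Gs] with [al = 0] and [l = 1] again, for the symbol [w^{-nu} / 2] and now at every [s].
    The condition [-1 < p < al] on its exponent is what limits this case to [nu < 1]. *)
Lemma kk_laplace_base nu : 0 < nu < 1 -> kk_laplace nu.
Proof.
move=> hnu s s0; have pi0 := pi_gt0 R.
pose th : R := 3 / 4 * pi.
have hth : pi / 2 < th < pi by rewrite /th; apply/andP; split; lra.
have hq : -1 < - nu < 0 by case/andP: hnu => *; apply/andP; split; lra.
have q1 : -1 < - nu by case/andP: hq.
have hG : Gamma nu * gT th (- nu) = 1.
  rewrite -{1}[nu]opprK; apply: Gamma_gT => // m.
  by apply/eqP => h; have : 0 <= m%:R :> R by []; rewrite -h; case/andP: hnu => *; lra.
have gE : gT th (- nu) = (Gamma nu)^-1.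
  have G0 : Gamma nu != 0 by apply/eqP => G0; move: hG; rewrite G0 mul0r => /eqP; rewrite eq_sym oner_eq0.
  by apply: (mulfI G0); rewrite hG divff.
have [|i1 e1] := @laplace_Gs R th (- nu) 0 hth (lexx 0) _ hq 1 s ltr01 s0; first by rewrite mul0r.
have hT t : 0 < t -> TT th (Gs (- nu) 0 1 ^~ th) t = 2^-1 * (t `^ (nu - 1) / Gamma nu).
  move=> t0; rewrite -gE -{2}[nu]opprK -TT_cexp//.
  have -> : Gs (- nu) 0 1 ^~ th = fun x => (2^-1)%:C * cexp (- nu * x) (- nu * th) + (0 : R)%:C * cexp (- nu * x) (- nu * th).
    apply/funext => x; rewrite /Gs !mul0r cexp0 addr0 mulrC.
    by rewrite -[1]/((1 : R)%:C) -rmorphD fmorphV.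
  by rewrite (TT_lin hth _ _ q1 q1 (powbd_cexp th _) (powbd_cexp th _) t0) mul0r addr0.
have mE : measurable_fun setT (fun t : R => 2^-1 * (expR (- (s * t)) * kk nu t)).
  apply: measurable_funM => //; apply: measurable_funM; last exact: measurable_kk.
  by apply: measurableT_comp => //; apply: measurableT_comp => //; exact: measurable_funM.
have ae : {ae mu, forall t, \1_`[0, +oo[ t * (expR (- (s * t)) * TT th (Gs (- nu) 0 1 ^~ th) t) = 2^-1 * (expR (- (s * t)) * kk nu t)}.
  exists [set 0]; split => //; first exact: lebesgue_measure_set1.
  move=> t /= h; apply: contrapT => /eqP t0; apply: h.
  have [t1|t1] := ltP 0 t.
    rewrite kkE// !indicE !mem_set ?mul1r/=; try by rewrite in_itv/= ?(ltW t1) ?t1.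
    by rewrite hT//; ring.
  have t2 : t < 0 by rewrite lt_neqAle t0.
  by rewrite kk0// !indicE !memNset ?mul0r ?mulr0//= in_itv/= andbT; apply/negP; rewrite -ltNge.
have i2 := ae_eq_L1 ae mE i1.
have e2 := ae_eq_RI ae (L1_measurable i1) mE.
have i3 : L1 mu (fun t => expR (- (s * t)) * kk nu t).
  have := L1_Z 2 i2; rewrite (_ : (fun x => _) = (fun t => expR (- (s * t)) * kk nu t))//.
  by apply/funext => t; rewrite mulrA divff ?mul1r// pnatr_eq0.
split=> //; move: e1; rewrite e2 RI_Z// powRr0 => h.
have -> : s `^ (- nu) = 2 * (s `^ (- nu) / (1 + 1)) by field.
by rewrite -h mulrA divff ?mul1r// pnatr_eq0.
Qed.

Lemma cv_kk_scale a b t : 0 < t -> cv (kk a) (kk b) t = t `^ (a + b - 1) * cv (kk a) (kk b) 1.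
Proof.
move=> t0; rewrite /cv.
have mF u : measurable_fun setT (fun z : R => kk a z * kk b (u - z)).
  by apply: measurable_funM; [exact: measurable_kk|apply: measurable_shift; exact: measurable_kk].
have tn : t != 0 by rewrite gt_eqF.
have kt nu y : kk nu (t * y) = t `^ (nu - 1) * kk nu y.
  have [y0|y0] := ltP 0 y; last by rewrite !kk0 ?mulr0// pmulr_rle0.
  by rewrite !kkE ?mulr_gt0// powRM ?(ltW t0) ?(ltW y0)// mulrA.
have h := @RI_affine_m t 0 (fun z => kk a z * kk b (t - z)) tn (mF t).
have e : (fun x => kk a (t * x + 0) * kk b (t - (t * x + 0))) =
    fun x => t `^ (a - 1) * t `^ (b - 1) * (kk a x * kk b (1 - x)).
  apply/funext => z; rewrite addr0; have -> : t - t * z = t * (1 - z) by ring.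
  by rewrite !kt; ring.
rewrite e (RI_Zm mu _ (mF 1)) (gtr0_norm t0) in h.
have -> : a + b - 1 = 1 + ((a - 1) + (b - 1)) by ring.
by rewrite (powR_gtD _ _ t0) (powR_gtD _ _ t0) (powRr1 (ltW t0)) -mulrA h (mulVKf tn).
Qed.

Lemma cv_kk_le0 a b t : t <= 0 -> (fun z => kk a z * kk b (t - z)) = fun=> 0.
Proof.
move=> t0; apply/funext => z; have [z0|z0] := leP z 0; first by rewrite kk0 ?mul0r.
by rewrite (@kk0 b) ?mulr0//; lra.
Qed.

(** The beta integral without evaluating it: the convolution is homogeneous, hence equal to
    [c t^{a + b - 1}], and its Laplace transform at [s = 1], a product of two values 1, shows that
    [c Gamma (a + b) = 1]. *)
Lemma kk_laplaceD a b : 0 < a -> 0 < b -> kk_laplace a -> kk_laplace b ->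
  kk_laplace (a + b) /\ forall t, L1 mu (fun z => kk a z * kk b (t - z)) /\ cv (kk a) (kk b) t = kk (a + b) t.
Proof.
move=> a0 b0 La Lb; have ab0 : 0 < a + b by rewrite addr_gt0.
have key s : 0 < s -> L1 mu (fun t => expR (- (s * t)) * cv (kk a) (kk b) t) /\
    RI mu (fun t => expR (- (s * t)) * cv (kk a) (kk b) t) = s `^ (- (a + b)).
  move=> s0; have [ia ea] := La s s0; have [ib eb] := Lb s s0.
  have [ic ec] := cv_L1 ia ib.
  have E : cv (fun t => expR (- (s * t)) * kk a t) (fun t => expR (- (s * t)) * kk b t) =
     fun t => expR (- (s * t)) * cv (kk a) (kk b) t.
    by apply/funext => t; apply: cv_expR; exact: measurable_kk.
  rewrite -E ec ea eb; split=> //.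
  by rewrite opprD powR_gtD.
pose c := cv (kk a) (kk b) 1.
have cE t : cv (kk a) (kk b) t = c * (\1_`]0, +oo[ t * t `^ (a + b - 1)).
  have [t0|t0] := ltP 0 t.
    by rewrite cv_kk_scale// indic_pos// mul1r mulrC.
  by rewrite /cv cv_kk_le0// RI_0 indic_npos// mul0r mulr0.
have mG : measurable_fun setT (fun s : R => \1_`]0, +oo[ s * (s `^ (a + b - 1) * expR (- s)) : R).
  apply: measurable_funM; first exact: measurable_indic.
  apply: measurable_funM; first exact: measurable_powR.
  by apply: measurableT_comp => //; exact: measurableT_comp.
have cG : c * Gamma (a + b) = 1.
  have [_] := key 1 ltr01; rewrite powR1 => <-; rewrite GammaE// -RI_Zm//.
  by apply: eq_RI => t; rewrite cE mul1r; ring.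
have c0 : c != 0 by apply/eqP => c0; move: cG; rewrite c0 mul0r => /eqP; rewrite eq_sym oner_eq0.
have G0 : Gamma (a + b) != 0 by apply/eqP => G0; move: cG; rewrite G0 mulr0 => /eqP; rewrite eq_sym oner_eq0.
have ckk t : cv (kk a) (kk b) t = kk (a + b) t.
  rewrite cE /kk; have -> : c = (Gamma (a + b))^-1 by apply: (mulIf G0); rewrite cG mulVf.
  by ring.
split=> [s s0|t]; first by have := key s s0; rewrite (funext ckk).
split=> //; have [t0|t0] := ltP 0 t; last by rewrite cv_kk_le0//; exact: L1_0.
(* Integrability at every [t > 0] comes from the value: otherwise [RI] would be 0 by [RI_nonL1],
   whereas [kk (a + b) t] is not 0. *)
apply: contrapT => h; have := ckk t; rewrite /cv RI_nonL1//.
  move/esym/eqP; rewrite kkE// mulf_eq0 invr_eq0 (negbTE G0) orbF.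
  by rewrite gt_eqF// powR_gt0.
by apply: measurable_funM; [exact: measurable_kk|apply: measurable_shift; exact: measurable_kk].
Qed.

(** By repeated halving, every [nu] reduces to the base case [0 < nu < 1]. *)
Lemma laplace_kk nu : 0 < nu -> kk_laplace nu.
Proof.
suff H (k : nat) : forall nu, 0 < nu < 2 ^+ k -> kk_laplace nu.
  move=> nu0; apply: (H (Num.bound nu)); rewrite nu0/=.
  rewrite (lt_le_trans (archi_boundP (ltW nu0)))// -natrX ler_nat ltnW// ltn_expl//.
elim: k => [|k IH] {}nu hnu; first by apply: kk_laplace_base; rewrite expr0 in hnu.
have h2 : 0 < nu / 2 < 2 ^+ k by move: hnu; rewrite exprS => /andP[*]; apply/andP; split; lra.
have [nu0 _] := andP h2.
have -> : nu = nu / 2 + nu / 2 by field.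
exact: (kk_laplaceD nu0 nu0 (IH _ h2) (IH _ h2)).1.
Qed.

Lemma cv_kk a b t : 0 < a -> 0 < b ->
  L1 mu (fun z => kk a z * kk b (t - z)) /\ cv (kk a) (kk b) t = kk (a + b) t.
Proof. by move=> a0 b0; have [_] := kk_laplaceD a0 b0 (laplace_kk a0) (laplace_kk b0); exact. Qed.

Lemma kk1 t : 0 < t -> kk 1 t = 1.
Proof.
move=> t0; rewrite kkE// subrr powRr0 GammaE//.
rewrite (_ : RI _ _ = 1) ?divr1//.
have [i e] := RI_exp (@ltr01 R); move: e; rewrite invr1 => <-.
apply: ae_eq_RI; [|by apply: measurable_funM; [exact: measurable_indic|apply: measurable_funM; [exact: measurable_powR|by apply: measurableT_comp => //; exact: measurableT_comp]]|exact: L1_measurable i].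
exists [set 0]; split => //; first exact: lebesgue_measure_set1.
move=> s /= h; apply: contrapT => /eqP s0; apply: h.
rewrite subrr powRr0 !mul1r !indicE; congr (_%:R * _).
by congr nat_of_bool; apply/idP/idP; rewrite !inE/= !in_itv/= !andbT; [exact: ltW|rewrite lt_neqAle eq_sym s0].
Qed.

End convolution.

(** * Fractional integrals, Lerch's theorem and uniqueness for Volterra equations *)

Section volterra.
Context {R : realType}.
Local Notation mu := (@lebesgue_measure R).
Local Notation D1 f x d := (is_derive (x : R) (1 : R) (f : R -> R) (d : R)).
Implicit Types f g h : R -> R.

Definition loc f := forall T : R, L1 mu (fun z => \1_`]0, T[ z * f z).

(** The Riemann-Liouville integral as a convolution with [kk nu]; [RL_integralE] identifies the two
    for [nu > 0] and locally integrable [f]. *)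
Definition J nu f := cv (fun z => \1_`]0, +oo[ z * f z) (kk nu).

Lemma indic_oo (T z : R) : 0 < z < T -> \1_`]0, T[ z = 1 :> R.
Proof. by move=> h; rewrite indicE mem_set//= in_itv/= h. Qed.

Lemma indic_oo0 (T z : R) : ~~ (0 < z < T) -> \1_`]0, T[ z = 0 :> R.
Proof. by move=> h; rewrite indicE memNset//= in_itv/=; exact/negP. Qed.

Lemma indic_ooM (T z : R) : \1_`]0, T[ z = \1_`]0, +oo[ z * kk 1 (T - z) :> R.
Proof.
have [z0|z0] := ltP 0 z; last by rewrite indic_npos// mul0r indic_oo0// negb_and -leNgt z0.
rewrite indic_pos// mul1r; have [zT|zT] := ltP z T.
  by rewrite indic_oo ?z0// kk1// subr_gt0.
by rewrite kk0 ?subr_le0// indic_oo0// negb_and -!leNgt zT orbT.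
Qed.

Lemma measurable_ioo (T : R) : measurable_fun setT (\1_`]0, T[ : R -> R).
Proof. exact: measurable_indic. Qed.

Lemma measurable_ipos : measurable_fun setT (\1_`]0, +oo[ : R -> R).
Proof. exact: measurable_indic. Qed.

Lemma loc_eq f g : (forall t, 0 < t -> f t = g t) -> loc f -> loc g.
Proof.
move=> fg lf T; have := lf T; rewrite (_ : (fun z => \1_`]0, T[ z * f z) = (fun z => \1_`]0, T[ z * g z))//.
apply/funext => z; have [h|h] := boolP (0 < z < T); last by rewrite indic_oo0// !mul0r.
by rewrite fg//; case/andP: h.
Qed.

Lemma J_eq nu f g : (forall t, 0 < t -> f t = g t) -> J nu f = J nu g.
Proof.
move=> fg; rewrite /J; congr cv; apply/funext => z.
by have [h|h] := ltP 0 z; [rewrite fg|rewrite indic_npos// !mul0r].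
Qed.

Lemma measurable_loc f : loc f -> measurable_fun setT (fun z : R => \1_`]0, +oo[ z * f z).
Proof.
move=> lf; apply: (@measurable_fun_cvg _ _ R setT (fun (n : nat) (z : R) => \1_`]0, n%:R[ z * f z : R)).
  by move=> n; exact: L1_measurable (lf n%:R).
move=> z _; have [z0|z0] := ltP 0 z; last first.
  rewrite indic_npos// mul0r (_ : (fun n => _) = fun=> 0); first exact: cvg_cst.
  by apply/funext => n; rewrite indic_oo0 ?mul0r// negb_and -leNgt z0.
apply: cvg_near_cst; near=> n; rewrite indic_pos// indic_oo// z0/=.
by near: n; exact: nbhs_infty_gtr.
Unshelve. all: by end_near. Qed.

Lemma J0 nu f t : t <= 0 -> J nu f t = 0.
Proof.
move=> t0; rewrite /J /cv (_ : (fun z => _) = fun=> 0) ?RI_0//; apply/funext => z.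
by have [z0|z0] := ltP 0 z; [rewrite kk0 ?mulr0//; lra|rewrite indic_npos// !mul0r].
Qed.

Lemma Jint nu f t : 1 <= nu -> loc f -> L1 mu (fun z => \1_`]0, +oo[ z * f z * kk nu (t - z)).
Proof.
move=> nu1 lf; have nu0 : 0 < nu by lra.
pose h z := \1_`]0, t[ z * kk nu (t - z).
have mh : measurable_fun setT h.
  by apply: measurable_funM; [exact: measurable_ioo|apply: measurable_shift; exact: measurable_kk].
have hb z : `|h z| <= t `^ (nu - 1) / Gamma nu.
  rewrite /h; have [hz|hz] := boolP (0 < z < t); last first.
    by rewrite indic_oo0// mul0r normr0 divr_ge0 ?powR_ge0 ?Gamma_ge0.
  have [z0 zt] := andP hz.
  rewrite indic_oo// mul1r ger0_norm ?kk_ge0// kkE ?subr_gt0// ler_wpM2r ?invr_ge0 ?Gamma_ge0//.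
  by apply: ge0_ler_powR; rewrite ?nnegrE ?subr_ge0//; lra.
have := @L1_bM _ _ _ mu _ _ _ mh hb (lf t); rewrite (_ : (fun z => h z * _) = (fun z => \1_`]0, +oo[ z * f z * kk nu (t - z)))//.
apply/funext => z; rewrite /h; have [hz|hz] := boolP (0 < z < t).
  by rewrite indic_oo// indic_pos; [ring|case/andP: hz].
rewrite indic_oo0// !mul0r; have [z0|z0] := ltP 0 z; last by rewrite indic_npos// !mul0r.
by rewrite kk0 ?mulr0//; move: hz; rewrite z0/= -leNgt; lra.
Qed.

(** Fubini and the beta integral. The condition [1 <= a + b] makes [kk (a + b)] bounded on []0, t[],
    so that the double integral converges at every [t] and not just at almost every one. *)
Lemma J_semigroup a b f t : 0 < a -> 0 < b -> 1 <= a + b -> loc f ->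
  L1 mu (fun y => \1_`]0, +oo[ y * J b f y * kk a (t - y)) /\ J a (J b f) t = J (a + b) f t.
Proof.
move=> a0 b0 ab lf; set fp := fun z : R => \1_`]0, +oo[ z * f z.
have mfp : measurable_fun setT fp := measurable_loc lf.
pose F (p : R * R) := fp p.1 * kk b (p.2 - p.1) * kk a (t - p.2).
have mF : measurable_fun setT F.
  apply: measurable_funM.
    apply: measurable_funM; first exact: (measurableT_comp mfp).
    by apply: (measurableT_comp (measurable_kk b)); exact: measurable_funB.
  by apply: (measurableT_comp (measurable_kk a)); exact: measurable_funB.
have sh z : L1 mu (fun y => kk b (y - z) * kk a (t - y)) /\
    RI mu (fun y => kk b (y - z) * kk a (t - y)) = kk (a + b) (t - z).
  have [i e] := cv_kk (t - z) b0 a0.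
  have E : (fun y => kk b (y - z) * kk a (t - y)) = fun y => (fun y => kk b y * kk a (t - z - y)) (1 * y + - z).
    by apply/funext => y; rewrite mul1r; congr (_ * kk a _); ring.
  rewrite E; split; first exact: (L1_affine _ (oner_neq0 R) i).
  by rewrite (RI_affine _ (oner_neq0 R) i) normr1 invr1 mul1r [LHS]e addrC.
have Fi : L1 (mu \x mu)%E F.
  apply: (@L1_prod _ _ _ _ _ mu mu F (fun z => `|fp z * kk (a + b) (t - z)|) mF).
    exact: L1_norm (Jint t ab lf).
  move=> z; have [i e] := sh z.
  have -> : (\int[mu]_y `|F (z, y)|%:E = \int[mu]_y (`|fp z| * (kk b (y - z) * kk a (t - y)))%:E)%E.
    apply: eq_integral => y _; rewrite /F -mulrA normrM; congr (_ * _)%:E.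
    by rewrite ger0_norm// mulr_ge0// kk_ge0.
  by rewrite -(RI_EFin (L1_Z `|fp z| i)) (RI_Z _ i) e lee_fin [leRHS]normrM (ger0_norm (kk_ge0 _ (addr_gt0 a0 b0))).
have [i2 e2] := RI_prod2 Fi; have [i1 e1] := RI_prod1 Fi.
have E2 y : RI mu (fun z => F (z, y)) = \1_`]0, +oo[ y * J b f y * kk a (t - y).
  rewrite /F /= (_ : (fun z => _) = fun z => kk a (t - y) * (fp z * kk b (y - z))); last first.
    by apply/funext => z; rewrite mulrC.
  rewrite RI_Zm; last by apply: measurable_funM => //; apply: measurable_shift; exact: measurable_kk.
  rewrite -[RI _ _]/(J b f y).
  by have [y0|y0] := ltP 0 y; [rewrite indic_pos// mul1r mulrC|rewrite indic_npos// J0// !mulr0 !mul0r].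
have E1 z : RI mu (fun y => F (z, y)) = fp z * kk (a + b) (t - z).
  have [i e] := sh z.
  by rewrite /F /= -e -RI_Z//; apply: eq_RI => y; rewrite mulrA.
have i2' := i2; rewrite (funext E2) in i2'; split; first exact: i2'.
rewrite /J /cv -(eq_RI mu E2); rewrite [LHS]e2 -e1.
exact: (eq_RI mu E1).
Qed.

Lemma J1E f t : J 1 f t = RI mu (fun z => \1_`]0, t[ z * f z).
Proof. by rewrite /J /cv; apply: eq_RI => z; rewrite indic_ooM; ring. Qed.

Lemma loc_J1 b f : 0 < b -> loc f -> loc (J b f).
Proof.
move=> b0 lf T; have [|i _] := @J_semigroup 1 b f T ltr01 b0 _ lf; first by rewrite lerDl ltW.
move: i; rewrite (_ : (fun y => _ * _ * _) = (fun z => \1_`]0, T[ z * J b f z))//.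
by apply/funext => z; rewrite indic_ooM; ring.
Qed.

Lemma loc_kk b : 0 < b -> loc (kk b).
Proof.
move=> b0 T; have [i _] := cv_kk T b0 (@ltr01 R).
move: i; rewrite (_ : (fun y => kk b y * _) = (fun z => \1_`]0, T[ z * kk b z))//.
apply/funext => z; rewrite indic_ooM; have [z0|z0] := ltP 0 z; last by rewrite kk0// mul0r mulr0.
by rewrite indic_pos//; ring.
Qed.

Lemma loc_lin f g (u v : R) : loc f -> loc g -> loc (fun z => u * f z + v * g z).
Proof.
move=> lf lg T; have := L1_D (L1_Z u (lf T)) (L1_Z v (lg T)).
rewrite (_ : (fun x => _ + _) = (fun z => \1_`]0, T[ z * (u * f z + v * g z)))//.
by apply/funext => z; ring.
Qed.

Lemma volterra_step b c e a lam f g t : 0 < b -> 0 < c -> 0 < e -> 1 <= c + e -> loc f ->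
  (forall z, 0 < z -> g z = a * kk b z - lam * J e f z) ->
  J c g t = a * kk (b + c) t - lam * J (c + e) f t.
Proof.
move=> b0 c0 e0 ce lf gE.
have [i1 e1] := cv_kk t b0 c0; have [i2 e2] := J_semigroup t c0 e0 ce lf.
rewrite (J_eq c gE) -e1 -e2 -(RI_Z _ i1) -(RI_Z _ i2) -(RI_B (L1_Z a i1) (L1_Z lam i2)).
apply: eq_RI => z; have [z0|z0] := ltP 0 z; first by rewrite indic_pos//; ring.
by rewrite indic_npos// (kk0 b)//; ring.
Qed.

(** The derivative is only given on [t > 0], so the fundamental theorem is applied on [[eps, t]].
    The limit [eps -> 0] uses the integrability of [f] near 0 and the limit [g0] of [g]. *)
Lemma taylor1 f g (g0 t : R) : (forall z, 0 < z -> D1 g z (f z)) -> (forall z, 0 < z -> {for z, continuous f}) ->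
  loc f -> g z @[z --> 0^'+] --> g0 -> 0 < t -> g t = g0 * kk 1 t + J 1 f t.
Proof.
move=> dg cf lf gc t0.
pose eps n : R := t / 2 * n.+1%:R^-1.
have e0 n : 0 < eps n < t.
  have n1 : n.+1%:R^-1 <= 1 :> R by rewrite invf_le1// ler1n.
  have n0 : 0 < n.+1%:R^-1 :> R by rewrite invr_gt0.
  apply/andP; split; first by rewrite !mulr_gt0.
  rewrite (@le_lt_trans _ _ (t / 2 * 1))//; last lra.
  by rewrite /eps ler_wpM2l// divr_ge0// ltW.
have ce : eps n @[n --> \oo] --> (0 : R).
  rewrite -(mulr0 (t / 2)); apply: cvgM; first exact: cvg_cst.
  exact: cvg_harmonic.
rewrite kk1// mulr1 J1E.
have ftc n : RI mu (fun z => \1_`[eps n, t] z * f z) = g t - g (eps n).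
  have [e1 e2] := andP (e0 n).
  rewrite -RI_indic; apply: RI_FTC; first exact: ltW.
    by move=> z /andP[ze _]; apply: dg; exact: lt_le_trans ze.
  by move=> z /andP[ze _]; apply: cf; exact: lt_le_trans ze.
have c1 : RI mu (fun z => \1_`[eps n, t] z * f z) @[n --> \oo] --> g t - g0.
  rewrite (funext ftc); apply: cvgB; first exact: cvg_cst.
  by have /cvg_at_rightP := gc; apply; split => // n; case/andP: (e0 n).
have c2 : RI mu (fun z => \1_`[eps n, t] z * f z) @[n --> \oo] --> RI mu (fun z => \1_`]0, t[ z * f z).
  have lt1 : t < t + 1 by rewrite ltrDl.
  have mfp : measurable_fun setT (fun z : R => \1_`]0, t + 1[ z * f z) := L1_measurable (lf (t + 1)).
  apply: (proj2 (RI_dct _ _ _ (L1_norm (lf (t + 1))) _)).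
  - move=> n; rewrite (_ : (fun x => _) = fun z : R => \1_`[eps n, t] z * (\1_`]0, t + 1[ z * f z)).
      by apply: measurable_funM => //; exact: measurable_indic.
    apply/funext => z; have [h|h] := boolP (0 < z < t + 1); first by rewrite indic_oo// mul1r.
    rewrite indic_oo0// mul0r mulr0 indicE memNset ?mul0r//= in_itv/= => /andP[h1 h2].
    by move/negP: h; apply; have /andP[h3 _] := e0 n; rewrite (lt_le_trans h3 h1)/= (le_lt_trans h2).
  - exact: L1_measurable (lf t).
  - exists [set t]; split => //; first exact: lebesgue_measure_set1.
    move=> z /= h; apply: contrapT => /eqP zt; apply: h.
    have [h|h] := boolP (0 < z < t).
      have [z0 zt1] := andP h.
      have ez : \forall n \near \oo, eps n <= z by exact: (@cvgr_le _ _ _ _ _ _ ce).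
      apply: cvg_near_cst; near=> n; congr (_ * _).
      rewrite indic_oo// indicE mem_set//= in_itv/= (ltW zt1) andbT.
      by near: n.
    apply: cvg_near_cst; near=> n; congr (_ * _).
    rewrite indic_oo0// indicE memNset//= in_itv/= => /andP[h1 h2].
    by move/negP: h; apply; have /andP[h3 _] := e0 n; rewrite (lt_le_trans h3 h1)/= lt_neqAle zt.
  - apply: aeW => z n.
    have [h|h] := boolP (eps n <= z <= t).
      have /andP[h1 h2] := h; have /andP[h3 _] := e0 n.
      by rewrite indic_oo ?(lt_le_trans h3 h1) ?(le_lt_trans h2)// indicE mem_set//= ?in_itv/= ?h1 ?h2.
    by rewrite indicE memNset ?mul0r ?normr0//= in_itv/=; exact/negP.
have := cvg_unique _ c1 c2; move=> /(_ (@Rhausdorff R)) <-; ring.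
Unshelve. all: by end_near. Qed.

Lemma D1_J1 f t : loc f -> 0 < t -> {for t, continuous f} -> D1 (J 1 f) t (f t).
Proof.
move=> lf t0 cf.
have fi : mu.-integrable `]0, (t + 1)] (EFin \o f).
  apply: (@integrableS _ _ _ mu `]0, t + 2[) => //.
    by move=> z /=; rewrite !in_itv/= => /andP[-> zt]/=; lra.
  by apply/L1_indic => //; exact: lf.
have lt1 : t < t + 1 by rewrite ltrDl.
have a0t : (BRight (0 : R) < BRight t)%O by rewrite bnd_simp.
have [d e] := @continuous_FTC1 R f (BRight 0) t (t + 1) lt1 fi a0t cf.
have E : J 1 f = fun x => (\int[mu]_(z in `]0%R, x]) f z)%R.
  apply/funext => x; rewrite J1E [RHS]RI_indic.
  have mfp := L1_measurable (lf (x + 1)).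
  apply: ae_eq_RI; last first.
  - rewrite (_ : (fun x0 => _) = fun z : R => \1_`]0, x] z * (\1_`]0, x + 1[ z * f z)).
      by apply: measurable_funM => //; exact: measurable_indic.
    apply/funext => z; have [h|h] := boolP (0 < z < x + 1); first by rewrite indic_oo// mul1r.
    rewrite indic_oo0// mul0r mulr0 indicE memNset ?mul0r//= in_itv/= => /andP[h1 h2].
    by move/negP: h; apply; rewrite h1/=; lra.
  - exact: L1_measurable (lf x).
  exists [set x]; split => //; first exact: lebesgue_measure_set1.
  move=> z /= h; apply: contrapT => /eqP zx; apply: h; congr (_ * _).
  rewrite !indicE; congr (_%:R); congr nat_of_bool.
  by apply/idP/idP; rewrite !inE/= !in_itv/= => /andP[-> h]/=; [exact: ltW|rewrite lt_neqAle zx].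
rewrite E -e derive1E; exact: derivableP.
Qed.

Lemma J1_eq0 f t : loc f -> (forall t, 0 < t -> RI mu (fun z => \1_`]0, t[ z * f z) = 0) ->
  0 < t -> {for t, continuous f} -> f t = 0.
Proof.
move=> lf f0 t0 cf; have := D1_J1 lf t0 cf.
rewrite (_ : J 1 f = fun=> 0).
  by move=> h; rewrite -(@derive_val _ _ _ _ _ _ _ h) (@derive_val _ _ _ _ _ _ _ (D1_cst 0 t)).
apply/funext => x; rewrite J1E; have [x0|x0] := ltP 0 x; first exact: f0.
rewrite (_ : (fun z => _) = fun=> 0) ?RI_0//; apply/funext => z.
by rewrite indic_oo0 ?mul0r//; apply/negP => /andP[]; lra.
Qed.

Lemma normr_series_exp (x : R) n : `|series (exp_coeff x) n| <= expR `|x|.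
Proof.
have h : `|series (exp_coeff x) n| <= series (exp_coeff `|x|) n.
  rewrite /series /= (le_trans (ler_norm_sum _ _ _))// ler_sum// => i _.
  by rewrite /exp_coeff /= normf_div normrX normr_nat.
rewrite (le_trans h)// /expR; apply: nondecreasing_cvgn_le; last exact: is_cvg_series_exp_coeff.
by apply/nondecreasing_series => i _ _; exact: exp_coeff_ge0.
Qed.

(* [exp (- e^{N (tau - t)})] is a uniform limit of polynomials in [e^{- N t}], and tends to the
   indicator function of [tau < t] as [N] grows. *)
Lemma lerch g tau : L1 mu g -> (forall t, t <= 0 -> g t = 0) ->
  (forall j : nat, RI mu (fun t => expR (- (j%:R * t)) * g t) = 0) ->
  0 < tau -> RI mu (fun z => \1_`]0, tau[ z * g z) = 0.
Proof.
move=> gi g0 gj tau0; have mg := L1_measurable gi.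
have mej (j : nat) : measurable_fun setT (fun t : R => expR (- (j%:R * t)) * g t).
  by apply: measurable_funM => //; apply: measurableT_comp => //; apply: measurableT_comp.
have ej (j : nat) : L1 mu (fun t => expR (- (j%:R * t)) * g t).
  apply: (@L1_le _ _ _ mu _ _ (mej j) (L1_norm gi)) => t.
   have [t0|t0] := leP t 0; first by rewrite g0// mulr0.
  by rewrite normrM ger0_norm ?expR_ge0// ler_piMl// expR_le1 oppr_le0 mulr_ge0// ltW.
have mx (N : nat) (y : R) : measurable_fun setT (fun t : R => - y * expR (- (N%:R * t))).
  by apply: measurable_funM => //; apply: measurableT_comp => //; apply: measurableT_comp.
(* In the power series of [exp (- y e^{- N t})] every term is a multiple of some [e^{- m N t}],
   whose integral against [g] vanishes; the partial sums are bounded by [e^y] on [t > 0]. *)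
have step1 (N : nat) (y : R) : 0 <= y -> RI mu (fun t => expR (- y * expR (- (N%:R * t))) * g t) = 0.
  move=> y0.
  pose u m t := series (exp_coeff (- y * expR (- (N%:R * t)))) m * g t.
  have uS m : L1 mu (u m) /\ RI mu (u m) = 0.
    elim: m => [|m [IHi IHe]].
      have -> : u 0%N = fun=> 0 by apply/funext => t; rewrite /u /series /= big_geq// mul0r.
      by split; [exact: L1_0|exact: RI_0].
    have E : u m.+1 = fun t => u m t + ((- y) ^+ m / m`!%:R) * (expR (- ((m * N)%:R * t)) * g t).
      apply/funext => t; rewrite /u /series /= big_nat_recr//= mulrDl; congr (_ + _).
      rewrite /exp_coeff /= exprMn -expRM_natl natrM.
      have -> : m%:R * - (N%:R * t) = - (m%:R * N%:R * t) by ring.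
      by ring.
    rewrite E; have i2 := L1_Z ((- y) ^+ m / m`!%:R) (ej (m * N)%N).
    by split; [exact: L1_D|rewrite RI_D// RI_Z// IHe gj mulr0 addr0].
  have mlim : measurable_fun setT (fun t : R => expR (- y * expR (- (N%:R * t))) * g t).
    by apply: measurable_funM => //; exact: (measurableT_comp (@measurable_expR R) (mx N y)).
  have cu : {ae mu, forall t, u n t @[n --> \oo] --> expR (- y * expR (- (N%:R * t))) * g t}.
    apply: aeW => t; apply: cvgM; [exact: is_cvg_series_exp_coeff|exact: cvg_cst].
  have bu : {ae mu, forall t, forall n, `|u n t| <= expR y * `|g t|}.
    apply: aeW => t m; rewrite /u; have [t0|t0] := leP t 0; first by rewrite g0// mulr0 normr0 mulr0.
    rewrite normrM ler_wpM2r// (le_trans (normr_series_exp _ _))// ler_expR normrM normrN (ger0_norm y0).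
    by rewrite ger0_norm ?expR_ge0// ler_piMr// expR_le1 oppr_le0 mulr_ge0// ltW.
  have [_ h] := @RI_dct _ _ _ mu u _ _ (fun m => L1_measurable (uS m).1) mlim cu (L1_Z (expR y) (L1_norm gi)) bu.
  have e : (fun m => RI mu (u m)) = fun=> 0 by apply/funext => m; exact: (uS m).2.
  by rewrite e in h; apply: (cvg_unique _ h (cvg_cst _)).
have step2 : RI mu (fun t : R => (tau < t)%R%:R * g t) = 0.
  have mt : measurable_fun setT (fun t : R => (tau < t)%R%:R * g t : R).
    rewrite (_ : (fun t => _) = fun t => \1_`]tau, +oo[ t * g t).
      by apply: measurable_funM => //; exact: measurable_indic.
    apply/funext => t; rewrite indicE; congr (_%:R * _); congr nat_of_bool.
    by apply/idP/idP; rewrite inE/= in_itv/= andbT.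
  pose u (N : nat) t := expR (- expR (N%:R * tau) * expR (- (N%:R * t))) * g t.
  have mu_ N : measurable_fun setT (u N).
    by apply: measurable_funM => //; exact: (measurableT_comp (@measurable_expR R) (mx N _)).
  have cu : {ae mu, forall t, u n t @[n --> \oo] --> (tau < t)%R%:R * g t}.
    exists [set tau]; split => //; first exact: lebesgue_measure_set1.
    move=> t /= h; apply: contrapT => /eqP tt; apply: h.
    apply: cvgM; last exact: cvg_cst.
    have uE N : expR (- expR (N%:R * tau) * expR (- (N%:R * t))) = expR (- expR (N%:R * (tau - t))).
      by rewrite mulNr -expRD; congr (expR (- expR _)); ring.
    rewrite (funext uE).
    have [h|h] := ltP tau t.
      have -> : true%:R = expR (- 0) :> R by rewrite oppr0 expR0.
      apply: continuous_cvg; first exact: continuous_expR.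
      apply: cvgN.
      have -> : (fun N : nat => expR (N%:R * (tau - t))) = (fun x => expR (- x)) \o (fun N : nat => N%:R * (t - tau)).
        by apply/funext => N /=; congr expR; ring.
      apply: (cvg_comp _ _ _ (@cvgr_expR R)).
      apply/cvgryPge => A; near=> N; rewrite -ler_pdivrMr ?subr_gt0//.
      by near: N; exact: nbhs_infty_ger.
    have {}h : t < tau by rewrite lt_neqAle tt.
    apply: (cvg_comp _ _ _ (@cvgr_expR R)).
    apply/cvgryPge => A; near=> N; apply: (le_trans _ (expR_ge1Dx _)).
    rewrite -lerBlDl -ler_pdivrMr ?subr_gt0//.
    by near: N; exact: nbhs_infty_ger.
  have bu : {ae mu, forall t, forall n, `|u n t| <= `|g t|}.
    apply: aeW => t N; rewrite /u normrM ger0_norm ?expR_ge0// ler_piMl// expR_le1.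
  have [_ h] := @RI_dct _ _ _ mu u _ _ mu_ mt cu (L1_norm gi) bu.
  have e : (fun m => RI mu (u m)) = fun=> 0 by apply/funext => m; apply: step1; exact: expR_ge0.
  by rewrite e in h; rewrite -(cvg_unique _ h (cvg_cst _)).
have mi : measurable_fun setT (fun z : R => \1_`]0, tau[ z * g z).
  by apply: measurable_funM => //; exact: measurable_ioo.
have i1 : L1 mu (fun z => \1_`]0, tau[ z * g z).
  apply: (@L1_le _ _ _ mu _ _ mi (L1_norm gi)) => z.
  by rewrite normrM ler_piMl// indicE; case: (_ \in _); rewrite ?normr1 ?normr0.
have mt : measurable_fun setT (fun t : R => (tau < t)%R%:R * g t : R).
  rewrite (_ : (fun t => _) = fun t => \1_`]tau, +oo[ t * g t).
    by apply: measurable_funM => //; exact: measurable_indic.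
  apply/funext => t; rewrite indicE; congr (_%:R * _); congr nat_of_bool.
  by apply/idP/idP; rewrite inE/= in_itv/= andbT.
have i2 : L1 mu (fun z : R => (tau < z)%R%:R * g z).
  apply: (@L1_le _ _ _ mu _ _ mt (L1_norm gi)) => z.
  by rewrite normrM ler_piMl//; case: (_ < _); rewrite ?normr1 ?normr0.
(* The hypothesis for [j = 0] says that the total integral vanishes; removing the part beyond [tau],
   which is 0 by [step2], leaves the integral over []0, tau[]. *)
have := gj 0%N; rewrite (@ae_eq_RI _ _ _ mu _ (fun z => \1_`]0, tau[ z * g z + (tau < z)%R%:R * g z)).
- by rewrite RI_D// step2 addr0.
- exists [set tau]; split => //; first exact: lebesgue_measure_set1.
  move=> z /= h; apply: contrapT => /eqP zt; apply: h.
  rewrite mul0r oppr0 expR0 mul1r.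
  have [z0|z0] := leP z 0; first by rewrite g0// !mulr0 addr0.
  have [h|h] := ltP tau z; first by rewrite indic_oo0 ?mul0r ?add0r ?mul1r// negb_and -!leNgt (ltW h) orbT.
  by rewrite indic_oo ?mul1r ?mul0r ?addr0// z0/= lt_neqAle zt.
- exact: mej.
- exact: measurable_funD.
Unshelve. all: by end_near. Qed.

Lemma L1_trunc f B : measurable_fun setT f -> (forall t, t <= 0 -> f t = 0) ->
  (forall n : nat, L1 mu (fun t => \1_`]0, n%:R[ t * `|f t|) /\
     RI mu (fun t => \1_`]0, n%:R[ t * `|f t|) <= B) -> L1 mu f.
Proof.
move=> mf f0 H.
have mf_ (n : nat) : measurable_fun setT (fun t : R => \1_`]0, n%:R[ t * `|f t|).
  by apply: measurable_funM; [exact: measurable_ioo|exact: measurableT_comp].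
pose g (n : nat) (t : R) := (\1_`]0, n%:R[ t * `|f t|)%:E.
have mg n : measurable_fun setT (g n) by exact/measurable_EFinP.
have g0 n t : setT t -> (0 <= g n t)%E by move=> _; rewrite lee_fin mulr_ge0// indicE.
have gnd t : setT t -> nondecreasing_seq (g ^~ t).
  move=> _ m n mn; rewrite lee_fin ler_wpM2r//.
  have [h|h] := boolP (0 < t < m%:R); last by rewrite indic_oo0// indicE.
  have [h1 h2] := andP h.
  by rewrite !indic_oo ?h1//= (lt_le_trans h2)// ler_nat.
have gl t : limn (g ^~ t) = `|f t|%:E.
  apply/cvg_lim => //; apply: cvg_EFin; first exact: nearW.
  have [t0|t0] := ltP 0 t; last first.
    by apply: cvg_near_cst; apply: nearW => n; rewrite /= f0// normr0 mulr0.
  apply: cvg_near_cst; near=> n; rewrite /= indic_oo ?mul1r// t0/=.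
  by near: n; exact: nbhs_infty_gtr.
apply/integrableP; split; first exact/measurable_EFinP.
have -> : (\int[mu]_x `|(EFin \o f) x| = \int[mu]_x limn (g ^~ x))%E.
  by apply: eq_integral => x _; rewrite gl.
rewrite (@monotone_convergence _ (measurableTypeR R) R mu setT measurableT g mg g0 gnd).
apply: (@le_lt_trans _ _ B%:E); last exact: ltry.
apply: lime_le.
  apply: ereal_nondecreasing_is_cvgn => m n mn; apply: (@ge0_le_integral _ _ _ mu setT measurableT (g m) (g n)).
  - by move=> t _; exact: g0.
  - exact: (mg m).
  - exact: (mg n).
  - by move=> t _; exact: gnd.
apply: nearW => n; have [i e] := H n.
by rewrite -[X in (X <= _)%E](RI_EFin i) lee_fin.
Unshelve. all: by end_near. Qed.

(** Absorption: let [X] be the integral of [e^{- s t} |Phi|] over []0, n[], finite because [Phi] is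
    locally integrable. The equation gives [X <= |a| s^{-be} + X / 2], so [X] is bounded
    independently of [n] and the transform exists. It then satisfies a linear equation, which is
    solved. *)
Lemma laplace_volterra (Phi : R -> R) (a be al lam s : R) :
  loc Phi -> (forall t, t <= 0 -> Phi t = 0) ->
  (forall t, L1 mu (fun z => Phi z * kk al (t - z))) ->
  0 < be -> 0 < al -> 0 <= lam -> 0 < s -> lam * s `^ (- al) <= 2^-1 ->
  (forall t, 0 < t -> Phi t = a * kk be t - lam * cv Phi (kk al) t) ->
  L1 mu (fun t => expR (- (s * t)) * Phi t) /\
  RI mu (fun t => expR (- (s * t)) * Phi t) = a * s `^ (- be) / (1 + lam * s `^ (- al)).
Proof.
move=> lP P0 iP be0 al0 lam0 s0 hs PE.
have mP : measurable_fun setT Phi.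
  have := measurable_loc lP; rewrite (_ : (fun z => _) = Phi)//; apply/funext => z.
  by have [z0|z0] := ltP 0 z; [rewrite indic_pos// mul1r|rewrite P0// mulr0].
have me : measurable_fun setT (fun t : R => expR (- (s * t))).
  by apply: measurableT_comp => //; apply: measurableT_comp.
have [kbi kbe] := laplace_kk be0 s0; have [kai kae] := laplace_kk al0 s0.
pose eP t := expR (- (s * t)) * Phi t.
have meP : measurable_fun setT eP by exact: measurable_funM.
have key : L1 mu eP.
  apply: (@L1_trunc eP (2 * (`|a| * s `^ (- be)))) => // [t t0|n]; first by rewrite /eP P0// mulr0.
  pose P t := \1_`]0, n%:R[ t * `|eP t|.
  have mPn : measurable_fun setT P.
    by apply: measurable_funM; [exact: measurable_ioo|exact: measurableT_comp].
  have Pi : L1 mu P.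
    apply: (@L1_le _ _ _ mu _ _ mPn (L1_norm (lP n%:R))) => t.
    have [h|h] := boolP (0 < t < n%:R); last by rewrite /P indic_oo0// !mul0r.
    rewrite /P indic_oo// !mul1r normr_id /eP normrM ger0_norm ?expR_ge0// ler_piMl// expR_le1.
    by rewrite oppr_le0 mulr_ge0 ?(ltW s0)//; case/andP: h => /ltW.
  have P_ge0 t : 0 <= P t by rewrite mulr_ge0// indicE.
  pose Q t := expR (- (s * t)) * kk al t.
  have Q0 t : 0 <= Q t by rewrite mulr_ge0 ?expR_ge0 ?kk_ge0.
  have [ci ce] := cv_L1 Pi kai.
  have bd t : P t <= `|a| * (expR (- (s * t)) * kk be t) + lam * cv P Q t.
    have cv0 : 0 <= cv P Q t by apply: RI_ge0 => z; rewrite mulr_ge0.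
    have [h|h] := boolP (0 < t < n%:R); last first.
      have -> : P t = 0 by rewrite /P indic_oo0// mul0r.
      by apply: addr_ge0; apply: mulr_ge0 => //; apply: mulr_ge0; rewrite ?expR_ge0 ?kk_ge0.
    have [h1 h2] := andP h; rewrite {1}/P indic_oo// mul1r /eP PE// normrM ger0_norm ?expR_ge0//.
    (* For [t < n] only the values of [Phi] on []0, t[] enter the convolution, which does not see
       the truncation. *)
    have cvE : cv P Q t = expR (- (s * t)) * RI mu (fun z => `|Phi z * kk al (t - z)|).
      rewrite /cv -(RI_Z _ (L1_norm (iP t))); apply: eq_RI => z.
      rewrite normrM (ger0_norm (kk_ge0 _ al0)) /P /Q /eP normrM ger0_norm ?expR_ge0//.
      have -> : expR (- (s * t)) = expR (- (s * z)) * expR (- (s * (t - z))).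
        by rewrite -expRD; congr expR; ring.
      have [z0|z0] := leP z 0; first by rewrite P0// normr0 !(mulr0, mul0r).
      have [tz|tz] := leP (t - z) 0; first by rewrite kk0// !mulr0.
      by rewrite indic_oo ?z0/=; [ring|lra].
    rewrite cvE; have -> : `|a| * (expR (- (s * t)) * kk be t) + lam * (expR (- (s * t)) * RI mu (fun z => `|Phi z * kk al (t - z)|)) =
      expR (- (s * t)) * (`|a| * kk be t + lam * RI mu (fun z => `|Phi z * kk al (t - z)|)) by ring.
    rewrite ler_wpM2l ?expR_ge0// (le_trans (ler_normB _ _))// lerD//.
      by rewrite normrM (ger0_norm (kk_ge0 _ be0)).
    rewrite normrM (ger0_norm lam0) ler_wpM2l//; exact: RI_normr.
  split; first exact: Pi.
  have := RI_le Pi (L1_D (L1_Z `|a| kbi) (L1_Z lam ci)) bd.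
  rewrite (RI_D (L1_Z `|a| kbi) (L1_Z lam ci)) (RI_Z _ kbi) (RI_Z _ ci) kbe ce kae => h.
  have P1 : 0 <= RI mu P by exact: RI_ge0.
  have : lam * (RI mu P * s `^ (- al)) <= 2^-1 * RI mu P.
    by rewrite mulrCA [leRHS]mulrC ler_wpM2l.
  have {}h : RI mu P <= `|a| * s `^ (- be) + lam * (RI mu P * s `^ (- al)) := h.
  rewrite -[X in _ -> X <= _]/(RI mu P); move: (RI mu P) h => X h1 h2.
  clear -h1 h2; move: (`|a| * _) (lam * _) h1 h2 => A L; lra.
split=> //.
have [ci ce] := cv_L1 key kai.
have E : eP = fun t => a * (expR (- (s * t)) * kk be t) - lam * cv eP (fun t => expR (- (s * t)) * kk al t) t.
  apply/funext => t; rewrite (cv_expR _ _ mP (measurable_kk al)) /eP.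
  have [t0|t0] := ltP 0 t; first by rewrite PE//; ring.
  rewrite P0// kk0// /cv (_ : (fun z => _) = fun=> 0) ?RI_0 ?mulr0 ?subr0//.
  apply/funext => z; have [z0|z0] := leP z 0; first by rewrite P0// mul0r.
  by rewrite kk0 ?mulr0//; lra.
have := congr1 (fun f => RI mu f) E.
rewrite (RI_B (L1_Z a kbi) (L1_Z lam ci)) (RI_Z _ kbi) (RI_Z _ ci) kbe ce kae -/eP => h.
have n0 : 1 + lam * s `^ (- al) != 0 by rewrite gt_eqF// ltr_pwDl// mulr_ge0// powR_ge0.
apply: (mulIf n0); rewrite divfK//; rewrite mulrDr mulr1 {1}h; ring.
Qed.

(* Laplace transform, with [laplace_Gs] for the solution and [laplace_volterra] for the equation,
   then Lerch. *)
Lemma volterra_unique th (f : R -> R) (a b al lam t : R) : pi / 2 < th < pi -> al * th < pi ->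
  0 < al -> -1 < al - b < al -> 0 < lam -> loc f -> (forall t, 0 < t -> {for t, continuous f}) ->
  (forall t, 0 < t -> J 1 f t = a * kk (b + 1) t - lam * J al (J 1 f) t) -> 0 < t ->
  f t = a * TT th (Gs (al - b) al lam ^~ th) t.
Proof.
move=> hth halth al0 hp lam0 lf cf fE t0.
have b0 : 0 < b by case/andP: hp; lra.
have p1 : -1 < al - b by case/andP: hp.
set G := Gs (al - b) al lam ^~ th.
have lG s : 0 < s -> L1 mu (fun t => expR (- (s * t)) * (\1_`]0, +oo[ t * TT th G t)) /\
    RI mu (fun t => expR (- (s * t)) * (\1_`]0, +oo[ t * TT th G t)) = s `^ (al - b) / (s `^ al + lam).
  move=> s0; have [i e] := laplace_Gs hth (ltW al0) halth hp lam0 s0.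
  have mE : measurable_fun setT (fun t : R => expR (- (s * t)) * (\1_`]0, +oo[ t * TT th G t)).
    rewrite (_ : (fun t => _) = fun t : R => \1_`]0, +oo[ t * (\1_`[0, +oo[ t * (expR (- (s * t)) * TT th G t))).
      by apply: measurable_funM; [exact: measurable_ipos|exact: L1_measurable i].
    apply/funext => z; have [z0|z0] := ltP 0 z; last by rewrite indic_npos// !(mul0r, mulr0).
    by rewrite indic_pos// indicE mem_set ?mul1r//= in_itv/= (ltW z0).
  have ae : {ae mu, forall t, \1_`[0, +oo[ t * (expR (- (s * t)) * TT th G t) = expR (- (s * t)) * (\1_`]0, +oo[ t * TT th G t)}.
    exists [set 0]; split => //; first exact: lebesgue_measure_set1.
    move=> z /= h; apply: contrapT => /eqP z0; apply: h.
    have [z1|z1] := ltP 0 z.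
      by rewrite indic_pos// indicE mem_set ?mul1r//= in_itv/= (ltW z1).
    rewrite indic_npos// indicE memNset ?mul0r ?mulr0//= in_itv/= andbT; apply/negP.
    by rewrite -ltNge lt_neqAle z0.
  by split; [exact: ae_eq_L1 ae mE i|rewrite -(ae_eq_RI ae (L1_measurable i) mE)].
have lTT : loc (TT th G).
  move=> T; have [i _] := lG 1 ltr01.
  have mh : measurable_fun setT (fun z : R => \1_`]0, T[ z * expR z).
    by apply: measurable_funM => //; exact: measurable_ioo.
  have hb (z : R) : `|\1_`]0, T[ z * expR z| <= expR T.
    have [h|h] := boolP (0 < z < T); last by rewrite indic_oo0// mul0r normr0 expR_ge0.
    by rewrite indic_oo// mul1r ger0_norm ?expR_ge0// ler_expR; case/andP: h => _ /ltW.
  have := @L1_bM _ _ _ mu _ _ _ mh hb i; rewrite (_ : (fun x => _ * _) = (fun z => \1_`]0, T[ z * TT th G z))//.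
  apply/funext => z; have [h|h] := boolP (0 < z < T); last by rewrite indic_oo0// !mul0r.
  rewrite indic_pos; last by case/andP: h.
  by rewrite !mul1r mulrA -(mulrA _ (expR z)) expRxMexpNx_1 mulr1.
pose h z := f z + (- a) * TT th G z.
have lh : loc h.
  by have := loc_lin 1 (- a) lf lTT; apply: loc_eq => z _; rewrite mul1r.
have ch z : 0 < z -> {for z, continuous h}.
  move=> z0; apply: cvgD; first exact: cf.
  apply: cvgM; first exact: cvg_cst.
  exact: (TT_continuous hth p1 (powbd_Gs hth (ltW al0) halth (al - b) lam0) z0).
have JE z : J 1 h z = J 1 f z - a * J 1 (TT th G) z.
  rewrite !J1E -(RI_Z a (lTT z)) -(RI_B (lf z) (L1_Z a (lTT z))).
  by apply: eq_RI => y; rewrite /h; ring.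
(* From [s0] on, [lam s^{-al} <= 1 / 2], as the absorption in [laplace_volterra] requires. *)
pose s0 := Num.max 1 ((2 * lam) `^ al^-1).
have s01 : 1 <= s0 by rewrite le_max lexx.
have hs0 s : s0 <= s -> lam * s `^ (- al) <= 2^-1.
  move=> hs; have sp : 0 < s by rewrite (lt_le_trans ltr01)// (le_trans s01).
  rewrite powRN ler_pdivrMr ?powR_gt0// mulrC ler_pdivlMr// mulrC.
  have l2 : 0 <= 2 * lam by rewrite mulr_ge0// ltW.
  have -> : 2 * lam = ((2 * lam) `^ al^-1) `^ al.
    by rewrite -powRrM mulVf ?gt_eqF// powRr1.
  apply: ge0_ler_powR; rewrite ?nnegrE ?powR_ge0 ?(ltW al0) ?(ltW sp)//.
  by rewrite (le_trans _ hs)// le_max lexx orbT.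
have iP z : L1 mu (fun y => J 1 f y * kk al (z - y)).
  have [|i _] := @J_semigroup al 1 f z al0 ltr01 _ lf; first by rewrite lerDr ltW.
  move: i; rewrite (_ : (fun y => _ * _ * _) = (fun y => J 1 f y * kk al (z - y)))//.
  apply/funext => y; have [y0|y0] := ltP 0 y; first by rewrite indic_pos// mul1r.
  by rewrite (J0 _ _ y0) mulr0.
have JJ z : J al (J 1 f) z = cv (J 1 f) (kk al) z.
  apply: eq_RI => y; have [y0|y0] := ltP 0 y; first by rewrite indic_pos// mul1r.
  by rewrite (J0 _ _ y0) mulr0.
have LP s : s0 <= s -> L1 mu (fun t => expR (- (s * t)) * J 1 f t) /\
    RI mu (fun t => expR (- (s * t)) * J 1 f t) = a * s `^ (- (b + 1)) / (1 + lam * s `^ (- al)).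
  move=> hs; have sp : 0 < s by rewrite (lt_le_trans ltr01)// (le_trans s01).
  apply: laplace_volterra; rewrite ?(ltW lam0) ?hs0//.
  - exact: loc_J1.
  - by move=> z; exact: J0.
  - by rewrite addr_gt0.
  - by move=> z z0; rewrite fE// JJ.
have LT s : 0 < s -> L1 mu (fun t => expR (- (s * t)) * J 1 (TT th G) t) /\
    RI mu (fun t => expR (- (s * t)) * J 1 (TT th G) t) = s `^ (al - b) / (s `^ al + lam) * s `^ (- 1).
  move=> sp; have [i1 e1] := lG s sp; have [i2 e2] := laplace_kk ltr01 sp.
  have [i e] := cv_L1 i1 i2.
  have E : cv (fun t => expR (- (s * t)) * (\1_`]0, +oo[ t * TT th G t)) (fun t => expR (- (s * t)) * kk 1 t) =
      fun t => expR (- (s * t)) * J 1 (TT th G) t.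
    apply/funext => z; apply: cv_expR; last exact: measurable_kk.
    exact: measurable_loc.
  by rewrite E in i e; rewrite e e1 e2.
(* The weight [e^{- s0 z}] shifts the range [s >= s0] to [[0, +oo[], so that [lerch] can be applied
   to [g] with the integer exponents [j], that is [s = s0 + j]. *)
pose g z := expR (- (s0 * z)) * J 1 h z.
have LD s : s0 <= s -> L1 mu (fun t => expR (- (s * t)) * J 1 h t) /\
    RI mu (fun t => expR (- (s * t)) * J 1 h t) = 0.
  move=> hs; have sp : 0 < s by rewrite (lt_le_trans ltr01)// (le_trans s01).
  have [i1 e1] := LP s hs; have [i2 e2] := LT s sp.
  have -> : (fun t => expR (- (s * t)) * J 1 h t) = fun t => expR (- (s * t)) * J 1 f t - a * (expR (- (s * t)) * J 1 (TT th G) t).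
    by apply/funext => z; rewrite JE; ring.
  split; first exact: L1_B i1 (L1_Z a i2).
  rewrite (RI_B i1 (L1_Z a i2)) (RI_Z _ i2) e1 e2.
  have -> : - (b + 1) = (al - b) + (- 1) + (- al) by ring.
  rewrite !(powR_gtD _ _ sp) [s `^ (- al)]powRN.
  have n1 : s `^ al != 0 by rewrite gt_eqF// powR_gt0.
  have n2 : s `^ al + lam != 0 by rewrite gt_eqF// addr_gt0// powR_gt0.
  have n3 : 1 + lam / s `^ al != 0 by rewrite gt_eqF// addr_gt0// divr_gt0// powR_gt0.
  move: n1 n2 n3; move: (s `^ al) (s `^ (- b)) (s `^ (- 1)) => A B C n1 n2 n3.
  by field; rewrite ?n1 ?n2 ?n3.
have gi : L1 mu g by exact: (LD s0 (lexx _)).1.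
have g0 z : z <= 0 -> g z = 0 by move=> z0; rewrite /g J0// mulr0.
have gj (j : nat) : RI mu (fun t => expR (- (j%:R * t)) * g t) = 0.
  have [|_ e] := LD (s0 + j%:R); first by rewrite lerDl.
  rewrite -[RHS]e; apply: eq_RI => z; rewrite /g mulrA -expRD; congr (expR _ * _); ring.
have lg : loc g.
  move=> T; apply: (@L1_bM _ _ _ mu 1 _ _ (measurable_ioo T)) gi => z.
  by rewrite indicE; case: (_ \in _); rewrite ?normr1 ?normr0.
(* [lerch] only makes the primitive of [g] vanish. A first differentiation gives [g = 0], hence
   [J 1 h = 0], and a second one, below, gives [h = 0]. *)
have hz z : 0 < z -> J 1 h z = 0.
  move=> z0; have : g z = 0.
    apply: (J1_eq0 lg) => //; first by move=> u u0; exact: (lerch gi g0 gj u0).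
    apply: cvgM; last exact: D1_continuous (D1_J1 lh z0 (ch z z0)).
    by apply: D1_continuous (D1_expR (D1_N (D1_lin s0 z))).
  by move/eqP; rewrite mulf_eq0 gt_eqF ?expR_gt0//= => /eqP.
have : h t = 0.
  by apply: (J1_eq0 lh) => //; [move=> u u0; rewrite -J1E hz|exact: ch].
by rewrite /h => /eqP; rewrite mulNr subr_eq0 => /eqP.
Qed.

End volterra.

(** * The Fourier modes *)

Section modes.
Context {R : realType}.
Local Notation mu := (@lebesgue_measure R).
Local Notation D1 f x d := (is_derive (x : R) (1 : R) (f : R -> R) (d : R)).
Implicit Types f g h : R -> R.

Lemma J_scale nu (k : R) f t : loc f -> J nu (fun z => k * f z) t = k * J nu f t.
Proof.
move=> lf; rewrite /J /cv -RI_Zm.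
  by apply: eq_RI => z; ring.
apply: measurable_funM; first exact: measurable_loc.
by apply: measurable_shift; exact: measurable_kk.
Qed.

Lemma RL_integralE nu f : 0 < nu -> loc f -> RL_integral nu f = J nu f.
Proof.
move=> nu0 lf; apply/funext => t; rewrite /RL_integral gt_eqF// RI_indic -RI_Zm.
  apply: eq_RI => z; have [h|h] := boolP (0 < z < t).
    have [z0 zt] := andP h.
    by rewrite indic_oo// indic_pos// kkE ?subr_gt0//; ring.
  rewrite indic_oo0// mul0r mulr0; have [z0|z0] := ltP 0 z; last by rewrite indic_npos// !mul0r.
  by rewrite kk0 ?mulr0//; move: h; rewrite z0/= -leNgt subr_le0.
rewrite (_ : (fun z => _) = fun z : R => (\1_`]0, t[ z * f z) * (t - z) `^ (nu - 1)); last first.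
  by apply/funext => z; rewrite mulrA.
apply: measurable_funM; first exact: L1_measurable (lf t).
have mm : measurable_fun setT (fun x : R => (t - x) `^ (nu - 1)).
  by apply: (measurable_shift t (g := @powR R ^~ (nu - 1))); exact: measurable_powR.
exact: mm.
Qed.

Lemma cont_loc f : continuous_locally_integrable f ->
  (forall t, 0 < t -> {for t, continuous f}) /\ loc f.
Proof.
move=> [cf fi]; split=> // T; have [T0|T0] := ltP 0 T.
  exact: (proj1 (L1_indic f (measurable_itv _)) (fi T T0)).
rewrite (_ : (fun z => _) = fun=> 0); first exact: L1_0.
by apply/funext => z; rewrite indic_oo0 ?mul0r//; apply/negP => /andP[]; lra.
Qed.

Lemma ceiln1 (x : R) : 0 < x <= 1 -> ceiln x = 1%N.
Proof.
move=> h; suff -> : ceiln x = `|(1 : int)|%N by [].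
by congr absz; apply/eqP; rewrite Num.Theory.ceil_eq subrr.
Qed.

Lemma ceiln2 (x : R) : 1 < x <= 2 -> ceiln x = 2%N.
Proof.
move=> h; suff -> : ceiln x = `|(2 : int)|%N by [].
by congr absz; apply/eqP; rewrite Num.Theory.ceil_eq.
Qed.

Lemma derivable_D1 f t : derivable f t 1 -> D1 f t (derive1n 1 f t).
Proof. by move=> d; rewrite derive1n1 derive1E; exact: derivableP. Qed.

Variable al : R.
Hypothesis hal : 0 < al < 1 \/ 1 < al < 2.

Let al0 : 0 < al. Proof. by case: hal => /andP[]; lra. Qed.

Lemma volterra_int b (a lam : R) f : 0 < b -> loc f ->
  (forall t, 0 < t -> f t = a * kk b t - lam * J al f t) ->
  forall t, J 1 f t = a * kk (b + 1) t - lam * J al (J 1 f) t.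
Proof.
move=> b0 lf fE t; rewrite (volterra_step t b0 ltr01 al0 _ lf fE) ?lerDl ?(ltW al0)//.
have [|_ ->] := @J_semigroup R al 1 f t al0 ltr01 _ lf; first by rewrite lerDr ltW.
by rewrite (addrC al).
Qed.

(** Applying [J (al + 1 - m)] to the equation for [J (m - al) f] raises the order on the left to 1,
    the least at which [J_semigroup] is available. *)
Lemma volterra_RL b m (a lam : R) f : 0 < b -> 1 <= m -> 0 < m - al <= 1 -> m - al < 1 -> loc f ->
  (forall t, 0 < t -> J (m - al) f t = a * kk b t - lam * J m f t) ->
  forall t, J 1 f t = a * kk (b + (al + 1 - m)) t - lam * J al (J 1 f) t.
Proof.
move=> b0 m1 /andP[ma0 ma1] ma lf fE t.
have c0 : 0 < al + 1 - m by lra.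
have m0 : 0 < m by lra.
have e1 : al + 1 - m + (m - al) = 1 by ring.
have [|_ h] := @J_semigroup R (al + 1 - m) (m - al) f t c0 ma0 _ lf; first by rewrite e1.
rewrite e1 in h; rewrite -h (volterra_step t b0 c0 m0 _ lf fE); last by have := al0; lra.
have [|_ ->] := @J_semigroup R al 1 f t al0 ltr01 _ lf; first by rewrite lerDr ltW.
by have -> : al + 1 - m + m = al + 1 by ring.
Qed.

Lemma taylor2 f f1 f2 (g0 g1 : R) : (forall z, 0 < z -> D1 f z (f1 z)) ->
  (forall z, 0 < z -> D1 f1 z (f2 z)) -> (forall z, 0 < z -> {for z, continuous f2}) ->
  loc f2 -> f z @[z --> 0^'+] --> g0 -> f1 z @[z --> 0^'+] --> g1 -> 
  forall t, 0 < t -> f t = g0 * kk 1 t + g1 * kk 2 t + J 2 f2 t.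
Proof.
move=> d1 d2 c2 l2 fg0 fg1 t t0.
have f1E z : 0 < z -> f1 z = g1 * kk 1 z - (- 1) * J 1 f2 z.
  by move=> z0; rewrite mulN1r opprK; exact: taylor1.
have l1 : loc f1.
  have := loc_lin g1 1 (loc_kk (@ltr01 R)) (loc_J1 ltr01 l2).
  by apply: loc_eq => z z0; rewrite f1E//; ring.
have c1 z : 0 < z -> {for z, continuous f1} by move=> z0; exact: D1_continuous (d2 z z0).
rewrite (taylor1 d1 c1 l1 fg0 t0) (volterra_step t ltr01 ltr01 ltr01 _ l2 f1E) ?lerDl//.
by rewrite mulN1r opprK addrA.
Qed.

(** The exponent for which the mode formally satisfies [f = a kk b - lam J al f], that is, for which
    its Laplace transform is [a s^{al - b} / (s^al + lam)]. *)
Definition b_of (i : datum_index) : R :=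
  match i with gamma_0 => 1 | gamma_1 => 2 | gamma_am1 => al | gamma_am2 => al - 1 end.

Lemma caputo_volterra (m : nat) (lam : R) f : ceiln al = m -> al < m%:R -> (1 <= m)%N ->
  loc f -> loc (derive1n m f) ->
  (forall t, 0 < t -> fracD Caputo al f t = - lam * f t) ->
  forall t, J m%:R (derive1n m f) t = - lam * J al f t.
Proof.
move=> cm alm m1 lf lm fE t.
have ma0 : 0 < m%:R - al by rewrite subr_gt0.
have e : al + (m%:R - al) = m%:R by ring.
have [|_ h] := @J_semigroup R al (m%:R - al) (derive1n m f) t al0 ma0 _ lm.
  by rewrite e ler1n.
rewrite e in h; rewrite -h -J_scale//; congr (_ t); apply: J_eq => z z0.
by rewrite -fE// /fracD leNgt al0/= cm RL_integralE.
Qed.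

(** In the Caputo cases Taylor's formula expands [f], and [J al] of the equation rewrites the
    remainder as [- lam J al f]. In the Riemann-Liouville cases Taylor's formula expands
    [J (m - al) f], with [m] the ceiling of [al], and [volterra_RL] passes to [J 1 f]; this is why
    all four cases are stated for [J 1 f]. *)
Lemma mode_loc i lam a f : mode_solution al i lam a f -> (i = gamma_1 \/ i = gamma_am2 -> 1 < al) ->
  [/\ forall t, 0 < t -> {for t, continuous f}, loc f &
  forall t, J 1 f t = a * kk (b_of i + 1) t - lam * J al (J 1 f) t].
Proof.
move=> [ex eq_ c1 c2] hi.
have one0 : (1 <= 0 :> R) = false by rewrite ler10.
case: hal => hal'.
- have cm : ceiln al = 1%N by apply: ceiln1; case/andP: hal' => -> /ltW.
  have alm : al < 1%:R by case/andP: hal'.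
  case: i ex eq_ c1 c2 hi => /=; rewrite /fracD_exists cm => ex eq_ c1 c2 hi.
  + case: ex => dt /cont_loc[cf lf'].
    have d1 z : 0 < z -> D1 f z (derive1n 1 f z) by move=> z0; apply: derivable_D1; exact: (dt 0%N).
    have cE : fracD Caputo 0 f = f.
      by apply/funext => z; rewrite /fracD lexx /RL_integral oppr0 eqxx.
    rewrite cE in c1.
    have fE z : 0 < z -> f z = a * kk 1 z + J 1 (derive1n 1 f) z by move=> z0; exact: taylor1.
    have lf : loc f.
      have := loc_lin a 1 (loc_kk (@ltr01 R)) (loc_J1 ltr01 lf').
      by apply: loc_eq => z z0; rewrite fE//; ring.
    have E := caputo_volterra cm alm isT lf lf' eq_.
    split=> //; first by move=> z z0; exact: D1_continuous (d1 z z0).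
    by apply: volterra_int => // z z0; rewrite {1}fE// E mulNr.
  + by have := hi (or_introl erefl); rewrite ltNge (ltW alm).
  + case: ex => /cont_loc[cf lf] dt.
    have ma0 : 0 < 1 - al by rewrite subr_gt0.
    rewrite (RL_integralE ma0 lf) in dt.
    have cE : fracD RiemannLiouville (al - 1) f = J (1 - al) f.
      by apply/funext => z; rewrite /fracD subr_le0 (ltW alm) opprB RL_integralE.
    rewrite cE in c1.
    have d1 z : 0 < z -> D1 (J (1 - al) f) z (- lam * f z).
      move=> z0; rewrite -eq_// /fracD leNgt al0/= cm -(RL_integralE ma0 lf).
      by apply: derivable_D1; rewrite (RL_integralE ma0 lf); exact: (dt 0%N).
    have cl z : 0 < z -> {for z, continuous (fun z => - lam * f z)}.
      by move=> z0; apply: cvgM; [exact: cvg_cst|exact: cf].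
    have ll : loc (fun z => - lam * f z).
      by have := loc_lin (- lam) 0 lf lf; apply: loc_eq => z _; ring.
    split=> //.
    have -> : al + 1 = 1 + (al + 1 - 1) by ring.
    apply: volterra_RL => //; first by rewrite ma0/=; lra.
      by have := al0; lra.
    by move=> z z0; rewrite (taylor1 d1 cl ll c1 z0) J_scale// mulNr.
  + by have := hi (or_intror erefl); rewrite ltNge (ltW alm).
have [al1 al2] := andP hal'.
have cm : ceiln al = 2%N by apply: ceiln2; rewrite al1 ltW.
have {}c2 := c2 al1.
have ll f' : loc f' -> loc (fun z => - lam * f' z).
  by move=> lf'; have := loc_lin (- lam) 0 lf' lf'; apply: loc_eq => z _; ring.
have cap (g0 g1 : R) : fracD_exists Caputo al f ->
   (forall t, 0 < t -> fracD Caputo al f t = - lam * f t) ->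
   fracD Caputo 0 f t @[t --> 0^'+] --> g0 -> fracD Caputo 1 f t @[t --> 0^'+] --> g1 ->
   [/\ forall t, 0 < t -> {for t, continuous f}, loc f &
     forall t, 0 < t -> f t = g0 * kk 1 t + g1 * kk 2 t - lam * J al f t].
  rewrite /fracD_exists cm => -[dt /cont_loc[cf lf2]] e k0 k1.
  have d1 z : 0 < z -> D1 f z (derive1n 1 f z) by move=> z0; apply: derivable_D1; exact: (dt 0%N).
  have d2 z : 0 < z -> D1 (derive1n 1 f) z (derive1n 2 f z) by move=> z0; apply: (@derivable_D1 (derive1n 1 f)); exact: (dt 1%N).
  have cE : fracD Caputo 0 f = f.
    by apply/funext => z; rewrite /fracD lexx /RL_integral oppr0 eqxx.
  have cE1 : fracD Caputo 1 f = derive1n 1 f.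
    by apply/funext => z; rewrite /fracD one0 (@ceiln1 1) ?ltr01 ?lexx// /RL_integral subrr eqxx.
  rewrite cE in k0; rewrite cE1 in k1.
  have fE := taylor2 d1 d2 cf lf2 k0 k1.
  have lf : loc f.
    have two0 : 0 < 2 :> R by [].
    have := loc_lin 1 1 (loc_lin g0 g1 (loc_kk (@ltr01 R)) (loc_kk two0)) (loc_J1 two0 lf2).
    by apply: loc_eq => z z0; rewrite fE//; ring.
  have E := @caputo_volterra 2 lam f cm al2 isT lf lf2 e.
  split=> // [z z0|z z0]; first exact: D1_continuous (d1 z z0).
  by rewrite {1}fE// E mulNr.
have rl (g0 g1 : R) : fracD_exists RiemannLiouville al f ->
   (forall t, 0 < t -> fracD RiemannLiouville al f t = - lam * f t) ->
   fracD RiemannLiouville (al - 2) f t @[t --> 0^'+] --> g0 ->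
   fracD RiemannLiouville (al - 1) f t @[t --> 0^'+] --> g1 ->
   [/\ forall t, 0 < t -> {for t, continuous f}, loc f &
     forall t, 0 < t -> J (2 - al) f t = g0 * kk 1 t + g1 * kk 2 t - lam * J 2 f t].
  rewrite /fracD_exists cm => -[/cont_loc[cf lf] dt] e k0 k1.
  have ma0 : 0 < 2 - al by rewrite subr_gt0.
  rewrite (RL_integralE ma0 lf) in dt.
  have cE : fracD RiemannLiouville (al - 2) f = J (2 - al) f.
    by apply/funext => z; rewrite /fracD subr_le0 (ltW al2) opprB RL_integralE.
  have cE1 : fracD RiemannLiouville (al - 1) f = derive1n 1 (J (2 - al) f).
    apply/funext => z; rewrite /fracD subr_le0 leNgt al1/= (@ceiln1 (al - 1)); last first.
      by apply/andP; split; lra.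
    have -> : 1%:R - (al - 1) = 2 - al by ring.
    by rewrite RL_integralE.
  rewrite cE in k0; rewrite cE1 in k1.
  have d1 z : 0 < z -> D1 (J (2 - al) f) z (derive1n 1 (J (2 - al) f) z).
    by move=> z0; apply: derivable_D1; exact: (dt 0%N).
  have d2 z : 0 < z -> D1 (derive1n 1 (J (2 - al) f)) z (- lam * f z).
    move=> z0; rewrite -(e _ z0) /fracD leNgt al0 /= cm (RL_integralE ma0 lf).
    by apply: (@derivable_D1 (derive1n 1 (J (2 - al) f))); exact: (dt 1%N).
  have cl z : 0 < z -> {for z, continuous (fun z => - lam * f z)}.
    by move=> z0; apply: cvgM; [exact: cvg_cst|exact: cf].
  split=> // z z0; by rewrite (taylor2 d1 d2 cl (ll f lf) k0 k1 z0) J_scale// mulNr.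
have two0 : 0 < 2 :> R by [].
(* [cap] and [rl] take the two data by increasing order of differentiation, whereas [c1] is the
   prescribed datum and [c2] the vanishing one; hence [c2 c1] for [gamma_1] and [gamma_am1]. *)
case: i ex eq_ c1 c2 hi => /= ex eq_ c1 c2 hi.
- have [cf lf E] := cap _ _ ex eq_ c1 c2; split=> //.
  by apply: volterra_int => // z z0; rewrite {1}E// mul0r addr0.
- have [cf lf E] := cap _ _ ex eq_ c2 c1; split=> //.
  by apply: volterra_int => // z z0; rewrite {1}E// mul0r add0r.
- have [cf lf E] := rl _ _ ex eq_ c2 c1; split=> //.
  have -> : al + 1 = 2 + (al + 1 - 2) by ring.
  apply: volterra_RL => //; try by [lra|apply/andP; split; lra].
  by move=> z z0; rewrite E// mul0r add0r.
- have [cf lf E] := rl _ _ ex eq_ c1 c2; split=> //.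
  have -> : al - 1 + 1 = 1 + (al + 1 - 2) by ring.
  apply: volterra_RL => //; try by [lra|apply/andP; split; lra].
  by move=> z z0; rewrite E// mul0r addr0.
Qed.

(* The solution is equivalent to [(-1)^(m - 1) a lam^{- m} t^{- q - 1} / Gamma (- q)] for large [t]. *)
Definition q_of (i : datum_index) : R :=
  match i with gamma_0 => al - 1 | gamma_1 => al - 2 | gamma_am1 => al | gamma_am2 => al + 1 end.

Definition m_of (i : datum_index) : nat :=
  match i with gamma_0 | gamma_1 => 1%N | gamma_am1 | gamma_am2 => 2%N end.

Definition c_of (i : datum_index) (t : R) : R :=
  (-1) ^+ (m_of i).-1 * t `^ (q_of i + 1) * Gamma (- q_of i).

(** [M] is chosen before [lam], [a] and [f]: one function of [lam t^al] serves all the modes, and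
    its bound is the uniform domination needed to integrate over the frequencies. *)
Lemma mode_multiplier i : (i = gamma_1 \/ i = gamma_am2 -> 1 < al) ->
  exists M : R -> R, [/\ exists B, forall l, 0 < l -> `|M l| <= B,
    forall l_ : nat -> R, (forall n, 0 < l_ n) -> l_ n @[n --> \oo] --> +oo -> M (l_ n) @[n --> \oo] --> (1 : R),
    forall lam a f t, 0 < lam -> mode_solution al i lam a f -> 0 < t ->
      c_of i t * (lam ^+ m_of i * f t) = M (lam * t `^ al) * a &
    forall t, 0 < t -> c_of i t != 0].
Proof.
move=> hi; have pi0 := pi_gt0 R.
(* For [al < 1] any angle between [pi / 2] and [pi] will do. For [al] in []1, 2[] the midpoint of
   [pi / 2] and [pi / al] is taken. *)
have [th hth halth] : exists2 th : R, pi / 2 < th < pi & al * th < pi.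
  case: hal => /andP[h1 h2].
    exists (3 / 4 * pi); first by apply/andP; split; lra.
    by apply: (@lt_trans _ _ (1 * (3 / 4 * pi))); [rewrite ltr_pM2r//; lra|lra].
  exists ((pi / 2 + pi / al) / 2).
    have h3 : pi / 2 < pi / al by rewrite ltr_pM2l// ltf_pV2 ?posrE//; lra.
    have h4 : pi / al < pi by rewrite ltr_pdivrMr// ltr_pMr.
    by apply/andP; split; lra.
  have -> : al * ((pi / 2 + pi / al) / 2) = (pi * (al / 2) + pi) / 2 by field; rewrite gt_eqF.
  have : pi * (al / 2) < pi by rewrite gtr_pMr//; lra.
  lra.
have q1 : -1 < q_of i.
  case: i hi => /= hi; have := al0; try lra.
  by have := hi (or_introl erefl); lra.
(* Thus [- q] avoids the poles of [Gamma]. This is where integer values of [al] have to be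
   excluded. *)
have qn (m : nat) : q_of i != m%:R.
  have nat_lt1 (k : nat) (x : R) : 0 < x < 1 -> x != k%:R.
    move=> /andP[x0 x1]; apply/eqP => e; move: x0 x1; rewrite e ltr0n ltrn1.
    by case: k {e}.
  have nat_lt2 (k : nat) (x : R) : (0 < x < 1) || (1 < x < 2) -> x != k%:R.
    move=> /orP[|/andP[x0 x1]]; first exact: nat_lt1.
    apply/eqP => e; move: x0 x1; rewrite e ltr1n ltr_nat; by case: k {e} => [|[|]].
  have nat_lt0 (k : nat) (x : R) : x < 0 -> x != k%:R.
    by move=> x0; rewrite lt_eqF// (lt_le_trans x0).
  have nat_ltS (k : nat) (x : R) : (0 < x < 1) || (1 < x < 2) -> x + 1 != k%:R.
    case: k => [|k] h; last first.
      by rewrite -natr1 (inj_eq (addIr 1)); exact: nat_lt2.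
    by rewrite gt_eqF//; case/orP: h => /andP[]; lra.
  have h : (0 < al < 1) || (1 < al < 2) by apply/orP.
  case: i hi {q1} => /= hi; last 2 first.
  - exact: nat_lt2.
  - exact: nat_ltS.
  - case: hal => /andP[h1 h2]; first by apply: nat_lt0; lra.
    by apply: nat_lt1; apply/andP; split; lra.
  - have := hi (or_introl erefl) => h1; case: hal => /andP[h2 h3]; first lra.
    by apply: nat_lt0; lra.
have hG := Gamma_gT hth q1 qn.
exists (fun l => Gamma (- q_of i) * mT th al (q_of i) l); split.
- have [B hB] := mT_bounded hth (ltW al0) halth q1.
  exists (`|Gamma (- q_of i)| * B) => l l0; rewrite normrM ler_wpM2l//; exact: hB.
- move=> l_ l0 ly; rewrite -hG; apply: cvgM; first exact: cvg_cst.
  exact: (mT_cvg hth (ltW al0) halth q1 l0 ly).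
- move=> lam a f t lam0 hf t0; have [cf lf E] := mode_loc hf hi.
  have bq : -1 < al - b_of i < al.
    case: i hi {hf E qn hG} q1 => /= hi q1; have := al0 => al0'; apply/andP; split; try lra.
    by have := hi (or_intror erefl); lra.
  have b0 : -1 < al - b_of i by case/andP: bq.
  rewrite (volterra_unique hth halth al0 bq lam0 lf cf (fun t _ => E t) t0).
  rewrite -(TT_Gs hth (ltW al0) halth q1 lam0 t0) /c_of.
  (* [lam w^j / (w^al + lam) = w^j - w^{al + j} / (w^al + lam)], and the inverse transform of [w^j]
     is a multiple of [gT j]. When that is 0, one factor [lam] is exchanged for a sign and for
     [w^al] in the numerator. *)
  have one (j : R) : 0 <= j -> b_of i = al - j -> q_of i = al + j -> gT th j = 0 ->
      lam * TT th (Gs (al - b_of i) al lam ^~ th) t = - TT th (Gs (q_of i) al lam ^~ th) t.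
    move=> j0 bj qj gj; have j1 : -1 < j by lra.
    have := TT_lin hth 1 (-1) j1 q1 (powbd_cexp th j) (powbd_Gs hth (ltW al0) halth (q_of i) lam0) t0.
    rewrite TT_cexp// gj mulr0 mulr0 add0r mulN1r => <-.
    have pb := powbd_Gs hth (ltW al0) halth j lam0.
    have ej : al - b_of i = j by rewrite bj; ring.
    rewrite ej; have := TT_lin hth lam 0 j1 j1 pb pb t0; rewrite mul0r addr0 => <-.
    congr (TT th _ t); apply/funext => x; rewrite mul0r addr0 rmorphN mulN1r mul1r /Gs.
    have th0 : 0 <= th <= th by rewrite lexx andbT; case/andP: hth; lra.
    have n2 := Gs_den_neq0 hth (ltW al0) halth x lam0 th0.
    have -> : cexp (q_of i * x) (q_of i * th) = cexp (al * x) (al * th) * cexp (j * x) (j * th) :> R[i].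
      by rewrite -cexpD qj; congr cexp; ring.
    by move: n2; move: (cexp (al * x) _) (cexp (j * x) _) lam%:C => A B L n2; field.
  have g0 : gT th 0 = 0 by rewrite gT_rec// oppr0 mul0r.
  case: i hi {hf E qn hG bq b0} q1 one => /= hi q1 one; rewrite ?expr0 ?mul1r ?expr1 ?mulN1r.
  + by ring.
  + by ring.
  + have h := one 0 (lexx _) (esym (subr0 _)) (esym (addr0 _)) g0.
    have -> : - t `^ (al + 1) * Gamma (- al) * (lam ^+ 2 * (a * TT th (Gs (al - al) al lam ^~ th) t)) =
      - t `^ (al + 1) * Gamma (- al) * lam * a * (lam * TT th (Gs (al - al) al lam ^~ th) t) by ring.
    by rewrite h; ring.
  + have g1 : gT th 1 = 0 by rewrite gT_rec// subrr g0 mulr0.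
    have h := one 1 ler01 erefl erefl g1.
    have -> : - t `^ (al + 1 + 1) * Gamma (- (al + 1)) * (lam ^+ 2 * (a * TT th (Gs (al - (al - 1)) al lam ^~ th) t)) =
      - t `^ (al + 1 + 1) * Gamma (- (al + 1)) * lam * a * (lam * TT th (Gs (al - (al - 1)) al lam ^~ th) t) by ring.
    by rewrite h; ring.
- move=> t t0; rewrite /c_of; apply: mulf_neq0.
    by apply: mulf_neq0; rewrite ?signr_eq0// gt_eqF// powR_gt0.
  by apply/eqP => e; move: hG; rewrite e mul0r => /eqP; rewrite eq_sym oner_eq0.
Qed.

End modes.

(** * Square-integrable functions *)

Section square_integrable.
Context d (T : measurableType d) (R : realType).
Variable mu : {measure set T -> \bar R}.
Local Notation normc := Normc.normc.
Implicit Types f g h : T -> R[i].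

Definition SQ f : R := RI mu (fun x => normc (f x) ^+ 2).

Definition L2 f := cmeas f /\ L1 mu (fun x => normc (f x) ^+ 2).

Lemma sqr_normcD (x y : R[i]) : normc (x + y) ^+ 2 <= 2 * normc x ^+ 2 + 2 * normc y ^+ 2.
Proof.
rewrite !normc_sqr cReD cImD.
have h (a b : R) : (a + b) ^+ 2 <= 2 * a ^+ 2 + 2 * b ^+ 2.
  rewrite -subr_ge0; have -> : 2 * a ^+ 2 + 2 * b ^+ 2 - (a + b) ^+ 2 = (a - b) ^+ 2 by ring.
  exact: sqr_ge0.
by have := h (complex.Re x) (complex.Re y); have := h (complex.Im x) (complex.Im y); lra.
Qed.

(** Young's inequality with a free parameter [e]. It stands in for Minkowski's inequality, so that
    the L2 arguments can be carried out on squared norms, with no square roots. *)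
Lemma sqr_normc_dist (e : R) (x y : R[i]) : 0 < e ->
  `|normc x ^+ 2 - normc y ^+ 2| <= (1 + e^-1) * normc (x - y) ^+ 2 + e * normc y ^+ 2.
Proof.
move=> e0; rewrite !normc_sqr cReD cImD cReN cImN.
have h (a b : R) : `|a ^+ 2 - b ^+ 2| <= (1 + e^-1) * (a - b) ^+ 2 + e * b ^+ 2.
  have e1 : (1 + e^-1) * (a - b) ^+ 2 + e * b ^+ 2 - (a ^+ 2 - b ^+ 2) = ((a - b) - e * b) ^+ 2 / e.
    by field; rewrite gt_eqF.
  have e2 : (1 + e^-1) * (a - b) ^+ 2 + e * b ^+ 2 - (b ^+ 2 - a ^+ 2) = ((a - b) + e * b) ^+ 2 / e + 2 * (a - b) ^+ 2.
    by field; rewrite gt_eqF.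
  rewrite ler_norml; apply/andP; split.
    have : 0 <= ((a - b) + e * b) ^+ 2 / e + 2 * (a - b) ^+ 2.
      by apply: addr_ge0; apply: mulr_ge0; rewrite ?sqr_ge0// invr_ge0 ltW.
    by rewrite -e2; lra.
  have : 0 <= ((a - b) - e * b) ^+ 2 / e by apply: mulr_ge0; rewrite ?sqr_ge0// invr_ge0 ltW.
  by rewrite -e1; lra.
have := h (complex.Re x) (complex.Re y); have := h (complex.Im x) (complex.Im y).
rewrite !ler_norml => /andP[a1 a2] /andP[b1 b2]; apply/andP; split; lra.
Qed.

Lemma measurable_sqr_normc f : cmeas f -> measurable_fun setT (fun x => normc (f x) ^+ 2).
Proof. by move=> mf; apply: measurable_funX; exact: cmeas_normc. Qed.

Lemma SQ_ge0 f : 0 <= SQ f.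
Proof. by apply: RI_ge0 => x; exact: sqr_ge0. Qed.

Lemma L2_le f g (K : R) : cmeas f -> L2 g -> (forall x, normc (f x) ^+ 2 <= K * normc (g x) ^+ 2) ->
  L2 f /\ SQ f <= K * SQ g.
Proof.
move=> mf [mg ig] fg.
have i : L2 f.
  split=> //; apply: (@L1_le _ _ _ mu _ _ (measurable_sqr_normc mf) (L1_Z K ig)) => x.
  by rewrite ger0_norm ?sqr_ge0.
by split=> //; rewrite /SQ -(RI_Z _ ig); apply: RI_le => //; [exact: i.2|exact: L1_Z].
Qed.

Lemma L2_D f g : L2 f -> L2 g -> L2 (fun x => f x + g x) /\ SQ (fun x => f x + g x) <= 2 * SQ f + 2 * SQ g.
Proof.
move=> [mf fi] [mg gi]; have mfg : cmeas (fun x => f x + g x) by exact: cmeasD.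
have ii := L1_D (L1_Z 2 fi) (L1_Z 2 gi).
have i : L2 (fun x => f x + g x).
  split=> //; apply: (@L1_le _ _ _ mu _ _ (measurable_sqr_normc mfg) ii) => x.
  by rewrite ger0_norm ?sqr_ge0// sqr_normcD.
split=> //; rewrite /SQ -(RI_Z _ fi) -(RI_Z _ gi) -(RI_D (L1_Z 2 fi) (L1_Z 2 gi)).
by apply: RI_le => //; [exact: i.2|move=> x; exact: sqr_normcD].
Qed.

Lemma L2_Z (c : R[i]) f : L2 f -> L2 (fun x => c * f x) /\ SQ (fun x => c * f x) = normc c ^+ 2 * SQ f.
Proof.
move=> [mf fi].
have E : (fun x => normc (c * f x) ^+ 2) = fun x => normc c ^+ 2 * normc (f x) ^+ 2.
  by apply/funext => x; rewrite Normc.normcM exprMn.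
split; last by rewrite /SQ E RI_Z.
by split; [apply: cmeasM => //; exact: cmeas_cst|rewrite E; exact: L1_Z].
Qed.

Lemma L2_N f : L2 f -> L2 (fun x => - f x) /\ SQ (fun x => - f x) = SQ f.
Proof.
move=> [mf fi]; have E : (fun x => normc (- f x) ^+ 2) = fun x => normc (f x) ^+ 2.
  by apply/funext => x; rewrite normcN.
by split; [split; [exact: cmeasN|rewrite E]|rewrite /SQ E].
Qed.

Lemma L2_B f g : L2 f -> L2 g -> L2 (fun x => f x - g x) /\ SQ (fun x => f x - g x) <= 2 * SQ f + 2 * SQ g.
Proof. by move=> Lf Lg; have [Ng <-] := L2_N Lg; exact: L2_D. Qed.

Lemma SQ_distC f g : SQ (fun x => f x - g x) = SQ (fun x => g x - f x).
Proof. by apply: eq_RI => x; rewrite -normcN opprB. Qed.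

Lemma SQ_triangle f g h : L2 f -> L2 g -> L2 h ->
  SQ (fun x => f x - h x) <= 2 * SQ (fun x => f x - g x) + 2 * SQ (fun x => g x - h x).
Proof.
move=> Lf Lg Lh; have [_] := L2_D (L2_B Lf Lg).1 (L2_B Lg Lh).1.
by congr (SQ _ <= _); apply/funext => x; ring.
Qed.

Lemma SQ_dist (e : R) f g : 0 < e -> L2 f -> L2 g ->
  `|SQ f - SQ g| <= (1 + e^-1) * SQ (fun x => f x - g x) + e * SQ g.
Proof.
move=> e0 Lf Lg; have [[_ i] _] := L2_B Lf Lg.
rewrite /SQ -(RI_B Lf.2 Lg.2) -(RI_Z _ i) -(RI_Z _ Lg.2) -(RI_D (L1_Z _ i) (L1_Z _ Lg.2)).
apply: RI_normr_le; first exact: (L1_B Lf.2 Lg.2).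
  exact: (L1_D (L1_Z _ i) (L1_Z _ Lg.2)).
by move=> x; exact: sqr_normc_dist.
Qed.

Lemma SQ_cvg (f_ : nat -> T -> R[i]) f : (forall n, L2 (f_ n)) -> L2 f ->
  SQ (fun x => f_ n x - f x) @[n --> \oo] --> (0 : R) -> SQ (f_ n) @[n --> \oo] --> SQ f.
Proof.
move=> Lf_ Lf c0; apply/cvgrPdist_le => eps eps0.
(* Makes [e * SQ f <= eps / 2]; the other half is left for the first term of [SQ_dist], whose
   coefficient is now fixed. *)
pose e := eps / (2 * (SQ f + 1)).
have s1 : 0 < SQ f + 1 by rewrite ltr_wpDl ?SQ_ge0.
have e0 : 0 < e by rewrite divr_gt0// mulr_gt0.
have k0 : 0 < 1 + e^-1 by rewrite addr_gt0// invr_gt0.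
have d0 : 0 < eps / (2 * (1 + e^-1)) by rewrite divr_gt0// mulr_gt0.
have nd : \forall n \near \oo, SQ (fun x => f_ n x - f x) <= eps / (2 * (1 + e^-1)) by exact: (@cvgr_le R _ _ _ _ _ c0 _ d0).
apply: filterS nd => n h.
rewrite distrC (le_trans (SQ_dist e0 (Lf_ n) Lf))//.
have h1 : (1 + e^-1) * SQ (fun x => f_ n x - f x) <= eps / 2.
  by rewrite mulrC -ler_pdivlMr// -mulrA -invfM.
have h2 : e * SQ f <= eps / 2.
  rewrite /e mulrAC ler_pdivrMr ?mulr_gt0//.
  have -> : eps / 2 * (2 * (SQ f + 1)) = eps * (SQ f + 1) by field.
  by rewrite ler_wpM2l ?(ltW eps0)// lerDl.
lra.
Qed.

Lemma SQ_fatou (f_ : nat -> T -> R[i]) f (B : R) : (forall n, L2 (f_ n)) -> cmeas f ->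
  {ae mu, forall x, normc (f_ n x) @[n --> \oo] --> normc (f x)} ->
  (forall n, SQ (f_ n) <= B) -> L2 f /\ SQ f <= B.
Proof.
move=> Lf_ mf cf fB.
pose u n x := (normc (f_ n x) ^+ 2)%:E.
have mu_ n : measurable_fun setT (u n) by apply/measurable_EFinP; exact: measurable_sqr_normc (Lf_ n).1.
have u0 n x : setT x -> (0 <= u n x)%E by move=> _; rewrite lee_fin sqr_ge0.
have mf2 := measurable_sqr_normc mf.
have key : (\int[mu]_x (normc (f x) ^+ 2)%:E <= B%:E)%E.
  have ae : {ae mu, forall x, setT x -> (normc (f x) ^+ 2)%:E = limn_einf (u ^~ x)}.
    apply: filterS cf => x h _; apply/esym.
    have c : u n x @[n --> \oo] --> (normc (f x) ^+ 2)%:E.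
      by apply: cvg_EFin; [exact: nearW|rewrite expr2; apply: cvgM].
    by have [-> _] := cvg_limn_einf_sup c.
  have -> : (\int[mu]_x (normc (f x) ^+ 2)%:E = \int[mu]_x limn_einf (u ^~ x))%E.
    apply: ae_eq_integral => //; first exact/measurable_EFinP.
    rewrite (_ : (fun x => _) = fun x => (- limn_esup (fun n => - u n x))%E); last first.
      by apply/funext => x; rewrite (limn_esupN (u ^~ x)) oppeK.
    apply: measurableT_comp => //.
    apply: (@measurable_fun_limn_esup _ _ _ setT (fun n x => - u n x)%E) => // n.
    exact: measurableT_comp.
  rewrite (le_trans (fatou mu measurableT mu_ u0))//.
  rewrite limn_einf_lim; apply: lime_le; first exact: is_cvg_einfs.
  apply: nearW => n; apply: (@le_trans _ _ (\int[mu]_x u n x)%E).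
    by apply: ereal_inf_lbound; exists n => //=.
  by rewrite /u -(RI_EFin (Lf_ n).2) lee_fin fB.
have i : L2 f.
  by split=> //; exact: (ge0_L1 mf2 (fun x => sqr_ge0 _) key).
split=> //; rewrite -lee_fin /SQ (RI_EFin i.2); exact: key.
Qed.

(** Riesz-Fischer: a rapidly converging subsequence [g] converges almost everywhere, and Fatou's
    lemma transfers the Cauchy estimate to its limit. *)
Lemma SQ_complete (f_ : nat -> T -> R[i]) : (forall n, L2 (f_ n)) ->
  (forall e : R, 0 < e -> exists N, forall m n, (N <= m)%N -> (N <= n)%N ->
     SQ (fun x => f_ m x - f_ n x) <= e) ->
  exists2 f, L2 f & SQ (fun x => f_ n x - f x) @[n --> \oo] --> (0 : R).
Proof.
move=> Lf_ cauchy_f.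
(* The rate [8^{-j}] leaves [2^{-j}], still summable, after weighting by [4^j]. Where the weighted
   sum of the squared increments is finite, the increments themselves are at most a multiple of
   [2^{-j}]. *)
have e8 (j : nat) : 0 < (8%:R^-1) ^+ j :> R by rewrite exprn_gt0// invr_gt0.
pose N j := projT1 (cid (cauchy_f _ (e8 j))).
have hN j : forall m n, (N j <= m)%N -> (N j <= n)%N -> SQ (fun x => f_ m x - f_ n x) <= 8%:R^-1 ^+ j.
  exact: projT2 (cid (cauchy_f _ (e8 j))).
pose phi := fix phi j := if j is j'.+1 then maxn (phi j') (N j) else N 0%N.
have phiN j : (N j <= phi j)%N by case: j => [|j] //=; exact: leq_maxr.
have phiS j : (phi j <= phi j.+1)%N by exact: leq_maxl.
pose g j := f_ (phi j).
have Lg j : L2 (g j) by exact: Lf_.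
pose D j x := normc (g j.+1 x - g j x) ^+ 2.
have LD j : L2 (fun x => g j.+1 x - g j x) := (L2_B (Lg j.+1) (Lg j)).1.
have hD j : RI mu (D j) <= 8%:R^-1 ^+ j.
  by apply: hN => //; rewrite (leq_trans (phiN j)).
pose u j x := (4%:R ^+ j * D j x)%:E.
have iu j : L1 mu (fun x => 4%:R ^+ j * D j x) by apply: L1_Z; exact: (LD j).2.
have mu_ j : measurable_fun setT (u j) by apply/measurable_EFinP; exact: L1_measurable (iu j).
have u0 j x : setT x -> (0 <= u j x)%E.
  by move=> _; rewrite lee_fin mulr_ge0 ?sqr_ge0// exprn_ge0.
have mS : measurable_fun setT (fun x => \sum_(j <oo) u j x)%E.
  rewrite (_ : (fun x => _) = fun x => (\sum_(j <oo | j \in xpredT) u j x)%E).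
    by apply: ge0_emeasurable_sum => [k x|k]; [move=> h _; exact: u0|move=> _; exact: mu_].
  by apply/funext => x; congr (limn _); apply/funext => n; exact: eq_bigl.
have iS : (\int[mu]_x (\sum_(j <oo) u j x) <= 2%:E)%E.
  rewrite (integral_nneseries mu measurableT mu_ u0).
  apply: lime_le; first by apply: is_cvg_nneseries => n _ _; apply: integral_ge0 => x; exact: u0.
  apply: nearW => n.
  apply: (@le_trans _ _ (\sum_(0 <= j < n) ((2^-1) ^+ j)%:E)%E).
    apply: lee_sum => j _; rewrite /u -(RI_EFin (iu j)) (RI_Z _ (LD j).2) lee_fin.
    have -> : 2^-1 ^+ j = 4%:R ^+ j * 8%:R^-1 ^+ j :> R.
      by rewrite -exprMn; congr (_ ^+ _); field.
    by rewrite ler_wpM2l ?exprn_ge0// hD.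
  rewrite sumEFin lee_fin.
  have -> : \sum_(0 <= j < n) 2^-1 ^+ j = 2 - 2 * 2^-1 ^+ n :> R.
    elim: n => [|n IH]; first by rewrite big_geq// expr0; ring.
    by rewrite big_nat_recr//= IH exprS; field.
  by rewrite gerBl mulr_ge0// exprn_ge0// invr_ge0.
have S0 x : (0 <= \sum_(j <oo) u j x)%E by apply: nneseries_ge0 => j _ _; exact: u0.
have [A [mA A0 hA]] : {ae mu, forall x, setT x -> (\sum_(j <oo) u j x)%E \is a fin_num}.
  apply: integrable_ae => //; apply/integrableP; split=> //.
  rewrite (eq_integral (fun x => \sum_(j <oo) u j x)%E); last by move=> x _; rewrite gee0_abs.
  by rewrite (le_lt_trans iS)// ltry.
have bd x : ~ A x -> exists K : R, forall j, normc (g j.+1 x - g j x) <= K * 2^-1 ^+ j.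
  move=> nA; have fS : (\sum_(j <oo) u j x)%E \is a fin_num.
    by apply: contrapT => h; apply: nA; apply: hA => /(_ I).
  pose C := fine (\sum_(j <oo) u j x)%E.
  have C0 : 0 <= C by rewrite /C fine_ge0.
  have hC j : 4%:R ^+ j * D j x <= C.
    rewrite -lee_fin /C fineK//.
    apply: (@le_trans _ _ (\sum_(0 <= i < j.+1) u i x)%E); last by apply: nneseries_lim_ge => i _ _; exact: u0.
    rewrite big_nat_recr//= leeDr//; apply: sume_ge0 => i _; exact: u0.
  exists (Num.sqrt C) => j.
  have : D j x <= (Num.sqrt C * 2^-1 ^+ j) ^+ 2.
    rewrite exprMn sqr_sqrtr// -exprM mulnC exprM exprVn.
    have -> : (2 ^+ 2)^-1 ^+ j = (4%:R ^+ j)^-1 :> R by rewrite exprVn; congr ((_ ^+ _)^-1); ring.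
    by rewrite ler_pdivlMr ?exprn_gt0// mulrC.
  by rewrite /D ler_pXn2r// nnegrE ?normc_ge0// mulr_ge0 ?sqrtr_ge0// exprn_ge0// invr_ge0.
have cvg1 (p : R[i] -> R) x : (forall z w, p (z - w) = p z - p w) -> (forall z, `|p z| <= normc z) -> ~ A x ->
    cvgn (fun j => p (g j x)).
  move=> pB pn nA; have [K hK] := bd x nA.
  pose r j := p (g j x).
  have tel : r = fun n => r 0%N + series (telescope r) n by apply/funext => n; exact: eq_sum_telescope.
  rewrite -/r tel; apply: is_cvgD; first exact: is_cvg_cst.
  apply: normed_cvg.
  apply: (@series_le_cvg R _ (geometric K 2^-1)).
  - by move=> n; exact: normr_ge0.
  - move=> n; rewrite /geometric /=; exact: le_trans (normc_ge0 _) (hK n).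
  - by move=> n; rewrite /telescope /= /r -pB (le_trans (pn _)).
  - by apply: is_cvg_geometric_series; rewrite ger0_norm ?invr_ge0// invf_lt1// ltr1n.
(* Replacing the sequence by 0 on the exceptional set [A] makes it converge everywhere, so that its
   limit is measurable. *)
pose h (p : R[i] -> R) j x := \1_(~` A) x * p (g j x).
have ch (p : R[i] -> R) : (forall z w, p (z - w) = p z - p w) -> (forall z, `|p z| <= normc z) ->
    forall x, cvgn (fun j => h p j x).
  move=> pB pn x; have [Ax|nAx] := pselect (A x).
    rewrite (_ : (fun j => _) = fun=> 0); first exact: is_cvg_cst.
    by apply/funext => j; rewrite /h indicE memNset ?mul0r//= => /(_ Ax).
  by apply: is_cvgM; [exact: is_cvg_cst|exact: cvg1].
have ReB (z w : R[i]) : complex.Re (z - w) = complex.Re z - complex.Re w by rewrite cReD cReN.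
have ImB (z w : R[i]) : complex.Im (z - w) = complex.Im z - complex.Im w by rewrite cImD cImN.
have chR := ch _ ReB (@normr_Re_le R); have chI := ch _ ImB (@normr_Im_le R).
pose f x : R[i] := limn (fun j => h (@complex.Re R) j x) +i* limn (fun j => h (@complex.Im R) j x).
have mA' : measurable_fun setT (\1_(~` A) : T -> R) by apply: measurable_indic; exact: measurableC.
have mf : cmeas f.
  split.
    apply: (@measurable_fun_cvg _ T R setT (fun j x => h (@complex.Re R) j x)) => // j.
    by apply: measurable_funM => //; exact: (Lg j).1.1.
  apply: (@measurable_fun_cvg _ T R setT (fun j x => h (@complex.Im R) j x)) => // j.
  by apply: measurable_funM => //; exact: (Lg j).1.2.
have gf : {ae mu, forall x, complex.Re (g j x) @[j --> \oo] --> complex.Re (f x) /\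
     complex.Im (g j x) @[j --> \oo] --> complex.Im (f x)}.
  exists A; split => // x /= nx; apply: contrapT => nA; apply: nx.
  have i1 : \1_(~` A) x = 1 :> R by rewrite indicE mem_set.
  have e p : (fun j => h p j x) = fun j => p (g j x) by apply/funext => j; rewrite /h i1 mul1r.
  by split; [have := chR x|have := chI x]; rewrite e.
(* Fatou applied to [f_ n - g (m + j)] as [j] grows; both indices are beyond [N m], so all the
   squared distances are at most [8^{-m}]. *)
have key n m : (N m <= n)%N -> L2 (fun x => f_ n x - f x) /\ SQ (fun x => f_ n x - f x) <= 8%:R^-1 ^+ m.
  move=> mn.
  apply: (@SQ_fatou (fun j x => f_ n x - g (m + j)%N x)).
  - by move=> j; exact: (L2_B (Lf_ n) (Lg _)).1.
  - by apply: cmeasB; [exact: (Lf_ n).1|exact: mf].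
  - apply: filterS gf => x [c1 c2].
    have nE (z : R[i]) : normc z = Num.sqrt (complex.Re z ^+ 2 + complex.Im z ^+ 2) by case: z.
    rewrite nE cReD cImD cReN cImN (funext (fun j => nE (f_ n x - g (m + j)%N x))).
    have s1 : complex.Re (g (m + j)%N x) @[j --> \oo] --> complex.Re (f x) by rewrite (_ : (fun j => _) = (fun j => complex.Re (g (j + m)%N x))); [rewrite (cvg_shiftn m (fun j => complex.Re (g j x)))|apply/funext => j; rewrite addnC].
    have s2 : complex.Im (g (m + j)%N x) @[j --> \oo] --> complex.Im (f x) by rewrite (_ : (fun j => _) = (fun j => complex.Im (g (j + m)%N x))); [rewrite (cvg_shiftn m (fun j => complex.Im (g j x)))|apply/funext => j; rewrite addnC].
    apply: continuous_cvg; first exact: sqrt_continuous.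
    rewrite (_ : (fun j => _) = fun j => (complex.Re (f_ n x) - complex.Re (g (m + j)%N x)) * (complex.Re (f_ n x) - complex.Re (g (m + j)%N x)) +
       (complex.Im (f_ n x) - complex.Im (g (m + j)%N x)) * (complex.Im (f_ n x) - complex.Im (g (m + j)%N x))); last first.
      by apply/funext => j; rewrite cReD cImD cReN cImN !expr2.
    rewrite !expr2; apply: cvgD; apply: cvgM; apply: cvgB => //; exact: cvg_cst.
  - move=> j; apply: hN => //; rewrite (leq_trans (phiN m))//.
    by elim: j => [|j IH]; rewrite ?addn0// addnS (leq_trans IH).
exists f.
  have [L _] := key (N 0%N) 0%N (leqnn _).
  have := (L2_B (Lf_ (N 0%N)) L).1; congr (L2 _); apply/funext => x; ring.
apply/cvgrPdist_le => e e0.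
have [m hm] : exists m, 8%:R^-1 ^+ m <= e.
  have c : geometric 1 (8%:R^-1 : R) @ \oo --> (0 : R).
    by apply: cvg_geometric; rewrite ger0_norm ?invr_ge0// invf_lt1// ltr1n.
  have [m _ /(_ m (leqnn m))] : \forall n \near \oo, geometric 1 (8%:R^-1 : R) n <= e.
    by exact: (@cvgr_le R _ _ _ _ _ c _ e0).
  by rewrite /geometric /= mul1r => hm; exists m.
near=> n; have [|_ bnd] := key n m; first by near: n; exact: nbhs_infty_ge.
by rewrite sub0r normrN ger0_norm ?SQ_ge0// (le_trans bnd).
Unshelve. all: by end_near. Qed.

End square_integrable.

(** * Plancherel's theorem on the line *)

Section parametric.
Context d1 d2 (T1 : measurableType d1) (T2 : measurableType d2) (R : realType).
Variable m2 : {sigma_finite_measure set T2 -> \bar R}.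

(** Tonelli on the positive and negative parts separately, so that measurability holds whether or
    not the inner integrals converge. *)
Lemma measurable_RI_param (F : T1 * T2 -> R) : measurable_fun setT F ->
  measurable_fun setT (fun x => RI m2 (fun y => F (x, y))).
Proof.
move=> mF; have mE : measurable_fun setT (EFin \o F) by exact/measurable_EFinP.
have -> : (fun x => RI m2 (fun y => F (x, y))) = fun x =>
   fine ((\int[m2]_y (EFin \o F)^\+ (x, y)) - (\int[m2]_y (EFin \o F)^\- (x, y)))%E.
  apply/funext => x; rewrite /Rintegral; rewrite (integralE m2 setT (fun y => (F (x, y))%:E)).
  by congr (fine (_ - _)); apply: eq_integral => y _; rewrite ?funeposE ?funenegE.
apply: measurableT_comp => //; apply: emeasurable_funB.
  by apply: (measurable_fun_fubini_tonelli_F ((EFin \o F)^\+)%E) => //; exact: measurable_funepos.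
by apply: (measurable_fun_fubini_tonelli_F ((EFin \o F)^\-)%E) => //; exact: measurable_funeneg.
Qed.

Lemma cmeas_CI_param (F : T1 * T2 -> R[i]) : cmeas F -> cmeas (fun x => CI m2 (fun y => F (x, y))).
Proof.
move=> [m n]; split; first exact: (measurable_RI_param (F := fun p => complex.Re (F p))).
exact: (measurable_RI_param (F := fun p => complex.Im (F p))).
Qed.

End parametric.

Section translation.
Context {R : realType}.
Local Notation mu := (@lebesgue_measure R).

Lemma L1_itv_cst (a b c : R) : L1 mu (fun x => \1_`[a, b] x * c).
Proof.
have H : mu.-integrable `[a, b] (EFin \o (fun=> c)).
  by apply: continuous_L1_itv => x _; exact: cvg_cst.
exact: (proj1 (L1_indic (fun=> c) (measurable_itv _)) H).
Qed.

Lemma indic_normr_le (N x : R) : \1_`[- N, N] x = ((`|x| <= N)%R)%:R :> R.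
Proof.
rewrite indicE; congr ((nat_of_bool _)%:R); apply/idP/idP.
  by rewrite inE/= in_itv/= -ler_norml.
by rewrite inE/= in_itv/= -ler_norml.
Qed.

Lemma RI_translate (c : R) (f : R -> R) : L1 mu f -> RI mu (fun x => f (x - c)) = RI mu f.
Proof.
move=> fi; have := RI_affine (- c) (oner_neq0 R) fi; rewrite normr1 invr1 mul1r => <-.
by apply: eq_RI => x; rewrite mul1r.
Qed.

Lemma L1_translate (c : R) (f : R -> R) : L1 mu f -> L1 mu (fun x => f (x - c)).
Proof.
move=> fi; have := L1_affine (- c) (oner_neq0 R) fi.
by congr (L1 mu _); apply/funext => x; rewrite mul1r.
Qed.

(* By density of continuous functions in L^1. *)
Lemma L1_translation (N : R) (g : R -> R) (w_ : nat -> R) : L1 mu g ->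
  (forall x, N < `|x| -> g x = 0) -> w_ n @[n --> \oo] --> (0 : R) ->
  RI mu (fun x => `|g (x - w_ n) - g x|) @[n --> \oo] --> (0 : R).
Proof.
move=> gi g0 w0; have mg := L1_measurable gi.
(* The margin is 2 because eventually [|w_ n| <= 1]: for [|x| <= N + 1] the point [x - w_ n] is
   still in [E], and for [|x| > N + 1] both values of [g] are 0. *)
pose E : set R := `[- (N + 2), N + 2]%classic.
have mE : measurable (E : set (measurableTypeR R)) by exact: measurable_itv.
have fE : (mu E < +oo)%E by rewrite /E lebesgue_measure_itv/=; case: ifP => // _; rewrite -EFinB ltry.
have igE : mu.-integrable E (EFin \o g) by apply: (integrableS measurableT).
have [g_ [cg ig_ cg0]] := approximation_continuous_integrable mE fE igE.
apply/cvgrPdist_le => eps eps0.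
have e4 : 0 < eps / 4 by rewrite divr_gt0.
have [n0 hn0] : exists n, (\int[mu]_(z in E) `|(g z - g_ n z)%:E| <= (eps / 4)%:E)%E.
  have e4' : (0 < (eps / 4)%:E)%E by rewrite lte_fin.
  have [m _ /(_ m (leqnn m))] : \forall n \near \oo, (\int[mu]_(z in E) `|(g z - g_ n z)%:E| <= (eps / 4)%:E)%E.
    have /fine_cvgP[fin c0] := cg0.
    have l0 : \forall n \near \oo, fine (\int[mu]_(z in E) `|(g z - g_ n z)%:E|) <= eps / 4.
      by exact: (@cvgr_le R _ _ _ _ _ c0 _ e4).
    by apply: filterS (filterI fin l0) => n [f1 f2]; rewrite -(fineK f1) lee_fin.
  by move=> h; exists m.
pose G := g_ n0.
have cG (x : R) : {for x, continuous G} by exact: cg.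
have mG : measurable_fun setT G by apply: continuous_measurable_fun; exact: cG.
pose h x := \1_E x * (g x - G x).
have hi : L1 mu h.
  by apply: (proj1 (L1_indic (fun x => g x - G x) mE)); exact: (integrableB mE igE (ig_ n0)).
have hle : RI mu (fun x => `|h x|) <= eps / 4.
  rewrite -lee_fin (RI_EFin (L1_norm hi)) (le_trans _ hn0)//.
  rewrite [leRHS]integral_mkcond le_eqVlt; apply/orP; left; apply/eqP.
  apply: eq_integral => x _; rewrite patchE /h indicE.
  by case: ifP => _; rewrite ?mul1r// mul0r normr0.
have [K hK] : exists K : R, forall x : R, `|x| <= N + 2 -> `|G x| <= K.
  have [hN|hN] := ltP (N + 2) 0.
    by exists 0 => x hx; have := normr_ge0 x; rewrite leNgt (le_lt_trans hx hN).
  have [||c _ hc] := @EVT_max R (fun x => `|G x|) (- (N + 2)) (N + 2); first by lra.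
    by apply: within_continuous_pt => x _; apply: continuous_comp; [exact: cG|exact: norm_continuous].
  by exists `|G c| => x hx; apply: hc; rewrite in_itv/= -ler_norml.
pose D n (x : R) : R := \1_`[- (N + 1), N + 1] x * `|G (x - w_ n) - G x|.
have mD n : measurable_fun setT (D n).
  apply: measurable_funM => //; apply: measurableT_comp => //; apply: measurable_funB => //.
  by apply: (measurableT_comp mG); exact: measurable_funB.
have near1 : \forall n \near \oo, `|w_ n| <= 1.
  have /cvgrPdist_le/(_ 1 ltr01) := w0.
  by apply: filterS => n; rewrite sub0r normrN.
have [n1 _ hn1] := near1.
have D0 : RI mu (D n) @[n --> \oo] --> (0 : R).
  have [_] : L1 mu (fun=> 0) /\ RI mu (D (n + n1)%N) @[n --> \oo] --> RI mu (fun=> (0 : R)).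
    apply: (@RI_dct _ _ _ mu (fun n => D (n + n1)%N) (fun=> 0) (fun x => \1_`[- (N + 1), N + 1] x * (K + K))) => //.
    - by move=> n; exact: mD.
    - apply: nearW => x; have -> : 0 = \1_`[- (N + 1), N + 1] x * `|G (x - 0) - G x| by rewrite subr0 subrr normr0 mulr0.
      rewrite (cvg_shiftn n1 (fun n => D n x)) /D; apply: cvgM; first exact: cvg_cst.
      apply: cvg_norm; apply: cvgB; last exact: cvg_cst.
      apply: continuous_cvg; first by rewrite subr0; exact: cG.
      by apply: cvgB => //; exact: cvg_cst.
    - exact: L1_itv_cst.
    - apply: nearW => x n; rewrite /D indic_normr_le.
      have [hx|hx] := leP `|x| (N + 1); last by rewrite !mul0r normr0.
      have := hn1 (n + n1)%N (leq_addl _ _) => /= hw.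
      rewrite !mul1r ger0_norm// (le_trans (ler_normB _ _))// lerD// hK//.
        by rewrite (le_trans (ler_normB _ _))//; lra.
      by lra.
  by rewrite RI_0 (cvg_shiftn n1 (fun n => RI mu (D n))).
have D4 : \forall n \near \oo, RI mu (D n) <= eps / 4 by exact: (@cvgr_le R _ _ _ _ _ D0 _ e4).
near=> n.
have hw : `|w_ n| <= 1 by near: n; exact: near1.
have hD : RI mu (D n) <= eps / 4 by near: n; exact: D4.
rewrite sub0r normrN ger0_norm ?RI_ge0//.
have hsi := L1_translate (w_ n) (L1_norm hi).
have Di : L1 mu (D n).
  apply: (@L1_le _ _ _ mu _ _ (mD n) (L1_itv_cst (- (N + 1)) (N + 1) (K + K))) => x.
  rewrite /D indic_normr_le; have [hx|hx] := leP `|x| (N + 1); last by rewrite !mul0r normr0.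
  rewrite !mul1r ger0_norm// (le_trans (ler_normB _ _))// lerD// hK//.
    by rewrite (le_trans (ler_normB _ _))//; lra.
  by lra.
have bi := L1_D (L1_D hsi (L1_norm hi)) Di.
have gsi := L1_norm (L1_B (L1_translate (w_ n) gi) gi).
(* Passing through the continuous approximation [G]: two terms for [g - G], with equal integrals by
   translation invariance, and the term [D n], which tends to 0 by the continuity of [G]. *)
have pt x : `|g (x - w_ n) - g x| <= `|h (x - w_ n)| + `|h x| + D n x.
  have [hx|hx] := leP `|x| (N + 1).
    have h1 : `|x - w_ n| <= N + 2 by rewrite (le_trans (ler_normB _ _))//; lra.
    have h2 : `|x| <= N + 2 by lra.
    rewrite /h /D !indic_normr_le h1 h2 hx !mul1r.
    have -> : g (x - w_ n) - g x = (g (x - w_ n) - G (x - w_ n)) + (G (x - w_ n) - G x) - (g x - G x) by ring.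
    rewrite (le_trans (ler_normB _ _))//.
    have := ler_normD (g (x - w_ n) - G (x - w_ n)) (G (x - w_ n) - G x); lra.
  have h1 : N < `|x - w_ n| by have := lerB_dist x (w_ n); lra.
  rewrite g0// g0; last by lra.
  by rewrite subrr normr0 /D indic_normr_le !addr_ge0// mulr_ge0.
have E1 := RI_translate (w_ n) (L1_norm hi).
rewrite (le_trans (RI_le gsi bi pt))//.
rewrite (RI_D (L1_D hsi (L1_norm hi)) Di) (RI_D hsi (L1_norm hi)) E1.
move: (RI mu (fun x => `|h x|)) (RI mu (D n)) hle hD => a b; lra.
Unshelve. all: by end_near. Qed.

End translation.

Lemma cmeas_comp d1 d2 (T1 : measurableType d1) (T2 : measurableType d2) (R : realType)
    (g : T2 -> R[i]) (h : T1 -> T2) : cmeas g -> measurable_fun setT h ->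
  cmeas (fun x => g (h x)).
Proof. by move=> [m n] mh; split; [exact: (measurableT_comp m)|exact: (measurableT_comp n)]. Qed.

Section unit_circle.
Context {R : realType}.
Local Notation normc := Normc.normc.

(** This is [e^{- i y}], with the sign of the kernel in [fourier_ball]. *)
Definition cis (y : R) : R[i] := cos y -i* sin y.

Lemma cisD x y : cis (x + y) = cis x * cis y.
Proof. by apply: complex_eq; rewrite ?cReM ?cImM /= ?cosD ?sinD; ring. Qed.

Lemma cisN x : cis (- x) = (cis x)^*.
Proof. by apply: complex_eq; rewrite ?conjc_Re ?conjc_Im /= ?cosN ?sinN. Qed.

Lemma normc_cis x : normc (cis x) = 1.
Proof. by rewrite /= sqrrN cos2Dsin2 sqrtr1. Qed.

Lemma cmeas_cis d (T : measurableType d) (f : T -> R) : measurable_fun setT f ->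
  cmeas (fun x => cis (f x)).
Proof.
move=> mf; split => /=.
  by apply: (measurableT_comp _ mf); apply: continuous_measurable_fun; exact: continuous_cos.
apply: measurableT_comp => //.
by apply: (measurableT_comp _ mf); apply: continuous_measurable_fun; exact: continuous_sin.
Qed.

End unit_circle.

(** * The Abel factor [e^{- e |k|}] and the Cauchy density *)

Section abel_kernel.
Context {R : realType}.
Local Notation mu := (@lebesgue_measure R).

Lemma RI_halves (f : R -> R) : L1 mu f ->
  RI mu f = RI mu (fun x => \1_`[0, +oo[ x * (f x + f (- x))).
Proof.
move=> fi; have mf := L1_measurable fi.
have N10 : -1 != 0 :> R by rewrite oppr_eq0 oner_eq0.
pose g (x : R) : R := \1_`[0, +oo[ x * f (- x).
have fni : L1 mu (fun x => f (- x)).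
  have := L1_affine 0 N10 fi; congr (L1 mu _); apply/funext => x.
  by rewrite mulN1r addr0.
have m1 : measurable_fun [set: measurableTypeR R] (\1_`[0, +oo[ : R -> R) by apply: measurable_indic; exact: measurable_itv.
have b1 (x : R) : `|\1_`[0, +oo[ x : R| <= 1 by rewrite indicE; case: (_ \in _); rewrite ?normr1 ?normr0.
have fpi : L1 mu (fun x => \1_`[0, +oo[ x * f x) := @L1_bM _ _ _ mu _ _ _ m1 b1 fi.
have gi : L1 mu g := @L1_bM _ _ _ mu _ _ _ m1 b1 fni.
have gni : L1 mu (fun x => g (- x)).
  have := L1_affine 0 N10 gi; congr (L1 mu _); apply/funext => x.
  by rewrite mulN1r addr0.
have -> : RI mu (fun x => \1_`[0, +oo[ x * (f x + f (- x))) = RI mu (fun x => \1_`[0, +oo[ x * f x + g x).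
  by apply: eq_RI => x; rewrite /g mulrDr.
rewrite (RI_D fpi gi).
have -> : RI mu g = RI mu (fun x => g (- x)).
  have := RI_affine 0 N10 gi; rewrite normrN1 invr1 mul1r => <-.
  by apply: eq_RI => x; rewrite mulN1r addr0.
rewrite -(RI_D fpi gni); apply: ae_eq_RI; [|exact: mf|exact: L1_measurable (L1_D fpi gni)].
exists [set 0]; split => //; first exact: lebesgue_measure_set1.
move=> x /= h; apply: contrapT => /eqP x0; apply: h.
rewrite /g opprK !indicE !mem_setE !in_itv/= !andbT oppr_ge0.
by case: ltgtP x0 => // _ _; rewrite mul1r mul0r ?addr0 ?add0r.
Qed.

(** Folding the line in two, the contributions of [k] and [- k] add up to [2 cos (k a) Re z], and
    [RI_cexp] integrates this against [e^{- e k}]. *)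
Lemma abel_kernel (e a : R) (z : R[i]) : 0 < e ->
  RI mu (fun k => expR (- (e * `|k|)) * complex.Re (z * cis (k * a))) =
  2 * e / (e ^+ 2 + a ^+ 2) * complex.Re z.
Proof.
move=> e0; pose h (k : R) : R := expR (- (e * `|k|)) * complex.Re (z * cis (k * a)).
have mc : cmeas (fun k : R => z * cis (k * a)).
  by apply: cmeasM; [exact: cmeas_cst|apply: cmeas_cis; exact: measurable_funM].
have hi : L1 mu h.
  have b k : `|complex.Re (z * cis (k * a))| <= Normc.normc z.
    by rewrite (le_trans (normr_Re_le _))// Normc.normcM normc_cis mulr1.
  have := @L1_bM _ _ _ mu _ _ _ mc.1 b (L1_expRN e0).
  by congr (L1 mu _); apply/funext => k; rewrite mulrC.
rewrite -/h (RI_halves hi).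
have [_ E] := RI_cexp a (0 +i* (2 * complex.Re z)) e0.
transitivity (complex.Im ((0 +i* (2 * complex.Re z)) / (e -i* a))).
  rewrite -E; apply: eq_RI => k; rewrite indicE mem_setE in_itv/= andbT.
  have [k0|_] := boolP (0 <= k); last by rewrite !mul0r.
  rewrite !mul1r /h normrN (ger0_norm k0) mulNr cisN !cReM conjc_Re conjc_Im /=.
  by rewrite (mulrC k a); ring.
rewrite cImM cReV cImV /= sqrrN; have : e ^+ 2 + a ^+ 2 != 0 by rewrite gt_eqF// ltr_pwDl ?sqr_ge0// exprn_gt0.
by move=> d0; field.
Qed.

Lemma RI_cauchy_density : L1 mu (fun v => 2 / (1 + v ^+ 2)) /\
  RI mu (fun v => 2 / (1 + v ^+ 2)) = 2 * pi.
Proof.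
have c : continuous (fun v : R => (1 + v ^+ 2)^-1) by exact: continuous_oneDsqrV.
have g0 (v : R) : 0 <= (1 + v ^+ 2)^-1 by rewrite invr_ge0 addr_ge0// sqr_ge0.
have E : (\int[mu]_v ((1 + v ^+ 2)^-1)%:E = pi%:E)%E.
  rewrite (ge0_symfun_integralT g0 c); last by move=> v /=; rewrite sqrrN.
  rewrite -set_itvcy (integral0y_oneDsqr R) -EFinM; congr (_%:E); by field.
have m : measurable_fun setT (fun v : R => (1 + v ^+ 2)^-1) by exact: continuous_measurable_fun.
have [i I] := @ge0_RI_EFin _ (measurableTypeR R) R mu _ _ m g0 E.
by split; [exact: L1_Z|rewrite (RI_Z _ i) I].
Qed.

End abel_kernel.

(** * Plancherel's identity for a bounded function of bounded support *)

Section plancherel_line.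
Context {R : realType}.
Local Notation mu := (@lebesgue_measure R).
Local Notation normc := Normc.normc.

Definition FT1 (f : R -> R[i]) (k : R) : R[i] := CI mu (fun x => f x * cis (k * x)).

Lemma normc_CI_sqr (g : R -> R[i]) : CL1 mu g -> normc (CI mu g) ^+ 2 =
  RI mu (fun x => RI mu (fun y => complex.Re (g x * (g y)^*))).
Proof.
move=> [g1 g2]; rewrite normc_sqr /=.
have E x : RI mu (fun y => complex.Re (g x * (g y)^*)) =
    RI mu (fun y => complex.Re (g y)) * complex.Re (g x) + RI mu (fun y => complex.Im (g y)) * complex.Im (g x).
  transitivity (RI mu (fun y => complex.Re (g x) * complex.Re (g y) + complex.Im (g x) * complex.Im (g y))).
    by apply: eq_RI => y; rewrite cReM conjc_Re conjc_Im mulrN opprK.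
  by rewrite (RI_D (L1_Z _ g1) (L1_Z _ g2)) (RI_Z _ g1) (RI_Z _ g2) mulrC [X in _ + X]mulrC.
by rewrite (eq_RI mu E) (RI_D (L1_Z _ g1) (L1_Z _ g2)) (RI_Z _ g1) (RI_Z _ g2) !expr2.
Qed.

Variables (f : R -> R[i]) (M N : R).
Hypotheses (mf : cmeas f) (fM : forall x, normc (f x) <= M)
  (f0 : forall x, N < `|x| -> f x = 0).

Let b (x : R) : R := \1_`[- N, N] x * M.

Let fb x : normc (f x) <= b x.
Proof.
rewrite /b indic_normr_le; have [h|h] := leP `|x| N; first by rewrite mul1r.
by rewrite f0// Normc.normc0 mul0r.
Qed.

Let bi : L1 mu b. Proof. exact: L1_itv_cst. Qed.

Let M0 : 0 <= M. Proof. exact: le_trans (normc_ge0 (f 0)) (fM 0). Qed.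

Let fi : CL1 mu f. Proof. exact: (@CL1_le _ _ _ mu _ _ mf bi fb). Qed.

Let L2f : L2 mu f.
Proof.
split=> //; have h x : `|normc (f x)| <= M by rewrite ger0_norm ?normc_ge0.
exact: (@L1_bM _ _ _ mu _ _ _ (cmeas_normc mf) h (CL1_normc fi)).
Qed.

Let mfcis : cmeas (fun p : R * R => f p.2 * cis (p.1 * p.2)).
Proof.
apply: cmeasM; first exact: (cmeas_comp mf).
by apply: cmeas_cis; exact: measurable_funM.
Qed.

Let fcis k : CL1 mu (fun x => f x * cis (k * x)).
Proof.
apply: (@CL1_le _ _ _ mu _ _ (cmeas_comp mfcis (measurable_pair1 k)) bi) => x.
by rewrite Normc.normcM normc_cis mulr1.
Qed.

Lemma cmeas_FT1 : cmeas (FT1 f).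
Proof. exact: (cmeas_CI_param mu mfcis). Qed.

Lemma FT1_le k : normc (FT1 f k) <= RI mu b.
Proof.
rewrite (le_trans (normc_CI (fcis k)))//; apply: RI_le => //; first exact: (CL1_normc (fcis k)).
by move=> x; rewrite Normc.normcM normc_cis mulr1.
Qed.

(** The autocorrelation of [f]. Its value at 0 is the squared norm of [f], and Plancherel's identity
    comes down to its continuity there. *)
Let acorr w := RI mu (fun x => complex.Re (f x * (f (x - w))^*)).

Let mcorr : cmeas (fun p : R * R => f p.2 * (f (p.2 - p.1))^*).
Proof.
apply: cmeasM; first exact: (cmeas_comp mf).
by apply: cmeas_conj; apply: (cmeas_comp mf); exact: measurable_funB.
Qed.

Let corri w : L1 mu (fun x => complex.Re (f x * (f (x - w))^*)).
Proof.
apply: (@L1_le _ _ _ mu _ _ (cmeas_comp mcorr (measurable_pair1 w)).1 (L1_Z M bi)) => x.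
rewrite (le_trans (normr_Re_le _))// Normc.normcM normc_conj mulrC.
by apply: ler_pM; rewrite ?normc_ge0.
Qed.

Let acorr_le w : `|acorr w| <= SQ mu f.
Proof.
have si := L1_translate w L2f.2; have h := L1_Z 2^-1 (L1_D L2f.2 si).
rewrite (le_trans (RI_normr_le (corri w) h _))//.
  move=> x; rewrite (le_trans (normr_Re_le _))// Normc.normcM normc_conj.
  have := sqr_ge0 (normc (f x) - normc (f (x - w))).
  by rewrite sqrrB; lra.
rewrite (RI_Z _ (L1_D L2f.2 si)) (RI_D L2f.2 si) (RI_translate w L2f.2) /SQ.
by move: (RI mu _) => q; lra.
Qed.

(** As [f] is bounded by [M], continuity at 0 follows from the L1 continuity of translations,
    applied to the real and imaginary parts. *)
Let acorr_cvg (w_ : nat -> R) : w_ n @[n --> \oo] --> (0 : R) ->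
  acorr (w_ n) @[n --> \oo] --> SQ mu f.
Proof.
move=> w0; have [f1 f2] := fi.
have c1 := L1_translation f1 (fun x h => congr1 (@complex.Re R) (f0 h)) w0.
have c2 := L1_translation f2 (fun x h => congr1 (@complex.Im R) (f0 h)) w0.
have c : M * (RI mu (fun x => `|complex.Re (f (x - w_ n)) - complex.Re (f x)|) +
    RI mu (fun x => `|complex.Im (f (x - w_ n)) - complex.Im (f x)|)) @[n --> \oo] --> (0 : R).
  have -> : 0 = M * (0 + 0) :> R by rewrite addr0 mulr0.
  by apply: cvgM; [exact: cvg_cst|exact: cvgD].
apply/cvgrPdist_le => e e0.
have ne : \forall n \near \oo, M * (RI mu (fun x => `|complex.Re (f (x - w_ n)) - complex.Re (f x)|) +
    RI mu (fun x => `|complex.Im (f (x - w_ n)) - complex.Im (f x)|)) <= e.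
  by exact: (@cvgr_le R _ _ _ _ _ c _ e0).
apply: filterS ne => n; apply: le_trans.
have E : SQ mu f = RI mu (fun x => complex.Re (f x * (f x)^*)).
  by apply: eq_RI => x; rewrite mulc_conj.
have i0 : L1 mu (fun x => complex.Re (f x * (f x)^*)).
  by have := L2f.2; congr (L1 mu _); apply/funext => x; rewrite mulc_conj.
have d1 := L1_norm (L1_B (L1_translate (w_ n) f1) f1).
have d2 := L1_norm (L1_B (L1_translate (w_ n) f2) f2).
rewrite E distrC /acorr -(RI_B (corri _) i0) -(RI_D d1 d2) -(RI_Z M (L1_D d1 d2)).
apply: RI_normr_le; [exact: (L1_B (corri _) i0)|exact: (L1_Z M (L1_D d1 d2))|move=> x].
have -> : complex.Re (f x * (f (x - w_ n))^*) - complex.Re (f x * (f x)^*) =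
    complex.Re (f x * ((f (x - w_ n))^* - (f x)^*)) by rewrite mulrBr cReD cReN.
rewrite (le_trans (normr_Re_le _))// Normc.normcM.
apply: ler_pM; rewrite ?normc_ge0//.
rewrite (le_trans (normc_le_ReIm _))// cReD cImD cReN cImN !conjc_Re !conjc_Im.
by rewrite -opprD normrN.
Qed.

(** The Abel factor makes the triple integral in [k], [x], [y] absolutely convergent. Integrating in
    [k] first produces the kernel [2 e / (e^2 + (x - y)^2)], and [y = x - e v] turns the rest into
    [acorr (e v)] against the Cauchy density. *)
Let FT1_abel e : 0 < e ->
  L1 mu (fun k => expR (- (e * `|k|)) * normc (FT1 f k) ^+ 2) /\
  RI mu (fun k => expR (- (e * `|k|)) * normc (FT1 f k) ^+ 2) =
  RI mu (fun v => 2 / (1 + v ^+ 2) * acorr (e * v)).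
Proof.
move=> e0; have ei := L1_expRN e0; split.
  have h k : `|normc (FT1 f k) ^+ 2| <= RI mu b ^+ 2.
    rewrite ger0_norm ?sqr_ge0// ler_pXn2r ?nnegrE ?normc_ge0 ?FT1_le//.
    exact: le_trans (normc_ge0 _) (FT1_le k).
  have := @L1_bM _ _ _ mu _ _ _ (measurable_sqr_normc cmeas_FT1) h ei.
  by congr (L1 mu _); apply/funext => k; rewrite mulrC.
have b0 x : 0 <= b x by exact: le_trans (normc_ge0 _) (fb x).
pose G (x y : R) : R[i] := f x * (f y)^*.
have Gb x y : normc (G x y) <= b x * b y.
  by rewrite Normc.normcM normc_conj ler_pM ?normc_ge0.
pose H (q : R * R * R) := expR (- (e * `|q.1.1|)) * complex.Re (G q.1.2 q.2 * cis (q.1.1 * (q.1.2 - q.2))).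
have Hle k x y : `|H (k, x, y)| <= expR (- (e * `|k|)) * b x * b y.
  rewrite /H /= normrM gtr0_norm ?expR_gt0// -mulrA ler_wpM2l ?expR_ge0//.
  by rewrite (le_trans (normr_Re_le _))// Normc.normcM normc_cis mulr1.
have mH : measurable_fun [set: measurableTypeR R * measurableTypeR R * measurableTypeR R] H.
  apply: measurable_funM.
    apply: measurableT_comp => //; apply: measurableT_comp => //; apply: measurable_funM => //.
    by apply: measurableT_comp => //; exact: measurableT_comp.
  apply: (cmeasM (cmeasM _ _) _).1.
  - by apply: (cmeas_comp mf); exact: measurableT_comp.
  - by apply: cmeas_conj; exact: (cmeas_comp mf).
  - apply: cmeas_cis; apply: measurable_funM; first exact: measurableT_comp.
    by apply: measurable_funB => //; exact: measurableT_comp.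
pose A (p : R * R) := RI mu (fun y => H (p, y)).
have mA : measurable_fun [set: measurableTypeR R * measurableTypeR R] A.
  exact: (@measurable_RI_param _ _ _ (measurableTypeR R) R mu H mH).
have mHkx k x : measurable_fun setT (fun y => H (k, x, y)).
  exact: (measurableT_comp mH (measurable_pair1 (k, x))).
have Ai : L1 (mu \x mu)%E A.
  apply: (@L1_prodM _ _ _ _ _ mu mu _ _ _ mA ei (L1_Z (RI mu b) bi)) => k x.
  have bi' := L1_Z (expR (- (e * `|k|)) * b x) bi.
  rewrite [leRHS]mulrCA mulrC -(RI_Z _ bi); apply: RI_normr_le => //.
  exact: (@L1_le _ _ _ mu _ _ (mHkx k x) bi').
have E1 k : expR (- (e * `|k|)) * normc (FT1 f k) ^+ 2 = RI mu (fun x => A (k, x)).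
  have mk := cmeas_comp mfcis (measurable_pair1 k).
  pose P (p : R * R) := complex.Re (f p.1 * cis (k * p.1) * (f p.2 * cis (k * p.2))^*).
  have mP : measurable_fun [set: measurableTypeR R * measurableTypeR R] P.
    apply: (cmeasM (cmeas_comp mk measurable_fst) _).1.
    by apply: cmeas_conj; exact: (cmeas_comp mk measurable_snd).
  have mRP := @measurable_RI_param _ _ _ (measurableTypeR R) R mu P mP.
  rewrite /FT1 (normc_CI_sqr (fcis k)) -(@RI_Zm _ (measurableTypeR R) R mu _ _ mRP).
  apply: eq_RI => x.
  have mPx : measurable_fun setT (fun y => P (x, y)) by exact: (measurableT_comp mP (measurable_pair1 x)).
  rewrite -(@RI_Zm _ (measurableTypeR R) R mu _ _ mPx); apply: eq_RI => y; rewrite /P /H /G /=; congr (_ * complex.Re _).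
  by rewrite rmorphM mulrACA mulrBr cisD cisN.
rewrite (eq_RI mu E1) (RI_fubini Ai).
pose Q (x y : R) : R := 2 * e / (e ^+ 2 + (x - y) ^+ 2) * complex.Re (G x y).
have E2 x : RI mu (fun k => A (k, x)) = RI mu (fun y => Q x y).
  pose Hx (p : R * R) := H (p.1, x, p.2).
  have mHx : measurable_fun [set: measurableTypeR R * measurableTypeR R] Hx.
    apply: (measurableT_comp mH); apply: measurable_fun_pair => //; exact: measurable_fun_pair.
  have Hxi : L1 (mu \x mu)%E Hx.
    apply: (@L1_prodM _ _ _ _ _ mu mu _ _ _ mHx (L1_Z (b x) ei) bi) => k y.
    by rewrite /Hx /= [b x * _]mulrC.
  transitivity (RI mu (fun k => RI mu (fun y => Hx (k, y)))); first exact: eq_RI.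
  rewrite (RI_fubini Hxi); apply: eq_RI => y.
  have := abel_kernel (x - y) (G x y) e0; exact.
transitivity (RI mu (fun x => RI mu (Q x))); first exact: (eq_RI mu E2).
have mGx x : cmeas (G x).
  by apply: cmeasM; [exact: cmeas_cst|exact: cmeas_conj].
have mQ (x : R) : measurable_fun [set: measurableTypeR R] (Q x).
  apply: measurable_funM; last exact: (mGx x).1.
  apply: measurable_funM => //.
  under eq_fun do rewrite -powR_inv1 ?addr_ge0 ?sqr_ge0//.
  apply: (measurableT_comp (measurable_powR _)); apply: measurable_funD => //.
  by apply: measurable_funX; exact: measurable_funB.
pose S (p : R * R) := 2 / (1 + p.2 ^+ 2) * complex.Re (f p.1 * (f (p.1 - e * p.2))^*).
have [ci _] := @RI_cauchy_density R.
have mS : measurable_fun setT S.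
  apply: measurable_funM; first exact: (measurableT_comp (L1_measurable ci)).
  apply: (cmeasM (cmeas_comp mf measurable_fst) _).1; apply: cmeas_conj; apply: (cmeas_comp mf).
  by apply: measurable_funB => //; exact: measurable_funM.
have Si : L1 (mu \x mu)%E S.
  apply: (@L1_prodM _ _ _ _ _ mu mu _ _ _ mS (L1_Z M bi) ci) => x v.
  have c0 : 0 <= 2 / (1 + v ^+ 2) by rewrite divr_ge0// addr_ge0// sqr_ge0.
  rewrite /S /= normrM ger0_norm// mulrC ler_wpM2r// (le_trans (normr_Re_le _))//.
  by rewrite Normc.normcM normc_conj mulrC ler_pM ?normc_ge0.
have E3 x : RI mu (Q x) = RI mu (fun v => S (x, v)).
  have ne0 : - e != 0 by rewrite oppr_eq0 gt_eqF.
  have := RI_affine_m x ne0 (mQ x); rewrite normrN gtr0_norm// => h.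
  have -> : RI mu (Q x) = e * RI mu (fun v => Q x (- e * v + x)).
    by rewrite h mulrA divff ?mul1r// gt_eqF.
  have mQ' : measurable_fun setT (fun v : R => Q x (- e * v + x)).
    exact: (measurableT_comp (mQ x) (measurable_affine _ _)).
  rewrite -(@RI_Zm _ (measurableTypeR R) R mu _ _ mQ'); apply: eq_RI => v.
  rewrite /Q /S /G /= mulNr (addrC _ x) mulrA; congr (_ * _).
  have -> : x - (x - e * v) = e * v by ring.
  have -> : e ^+ 2 + (e * v) ^+ 2 = e ^+ 2 * (1 + v ^+ 2) by ring.
  have : 1 + v ^+ 2 != 0 by rewrite gt_eqF// ltr_pwDl// sqr_ge0.
  by move=> v0; field; rewrite v0 gt_eqF.
rewrite (eq_RI mu E3) (RI_fubini Si); apply: eq_RI => v.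
by rewrite /S /= (RI_Z _ (corri _)).
Qed.

(** Let [e -> 0] in [FT1_abel]. The right side tends to [2 pi] times [acorr 0] by dominated
    convergence. On the left, Fatou first shows that the transform is in L2, and its square then
    dominates. *)
Theorem plancherel_line : L2 mu (FT1 f) /\ SQ mu (FT1 f) = 2 * pi * SQ mu f.
Proof.
have h0 n : 0 < harmonic n :> R by exact: harmonic_gt0.
have [ci cI] := @RI_cauchy_density R.
have c0 (v : R) : 0 <= 2 / (1 + v ^+ 2) by rewrite divr_ge0// addr_ge0// sqr_ge0.
pose S n := RI mu (fun v => 2 / (1 + v ^+ 2) * acorr (harmonic n * v)).
have macorr : measurable_fun [set: measurableTypeR R] acorr.
  exact: (@measurable_RI_param _ _ (measurableTypeR R) (measurableTypeR R) R mu (fun p => complex.Re (f p.2 * (f (p.2 - p.1))^*)) mcorr.1).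
have mS n : measurable_fun setT (fun v : R => 2 / (1 + v ^+ 2) * acorr (harmonic n * v)).
  apply: measurable_funM; first exact: L1_measurable ci.
  by apply: (measurableT_comp macorr); exact: measurable_funM.
have bS n v : `|2 / (1 + v ^+ 2) * acorr (harmonic n * v)| <= 2 / (1 + v ^+ 2) * SQ mu f.
  by rewrite normrM ger0_norm// ler_wpM2l.
have ciS : L1 mu (fun v : R => 2 / (1 + v ^+ 2) * SQ mu f).
  by have := L1_Z (SQ mu f) ci; congr (L1 mu _); apply/funext => v; rewrite mulrC.
have IS : RI mu (fun v : R => 2 / (1 + v ^+ 2) * SQ mu f) = 2 * pi * SQ mu f.
  by rewrite -cI mulrC -(RI_Z _ ci); apply: eq_RI => v; rewrite mulrC.
have Sle n : S n <= 2 * pi * SQ mu f.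
  rewrite -IS; apply: RI_le => //; first exact: (@L1_le _ _ _ mu _ _ (mS n) ciS).
  by move=> v; rewrite (le_trans (ler_norm _)).
have Scvg : S n @[n --> \oo] --> 2 * pi * SQ mu f.
  rewrite -IS; have mlim := L1_measurable ciS.
  have ae : {ae mu, forall v : R, forall n, `|2 / (1 + v ^+ 2) * acorr (harmonic n * v)| <= 2 / (1 + v ^+ 2) * SQ mu f}.
    by apply: nearW => v n; exact: bS.
  have [|_ c] := @RI_dct _ _ _ mu _ _ _ mS mlim _ ciS ae; last exact: c.
  apply: nearW => v; apply: cvgM; first exact: cvg_cst.
  apply: acorr_cvg; have -> : 0 = 0 * v by rewrite mul0r.
  by apply: cvgM; [exact: cvg_harmonic|exact: cvg_cst].
(* The exponent is halved so that the square of [g n] carries the Abel factor with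
   [e = harmonic n]. *)
pose g n (k : R) : R[i] := (expR (- (harmonic n / 2 * `|k|)))%:C * FT1 f k.
have gE n k : normc (g n k) ^+ 2 = expR (- (harmonic n * `|k|)) * normc (FT1 f k) ^+ 2.
  rewrite Normc.normcM exprMn normc_real gtr0_norm ?expR_gt0// expr2 -expRD.
  by congr (expR _ * _); field.
have mg n : cmeas (g n).
  apply: cmeasM; last exact: cmeas_FT1.
  apply: cmeas_real; apply: measurableT_comp => //; apply: measurableT_comp => //.
  by apply: measurable_funM => //; exact: measurableT_comp.
have Lg n : L2 mu (g n) /\ SQ mu (g n) = S n.
  have [i I] := FT1_abel (h0 n).
  rewrite /SQ /L2 (funext (gE n)); split; [split; [exact: mg|exact: i]|exact: I].
have gcvg k : normc (g n k) @[n --> \oo] --> normc (FT1 f k).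
  have E n : normc (g n k) = expR (- (harmonic n / 2 * `|k|)) * normc (FT1 f k).
    by rewrite Normc.normcM normc_real gtr0_norm// expR_gt0.
  rewrite (funext E); suff : expR (- (harmonic n / 2 * `|k|)) @[n --> \oo] --> (1 : R).
    by move=> /cvgM/(_ (cvg_cst (normc (FT1 f k)))); rewrite mul1r.
  have c0n : - (harmonic n / 2 * `|k|) @[n --> \oo] --> - (0 / 2 * `|k|).
    apply: cvgN; apply: cvgM; last exact: cvg_cst.
    by apply: cvgM; [exact: cvg_harmonic|exact: cvg_cst].
  have : expR (- (harmonic n / 2 * `|k|)) @[n --> \oo] --> expR (- (0 / 2 * `|k|)).
    by apply: continuous_cvg c0n; exact: continuous_expR.
  by rewrite !mul0r oppr0 expR0.
have [Lf _] : L2 mu (FT1 f) /\ SQ mu (FT1 f) <= 2 * pi * SQ mu f.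
  apply: (@SQ_fatou _ _ _ mu g) => //; [by move=> n; exact: (Lg n).1|exact: cmeas_FT1| |].
    exact: nearW.
  by move=> n; rewrite (Lg n).2.
split=> //.
have D : SQ mu (g n) @[n --> \oo] --> SQ mu (FT1 f).
  have bg n k : `|normc (g n k) ^+ 2| <= normc (FT1 f k) ^+ 2.
    rewrite gE ger0_norm ?mulr_ge0 ?sqr_ge0 ?expR_ge0// ler_piMl ?sqr_ge0//.
    by rewrite expR_le1 oppr_le0 mulr_ge0// ltW.
  have mg2 n := measurable_sqr_normc (mg n).
  have ae : {ae mu, forall k : R, forall n, `|normc (g n k) ^+ 2| <= normc (FT1 f k) ^+ 2}.
    by apply: nearW => k n; exact: bg.
  have [|_ c] := @RI_dct _ _ _ mu _ _ _ mg2 (L1_measurable Lf.2) _ Lf.2 ae; last exact: c.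
  by apply: nearW => k; rewrite expr2; under eq_cvg do rewrite expr2; exact: cvgM.
apply: (cvg_unique _ D); first exact: Rhausdorff.
by rewrite /= (funext (fun n => (Lg n).2)).
Qed.

End plancherel_line.

(** * Plancherel's theorem on R^n *)

Section lebesgue_Rn_integral.
Context {R : realType}.
Local Notation mu := (@lebesgue_measure R).
Local Notation leb n := (@lebesgueRn R n).

Lemma integral_cons n (f : Rn R n.+1 -> \bar R) : measurable_fun setT f ->
  (forall x, (0 <= f x)%E) ->
  (\int[leb n.+1]_x f x = \int[mu \x leb n]_p f (cons_pair p))%E.
Proof.
move=> mf f0.
transitivity (\int[pushforward (mu \x leb n) (@cons_pair R n)]_x f x)%E; last first.
  rewrite (@ge0_integral_pushforward _ _ _ _ _ _ (@measurable_cons_pair R n)) ?preimage_setT//.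
by apply: eq_measure_integral; first exact: measurable_cons_pair.
Qed.

Lemma RI_cons n (f : Rn R n.+1 -> R) : measurable_fun setT f ->
  L1 (mu \x leb n)%E (fun p => f (cons_pair p)) ->
  L1 (leb n.+1) f /\ RI (leb n.+1) f = RI (mu \x leb n)%E (fun p => f (cons_pair p)).
Proof.
move=> mf fi; have mE : measurable_fun setT (EFin \o f) by exact/measurable_EFinP.
split.
  apply/integrableP; split=> //; have /integrableP[_] := fi; congr (_ < _)%E.
  by rewrite integral_cons//; exact: measurableT_comp.
congr fine.
transitivity (\int[pushforward (mu \x leb n) (@cons_pair R n)]_x (f x)%:E)%E; last first.
  by rewrite (@integral_pushforward _ _ _ _ _ _ (@measurable_cons_pair R n)) ?preimage_setT.
by apply: eq_measure_integral; first exact: measurable_cons_pair.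
Qed.

Lemma cmeas_cons n (f : Rn R n.+1 -> R[i]) : cmeas f -> cmeas (fun p => f (cons_pair p)).
Proof. by move=> mf; exact: (cmeas_comp mf (@measurable_cons_pair R n)). Qed.

Lemma measurable_dotRn n d (T : measurableType d) (f g : T -> Rn R n) :
  measurable_fun setT f -> measurable_fun setT g ->
  measurable_fun setT (fun x => dotRn (f x) (g x)).
Proof.
move=> mf mg; apply: measurable_sum => i; apply: measurable_funM.
  exact: (measurableT_comp (measurable_tnth i) mf).
exact: (measurableT_comp (measurable_tnth i) mg).
Qed.

Lemma dotRn_cons n a b (k x : Rn R n) :
  dotRn (cons_pair (a, k)) (cons_pair (b, x)) = a * b + dotRn k x.
Proof.
by rewrite /dotRn big_ord_recl; congr (_ + _); apply: eq_bigr => i _; rewrite !tnthS.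
Qed.

Lemma tnth_cons_pair0 n a (x : Rn R n) : tnth (cons_pair (a, x)) ord0 = a.
Proof. by []. Qed.

Lemma tnth_cons_pairS n a (x : Rn R n) i : tnth (cons_pair (a, x)) (lift ord0 i) = tnth x i.
Proof. exact: tnthS. Qed.

End lebesgue_Rn_integral.

Section plancherel_Rn.
Context {R : realType}.
Local Notation mu := (@lebesgue_measure R).
Local Notation leb n := (@lebesgueRn R n).
Local Notation normc := Normc.normc.

(** Boxes are products of intervals, which the induction on the dimension needs; the balls of
    [fourier_ball] are contained in them. *)
Definition box n (N : R) : set (Rn R n) := [set x | forall i, `|tnth x i| <= N].

Definition FT n (f : Rn R n -> R[i]) (k : Rn R n) : R[i] :=
  CI (leb n) (fun x => f x * cis (dotRn k x)).

Lemma FT1_0 (f : R -> R[i]) k : (forall x, f x = 0) -> FT1 f k = 0.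
Proof.
move=> f0; rewrite /FT1 (_ : (fun x => _) = fun=> 0); last by apply/funext => x; rewrite f0 mul0r.
by apply: complex_eq; rewrite /CI /= RI_0.
Qed.

Lemma cmeas_kernel n (f : Rn R n -> R[i]) : cmeas f ->
  cmeas (fun p : Rn R n * Rn R n => f p.2 * cis (dotRn p.1 p.2)).
Proof.
move=> mf; apply: cmeasM; first exact: (cmeas_comp mf).
by apply: cmeas_cis; exact: measurable_dotRn.
Qed.

Lemma cmeas_FT n (f : Rn R n -> R[i]) : cmeas f -> cmeas (FT f).
Proof. by move=> mf; exact: (cmeas_CI_param (leb n) (cmeas_kernel mf)). Qed.

Lemma L1_dirac d (T : measurableType d) (a : T) (f : T -> R) : measurable_fun setT f ->
  L1 (\d_a) f /\ RI (\d_a) f = f a.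
Proof.
move=> mf; have mE : measurable_fun setT (EFin \o f) by exact/measurable_EFinP.
split; last by rewrite /Rintegral integral_dirac// diracT mul1e.
apply/integrableP; split=> //.
by rewrite integral_dirac ?diracT ?mul1e ?ltry//; exact: measurableT_comp.
Qed.

Definition bounded_on_box n (f : Rn R n -> R[i]) (M N : R) :=
  [/\ cmeas f, forall x, normc (f x) <= M & forall x, ~ box N x -> f x = 0].

Lemma bounded_on_box_slice1 n (f : Rn R n.+1 -> R[i]) M N y : bounded_on_box f M N ->
  [/\ cmeas (fun a : R => f (cons_pair (a, y))), forall a, normc (f (cons_pair (a, y))) <= M &
   forall a, N < `|a| -> f (cons_pair (a, y)) = 0].
Proof.
move=> [mf fM f0]; split => //.
  exact: (cmeas_comp (cmeas_cons mf) (measurable_pair2 y)).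
by move=> a Na; apply: f0 => /(_ ord0); rewrite tnth_cons_pair0 leNgt Na.
Qed.

(** The partial transform in the first variable is again bounded and supported in a box: this keeps
    the class stable under the induction on the dimension. *)
Lemma bounded_on_box_FT1 n (f : Rn R n.+1 -> R[i]) M N k : bounded_on_box f M N ->
  bounded_on_box (fun y => FT1 (fun a => f (cons_pair (a, y))) k) (RI mu (fun x => \1_`[- N, N] x * M)) N.
Proof.
move=> bf; have [mf fM f0] := bf; split.
- apply: (@cmeas_CI_param _ _ _ (measurableTypeR R) R mu (fun p => f (cons_pair (p.2, p.1)) * cis (k * p.2))).
  apply: cmeasM; last by apply: cmeas_cis; exact: measurable_funM.
  by apply: (cmeas_comp (cmeas_cons mf)); exact: measurable_fun_pair.
- by move=> y; have [h1 h2 h3] := bounded_on_box_slice1 y bf; exact: FT1_le.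
- move=> y ny; apply: FT1_0 => a; apply: f0 => h; apply: ny => i.
  by have := h (lift ord0 i); rewrite tnth_cons_pairS.
Qed.

Lemma measurable_box n N : measurable (@box n N).
Proof.
rewrite (_ : box N = \bigcap_(i in [set: 'I_n]) ((fun x => `|tnth x i|) @^-1` `]-oo, N])); last first.
  by apply/seteqP; split=> x /= h i => [_|]; [rewrite /= in_itv/=|have := h i I; rewrite /= in_itv/=].
apply: fin_bigcap_measurable => [|i _]; first exact: finite_finset.
rewrite -[X in measurable X]setTI.
have m : measurable_fun setT (fun x : Rn R n => `|tnth x i|).
  exact: (measurableT_comp (@normr_measurable R setT) (measurable_tnth i)).
exact: m.
Qed.

Lemma box_cons n N a (y : Rn R n) : box N (cons_pair (a, y)) <-> `|a| <= N /\ box N y.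
Proof.
split=> [h|[h0 h] i].
  split=> [|i]; first by have := h ord0; rewrite tnth_cons_pair0.
  by have := h (lift ord0 i); rewrite tnth_cons_pairS.
by case: (unliftP ord0 i) => [j|] ->; rewrite ?tnth_cons_pairS// tnth_cons_pair0.
Qed.

Lemma L1_box_bounded n (f : Rn R n -> R) (M N : R) : measurable_fun setT f ->
  (forall x, `|f x| <= M) -> (forall x, ~ box N x -> f x = 0) -> L1 (leb n) f.
Proof.
elim: n f M => [|n IH] f M mf fM f0; first exact: (L1_dirac _ mf).1.
have mfc := measurableT_comp mf (@measurable_cons_pair R n).
apply: (RI_cons mf _).1.
have i1 : L1 (leb n) (fun y => \1_(box N) y).
  apply: (IH _ 1); first by apply: measurable_indic; exact: measurable_box.
    by move=> x; rewrite indicE; case: (_ \in _); rewrite ?normr1 ?normr0.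
  by move=> x h; rewrite indicE memNset.
apply: (@L1_prodM _ _ _ _ _ mu (leb n) _ _ _ mfc (L1_itv_cst (- N) N M) i1) => a y /=.
rewrite indic_normr_le indicE.
have [b|nb] := pselect (box N (cons_pair (a, y))).
  by have [-> by'] := (box_cons _ _ _).1 b; rewrite mem_set// mulr1 mul1r.
rewrite f0// normr0; have M0 : 0 <= M by exact: le_trans (normr_ge0 _) (fM (cons_pair (a, y))).
by rewrite !mulr_ge0.
Qed.

Lemma bounded_on_box_L2 n (f : Rn R n -> R[i]) M N : bounded_on_box f M N -> L2 (leb n) f.
Proof.
move=> [mf fM f0]; split=> //; apply: (@L1_box_bounded _ _ (M ^+ 2) N).
- exact: measurable_sqr_normc.
- move=> x; rewrite ger0_norm ?sqr_ge0// ler_pXn2r ?nnegrE ?normc_ge0//.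
  exact: le_trans (normc_ge0 _) (fM x).
- by move=> x /f0 ->; rewrite Normc.normc0 expr0n.
Qed.

Lemma bounded_on_box_kernel n (f : Rn R n -> R[i]) M N k : bounded_on_box f M N ->
  bounded_on_box (fun x => f x * cis (dotRn k x)) M N.
Proof.
move=> [mf fM f0]; split; first exact: (cmeas_comp (cmeas_kernel mf) (measurable_pair1 k)).
  by move=> x; rewrite Normc.normcM normc_cis mulr1.
by move=> x /f0 ->; rewrite mul0r.
Qed.

Lemma CI_cons n (f : Rn R n.+1 -> R[i]) : cmeas f -> CL1 (mu \x leb n)%E (fun p => f (cons_pair p)) ->
  CI (leb n.+1) f = CI (leb n) (fun y => CI mu (fun a => f (cons_pair (a, y)))).
Proof.
move=> [m1 m2] [i1 i2]; apply: complex_eq => /=.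
  by rewrite (RI_cons m1 i1).2 -(RI_prod2 i1).2.
by rewrite (RI_cons m2 i2).2 -(RI_prod2 i2).2.
Qed.

Lemma bounded_on_box_cons_CL1 n (f : Rn R n.+1 -> R[i]) M N : bounded_on_box f M N ->
  CL1 (mu \x leb n)%E (fun p => f (cons_pair p)).
Proof.
move=> [mf fM f0]; have mfc := cmeas_cons mf.
have i1 : L1 (leb n) (fun y => \1_(box N) y).
  apply: (@L1_box_bounded _ _ 1 N); first by apply: measurable_indic; exact: measurable_box.
    by move=> x; rewrite indicE; case: (_ \in _); rewrite ?normr1 ?normr0.
  by move=> x h; rewrite indicE memNset.
have le a y : normc (f (cons_pair (a, y))) <= \1_`[- N, N] a * M * \1_(box N) y.
  rewrite indic_normr_le indicE.
  have [b|nb] := pselect (box N (cons_pair (a, y))).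
    by have [-> by'] := (box_cons _ _ _).1 b; rewrite mem_set// mulr1 mul1r.
  have M0 : 0 <= M by exact: le_trans (normc_ge0 _) (fM (cons_pair (a, y))).
  by rewrite f0// Normc.normc0 !mulr_ge0.
split; apply: (@L1_prodM _ _ _ _ _ mu (leb n) _ _ _ _ (L1_itv_cst (- N) N M) i1).
- exact: mfc.1.
- by move=> a y; exact: le_trans (normr_Re_le _) (le a y).
- exact: mfc.2.
- by move=> a y; exact: le_trans (normr_Im_le _) (le a y).
Qed.

Lemma FT_cons n (f : Rn R n.+1 -> R[i]) M N a k : bounded_on_box f M N ->
  FT f (cons_pair (a, k)) = FT (fun y => FT1 (fun b => f (cons_pair (b, y))) a) k.
Proof.
move=> bf; have bk := bounded_on_box_kernel (cons_pair (a, k)) bf.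
rewrite /FT (CI_cons _ (bounded_on_box_cons_CL1 bk)); last by have [] := bk.
apply: eq_CI => y; have [h1 h2 h3] := bounded_on_box_slice1 y bf.
have fi : CL1 mu (fun b : R => f (cons_pair (b, y)) * cis (a * b)).
  apply: (CL1_le _ (L1_itv_cst (- N) N M)).
    by apply: cmeasM => //; apply: cmeas_cis; exact: measurable_funM.
  move=> b; rewrite Normc.normcM normc_cis mulr1 indic_normr_le.
  by have [h|h] := leP `|b| N; rewrite ?mul1r// h3// Normc.normc0 mul0r.
rewrite mulrC -(CI_Z _ fi); apply: eq_CI => b.
by rewrite dotRn_cons cisD mulrA mulrC.
Qed.

Lemma L1_cons_sqr n (h : Rn R n.+1 -> R[i]) (g : R -> R) : cmeas h -> L1 mu g ->
  (forall a, L2 (leb n) (fun k => h (cons_pair (a, k))) /\ SQ (leb n) (fun k => h (cons_pair (a, k))) = g a) ->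
  L2 (leb n.+1) h /\ SQ (leb n.+1) h = RI mu g.
Proof.
move=> mh gi hg; have m2 := measurable_sqr_normc mh.
have i : L1 (mu \x leb n)%E (fun p => normc (h (cons_pair p)) ^+ 2).
  apply: (@L1_prod _ _ _ _ _ mu (leb n) _ g) => //.
    exact: (measurableT_comp m2 (@measurable_cons_pair R n)).
  move=> a; have [[_ Li] <-] := hg a; rewrite /SQ (RI_EFin Li) le_eqVlt; apply/orP; left; apply/eqP.
  by apply: eq_integral => k _; rewrite ger0_norm ?sqr_ge0.
have [i1 E] := RI_cons m2 i; split=> //.
rewrite /SQ E -(RI_prod1 i).2; apply: eq_RI => a; exact: (hg a).2.
Qed.

(** For a fixed first frequency the induction hypothesis applies to the partial transform.
    Integrating over that frequency, exchanging the integrals and using [plancherel_line] in the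
    first variable gives one more factor [2 pi]. *)
Theorem plancherel_bounded n (f : Rn R n -> R[i]) M N : bounded_on_box f M N ->
  L2 (leb n) (FT f) /\ SQ (leb n) (FT f) = (2 * pi) ^+ n * SQ (leb n) f.
Proof.
elim: n f M => [|n IH] f M bf.
  (* In dimension 0 the measure is a Dirac mass and the kernel is 1. *)
  have -> : FT f = f.
    apply/funext => k; have [mf _ _] := bf; rewrite /FT /=.
    have E : (fun x : Rn R 0 => f x * cis (dotRn k x)) = f.
      by apply/funext => x; rewrite /dotRn big_ord0; apply: complex_eq; rewrite ?cReM ?cImM /= cos0 sin0; ring.
    rewrite E (tuple0 k); apply: complex_eq => /=.
      exact: (L1_dirac _ mf.1).2.
    exact: (L1_dirac _ mf.2).2.
  by rewrite expr0 mul1r; split=> //; exact: (bounded_on_box_L2 bf).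
have [mf fM f0] := bf.
pose P (p : Rn R n * R) := normc (FT1 (fun b => f (cons_pair (b, p.1))) p.2) ^+ 2.
have cP : cmeas (fun p : Rn R n * R => FT1 (fun b => f (cons_pair (b, p.1))) p.2).
  apply: (@cmeas_CI_param _ _ _ (measurableTypeR R) R mu
    (fun q : Rn R n * R * R => f (cons_pair (q.2, q.1.1)) * cis (q.1.2 * q.2))).
  apply: cmeasM.
    apply: (cmeas_comp (cmeas_cons mf)); apply: measurable_fun_pair => //.
    exact: measurableT_comp.
  by apply: cmeas_cis; apply: measurable_funM => //; exact: measurableT_comp.
have mP : measurable_fun setT P by exact: (measurable_sqr_normc cP).
have sl y : L2 mu (FT1 (fun b => f (cons_pair (b, y)))) /\
    SQ mu (FT1 (fun b => f (cons_pair (b, y)))) = 2 * pi * SQ mu (fun b => f (cons_pair (b, y))).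
  by have [h1 h2 h3] := bounded_on_box_slice1 y bf; exact: (plancherel_line h1 h2 h3).
have f2i : L1 (mu \x leb n)%E (fun p => normc (f (cons_pair p)) ^+ 2).
  have fsq : bounded_on_box (fun x => (normc (f x) ^+ 2)%:C) (M ^+ 2) N.
    split; first by apply: cmeas_real; exact: measurable_sqr_normc.
      move=> x; rewrite normc_real ger0_norm ?sqr_ge0// ler_pXn2r ?nnegrE ?normc_ge0//.
      exact: le_trans (normc_ge0 _) (fM x).
    by move=> x /f0 ->; rewrite Normc.normc0 expr0n.
  exact: (bounded_on_box_cons_CL1 fsq).1.
have [f2s f2E] := RI_prod2 f2i.
have Pi : L1 (leb n \x mu)%E P.
  apply: (@L1_prod _ _ _ _ _ (leb n) mu P _ mP (L1_Z (2 * pi) f2s)) => y.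
  have [[_ Li] E] := sl y; rewrite -[X in (_ <= X%:E)%E]E /SQ (RI_EFin Li) le_eqVlt.
  by apply/orP; left; apply/eqP; apply: eq_integral => k _; rewrite ger0_norm ?sqr_ge0.
have [gi gE] := RI_prod2 Pi.
have [|L E] := L1_cons_sqr (cmeas_FT mf) (L1_Z ((2 * pi) ^+ n) gi).
  move=> a; have := IH _ _ (bounded_on_box_FT1 a bf).
  rewrite (_ : FT _ = (fun k => FT f (cons_pair (a, k)))) //.
  by apply/funext => k; rewrite (FT_cons _ _ bf).
split=> //; rewrite E (RI_Z _ gi) gE -(RI_prod1 Pi).2.
have -> : RI (leb n) (fun y => RI mu (fun k => P (y, k))) = RI (leb n) (fun y => 2 * pi * RI mu (fun b => normc (f (cons_pair (b, y))) ^+ 2)).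
  by apply: eq_RI => y; exact: (sl y).2.
rewrite (RI_Z _ f2s) f2E /SQ (RI_cons (measurable_sqr_normc mf) f2i).2 exprS.
by rewrite mulrCA !mulrA.
Qed.

End plancherel_Rn.

Lemma cvg0_squeeze (R : realType) (u v : nat -> R) : (forall j, 0 <= u j <= v j) ->
  v j @[j --> \oo] --> (0 : R) -> u j @[j --> \oo] --> (0 : R).
Proof.
move=> uv cv; apply: (squeeze_cvgr _ (cvg_cst (0 : R)) cv).
by apply: nearW => j; exact: uv.
Qed.

(** * From bounded functions to square-integrable functions supported in a box *)

Section fourier_box.
Context {R : realType} (n : nat).
Local Notation leb := (@lebesgueRn R n).
Local Notation normc := Normc.normc.
Implicit Types f g : Rn R n -> R[i].

Let c : R := (2 * pi) ^+ n.

Lemma L1_indic_box (N : R) : L1 leb (fun x => \1_(box N) x).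
Proof.
apply: (@L1_box_bounded _ _ _ 1 N); first by apply: measurable_indic; exact: measurable_box.
  by move=> x; rewrite indicE; case: (_ \in _); rewrite ?normr1 ?normr0.
by move=> x h; rewrite indicE memNset.
Qed.

Lemma L2_box_CL1 f (N : R) : L2 leb f -> (forall x, ~ box N x -> f x = 0) -> CL1 leb f.
Proof.
move=> [mf fi] f0; apply: (CL1_le mf (L1_D (L1_indic_box N) fi)) => x.
have [b|b] := pselect (box N x); last first.
  by rewrite f0// Normc.normc0 expr0n addr0 indicE.
rewrite indicE mem_set//; have := sqr_ge0 (normc (f x) - 1); have := normc_ge0 (f x).
have -> : (normc (f x) - 1) ^+ 2 = normc (f x) ^+ 2 - 2 * normc (f x) + 1 by ring.
by move: (normc (f x) ^+ 2) => b2 /=; lra.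
Qed.

Lemma CL1_kernel f k : CL1 leb f -> CL1 leb (fun x => f x * cis (dotRn k x)).
Proof.
move=> fi; have mf := CL1_cmeas fi.
apply: (CL1_le (cmeas_comp (cmeas_kernel mf) (measurable_pair1 k)) (CL1_normc fi)) => x /=.
by rewrite Normc.normcM normc_cis mulr1.
Qed.

Lemma FT_B f g : CL1 leb f -> CL1 leb g ->
  FT (fun x => f x - g x) = fun k => FT f k - FT g k.
Proof.
move=> fi gi; apply/funext => k; rewrite /FT -(CI_B (CL1_kernel k fi) (CL1_kernel k gi)).
by apply: eq_CI => x; rewrite mulrBl.
Qed.

Lemma FT_Z (z : R[i]) f : CL1 leb f -> FT (fun x => z * f x) = fun k => z * FT f k.
Proof.
move=> fi; apply/funext => k; rewrite /FT -(CI_Z z (CL1_kernel k fi)).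
by apply: eq_CI => x; rewrite mulrA.
Qed.

(** The multiplication formula: Fubini and the symmetry of the kernel in its two arguments. It
    provides the inner product in [fourier_surj_box]. *)
Lemma FT_pairing f g : CL1 leb f -> CL1 leb g ->
  RI leb (fun k => complex.Re (FT f k * g k)) = RI leb (fun x => complex.Re (f x * FT g x)).
Proof.
move=> fi gi; have mf := CL1_cmeas fi; have mg := CL1_cmeas gi.
pose h (p : Rn R n * Rn R n) := complex.Re (f p.2 * cis (dotRn p.1 p.2) * g p.1).
have mh : measurable_fun setT h.
  by apply: (cmeasM (cmeas_kernel mf) _).1; exact: (cmeas_comp mg).
have hi : L1 (leb \x leb)%E h.
  apply: (@L1_prodM _ _ _ _ _ leb leb _ _ _ mh (CL1_normc gi) (CL1_normc fi)) => k x.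
  by rewrite (le_trans (normr_Re_le _))// !Normc.normcM normc_cis mulr1 mulrC.
have E1 k : RI leb (fun x => h (k, x)) = complex.Re (FT f k * g k).
  by rewrite mulrC -(CI_Z _ (CL1_kernel k fi)); apply: eq_RI => x; rewrite /h /= mulrC.
have E2 x : RI leb (fun k => h (k, x)) = complex.Re (f x * FT g x).
  rewrite -(CI_Z _ (CL1_kernel x gi)); apply: eq_RI => k; rewrite /h /= -mulrA; congr (complex.Re (_ * _)).
  by rewrite mulrC; congr (_ * cis _); apply: eq_bigr => i _; rewrite mulrC.
by rewrite -(eq_RI leb E1) (RI_fubini hi) (eq_RI leb E2).
Qed.

(** Truncation by the size of the values, which produces functions in the scope of
    [plancherel_bounded]. *)
Definition trunc f (j : nat) x : R[i] := (\1_[set x | normc (f x) <= j%:R] x)%:C * f x.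

Lemma trunc_cases f j x : trunc f j x = if normc (f x) <= j%:R then f x else 0.
Proof.
rewrite /trunc indicE; case: ifPn => h; first by rewrite mem_set// mul1r.
by rewrite memNset ?mul0r//=; exact/negP.
Qed.

Lemma trunc_bounded_on_box f N j : cmeas f -> (forall x, ~ box N x -> f x = 0) ->
  bounded_on_box (trunc f j) j%:R N.
Proof.
move=> mf f0; split.
- apply: cmeasM => //; apply: cmeas_real; apply: measurable_indic.
  rewrite (_ : [set x | _] = (fun x => normc (f x)) @^-1` `]-oo, j%:R]); last first.
    by apply/seteqP; split=> x /=; rewrite in_itv.
  by rewrite -[X in measurable X]setTI; exact: (cmeas_normc mf).
- by move=> x; rewrite trunc_cases; case: ifP => // _; rewrite Normc.normc0.
- by move=> x /f0 fx; rewrite /trunc fx mulr0.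
Qed.

Lemma trunc_eventually f x : \forall j \near \oo, trunc f j x = f x.
Proof.
near=> j; rewrite trunc_cases ifT//; near: j.
exact: (@nbhs_infty_ger R).
Unshelve. all: by end_near. Qed.

Lemma trunc_L2 f N j : L2 leb f -> (forall x, ~ box N x -> f x = 0) ->
  L2 leb (trunc f j) /\ SQ leb (trunc f j) <= SQ leb f.
Proof.
move=> Lf f0; have [m _ _] := trunc_bounded_on_box j Lf.1 f0.
have := @L2_le _ _ _ leb (trunc f j) f 1 m Lf; rewrite mul1r; apply => x.
rewrite mul1r trunc_cases; case: ifP => // _; by rewrite Normc.normc0 expr0n sqr_ge0.
Qed.

Lemma SQ_dct (f_ : nat -> Rn R n -> R[i]) f (h : Rn R n -> R) :
  (forall j, L2 leb (f_ j)) -> L2 leb f -> L1 leb h ->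
  (forall j x, normc (f_ j x - f x) ^+ 2 <= h x) ->
  {ae leb, forall x, normc (f_ j x - f x) @[j --> \oo] --> (0 : R)} ->
  SQ leb (fun x => f_ j x - f x) @[j --> \oo] --> (0 : R).
Proof.
move=> Lf_ Lf hi le cv.
have m j := measurable_sqr_normc (L2_B (Lf_ j) Lf).1.1.
have ae : {ae leb, forall x, forall j, `|normc (f_ j x - f x) ^+ 2| <= h x}.
  by apply: nearW => x j; rewrite ger0_norm ?sqr_ge0.
have m0 : measurable_fun setT (fun _ : Rn R n => 0 : R) by [].
have [|_] := @RI_dct _ _ _ leb _ _ _ m m0 _ hi ae; last by rewrite RI_0.
apply: filterS cv => x cx; have -> : 0 = 0 * 0 :> R by rewrite mul0r.
by under eq_cvg do rewrite expr2; exact: cvgM.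
Qed.

Lemma trunc_cvg f N : L2 leb f -> (forall x, ~ box N x -> f x = 0) ->
  SQ leb (fun x => trunc f j x - f x) @[j --> \oo] --> (0 : R).
Proof.
move=> Lf f0; apply: (@SQ_dct _ _ (fun x => normc (f x) ^+ 2)) => //.
- by move=> j; exact: (trunc_L2 j Lf f0).1.
- exact: Lf.2.
- move=> j x; rewrite trunc_cases; case: ifP => _; first by rewrite subrr Normc.normc0 expr0n sqr_ge0.
  by rewrite sub0r normcN.
- apply: nearW => x; apply: cvg_near_cst; apply: filterS (trunc_eventually f x) => j ->.
  by rewrite subrr Normc.normc0.
Qed.

Lemma CI_dct (f_ : nat -> Rn R n -> R[i]) f (h : Rn R n -> R) : (forall j, cmeas (f_ j)) -> cmeas f -> L1 leb h ->
  (forall j x, normc (f_ j x) <= h x) -> (forall x, \forall j \near \oo, f_ j x = f x) ->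
  normc (CI leb (f_ j)) @[j --> \oo] --> normc (CI leb f).
Proof.
move=> mf_ mf hi le cv.
have p (q : R[i] -> R) : (forall z, `|q z| <= normc z) -> (forall j, measurable_fun setT (fun x => q (f_ j x))) ->
    measurable_fun setT (fun x => q (f x)) ->
    RI leb (fun x => q (f_ j x)) @[j --> \oo] --> RI leb (fun x => q (f x)).
  move=> qn mq_ mq.
  have ae : {ae leb, forall x, forall j, `|q (f_ j x)| <= h x}.
    by apply: nearW => x j; exact: le_trans (qn _) (le j x).
  have [|_] := @RI_dct _ _ _ leb _ _ _ mq_ mq _ hi ae => //.
  by apply: nearW => x; apply: cvg_near_cst; apply: filterS (cv x) => j ->.
have c1 := p _ (@normr_Re_le R) (fun j => (mf_ j).1) mf.1.
have c2 := p _ (@normr_Im_le R) (fun j => (mf_ j).2) mf.2.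
rewrite /CI /=; apply: continuous_cvg; first exact: sqrt_continuous.
by rewrite !expr2; under eq_cvg do rewrite !expr2; apply: cvgD; exact: cvgM.
Qed.

Let c0 : 0 <= c. Proof. by rewrite exprn_ge0// mulr_ge0// pi_ge0. Qed.

(** Fatou along the truncations gives only an inequality. Applied to [trunc f j - f], it yields the
    L2 convergence of the transforms, from which [plancherel_box] obtains the equality. *)
Let FT_box_le f N : L2 leb f -> (forall x, ~ box N x -> f x = 0) ->
  L2 leb (FT f) /\ SQ leb (FT f) <= c * SQ leb f.
Proof.
move=> Lf f0; have fi := L2_box_CL1 Lf f0.
apply: (@SQ_fatou _ _ _ leb (fun j => FT (trunc f j))).
- by move=> j; exact: (plancherel_bounded (trunc_bounded_on_box j Lf.1 f0)).1.
- exact: (cmeas_FT Lf.1).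
- apply: nearW => k; rewrite /FT; apply: (@CI_dct _ _ (fun x => normc (f x))).
  + by move=> j; have [m _ _] := bounded_on_box_kernel k (trunc_bounded_on_box j Lf.1 f0).
  + exact: (CL1_cmeas (CL1_kernel k fi)).
  + exact: CL1_normc.
  + move=> j x; rewrite Normc.normcM normc_cis mulr1 trunc_cases; case: ifP => // _.
    by rewrite Normc.normc0 normc_ge0.
  + by move=> x; apply: filterS (trunc_eventually f x) => j ->.
- move=> j; rewrite (plancherel_bounded (trunc_bounded_on_box j Lf.1 f0)).2.
  by rewrite ler_wpM2l// (trunc_L2 j Lf f0).2.
Qed.

Theorem plancherel_box f N : L2 leb f -> (forall x, ~ box N x -> f x = 0) ->
  L2 leb (FT f) /\ SQ leb (FT f) = c * SQ leb f.
Proof.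
move=> Lf f0; have [LF _] := FT_box_le Lf f0; split=> //.
have bj j := trunc_bounded_on_box j Lf.1 f0.
have Lj j := (plancherel_bounded (bj j)).1.
have cf := SQ_cvg (fun j => (trunc_L2 j Lf f0).1) Lf (trunc_cvg Lf f0).
have d0 : SQ leb (fun k => FT (trunc f j) k - FT f k) @[j --> \oo] --> (0 : R).
  have cc : c * SQ leb (fun x => trunc f j x - f x) @[j --> \oo] --> (0 : R).
    by rewrite -(mulr0 c); apply: cvgM; [exact: cvg_cst|exact: trunc_cvg Lf f0].
  apply: (cvg0_squeeze _ cc) => j; rewrite SQ_ge0/=.
  have Lt := (trunc_L2 j Lf f0).1.
  have t0 x : ~ box N x -> trunc f j x = 0 by have [_ _] := bj j; apply.
  rewrite -(FT_B (L2_box_CL1 Lt t0) (L2_box_CL1 Lf f0)).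
  apply: (FT_box_le (N := N) (L2_B Lt Lf).1 _).2 => x bx.
  by rewrite f0// t0// subrr.
have cF := SQ_cvg Lj LF d0.
apply: (cvg_unique _ cF); first exact: Rhausdorff.
rewrite /= (funext (fun j => (plancherel_bounded (bj j)).2)).
by apply: cvgM => //; exact: cvg_cst.
Qed.

End fourier_box.

(** * The Fourier-Plancherel transform: isometry and surjectivity *)

Section fourier_plancherel.
Context {R : realType} (n : nat).
Local Notation leb := (@lebesgueRn R n).
Local Notation normc := Normc.normc.
Implicit Types f g F G : Rn R n -> R[i].

Let c : R := (2 * pi) ^+ n.

Let c_gt0 : 0 < c. Proof. by rewrite exprn_gt0// mulr_gt0// pi_gt0. Qed.

Lemma normL2E f : normL2 f = sqrte (\int[leb]_x (normc (f x) ^+ 2)%:E)%E.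
Proof.
rewrite /normL2 unlock poweR12_sqrt; last by apply: integral_ge0 => x _; rewrite poweR_ge0.
congr sqrte; apply: eq_integral => x _.
by rewrite gee0_abs ?lee_fin ?normc_ge0// poweR_EFin powR_mulrn ?normc_ge0.
Qed.

Lemma in_L2E f : in_L2 f <-> L2 leb f.
Proof.
split=> [[m1 m2]|[[m1 m2] fi]].
  rewrite normL2E => h; have mf : cmeas f by [].
  split=> //; apply/integrableP; split; first by apply/measurable_EFinP; exact: measurable_sqr_normc.
  rewrite (eq_integral (fun x => (normc (f x) ^+ 2)%:E)); last first.
    by move=> x _ /=; rewrite ger0_norm ?sqr_ge0.
  by move: h; case: (\int[leb]_x _)%E => // r _; rewrite ltry.
by split=> //; rewrite normL2E -(RI_EFin fi) /= ltry.
Qed.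

Lemma normL2_SQ f : L2 leb f -> normL2 f = (Num.sqrt (SQ leb f))%:E.
Proof. by move=> [_ fi]; rewrite normL2E -(RI_EFin fi). Qed.

Lemma normL2_cvg0 (I : Type) (H : set_system I) {FH : Filter H} (h : I -> Rn R n -> R[i]) :
  (forall t, L2 leb (h t)) -> SQ leb (h t) @[t --> H] --> (0 : R) ->
  normL2 (h t) @[t --> H] --> 0%E.
Proof.
move=> Lh c0; rewrite (funext (fun t => normL2_SQ (Lh t))).
apply: cvg_EFin; first exact: nearW.
by rewrite -(@sqrtr0 R); apply: continuous_cvg c0; exact: sqrt_continuous.
Qed.

Lemma SQ_cvg0 (h : nat -> Rn R n -> R[i]) : (forall j, L2 leb (h j)) ->
  normL2 (h j) @[j --> \oo] --> 0%E -> SQ leb (h j) @[j --> \oo] --> (0 : R).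
Proof.
move=> Lh; rewrite (funext (fun t => normL2_SQ (Lh t))) => /fine_cvgP[_ c0].
have -> : (fun j => SQ leb (h j)) = (fun j => Num.sqrt (SQ leb (h j)) * Num.sqrt (SQ leb (h j))).
  by apply/funext => j; rewrite -expr2 sqr_sqrtr// SQ_ge0.
have -> : 0 = 0 * 0 :> R by rewrite mul0r.
by apply: cvgM; exact: c0.
Qed.

Definition ball_Rn (r : R) : set (Rn R n) := [set x | sqnormRn x <= r ^+ 2].

Definition cut f (r : R) x : R[i] := (\1_(ball_Rn r) x)%:C * f x.

Lemma ball_box r x : 0 <= r -> ball_Rn r x -> box r x.
Proof.
move=> r0; rewrite /ball_Rn /= /sqnormRn /dotRn => h i.
rewrite -(@ler_pXn2r _ 2)// ?nnegrE// real_normK ?num_real//.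
apply: le_trans h; rewrite (bigD1 i)//= -expr2 lerDl.
by apply: sumr_ge0 => j _; rewrite -expr2 sqr_ge0.
Qed.

Lemma measurable_ball r : measurable (ball_Rn r).
Proof.
rewrite (_ : ball_Rn r = (fun x => sqnormRn x) @^-1` `]-oo, r ^+ 2]); last first.
  by apply/seteqP; split=> x /=; rewrite /ball_Rn/= in_itv.
by rewrite -[X in measurable X]setTI; exact: measurable_dotRn.
Qed.

Lemma cut_cases f r x : cut f r x = if sqnormRn x <= r ^+ 2 then f x else 0.
Proof.
rewrite /cut indicE; case: ifPn => h; first by rewrite mem_set// mul1r.
by rewrite memNset ?mul0r//=; exact/negP.
Qed.

Lemma cut_box f r x : 0 <= r -> ~ box r x -> cut f r x = 0.
Proof. by move=> r0 nb; rewrite cut_cases; case: ifP => // /(ball_box r0). Qed.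

Lemma cut_L2 f r : L2 leb f -> L2 leb (cut f r) /\ SQ leb (cut f r) <= SQ leb f.
Proof.
move=> Lf; have m : cmeas (cut f r).
  apply: cmeasM; last exact: Lf.1.
  by apply: cmeas_real; apply: measurable_indic; exact: measurable_ball.
have := @L2_le _ _ _ leb (cut f r) f 1 m Lf; rewrite mul1r; apply => x.
rewrite mul1r cut_cases; case: ifP => // _; by rewrite Normc.normc0 expr0n sqr_ge0.
Qed.

Lemma cut_eventually f x : \forall N \near \oo, cut f N%:R x = f x.
Proof.
near=> N; rewrite cut_cases ifT//.
have h : sqnormRn x <= N%:R by near: N; exact: (@nbhs_infty_ger R).
have N1 : (1 : R) <= N%:R by near: N; exact: (@nbhs_infty_ger R).
by rewrite (le_trans h)// expr2 ler_peMr// (le_trans ler01).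
Unshelve. all: by end_near. Qed.

Lemma cut_cvg f : L2 leb f -> SQ leb (fun x => cut f N%:R x - f x) @[N --> \oo] --> (0 : R).
Proof.
move=> Lf; apply: (@SQ_dct _ _ _ _ (fun x => normc (f x) ^+ 2)) => //.
- by move=> j; exact: (cut_L2 _ Lf).1.
- exact: Lf.2.
- move=> j x; rewrite cut_cases; case: ifP => _; first by rewrite subrr Normc.normc0 expr0n sqr_ge0.
  by rewrite sub0r normcN.
- apply: nearW => x; apply: cvg_near_cst; apply: filterS (cut_eventually f x) => j ->.
  by rewrite subrr Normc.normc0.
Qed.

Lemma fourier_ballE f r : fourier_ball f r = FT (cut f r).
Proof.
apply/funext => k; rewrite /fourier_ball /Cintegral /FT.
have E (q : R[i] -> R) : q 0 = 0 ->
    (\int[leb]_(x in [set x | (sqnormRn x <= r ^+ 2)%R]) q (f x * (cos (dotRn k x) -i* sin (dotRn k x))))%R =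
    RI leb (fun x => q (cut f r x * cis (dotRn k x))).
  move=> q0; rewrite Rintegral_mkcond; apply: eq_Rintegral => x _.
  rewrite patchE cut_cases; case: ifPn; first by rewrite inE/= => ->.
  by rewrite notin_setE/= => /negP/negbTE ->; rewrite mul0r q0.
by apply: complex_eq; rewrite /= E.
Qed.

Lemma cut_FT f N : 0 <= N -> L2 leb f ->
  L2 leb (FT (cut f N)) /\ SQ leb (FT (cut f N)) = c * SQ leb (cut f N).
Proof.
by move=> N0 Lf; apply: (plancherel_box (N := N) (cut_L2 N Lf).1) => x; exact: cut_box.
Qed.

Lemma cut_CL1 f N : 0 <= N -> L2 leb f -> CL1 leb (cut f N).
Proof. by move=> N0 Lf; apply: (L2_box_CL1 (cut_L2 N Lf).1 (fun x => @cut_box f N x N0)). Qed.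

Definition fourier_pair f F := [/\ L2 leb f, L2 leb F &
  SQ leb (fun k => FT (cut f N%:R) k - F k) @[N --> \oo] --> (0 : R)].

Lemma is_fourierE f F : is_fourier f F <-> fourier_pair f F.
Proof.
split.
  move=> [/in_L2E Lf /in_L2E LF h]; split=> //; apply: SQ_cvg0 => [j|].
    exact: (L2_B (cut_FT (ler0n R j) Lf).1 LF).1.
  by move: h; under eq_fun do rewrite fourier_ballE.
move=> [Lf LF h]; split; [exact: (in_L2E f).2|exact: (in_L2E F).2|].
under eq_fun do rewrite fourier_ballE.
apply: normL2_cvg0 h => j; exact: (L2_B (cut_FT (ler0n R j) Lf).1 LF).1.
Qed.

Theorem fourier_isometry f F : fourier_pair f F -> SQ leb F = c * SQ leb f.
Proof.
move=> [Lf LF h].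
have h1 := SQ_cvg (fun j => (cut_FT (ler0n R j) Lf).1) LF h.
have h2 := SQ_cvg (fun j => (cut_L2 j%:R Lf).1) Lf (cut_cvg Lf).
apply: (cvg_unique _ h1); first exact: Rhausdorff.
rewrite /= (funext (fun j => (cut_FT (ler0n R j) Lf).2)).
by apply: cvgM => //; exact: cvg_cst.
Qed.

Lemma cut_B f g r : cut (fun x => f x - g x) r = fun x => cut f r x - cut g r x.
Proof. by apply/funext => x; rewrite /cut mulrBr. Qed.

Lemma cut_Z (z : R[i]) f r : cut (fun x => z * f x) r = fun x => z * cut f r x.
Proof. by apply/funext => x; rewrite /cut mulrCA. Qed.

Lemma fourier_pair_B f g F G : fourier_pair f F -> fourier_pair g G ->
  fourier_pair (fun x => f x - g x) (fun k => F k - G k).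
Proof.
move=> [Lf LF hf] [Lg LG hg]; split; [exact: (L2_B Lf Lg).1|exact: (L2_B LF LG).1|].
have cc : 2 * SQ leb (fun k => FT (cut f N%:R) k - F k) + 2 * SQ leb (fun k => FT (cut g N%:R) k - G k) @[N --> \oo] --> (0 : R).
  by rewrite -(addr0 0) -(mulr0 2); apply: cvgD; apply: cvgM => //; exact: cvg_cst.
apply: (cvg0_squeeze _ cc) => j; rewrite SQ_ge0/=.
have N0 := ler0n R j.
have [_] := L2_B (L2_B (cut_FT N0 Lf).1 LF).1 (L2_B (cut_FT N0 Lg).1 LG).1.
congr (SQ _ _ <= _); apply/funext => k.
by rewrite cut_B (FT_B (cut_CL1 N0 Lf) (cut_CL1 N0 Lg)); ring.
Qed.

Lemma fourier_pair_Z (z : R[i]) f F : fourier_pair f F ->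
  fourier_pair (fun x => z * f x) (fun k => z * F k).
Proof.
move=> [Lf LF hf]; split; [exact: (L2_Z z Lf).1|exact: (L2_Z z LF).1|].
have cc : normc z ^+ 2 * SQ leb (fun k => FT (cut f N%:R) k - F k) @[N --> \oo] --> (0 : R).
  by rewrite -(mulr0 (normc z ^+ 2)); apply: cvgM => //; exact: cvg_cst.
apply: (cvg0_squeeze _ cc) => j; rewrite SQ_ge0/=.
have N0 := ler0n R j.
have [_ <-] := L2_Z z (L2_B (cut_FT N0 Lf).1 LF).1.
rewrite le_eqVlt; apply/orP; left; apply/eqP; congr (SQ _ _); apply/funext => k.
by rewrite cut_Z (FT_Z _ (cut_CL1 N0 Lf)) mulrBr.
Qed.

Lemma SQ_sub_pairing (h g : Rn R n -> R[i]) : L2 leb h -> L2 leb g ->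
  SQ leb (fun x => h x - g x) =
  SQ leb h + SQ leb g - 2 * RI leb (fun x => complex.Re (h x * (g x)^*)).
Proof.
move=> Lh Lg; have i : L1 leb (fun x => complex.Re (h x * (g x)^*)).
  have m := (cmeasM Lh.1 (cmeas_conj Lg.1)).1.
  apply: (@L1_le _ _ _ leb _ _ m (L1_D Lh.2 Lg.2)) => x.
  rewrite (le_trans (normr_Re_le _))// Normc.normcM normc_conj.
  have := sqr_ge0 (normc (h x) - normc (g x)).
  have -> : (normc (h x) - normc (g x)) ^+ 2 = normc (h x) ^+ 2 + normc (g x) ^+ 2 - 2 * (normc (h x) * normc (g x)) by ring.
  have : 0 <= normc (h x) * normc (g x) by rewrite mulr_ge0// normc_ge0.
  lra.
rewrite /SQ -(RI_Z 2 i) -(RI_D Lh.2 Lg.2) -(RI_B (L1_D Lh.2 Lg.2) (L1_Z 2 i)).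
apply: eq_RI => x; rewrite !normc_sqr cReM !cReD !cImD !cReN !cImN conjc_Re conjc_Im; ring.
Qed.

Lemma conj_L2 f : L2 leb f -> L2 leb (fun x => (f x)^*) /\ SQ leb (fun x => (f x)^*) = SQ leb f.
Proof.
move=> [mf fi]; have E : (fun x => normc (f x)^* ^+ 2) = fun x => normc (f x) ^+ 2.
  by apply/funext => x; rewrite normc_conj.
by split; [split; [exact: cmeas_conj|rewrite E]|rewrite /SQ E].
Qed.

(* The candidate is the inverse transform [f]; Parseval gives
   [|FT (cut f N) - F|^2 = |F|^2 - c |cut f N|^2], which tends to [0]. *)
Lemma fourier_surj_box F N : L2 leb F -> (forall k, ~ box N k -> F k = 0) ->
  exists f, fourier_pair f F.
Proof.
move=> LF F0; have [LG GE] := conj_L2 LF.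
have G0 k : ~ box N k -> (F k)^* = 0 by move=> /F0 ->; rewrite conjc0.
have [LH HE] := plancherel_box LG G0.
have [LK KE] := conj_L2 LH.
(* The inverse transform, written with [FT] itself: conjugating before and after reverses the sign
   in the kernel, and [c = (2 pi)^n] normalizes. *)
pose f x : R[i] := (c^-1)%:C * (FT (fun k => (F k)^*) x)^*.
have [Lf fE] := L2_Z (c^-1)%:C LK.
exists f; split=> //.
have cF : c * SQ leb f = SQ leb F.
  rewrite [SQ leb f]fE KE HE GE normc_real ger0_norm ?invr_ge0 ?(ltW c_gt0)//.
  by rewrite -/c; field; rewrite gt_eqF.
have E j : SQ leb (fun k => FT (cut f j%:R) k - F k) = SQ leb F - c * SQ leb (cut f j%:R).
  have N0 := ler0n R j; have [Lj jE] := cut_FT N0 Lf.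
  rewrite (SQ_sub_pairing Lj LF) jE.
  have -> : RI leb (fun k => complex.Re (FT (cut f j%:R) k * (F k)^*)) = c * SQ leb (cut f j%:R).
    rewrite (FT_pairing (cut_CL1 N0 Lf) (L2_box_CL1 LG G0)) /SQ -(RI_Z _ (cut_L2 _ Lf).1.2).
    apply: eq_RI => x; have -> : FT (fun k => (F k)^*) x = c%:C * (f x)^*.
      rewrite /f; case: (FT _ x) => a b; apply: complex_eq; rewrite /= ?mul0r ?subr0 ?addr0 ?add0r ?oppr0;
        by field; rewrite gt_eqF.
    rewrite cut_cases; case: ifP => _; last by rewrite mul0r Normc.normc0 expr0n mulr0.
    by rewrite mulrCA mulc_conj -rmorphM.
  by ring.
rewrite (funext E); have h2 := SQ_cvg (fun j => (cut_L2 j%:R Lf).1) Lf (cut_cvg Lf).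
have -> : 0 = SQ leb F - c * SQ leb f by rewrite cF subrr.
by apply: cvgB; [exact: cvg_cst|apply: cvgM => //; exact: cvg_cst].
Qed.

(** The preimages of the truncations [cut F j] form a Cauchy sequence by the isometry. Their limit
    has transform [F], since on truncated functions [FT] is bounded by [c] in squared norm,
    uniformly in the truncation. *)
Theorem fourier_surj F : L2 leb F -> exists f, fourier_pair f F.
Proof.
move=> LF; have ex j : {f | fourier_pair f (cut F j%:R)}.
  apply: cid; apply: (@fourier_surj_box _ j%:R); first exact: (cut_L2 _ LF).1.
  by move=> k; exact: cut_box.
pose f_ j := projT1 (ex j); have hf j : fourier_pair (f_ j) (cut F j%:R) := projT2 (ex j).
have Lf_ j : L2 leb (f_ j) by case: (hf j).
have LF_ j : L2 leb (cut F j%:R) := (cut_L2 j%:R LF).1.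
have cF := cut_cvg LF.
have [f Lf cf] : exists2 f, L2 leb f & SQ leb (fun x => f_ j x - f x) @[j --> \oo] --> (0 : R).
  apply: SQ_complete => // e e0.
  (* [SQ_triangle] has factors 2, so two distances of [c e / 4] add up to [c e], and the isometry
     divides by [c]. *)
  have d0 : 0 < c * e / 4 by rewrite divr_gt0// mulr_gt0.
  have [N _ hN] : \forall j \near \oo, SQ leb (fun k => cut F j%:R k - F k) <= c * e / 4.
    by exact: (@cvgr_le R _ _ _ _ _ cF _ d0).
  exists N => i j Ni Nj.
  have := fourier_isometry (fourier_pair_B (hf i) (hf j)).
  have := SQ_triangle (LF_ i) LF (LF_ j).
  rewrite (SQ_distC _ F) => h1 h2.
  have a1 : SQ leb (fun k => cut F i%:R k - F k) <= c * e / 4 by exact: hN.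
  have a2 : SQ leb (fun k => cut F j%:R k - F k) <= c * e / 4 by exact: hN.
  rewrite -(ler_pM2l c_gt0) -h2 (le_trans h1)//.
  by move: (SQ _ _) (SQ _ _) a1 a2 => a b; lra.
exists f; split=> //; apply/cvgrPdist_le => e e0.
have e1 : 0 < e / 16 by rewrite divr_gt0.
(* Two nested uses of [SQ_triangle] give at most [2 + 4 + 4] times [e / 16]. The distance between
   [f_ j] and [f] is amplified by [c] under the transform, hence the extra [c]. *)
have e2 : 0 < e / (16 * c) by rewrite divr_gt0// mulr_gt0.
have n1 : \forall j \near \oo, SQ leb (fun k => cut F j%:R k - F k) <= e / 16 by exact: (@cvgr_le R _ _ _ _ _ cF _ e1).
have n2 : \forall j \near \oo, SQ leb (fun x => f_ j x - f x) <= e / (16 * c) by exact: (@cvgr_le R _ _ _ _ _ cf _ e2).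
have [j _ hj] := filterI n1 n2; have [h1 h2] := hj j (leqnn j).
have [_ _ hc] := hf j.
have n3 : \forall N \near \oo, SQ leb (fun k => FT (cut (f_ j) N%:R) k - cut F j%:R k) <= e / 16 by exact: (@cvgr_le R _ _ _ _ _ hc _ e1).
apply: filterS n3 => N h3; rewrite sub0r normrN ger0_norm ?SQ_ge0//.
have N0 := ler0n R N.
have [LA _] := cut_FT N0 Lf; have [LB _] := cut_FT N0 (Lf_ j).
have t1 := SQ_triangle LA LB LF; have t2 := SQ_triangle LB (LF_ j) LF.
have t3 : SQ leb (fun k => FT (cut f N%:R) k - FT (cut (f_ j) N%:R) k) <= e / 16.
  have [Ld _] := L2_B Lf (Lf_ j).
  have := (cut_FT N0 Ld).2; rewrite cut_B (FT_B (cut_CL1 N0 Lf) (cut_CL1 N0 (Lf_ j))) => ->.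
  have b1 := (cut_L2 N%:R Ld).2; rewrite cut_B in b1.
  have b2 : c * (e / (16 * c)) = e / 16 by field; rewrite gt_eqF.
  by rewrite -b2 ler_pM2l// (le_trans b1)// SQ_distC.
move: (SQ _ _) (SQ _ _) (SQ _ _) (SQ _ _) (SQ _ _) t1 t2 t3 h1 h3 => *; lra.
Qed.

End fourier_plancherel.

(** * Asymptotics of the diffusion equation *)

Section asymptotics.
Context {R : realType} (n : nat).
Local Notation leb := (@lebesgueRn R n).
Local Notation normc := Normc.normc.

(** The multiplier is controlled only for [lam > 0]. The zero frequency is a degenerate box, of
    measure 0 in positive dimension. *)
Lemma sqnormRn_gt0_ae : (0 < n)%N -> {ae leb, forall k, 0 < sqnormRn k}.
Proof.
case: n => // m _; exists [set x | forall i : 'I_m.+1, [set` `[0, 0]] (tnth x i)]; split.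
- rewrite (_ : mkset _ = box 0); first exact: measurable_box.
  apply/seteqP; split=> x /= h i; have := h i.
    by rewrite in_itv/= => /andP[a b]; rewrite normr_le0 eq_le a b.
  by rewrite normr_le0 in_itv/= => /eqP ->; rewrite lexx.
- rewrite (lebesgueRn_box (fun=> `[0, 0])) big_ord_recl.
  by rewrite set_itv1 lebesgue_measure_set1 mul0e.
- move=> x /= h i; rewrite in_itv/=; suff -> : tnth x i = 0 by rewrite lexx.
  apply/eqP; apply: contrapT => /negP xi; apply: h.
  rewrite /sqnormRn /dotRn (bigD1 i)//= ltr_pwDl//; first by rewrite -expr2 exprn_even_gt0.
  by apply: sumr_ge0 => j _; rewrite -expr2 sqr_ge0.
Qed.

Variables (al : R) (i : datum_index).
Hypothesis hal : 0 < al < 1 \/ 1 < al < 2.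
Hypothesis hi : i = gamma_1 \/ i = gamma_am2 -> 1 < al.
Hypothesis hn : (0 < n)%N.

Lemma diffusion_asymptotics (v : Rn R n -> R[i]) (u : R -> Rn R n -> R[i]) :
  diffusion_solution al i v u ->
  exists2 w : R -> Rn R n -> R[i],
    (forall t, 0 < t -> is_neg_laplacian_pow (m_of i) (u t) (w t)) &
    cvg_L2 +oo (fun t x => (c_of al i t)%:C * w t x) v.
Proof.
move=> [V [U [/is_fourierE fV fU ae _]]].
have al0 : 0 < al by case: hal => /andP[]; lra.
have [M [[B hB] M1 hM c0]] := mode_multiplier hal hi.
have [Lv LV _] := fV.
pose W t k : R[i] := (sqnormRn k ^+ m_of i)%:C * U t k.
have aeW : {ae leb, forall k, 0 < sqnormRn k /\ forall t, 0 < t ->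
    (c_of al i t)%:C * W t k = (M (sqnormRn k * t `^ al))%:C * V k}.
  apply: filterS2 (sqnormRn_gt0_ae hn) ae => k k0 [h1 h2]; split=> // t t0.
  have e1 := hM _ _ _ _ k0 h1 t0; have e2 := hM _ _ _ _ k0 h2 t0.
  apply: complex_eq; rewrite /W ?cReM ?cImM /= !mul0r ?subr0 ?addr0.
    by rewrite -e1; ring.
  by rewrite -e2; ring.
have mW t : 0 < t -> cmeas (W t).
  move=> t0; have /is_fourierE[_ [mU _] _] := fU t t0.
  apply: cmeasM => //; apply: cmeas_real; apply: measurable_funX.
  exact: measurable_dotRn.
have lt0 (k : Rn R n) (t : R) : 0 < sqnormRn k -> 0 < t -> 0 < sqnormRn k * t `^ al :> R.
  by move=> k0 t0; rewrite mulr_gt0// powR_gt0.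
(* That [(-Delta)^m u] is in L2 is not part of the assumptions: it follows from the bound on the
   multiplier after division by [c_of], which does not vanish. *)
have LW t : 0 < t -> L2 leb (W t).
  move=> t0; split; first exact: mW.
  apply: (@ae_L1_le _ _ _ leb _ _ (measurable_sqr_normc (mW t t0))
    (L1_Z ((B / normc (c_of al i t)%:C) ^+ 2) LV.2)).
  apply: filterS aeW => k [k0 hk]; have h := hk t t0.
  have cn : 0 < normc (c_of al i t)%:C by rewrite normc_real normr_gt0 c0.
  rewrite ger0_norm ?sqr_ge0// -exprMn.
  have E : normc (W t k) = `|M (sqnormRn k * t `^ al)| / normc (c_of al i t)%:C * normc (V k).
    rewrite mulrAC -normc_real -Normc.normcM -h (Normc.normcM _ (W t k)).
    by rewrite mulrAC divff ?mul1r// gt_eqF.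
  have le1 : normc (W t k) <= B / normc (c_of al i t)%:C * normc (V k).
    rewrite E ler_wpM2r ?normc_ge0// ler_wpM2r//; last by rewrite hB// lt0.
    by rewrite invr_ge0 ltW.
  by rewrite ler_pXn2r ?nnegrE ?normc_ge0// (le_trans _ le1)// normc_ge0.
(* For [t <= 0] the zero function is chosen, so that [w t] is square integrable for every real
   [t]. *)
have ex t : {w | (0 < t -> fourier_pair w (W t)) /\ L2 leb w}.
  apply: cid; have [t0|t0] := ltP 0 t.
    by have [w hw] := fourier_surj (LW t t0); exists w; split=> //; case: hw.
  by exists (fun x => 0 * v x); split=> //; exact: (L2_Z 0 Lv).1.
pose w t := projT1 (ex t).
have hw t : 0 < t -> fourier_pair (w t) (W t) := (projT2 (ex t)).1.
have Lw t : L2 leb (w t) := (projT2 (ex t)).2.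
exists w.
  by move=> t t0; exists (U t); [exact: fU|apply/is_fourierE; exact: hw].
have Ld t : L2 leb (fun x => (c_of al i t)%:C * w t x - v x).
  exact: (L2_B (L2_Z _ (Lw t)).1 Lv).1.
apply: (normL2_cvg0 Ld).
(* Dominated convergence is applied along an arbitrary sequence of times; the shift by [n0] keeps
   all of them positive. *)
apply/cvg_pinftyP => s sy.
have [n0 _ hn0] : \forall j \near \oo, 0 < s j by move/cvgryPgt : sy; exact.
rewrite -(cvg_shiftn n0).
have s0 j : 0 < s (j + n0)%N by apply: hn0; exact: leq_addl.
have sy' : s (j + n0)%N @[j --> \oo] --> +oo by rewrite (cvg_shiftn n0 s).
pose d j k := (c_of al i (s (j + n0)%N))%:C * W (s (j + n0)%N) k - V k.
have Lcd j : L2 leb (d j) := (L2_B (L2_Z _ (LW _ (s0 j))).1 LV).1.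
have p0 : 0 < (2 * pi) ^+ n :> R by rewrite exprn_gt0// mulr_gt0// pi_gt0.
have E j : SQ leb (fun x => (c_of al i (s (j + n0)%N))%:C * w (s (j + n0)%N) x - v x) =
    ((2 * pi) ^+ n)^-1 * SQ leb (d j).
  have := fourier_isometry (fourier_pair_B (fourier_pair_Z (c_of al i (s (j + n0)%N))%:C (hw _ (s0 j))) fV).
  by rewrite /d => ->; rewrite mulrA mulVf ?mul1r// gt_eqF.
suff cd : SQ leb (d j) @[j --> \oo] --> (0 : R).
  have h : ((2 * pi) ^+ n)^-1 * SQ leb (d j) @[j --> \oo] --> (0 : R).
    by have := cvgM (cvg_cst ((2 * pi) ^+ n)^-1) cd; rewrite mulr0; exact.
  by move: h; rewrite -(funext E); exact.
have md j := measurable_sqr_normc (Lcd j).1.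
have dE k : 0 < sqnormRn k -> (forall t, 0 < t ->
    (c_of al i t)%:C * W t k = (M (sqnormRn k * t `^ al))%:C * V k) ->
    forall j, normc (d j k) ^+ 2 = (M (sqnormRn k * s (j + n0)%N `^ al) - 1) ^+ 2 * normc (V k) ^+ 2.
  move=> k0 hk j; rewrite /d (hk _ (s0 j)).
  have -> : (M (sqnormRn k * s (j + n0)%N `^ al))%:C * V k - V k = (M (sqnormRn k * s (j + n0)%N `^ al) - 1)%:C * V k.
    by rewrite rmorphB mulrBl mul1r.
  by rewrite Normc.normcM exprMn normc_real real_normK ?num_real.
have bd : {ae leb, forall k, forall j, `|normc (d j k) ^+ 2| <= (B + 1) ^+ 2 * normc (V k) ^+ 2}.
  apply: filterS aeW => k [k0 hk] j; rewrite ger0_norm ?sqr_ge0// (dE k k0 hk).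
  rewrite ler_wpM2r ?sqr_ge0// -real_normK ?num_real// ler_pXn2r ?nnegrE//.
    by rewrite (le_trans (ler_normB _ _))// normr1 lerD2r hB// lt0.
  by rewrite addr_ge0// (le_trans (normr_ge0 _) (hB _ (lt0 _ _ k0 (s0 j)))).
have m0 : measurable_fun setT (fun _ : Rn R n => 0 : R) by [].
have [|_] := @RI_dct _ _ _ leb _ _ _ md m0 _ (L1_Z ((B + 1) ^+ 2) LV.2) bd; last by rewrite RI_0.
apply: filterS aeW => k [k0 hk]; rewrite (funext (dE k k0 hk)).
have cM : M (sqnormRn k * s (j + n0)%N `^ al) @[j --> \oo] --> (1 : R).
  apply: M1; first by move=> j; exact: lt0.
  (* [T] solves [|k|^2 T^al = |A| + 1]; the threshold depends on [k], so this convergence is only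
     pointwise. *)
  apply/cvgryPge => A; pose T := ((`|A| + 1) / sqnormRn k) `^ al^-1.
  have nT : \forall j \near \oo, T <= s (j + n0)%N by move/cvgryPge : sy'; exact.
  apply: filterS nT => j Tj.
  have q0 : 0 <= (`|A| + 1) / sqnormRn k by rewrite divr_ge0 ?addr_ge0// ltW.
  have : T `^ al <= s (j + n0)%N `^ al.
    by apply: ge0_ler_powR; rewrite ?nnegrE ?powR_ge0 ?(ltW al0)// ltW.
  rewrite /T -powRrM mulVf ?gt_eqF// powRr1// ler_pdivrMr// mulrC => h.
  by rewrite (le_trans _ h)// (le_trans (ler_norm A))// lerDl.
have -> : 0 = (1 - 1) * (1 - 1) * normc (V k) ^+ 2 :> R by rewrite subrr !mul0r.
apply: cvgM; last exact: cvg_cst.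
rewrite (funext (fun j => expr2 (M (sqnormRn k * s (j + n0)%N `^ al) - 1))).
by apply: cvgM; apply: cvgB => //; exact: cvg_cst.
Qed.

End asymptotics.

Theorem theorem10 (R : realType) (n : nat) (hn : (0 < n)%N) (alpha : R)
    (halpha : 0 < alpha < 1 \/ 1 < alpha < 2)
    (v : Rn R n -> R[i]) (hv : in_L2 v) (u : R -> Rn R n -> R[i]) :
  [/\ diffusion_solution alpha gamma_0 v u ->
        exists2 w : R -> Rn R n -> R[i],
          (forall t, 0 < t -> is_neg_laplacian_pow 1 (u t) (w t)) &
          cvg_L2 +oo
            (fun t x => (t `^ alpha * Gamma (1 - alpha))%:C * w t x) v,
      1 < alpha -> diffusion_solution alpha gamma_1 v u ->
        exists2 w : R -> Rn R n -> R[i],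
          (forall t, 0 < t -> is_neg_laplacian_pow 1 (u t) (w t)) &
          cvg_L2 +oo
            (fun t x => (t `^ (alpha - 1) * Gamma (2 - alpha))%:C * w t x) v,
      diffusion_solution alpha gamma_am1 v u ->
        exists2 w : R -> Rn R n -> R[i],
          (forall t, 0 < t -> is_neg_laplacian_pow 2 (u t) (w t)) &
          cvg_L2 +oo
            (fun t x => (- t `^ (alpha + 1) * Gamma (- alpha))%:C * w t x) v
    & 1 < alpha -> diffusion_solution alpha gamma_am2 v u ->
        exists2 w : R -> Rn R n -> R[i],
          (forall t, 0 < t -> is_neg_laplacian_pow 2 (u t) (w t)) &
          cvg_L2 +oo
            (fun t x => (- t `^ (alpha + 2) * Gamma (- alpha - 1))%:C * w t x) v].
Proof.
have E (i : datum_index) (q g e : R) : q_of alpha i + 1 = q -> - q_of alpha i = g ->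
    (-1) ^+ (m_of i).-1 = e -> forall w : R -> Rn R n -> R[i],
    cvg_L2 +oo (fun t x => (c_of alpha i t)%:C * w t x) v ->
    cvg_L2 +oo (fun t x => (e * t `^ q * Gamma g)%:C * w t x) v.
  by move=> <- <- <- w.
split=> [sol|a1 sol|sol|a1 sol].
- have [|w hw /(E _ alpha (1 - alpha) 1) cw] := diffusion_asymptotics halpha _ hn sol; first by case.
  exists w => //; have := cw _ _ _; under eq_fun do rewrite mul1r.
  by apply => /=; ring.
- have [|w hw /(E _ (alpha - 1) (2 - alpha) 1) cw] := diffusion_asymptotics halpha _ hn sol; first by [].
  exists w => //; have := cw _ _ _; under eq_fun do rewrite mul1r.
  by apply => /=; ring.
- have [|w hw /(E _ (alpha + 1) (- alpha) (-1)) cw] := diffusion_asymptotics halpha _ hn sol; first by case.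
  exists w => //; have := cw _ _ _; under eq_fun do rewrite mulN1r.
  by apply => /=; ring.
- have [|w hw /(E _ (alpha + 2) (- alpha - 1) (-1)) cw] := diffusion_asymptotics halpha _ hn sol; first by [].
  exists w => //; have := cw _ _ _; under eq_fun do rewrite mulN1r.
  by apply => /=; ring.
Qed.
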